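(* Let $K$ be an interface element and let $\hat u\in\mathcal H^{m+1}(\hat K_F,\hat\Gamma_{K_F};\beta)$ satisfy the jump conditions $[[\hat u]]=0$, $[[\hat\beta\,\hat u_\eta]]=0$ and $[[\hat\beta\,\frac{\partial^j}{\partial\eta^j}\mathscr L(\hat u)]]=0$ for $j=0,1,\dots,m-2$ across $\hat\Gamma_{K_F}$. Let $\hat\Pi\hat u$ be the $L^2(\hat K_F)$-orthogonal projection of $\hat u$ onto the space $\hat{\mathcal V}^m_{\hat\beta}(\hat K_F)$. Then $$|\hat\Pi\hat u-\hat u|_{i,\hat K_F}\lesssim h^{m+1-i}\,|\hat u|_{m+1,\hat K_F},\qquad i=0,1,\dots,m+1 .$$
   Context: Geometry. $\Omega\subset\mathbb R^2$ is a rectangle divided by a simple connected curve $\Gamma$ into $\Omega^+$ and $\Omega^-$; $\beta$ equals the constant $\beta^\pm>0$ on $\Omega^\pm$. $m\ge1$ is an integer. $\mathbf g:[\xi_s,\xi_e]\to\Gamma$ is a $C^{m+2}$ parametrization of $\Gamma$ with $\mathbf g'\neq0$ everywhere. Set $\boldsymbol\tau=\mathbf g'/\|\mathbf g'\|$, $\mathbf n=Q\boldsymbol\tau$ with $Q=\begin{bmatrix}0&1\\-1&0\end{bmatrix}$, signed curvature $\kappa=\|\mathbf g'\|^{-3}(\mathbf g')^TQ\,\mathbf g''$, $\kappa_\Gamma=\max|\kappa|$, and $P_\Gamma(\eta,\xi)=\mathbf g(\xi)+\eta\,\mathbf n(\xi)$. It is assumed that for some $\epsilon>0$ the map $P_\Gamma:[-\epsilon,\epsilon]\times[\xi_s,\xi_e]\to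 N_\Gamma(\epsilon)$ is a bijection onto its image with nonsingular Jacobian, that normal lines to $\Gamma$ at distinct points do not intersect inside $N_\Gamma(\epsilon)$, and that every point $A$ of $N_\Gamma(\epsilon)$ has a unique parameter $\xi_A$ with $\|A-\mathbf g(\xi_A)\|=\mathrm{dist}(\Gamma,A)$. $R_\Gamma=P_\Gamma^{-1}$. Mesh. $\mathcal T_h$ is a uniform mesh of $\Omega$ by rectangles of diameter $h<\epsilon$, with $h\kappa_\Gamma\le\frac12$. An interface element is $K\in\mathcal T_h$ whose interior meets $\Gamma$. If $\xi_1,\dots,\xi_4$ are the parameters $\xi_A$ of its four vertices, let $a_K=\min_i\xi_i$, $b_K=\max_i\xi_i$, $\hat K_F=[-h,h]\times[a_K,b_K]$, $\hat\Gamma_{K_F}=\{0\}\times[a_K,b_K]$, $\hat K_F^-=\hat K_F\cap\{\eta<0\}$, $\hat K_F^+=\hat K_F\cap\{\eta\ge0\}$. The orientation is such that points of $K$ with $\eta>0$ (resp. $\eta<0$) lie in $\Omega^+$ (resp. $\Omega^-$); $\hat\beta=\beta^\pm$ on $\hat K_F^\pm$. For $v$ on $\hat K_F$, $v^\pm=v|_{\hat K_F^\pm}$ and $[[v]]=v^+|_{\eta=0}-v^-|_{\eta=0}$ on $\hat\Gamma_{K_F}$. Operator. With $\psi=(1+\eta\kappa(\xi))^{-1}$, $$\mathscr L(v)=v_{\eta\eta}+J_0v_{\xi\xi}+J_1v_\eta+J_2v_\xi,\quad J_0=\frac{\psi^2}{\|\mathbf g'\|^2},\quad J_1=\kappa\psi,\quad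 J_2=-\frac{\psi^2}{\|\mathbf g'\|^2}\Big(\eta\kappa'\psi+\frac{\mathbf g'\cdot\mathbf g''}{\|\mathbf g'\|^2}\Big)$$ (the Laplacian expressed in the coordinates $(\eta,\xi)$). Spaces. $Q^m(O)$: polynomials in $(\eta,\xi)$ of degree $\le m$ in each variable, on $O$; $\mathcal P^m(\hat\Gamma_{K_F})$: polynomials in $\xi$ of degree $\le m$. $\hat{\mathcal V}^m_{\hat\beta}(\hat K_F)$ is the set of $\hat\phi:\hat K_F\to\mathbb R$ with $\hat\phi|_{\hat K_F^\pm}\in Q^m(\hat K_F^\pm)$ such that for all $v\in\mathcal P^m(\hat\Gamma_{K_F})$ $$\int_{\hat\Gamma_{K_F}}[[\hat\phi]]v=0,\quad\int_{\hat\Gamma_{K_F}}[[\hat\beta\hat\phi_\eta]]v=0,\quad\int_{\hat\Gamma_{K_F}}\Big[\Big[\hat\beta\frac{\partial^j}{\partial\eta^j}\mathscr L(\hat\phi)\Big]\Big]v=0\ (0\le j\le m-2).$$ $\mathcal H^{s}(\hat K_F,\hat\Gamma_{K_F};\beta)$ is the set of $v$ with $v^\pm\in H^s(\hat K_F^\pm)$, $[[v]]=0$, $[[\hat\beta v_\eta]]=0$. Norms and seminorms on $\hat K_F$ are broken: $|v|_{i,\hat K_F}^2=|v^+|_{i,\hat K_F^+}^2+|v^-|_{i,\hat K_F^-}^2$. $a\lesssim b$ means $a\le Cb$ with $C$ independent of the mesh size $h$, of the position of the interface relative to the mesh (in particular of $K$), and of $\beta^\pm$ ($C$ may depend on $m$,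 $\mathbf g$, $\epsilon$ and the fixed aspect ratio of the rectangles). *)

(* Defs.v *)
(* MathComp-Analysis, over an arbitrary real field [R : realType]. *)
From HB Require Import structures.
From mathcomp Require Import all_boot all_order all_algebra.
From mathcomp Require Import all_classical all_reals all_analysis.
Set Implicit Arguments.
Unset Strict Implicit.
Unset Printing Implicit Defensive.
Import Order.TTheory GRing.Theory Num.Theory numFieldNormedType.Exports.
Local Open Scope classical_set_scope.
Local Open Scope ring_scope.

Notation mu1 R := (@lebesgue_measure R) (only parsing).

Notation mu2 R := (@lebesgue_measure R \x @lebesgue_measure R)%E (only parsing).

Notation plane R := (measurableTypeR R * measurableTypeR R)%type (only parsing).

(* The norm of the library on [R * R] is the max norm. *)
Definition enorm (R : realType) (A : R * R) : R := Num.sqrt (A.1 ^+ 2 + A.2 ^+ 2).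

Definition dotp (R : realType) (A B : R * R) : R := A.1 * B.1 + A.2 * B.2.

Definition obox (R : realType) (a b c d : R) : set (R * R) := `]a, b[ `*` `]c, d[.

Definition cbox (R : realType) (a b c d : R) : set (R * R) := `[a, b] `*` `[c, d].

(* Two-sided differentiability is required at the end points as well: [g] stands
   for an extension of a C^k function on [[a, b]], and its derivatives of order
   at most [k] on [[a, b]] only depend on the values taken there. *)
Definition Ck_on (R : realType) (k : nat) (g : R -> R * R) (a b : R) : Prop :=
  (forall j : nat, (j < k)%N -> forall x : R, a <= x <= b ->
     derivable (derive1n j g) x 1) /\
  {within `[a, b], continuous (derive1n k g)}.

Definition rotQ (R : realType) (A : R * R) : R * R := (A.2, - A.1).

Definition unit_normal (R : realType) (g : R -> R * R) (xi : R) : R * R :=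
  rotQ ((enorm (derive1 g xi))^-1 *: derive1 g xi).

Definition curvature (R : realType) (g : R -> R * R) (xi : R) : R :=
  (enorm (derive1 g xi) ^+ 3)^-1 * dotp (derive1 g xi) (rotQ (derive1n 2 g xi)).

Definition max_curvature (R : realType) (g : R -> R * R) (xs xe : R) : R :=
  sup [set `|curvature g xi| | xi in `[xs, xe]].

(* Points of the parameter plane are pairs [(eta, xi)]. *)
Definition tube_map (R : realType) (g : R -> R * R) (p : R * R) : R * R :=
  g p.2 + p.1 *: unit_normal g p.2.

Definition tube (R : realType) (g : R -> R * R) (xs xe eps : R) : set (R * R) :=
  tube_map g @` cbox (- eps) eps xs xe.

Definition Dx (R : realType) (f : R * R -> R) : R * R -> R :=
  fun p => 'D_((1, 0) : R * R) f p.

Definition Dy (R : realType) (f : R * R -> R) : R * R -> R :=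
  fun p => 'D_((0, 1) : R * R) f p.

Definition pder (R : realType) (i j : nat) (f : R * R -> R) : R * R -> R :=
  iter i (@Dx R) (iter j (@Dy R) f).

Definition jacobian (R : realType) (F : R * R -> R * R) (p : R * R) : R :=
  Dx (fst \o F) p * Dy (snd \o F) p - Dy (fst \o F) p * Dx (snd \o F) p.

Definition curve_dist (R : realType) (g : R -> R * R) (xs xe : R) (A : R * R) : R :=
  inf [set enorm (A - g xi) | xi in `[xs, xe]].

Definition nearest_parameter (R : realType) (g : R -> R * R) (xs xe : R)
    (A : R * R) (xi : R) : Prop :=
  xs <= xi <= xe /\ enorm (A - g xi) = curve_dist g xs xe A.

Definition parameter_of (R : realType) (g : R -> R * R) (xs xe : R) (A : R * R) : R :=
  xget 0 [set xi | nearest_parameter g xs xe A xi].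

Record admissible_curve (R : realType) (m : nat) (g : R -> R * R) (xs xe eps : R)
    : Prop := AdmissibleCurve {
  ac_interval : xs < xe;
  ac_smooth : Ck_on m.+2 g xs xe;
  ac_regular : forall xi : R, xs <= xi <= xe -> derive1 g xi != 0;
  ac_eps : 0 < eps;
  ac_inj : forall p q : R * R, cbox (- eps) eps xs xe p ->
    cbox (- eps) eps xs xe q -> tube_map g p = tube_map g q -> p = q;
  ac_jacobian : forall p : R * R, cbox (- eps) eps xs xe p ->
    jacobian (tube_map g) p != 0;
  (* The normal lines are those of the tubular neighbourhood, i.e. the segments
     of length [2 eps] centred on the curve. *)
  ac_normals : forall xi zeta : R, xs <= xi <= xe -> xs <= zeta <= xe ->
    xi <> zeta ->
    tube g xs xe eps `&`
    [set tube_map g (eta, xi) | eta in `[- eps, eps]] `&`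
    [set tube_map g (eta, zeta) | eta in `[- eps, eps]] = set0;
  ac_nearest : forall A : R * R, tube g xs xe eps A ->
    exists! xi : R, nearest_parameter g xs xe A xi
}.

Record divides (R : realType) (Gam Om Omp Omm : set (R * R)) : Prop := Divides {
  dv_union : Om `\` Gam = Omp `|` Omm;
  dv_disjoint : Omp `&` Omm = set0;
  dv_open_p : open Omp;
  dv_open_m : open Omm;
  dv_connected_p : connected Omp;
  dv_connected_m : connected Omm;
  dv_nonempty_p : Omp !=set0;
  dv_nonempty_m : Omm !=set0
}.

Fixpoint Ck (R : realType) (k : nat) (f : R * R -> R) : Prop :=
  match k with
  | 0 => continuous f
  | k'.+1 => [/\ continuous f,
                (forall p : R * R, derivable f p ((1, 0) : R * R)),
                (forall p : R * R, derivable f p ((0, 1) : R * R)),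
                Ck k' (Dx f) & Ck k' (Dy f)]
  end.

Definition smooth (R : realType) (f : R * R -> R) : Prop := forall k : nat, Ck k f.

Definition test_function (R : realType) (O : set (R * R)) (f : R * R -> R) : Prop :=
  [/\ smooth f, compact (closure [set p | f p != 0]) &
      closure [set p | f p != 0] `<=` O].

Definition int2 (R : realType) (O : set (R * R)) (f : R * R -> R) : R :=
  (\int[mu2 R]_(p in O) f p)%R.

Definition int1 (R : realType) (a b : R) (f : R -> R) : R :=
  (\int[mu1 R]_(x in `[a, b]) f x)%R.

Definition L2fun2 (R : realType) (O : set (R * R)) (f : R * R -> R) : Prop :=
  measurable_fun (T := plane R) O f /\ (mu2 R).-integrable O (fun p => ((f p) ^+ 2)%:E).

Definition L2fun1 (R : realType) (a b : R) (f : R -> R) : Prop :=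
  measurable_fun (T := measurableTypeR R) `[a, b] f /\ (mu1 R).-integrable `[a, b] (fun x => ((f x) ^+ 2)%:E).

Definition weak_derivative (R : realType) (O : set (R * R)) (i j : nat)
    (f w : R * R -> R) : Prop :=
  [/\ L2fun2 O f, L2fun2 O w &
      forall phi : R * R -> R, test_function O phi ->
        int2 O (fun p => f p * pder i j phi p) =
        (-1) ^+ (i + j) * int2 O (fun p => w p * phi p)].

(* A representative of the almost everywhere class of weak derivatives,
   meaningful when a square-integrable weak derivative exists. *)
Definition wder (R : realType) (O : set (R * R)) (i j : nat) (f : R * R -> R)
    : R * R -> R :=
  xget (fun _ : R * R => 0) [set w | weak_derivative O i j f w].

Definition sobolev (R : realType) (s : nat) (O : set (R * R)) (f : R * R -> R)
    : Prop :=
  forall i j : nat, (i + j <= s)%N ->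
    exists w : R * R -> R, weak_derivative O i j f w.

Definition seminorm_sq (R : realType) (k : nat) (O : set (R * R)) (f : R * R -> R)
    : R :=
  \sum_(i < k.+1) int2 O (fun p => wder O i (k - i) f p ^+ 2).

(* [T] is the trace on [{0} x [a, b]] of [w] in H^1(O), where [{0} x [a, b]] is a
   side of the rectangle [O]: the restriction to that side, extended by
   continuity from the functions that are smooth up to the boundary. *)
Definition side_trace (R : realType) (a b : R) (O : set (R * R)) (w : R * R -> R)
    (T : R -> R) : Prop :=
  [/\ sobolev 1 O w, L2fun1 a b T &
  exists phi : nat -> R * R -> R,
    [/\ forall n : nat, smooth (phi n),
        forall i j : nat, (i + j <= 1)%N ->
          int2 O (fun p => (pder i j (phi n) p - wder O i j w p) ^+ 2)
            @[n --> \oo] --> (0 : R) &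
        int1 a b (fun xi => (phi n (0, xi) - T xi) ^+ 2) @[n --> \oo] --> (0 : R)]].

(* The fictitious element [[-h, h] x [a, b]]; open halves are used in Sobolev
   spaces, closed or half-open ones differ from them by null sets. *)
Definition Kfict (R : realType) (h a b : R) : set (R * R) := cbox (- h) h a b.
Definition Kplus (R : realType) (h a b : R) : set (R * R) := obox 0 h a b.
Definition Kminus (R : realType) (h a b : R) : set (R * R) := obox (- h) 0 a b.

(* [[c w]] = 0 in the sense of traces, with [c = cp, cm] and [w = wp, wm] on the
   two halves. *)
Definition no_jump (R : realType) (h a b cp cm : R) (wp wm : R * R -> R) : Prop :=
  exists Tp Tm : R -> R,
    [/\ side_trace a b (Kplus h a b) wp Tp, side_trace a b (Kminus h a b) wm Tm &
        {ae (mu1 R), forall xi : R, a <= xi <= b -> cp * Tp xi = cm * Tm xi}].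

Definition psi (R : realType) (g : R -> R * R) (p : R * R) : R :=
  (1 + p.1 * curvature g p.2)^-1.

Definition J0 (R : realType) (g : R -> R * R) (p : R * R) : R :=
  psi g p ^+ 2 / enorm (derive1 g p.2) ^+ 2.

Definition J1 (R : realType) (g : R -> R * R) (p : R * R) : R :=
  curvature g p.2 * psi g p.

Definition J2 (R : realType) (g : R -> R * R) (p : R * R) : R :=
  - (psi g p ^+ 2 / enorm (derive1 g p.2) ^+ 2) *
    (p.1 * derive1 (curvature g) p.2 * psi g p +
     dotp (derive1 g p.2) (derive1n 2 g p.2) / enorm (derive1 g p.2) ^+ 2).

(* [D i j v] is the derivative of [v] of order [(i, j)] in [(eta, xi)], either
   classical ([pder]) or weak ([wder O]). *)
Definition Lop (R : realType) (g : R -> R * R)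
    (D : nat -> nat -> (R * R -> R) -> (R * R -> R)) (v : R * R -> R) : R * R -> R :=
  fun p => D 2 0 v p + J0 g p * D 0 2 v p + J1 g p * D 1 0 v p + J2 g p * D 0 1 v p.

(* The space H^s(K, Gamma; beta); the last two clauses are the jump conditions on
   [v] and [beta * v_eta]. *)
Definition Hspace (R : realType) (s : nat) (h a b bp bm : R) (v : R * R -> R)
    : Prop :=
  [/\ measurable_fun (T := plane R) (Kfict h a b) v,
      sobolev s (Kplus h a b) v, sobolev s (Kminus h a b) v,
      no_jump h a b 1 1 v v &
      no_jump h a b bp bm (wder (Kplus h a b) 1 0 v) (wder (Kminus h a b) 1 0 v)].

Definition extended_jump (R : realType) (g : R -> R * R) (h a b bp bm : R) (j : nat)
    (v : R * R -> R) : Prop :=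
  exists wp wm : R * R -> R,
    [/\ weak_derivative (Kplus h a b) j 0 (Lop g (wder (Kplus h a b)) v) wp,
        weak_derivative (Kminus h a b) j 0 (Lop g (wder (Kminus h a b)) v) wm &
        no_jump h a b bp bm wp wm].

Definition Qpoly (R : realType) (m : nat) (c : 'M[R]_(m.+1)) (p : R * R) : R :=
  \sum_(i < m.+1) \sum_(j < m.+1) c i j * p.1 ^+ i * p.2 ^+ j.

(* The one-sided values at [eta = 0] of the two pieces of [phi] and of their
   derivatives are those of the polynomials [Qpoly cp] and [Qpoly cm]. *)
Definition Vspace (R : realType) (m : nat) (g : R -> R * R) (h a b bp bm : R)
    (phi : R * R -> R) : Prop :=
  exists cp cm : 'M[R]_(m.+1),
    [/\ forall p : R * R, Kfict h a b p -> 0 <= p.1 -> phi p = Qpoly cp p,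
        forall p : R * R, Kfict h a b p -> p.1 < 0 -> phi p = Qpoly cm p &
        forall v : {poly R}, (size v <= m.+1)%N ->
          [/\ int1 a b (fun xi => (Qpoly cp (0, xi) - Qpoly cm (0, xi)) * v.[xi]) = 0,
              int1 a b (fun xi => (bp * pder 1 0 (Qpoly cp) (0, xi) -
                                   bm * pder 1 0 (Qpoly cm) (0, xi)) * v.[xi]) = 0 &
              forall j : nat, (j.+2 <= m)%N ->
                int1 a b (fun xi =>
                  (bp * pder j 0 (Lop g (@pder R) (Qpoly cp)) (0, xi) -
                   bm * pder j 0 (Lop g (@pder R) (Qpoly cm)) (0, xi)) * v.[xi]) = 0]].

Definition is_L2_projection (R : realType) (V : set (R * R -> R)) (O : set (R * R))
    (u pu : R * R -> R) : Prop :=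
  V pu /\ forall v : R * R -> R, V v -> int2 O (fun p => (u p - pu p) * v p) = 0.

Definition broken_seminorm (R : realType) (k : nat) (h a b : R) (v : R * R -> R)
    : R :=
  Num.sqrt (seminorm_sq k (Kplus h a b) v + seminorm_sq k (Kminus h a b) v).

(* Main.v *)
Require Import Defs.
From HB Require Import structures.
From mathcomp Require Import all_boot all_order all_algebra.
From mathcomp Require Import all_classical all_reals all_analysis.
From mathcomp Require Import measurable_realfun ring lra zify.
Import Order.TTheory GRing.Theory Num.Theory numFieldNormedType.Exports.
Local Open Scope classical_set_scope.
Local Open Scope ring_scope.
Set Implicit Arguments.
Unset Strict Implicit.
Unset Printing Implicit Defensive.

(** On each side of the interface, averaged derivatives and the Poincare inequality
    give a polynomial [q s] of total degree at most [m] whose derivatives approximate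
    those of [u] with the optimal powers of [h] (Bramble-Hilbert).  All the jump
    conditions are of the form: the functionals
    [trace_op l u = u, u_eta, d^j/deta^j L(u)] at [eta = 0] agree on both sides up to
    the factor [beta].  A trace tested against a polynomial [v] equals an integral
    over the half element, with the cut-off [1 - |eta| / h], so the moments of
    [trace_op l] of [u - q s] are controlled by the previous estimates.

    At [eta = 0], [trace_op l] maps [eta^k P(xi)] to 0 if [k > l] and to [l! P] if
    [k = l]; the system being triangular, a polynomial on one side
    has an extension to the other side which satisfies the discrete jump conditions.
    Extending from the side with the smaller [beta], the factors that enter are at
    most 1, so the difference [d] between the extension and the polynomial already
    chosen there has moments bounded independently of [beta], and the triangular
    system bounds the coefficients of [d] by descending powers of [h].  The resulting
    pair lies in the discrete space; optimality of the projection and inverse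
    inequalities conclude.  Inverse inequalities need [b - a] comparable to [h]:
    this follows because the nearest parameter of a vertex is its tubular coordinate,
    and a rectangle of fixed aspect ratio cannot be seen under a too small interval
    of parameters. *)

(** * Square-integrable functions *)

(** Weak derivatives are only known against smooth functions supported inside the open rectangle,
    and the coefficients of the operator are used as functions regular in [eta] but merely
    measurable and bounded in [xi]. Neither the Poincare inequality nor the product rule can then be
    tested directly. The remedy is absolute continuity on lines: on almost every slice a function is
    the primitive of its weak [eta]-derivative plus a constant, which gives integration by parts
    against every square-integrable function whose slices have zero mean. Tensor products of test
    functions suffice for this, and for uniqueness.

    The degrees make the discrete jump conditions a square system: the coefficient of [eta^l] is any
    polynomial of degree at most [m] in [xi], and so are the test polynomials, for each [l <= m].
    Hence the system is solved by projections, and an unknown coefficient can be tested against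
    itself. The [l]-th moment of the error is of size [h^(m-l+1/2)]; the factor [eta^l] and the
    width [h] restore [h^(m+1)]. The coefficients are bounded independently of the element because
    [1 + eta kappa >= 1/2]. *)

Section L2.
Context d (T : measurableType d) (R : realType) (mu : {measure set T -> \bar R}).
Implicit Types (D : set T) (f g b : T -> R).

(** [L2fun2] and [L2fun1] are instances of this predicate up to conversion, so each inequality is
    proved once for the plane and for intervals. *)
Definition L2 D f := measurable_fun D f /\ mu.-integrable D (fun x => (f x ^+ 2)%:E).

Lemma L2_sq D f : L2 D f -> mu.-integrable D (fun x => (f x ^+ 2)%:E).
Proof. by case. Qed.

Variable D : set T.
Hypothesis mD : measurable D.

Lemma integrable_realZ k f : mu.-integrable D (EFin \o f) ->
  mu.-integrable D (EFin \o (fun x => k * f x)).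
Proof. by move=> /(integrableZl mD k). Qed.

Lemma integrable_realD f g : mu.-integrable D (EFin \o f) ->
  mu.-integrable D (EFin \o g) -> mu.-integrable D (EFin \o (fun x => f x + g x)).
Proof. exact: integrableD. Qed.

Lemma integrable_realB f g : mu.-integrable D (EFin \o f) ->
  mu.-integrable D (EFin \o g) -> mu.-integrable D (EFin \o (fun x => f x - g x)).
Proof. exact: integrableB. Qed.

Lemma L2_mul f g : L2 D f -> L2 D g -> mu.-integrable D (fun x => (f x * g x)%:E).
Proof.
move=> [mf f2] [mg g2].
have := integrableD mD f2 g2.
apply: le_integrable => //.
  by apply/measurable_EFinP; exact: measurable_funM.
move=> x Dx /=; rewrite lee_fin.
rewrite [leRHS]ger0_norm ?addr_ge0 ?sqr_ge0//.
rewrite normrM.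
have := sqr_ge0 (`|f x| - `|g x|); rewrite sqrrB !real_normK ?num_real//.
have : 0 <= `|f x| * `|g x| by rewrite mulr_ge0.
lra.
Qed.

Lemma L2_D f g : L2 D f -> L2 D g -> L2 D (fun x => f x + g x).
Proof.
move=> [mf f2] [mg g2]; split; first exact: measurable_funD.
have -> : (fun x => ((f x + g x) ^+ 2)%:E) =
  (fun x => ((f x ^+ 2)%:E + (g x ^+ 2)%:E + 2%:E * (f x * g x)%:E)%E).
  by apply/funext => x; rewrite -EFinM -!EFinD; congr EFin; ring.
apply: integrableD => //; first exact: integrableD.
by apply: integrableZl => //; exact: L2_mul.
Qed.

Lemma L2_Z k f : L2 D f -> L2 D (fun x => k * f x).
Proof.
move=> [mf f2]; split; first exact: measurable_funM.
under eq_fun do rewrite exprMn EFinM.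
exact: integrableZl.
Qed.

Lemma L2_N f : L2 D f -> L2 D (fun x => - f x).
Proof. by move=> /(L2_Z (-1)); under eq_fun do rewrite mulN1r. Qed.

Lemma L2_B f g : L2 D f -> L2 D g -> L2 D (fun x => f x - g x).
Proof. by move=> Lf /L2_N; exact: L2_D. Qed.

Lemma L2_bmul (B : R) b f : measurable_fun D b -> (forall x, D x -> `|b x| <= B) ->
  L2 D f -> L2 D (fun x => b x * f x).
Proof.
move=> mb bB [mf f2]; split; first exact: measurable_funM.
apply: le_integrable (integrableZl mD (B ^+ 2) f2) => //.
  apply/measurable_EFinP; apply: measurable_funX; exact: measurable_funM.
move=> x Dx; rewrite /= lee_fin exprMn !normrM.
rewrite ler_wpM2r ?mulr_ge0// ler_pM//; by rewrite (le_trans (bB _ Dx))// ler_norm.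
Qed.

Lemma L2_bounded (B : R) b : (mu D < +oo)%E -> measurable_fun D b ->
  (forall x, D x -> `|b x| <= B) -> L2 D b.
Proof.
move=> fD mb bB.
have -> : b = (fun x => b x * 1) by apply/funext => x; rewrite mulr1.
apply: (@L2_bmul B) => //; split=> //.
have -> : (fun=> (1 ^+ 2)%:E) = EFin \o (cst 1 : T -> R).
  by apply/funext => x /=; rewrite expr1n.
apply: measurable_bounded_integrable => //.
by exists 1; split; [rewrite num_real|move=> x x1 y _ /=; rewrite normr1 ltW].
Qed.

Lemma L2_integrable f : (mu D < +oo)%E -> L2 D f -> mu.-integrable D (EFin \o f).
Proof.
move=> fD Lf.
have L1 : L2 D (cst 1).
  by apply: (@L2_bounded 1) => // x _ /=; rewrite normr1.
by have := L2_mul Lf L1; apply: eq_integrable => // x _ /=; rewrite mulr1.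
Qed.

Notation intg f := (\int[mu]_(x in D) f x)%R.

Lemma quadr_disc (a b c : R) : 0 <= a -> 0 <= c ->
  (forall t, 0 <= a - t * b *+ 2 + t ^+ 2 * c) -> b ^+ 2 <= a * c.
Proof.
move=> a0 c0 H.
have [c00|cn0] := eqVneq c 0.
  have [->|bn0] := eqVneq b 0; first by rewrite c00 mulr0 expr0n.
  (* For [c = 0] the affine function [a - 2 t b] takes the negative value [- a - 2] at this [t]. *)
  have := H ((a + 1) / b); rewrite c00 mulr0 addr0 divfK//; lra.
have cp : 0 < c by rewrite lt_def cn0.
have := H (b / c).
have -> : a - b / c * b *+ 2 + (b / c) ^+ 2 * c = (a * c - b ^+ 2) / c by field.
by rewrite pmulr_lge0 ?invr_gt0// subr_ge0.
Qed.

Lemma L2_expand f g : L2 D f -> L2 D g ->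
  intg (fun x => (f x + g x) ^+ 2) =
  intg (fun x => f x ^+ 2) + 2 * intg (fun x => f x * g x) + intg (fun x => g x ^+ 2).
Proof.
move=> Lf Lg; have fg := L2_mul Lf Lg; case: Lf Lg => [mf f2] [mg g2].
rewrite -RintegralZl// -RintegralD//; last exact: integrable_realZ.
rewrite -RintegralD//; last by apply: integrable_realD => //; exact: integrable_realZ.
by apply: eq_Rintegral => x _; ring.
Qed.

Lemma L2_ge0 f : 0 <= intg (fun x => f x ^+ 2).
Proof. by apply: Rintegral_ge0 => x _; exact: sqr_ge0. Qed.

Lemma L2_sqZ k f : L2 D f ->
  intg (fun x => (k * f x) ^+ 2) = k ^+ 2 * intg (fun x => f x ^+ 2).
Proof.
by move=> [_ f2]; rewrite -RintegralZl//; apply: eq_Rintegral => x _; rewrite exprMn.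
Qed.

Lemma L2_CS f g : L2 D f -> L2 D g ->
  intg (fun x => f x * g x) ^+ 2 <=
  intg (fun x => f x ^+ 2) * intg (fun x => g x ^+ 2).
Proof.
move=> Lf Lg; apply: quadr_disc; rewrite ?L2_ge0// => t.
have := L2_ge0 (fun x => f x + - t * g x).
rewrite L2_expand//; last exact: L2_Z.
rewrite L2_sqZ// (_ : intg (fun x => f x * (- t * g x)) = - t * intg (fun x => f x * g x)).
  by move/le_trans; apply; rewrite le_eqVlt; apply/orP; left; apply/eqP; ring.
by rewrite -RintegralZl//; [apply: eq_Rintegral => x _; ring|exact: L2_mul].
Qed.

Lemma L2_sqD f g : L2 D f -> L2 D g ->
  intg (fun x => (f x + g x) ^+ 2) <=
  2 * intg (fun x => f x ^+ 2) + 2 * intg (fun x => g x ^+ 2).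
Proof.
move=> Lf Lg; have := L2_ge0 (fun x => f x + - 1 * g x).
rewrite L2_expand; [|exact: Lf|exact: L2_Z].
rewrite L2_expand//.
rewrite L2_sqZ// (_ : intg (fun x => f x * (- 1 * g x)) = - 1 * intg (fun x => f x * g x)).
  rewrite sqrrN expr1n mul1r; lra.
by rewrite -RintegralZl//; [apply: eq_Rintegral => x _; ring|exact: L2_mul].
Qed.

Lemma L2_sqB f g : L2 D f -> L2 D g ->
  intg (fun x => (f x - g x) ^+ 2) <=
  2 * intg (fun x => f x ^+ 2) + 2 * intg (fun x => g x ^+ 2).
Proof.
move=> Lf Lg; have := L2_sqD Lf (L2_N Lg).
by under [X in _ <= _ + 2 * X -> _]eq_Rintegral do rewrite sqrrN.
Qed.

Lemma L2_sqbM (B : R) b f : measurable_fun D b -> (forall x, D x -> `|b x| <= B) ->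
  L2 D f -> intg (fun x => (b x * f x) ^+ 2) <= B ^+ 2 * intg (fun x => f x ^+ 2).
Proof.
move=> mb bB Lf; have [_ bf2] := L2_bmul mb bB Lf; case: Lf => [mf f2].
rewrite -RintegralZl//; apply: le_Rintegral => //.
  exact: integrable_realZ.
move=> x Dx; rewrite exprMn ler_wpM2r ?sqr_ge0//.
by rewrite -ler_sqrt ?sqr_ge0// !sqrtr_sqr (le_trans (bB _ Dx))// ler_norm.
Qed.

Lemma ae_Rintegral f g : measurable_fun D f -> measurable_fun D g ->
  {ae mu, forall x, D x -> f x = g x} -> intg f = intg g.
Proof.
move=> mf mg fg; congr fine; apply: ae_eq_integral => //.
- exact/measurable_EFinP.
- exact/measurable_EFinP.
- by apply: filterS fg => x fg /fg ->.
Qed.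

End L2.

(** * Integration on rectangles *)

Section IntegralParam.
Context d1 d2 (T1 : measurableType d1) (T2 : measurableType d2) (R : realType).
Variable m2 : {sigma_finite_measure set T2 -> \bar R}.

(** Tonelli applies to the positive and negative parts separately, and their difference is
    measurable in the extended reals whatever its values. *)
Lemma measurable_int_param (f : T1 * T2 -> \bar R) : measurable_fun setT f ->
  measurable_fun setT (fun x => \int[m2]_y f (x, y))%E.
Proof.
move=> mf.
have mp : measurable_fun setT (fun x : T1 => \int[m2]_y f^\+ (x, y))%E.
  apply: (measurable_fun_fubini_tonelli_F (f^\+)%E) => //.
  exact: measurable_funepos.
have mm : measurable_fun setT (fun x : T1 => \int[m2]_y f^\- (x, y))%E.
  apply: (measurable_fun_fubini_tonelli_F (f^\-)%E) => //.
  exact: measurable_funeneg.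
rewrite (_ : (fun x => _) = (fun x => \int[m2]_y f^\+ (x, y) -
  \int[m2]_y f^\- (x, y))%E); first exact: emeasurable_funB.
apply/funext => x; rewrite [LHS]integralE.
under eq_integral do rewrite funepos_comp/=.
by under [X in (_ - X)%E = _]eq_integral do rewrite funeneg_comp/=.
Qed.

Lemma measurable_Rint_param (H : T1 * T2 -> R) : measurable_fun setT H ->
  measurable_fun setT (fun x => (\int[m2]_y H (x, y))%R).
Proof.
move=> mH; rewrite /Rintegral; apply: measurableT_comp => //.
by apply: (@measurable_int_param (EFin \o H)); exact/measurable_EFinP.
Qed.

End IntegralParam.

Section IntegrableAe.
Context d (T : measurableType d) (R : realType) (mu : {measure set T -> \bar R}).

Lemma ae_imp (P Q : T -> Prop) : {ae mu, forall x, P x} ->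
  (forall x, P x -> Q x) -> {ae mu, forall x, Q x}.
Proof. by move=> aeP PQ; apply: filterS aeP. Qed.

Lemma ae_imp2 (P1 P2 Q : T -> Prop) : {ae mu, forall x, P1 x} ->
  {ae mu, forall x, P2 x} -> (forall x, P1 x -> P2 x -> Q x) -> {ae mu, forall x, Q x}.
Proof. by move=> aeP1 aeP2 PQ; apply: filterS2 aeP1 aeP2. Qed.

Lemma integrable_ae_eq (D : set T) (f g : T -> R) : measurable D ->
  measurable_fun D g -> {ae mu, forall x, D x -> f x = g x} ->
  mu.-integrable D (EFin \o f) -> mu.-integrable D (EFin \o g).
Proof.
move=> mD mg fg /integrableP[mf foo]; apply/integrableP.
split; first exact/measurable_EFinP.
rewrite (@ae_eq_integral _ _ _ _ _ (fun x => `|(f x)%:E|%E))//.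
- by apply: measurableT_comp => //; exact/measurable_EFinP.
- by apply: measurableT_comp => //.
- by apply: filterS fg => x fg /fg ->.
Qed.

Lemma integrable_patch (D : set T) (f : T -> R) : measurable D ->
  mu.-integrable D (EFin \o f) <-> mu.-integrable setT (EFin \o (f \_ D)).
Proof. by move=> mD; rewrite -restrict_EFin; exact: integrable_mkcond. Qed.

Lemma le_Rintegral_ae (D : set T) (f g : T -> R) : measurable D ->
  mu.-integrable D (EFin \o f) -> mu.-integrable D (EFin \o g) ->
  {ae mu, forall x, D x -> f x <= g x} ->
  (\int[mu]_(x in D) f x <= \int[mu]_(x in D) g x)%R.
Proof.
move=> mD intf intg fg; rewrite -subr_ge0 -RintegralB//.
have mf : measurable_fun D f by apply/measurable_EFinP; exact: measurable_int intf.
have mg : measurable_fun D g by apply/measurable_EFinP; exact: measurable_int intg.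
rewrite (@ae_Rintegral _ _ _ _ _ mD _ (fun x => `|g x - f x|)).
- by apply: Rintegral_ge0.
- exact: measurable_funB.
- by apply: measurableT_comp => //; exact: measurable_funB.
- by apply: (ae_imp fg) => x H Dx; rewrite ger0_norm// subr_ge0 H.
Qed.

End IntegrableAe.

Section Plane.
Context (R : realType).
Implicit Types (c d a b : R) (f g h : R * R -> R).

Lemma measurable_obox c d a b : measurable (obox c d a b : set (plane R)).
Proof. exact: measurableX. Qed.

Lemma measurable_cbox c d a b : measurable (cbox c d a b : set (plane R)).
Proof. exact: measurableX. Qed.

Lemma mu1_itv_oo (c d : R) : ((mu1 R) `]c, d[%classic < +oo)%E.
Proof. by rewrite lebesgue_measure_itv /=; case: ifP => _; rewrite ?ltry. Qed.

Lemma mu1_itv_cc (c d : R) : ((mu1 R) `[c, d]%classic < +oo)%E.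
Proof. by rewrite lebesgue_measure_itv /=; case: ifP => _; rewrite ?ltry. Qed.

Lemma fine_mu1_oo (c d : R) : c <= d -> fine ((mu1 R) `]c, d[%classic) = d - c.
Proof.
move=> cd; rewrite lebesgue_measure_itv /= lte_fin; case: ltP => //= dc.
by apply/esym/eqP; rewrite subr_eq0 eq_le cd dc.
Qed.

Lemma mu2_obox_lt c d a b : ((mu2 R) (obox c d a b) < +oo)%E.
Proof.
rewrite product_measure1E//= lte_mul_pinfty//; last exact: mu1_itv_oo.
by rewrite ge0_fin_numE//; exact: mu1_itv_oo.
Qed.

Lemma patch_slice f c d a b x y : (f \_ (obox c d a b)) (x, y) =
  ((fun y => (fun x => f (x, y)) \_ `]c, d[%classic) \_ `]a, b[%classic) y x.
Proof.
rewrite !patchE; have [|] := boolP (y \in `]a, b[%classic).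
  rewrite inE => yab; rewrite patchE; have [|] := boolP (x \in `]c, d[%classic).
    by rewrite inE => xcd; rewrite mem_set.
  by move=> xn; rewrite memNset// => -[/= xcd _]; rewrite mem_set in xn.
by move=> yn; rewrite memNset// => -[/= _ yab]; rewrite mem_set in yn.
Qed.

Section Iter.
Variables (c d a b : R) (f : R * R -> R).
Let O : set (plane R) := obox c d a b.
Hypothesis intf : (mu2 R).-integrable O (EFin \o f).

Let F : plane R -> \bar R := EFin \o (f \_ O).

Let intF : (mu2 R).-integrable setT F.
Proof.
rewrite /F -restrict_EFin; apply/(integrable_mkcond _ (measurable_obox c d a b)); exact: intf.
Qed.

Let F_slice y : (fun x => F (x, y)) =
  if y \in `]a, b[%classic then (EFin \o (fun x => f (x, y))) \_ `]c, d[%classic else cst 0%E.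
Proof.
apply/funext => x; rewrite /F /= patch_slice patchE; case: ifPn => //.
by rewrite !patchE; case: ifPn.
Qed.

Let int_F y : (\int[mu1 R]_x F (x, y) =
  ((fun y => \int[mu1 R]_(x in `]c, d[) (f (x, y))%:E) \_ `]a, b[) y)%E.
Proof.
rewrite F_slice patchE; case: ifPn => _; last by rewrite integral0.
by rewrite [RHS]integral_mkcond.
Qed.

Lemma ae_slice_integrable : {ae (mu1 R), forall y, y \in `]a, b[ ->
  (mu1 R).-integrable `]c, d[ (EFin \o (fun x => f (x, y)))}.
Proof.
have := ae_integrable2 intF; apply: filterS => y + yab.
rewrite F_slice mem_set//= => ?; exact/integrable_mkcond.
Qed.

Lemma slice_measurable : measurable_fun `]a, b[
  (fun y => (\int[mu1 R]_(x in `]c, d[) f (x, y))%R).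
Proof.
apply/(measurable_restrictT _ (measurable_itv _)).
have := measurable_fubini_G intF; rewrite /fubini_G => mG.
rewrite (_ : _ \_ _ = fine \o (fun y => \int[mu1 R]_x F (x, y))%E).
  exact: measurableT_comp.
by apply/funext => y /=; rewrite int_F !patchE; case: ifPn.
Qed.

(** On almost every slice the absolute value of the integral is at most the integral of the absolute
    value, whose integral in [y] is finite by Tonelli. *)
Lemma slice_integrable : (mu1 R).-integrable `]a, b[
  (EFin \o (fun y => (\int[mu1 R]_(x in `]c, d[) f (x, y))%R)).
Proof.
apply/integrableP; split; first by apply/measurable_EFinP; exact: slice_measurable.
have mF : measurable_fun setT F by exact: measurable_int intF.
have := (integrable21ltyP (mu1 R) (mu1 R) mF).1 intF.
apply: le_lt_trans; rewrite integral_mkcond.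
apply: ae_ge0_le_integral => //.
- by move=> y _; rewrite erestrict_ge0.
- apply/(measurable_restrictT _ (measurable_itv _)).
  by apply: measurableT_comp => //; apply/measurable_EFinP; exact: slice_measurable.
- by move=> y _; apply: integral_ge0.
- apply: (measurable_fun_fubini_tonelli_G (abse \o F)) => //=; exact: measurableT_comp.
apply: (ae_imp ae_slice_integrable) => y Hy _.
rewrite patchE; case: ifPn => [|_]; last exact: integral_ge0.
rewrite inE => yab.
rewrite /= EFin_normr_Rintegral//; last exact: Hy.
apply: (le_trans (le_abse_integral _ _ _)) => //; first exact: measurable_int (Hy yab).
rewrite integral_mkcond; apply: ge0_le_integral => //.
- by move=> x _; rewrite erestrict_ge0.
- apply/(measurable_restrictT _ (measurable_itv _)); apply: measurableT_comp => //.
  exact: measurable_int (Hy yab).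
- have mFy : measurable_fun setT (fun x => F (x, y)).
    rewrite F_slice mem_set//.
    apply/(measurable_restrictT _ (measurable_itv _)); exact: measurable_int (Hy yab).
  rewrite (_ : (fun x => _) = abse \o (fun x => F (x, y)))//.
  by apply: measurableT_comp => //; exact: mFy.
- move=> x _; rewrite /= patch_slice patchE (mem_set yab) !patchE.
  by case: ifPn => //; rewrite normr0.
Qed.

Lemma int2_iter : int2 O f =
  (\int[mu1 R]_(y in `]a, b[) (\int[mu1 R]_(x in `]c, d[) f (x, y)))%R.
Proof.
rewrite /int2 Rintegral_mkcond /Rintegral.
have -> : (\int[mu2 R]_x ((f \_ O) x)%:E)%E = (\int[mu2 R]_x F x)%E by [].
rewrite -(integral21_prod_meas1 intF) /fubini_G; congr fine.
rewrite [RHS]integral_mkcond; apply: ae_eq_integral => //.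
- exact: measurable_fubini_G intF.
- apply/(measurable_restrictT _ (measurable_itv _)); apply/measurable_EFinP.
  exact: slice_measurable.
apply: (ae_imp ae_slice_integrable) => y Hy _.
rewrite int_F !patchE; case: ifPn => //; rewrite inE => yab.
by rewrite fineK//; apply: integrable_fin_num => //; exact: Hy.
Qed.

End Iter.

Lemma ae_snd (P : R -> Prop) : {ae (mu1 R), forall y, P y} ->
  {ae (mu2 R), forall p : plane R, P p.2}.
Proof.
move=> [N [mN N0 sub]]; exists (setT `*` N); split.
- exact: measurableX.
- rewrite product_measure1E//; transitivity ((mu1 R) setT * 0)%E; last exact: mule0.
  by congr (_ * _)%E; exact: N0.
- by move=> [x y] /= H; split=> //=; exact: sub.
Qed.

Lemma measurable_snd_comp (q : R -> R) a b c d : measurable_fun `]a, b[ q ->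
  measurable_fun (obox c d a b : set (plane R)) (fun p : plane R => q p.2).
Proof.
move=> mq; apply: (measurable_comp (F := `]a, b[%classic) _ _ mq) => //.
- by move=> _ [[x y] [_ yab] <-].
- by apply: (measurable_funS measurableT) => //; exact: measurable_snd.
Qed.

Lemma measurable_fst_comp (q : R -> R) a b c d : measurable_fun `]c, d[ q ->
  measurable_fun (obox c d a b : set (plane R)) (fun p : plane R => q p.1).
Proof.
move=> mq; apply: (measurable_comp (F := `]c, d[%classic) _ _ mq) => //.
- by move=> _ [[x y] [xcd _] <-].
- by apply: (measurable_funS measurableT) => //; exact: measurable_fst.
Qed.

Section Slices.
Variables (c d a b : R).
Hypothesis cd : c <= d.
Let O : set (plane R) := obox c d a b.
Let mO : measurable O := measurable_obox c d a b.

Lemma integrable_snd (q : R -> R) : (mu1 R).-integrable `]a, b[ (EFin \o q) ->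
  (mu2 R).-integrable O (EFin \o (fun p => q p.2)).
Proof.
move=> iq.
have mq : measurable_fun `]a, b[ q by apply/measurable_EFinP; exact: measurable_int iq.
have mqO := @measurable_snd_comp q a b c d mq.
pose F : plane R -> \bar R := EFin \o ((fun p => q p.2) \_ O).
have mF : measurable_fun setT F.
  by apply/measurable_EFinP; apply/(measurable_restrictT _ mO).
suff : (mu2 R).-integrable setT F.
  by rewrite /F -restrict_EFin => /(integrable_mkcond _ mO).
apply/(integrable21ltyP (mu1 R) (mu1 R) mF).
have -> : (fun y => \int[mu1 R]_x `|F (x, y)|)%E =
    ((fun y => (d - c)%:E * `|(q y)%:E|) \_ `]a, b[)%E.
  apply/funext => y; rewrite patchE /F; case: ifPn => yab.
    have -> : (fun x : R => `|(EFin \o (fun p => q p.2) \_ O) (x, y)|%E) =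
      ((cst `|(q y)%:E|%E) \_ `]c, d[).
      apply/funext => x; rewrite /= patch_slice !patchE yab patchE.
      by case: ifPn => //; rewrite normr0.
    rewrite -integral_mkcond integral_cst// muleC; congr (_ * _)%E.
    by rewrite -(fine_mu1_oo cd) fineK// ge0_fin_numE// mu1_itv_oo.
  rewrite integral0_eq// => x _; rewrite /= patch_slice patchE (negbTE yab).
  by rewrite normr0.
rewrite -integral_mkcond ge0_integralZl//; last 2 first.
  by apply: measurableT_comp => //; apply/measurable_EFinP.
  by rewrite lee_fin subr_ge0.
rewrite lte_mul_pinfty// ?lee_fin ?subr_ge0//.
by case/integrableP : iq.
Qed.

Lemma int2_snd (q : R -> R) : (mu1 R).-integrable `]a, b[ (EFin \o q) ->
  int2 O (fun p => q p.2) = (d - c) * (\int[mu1 R]_(y in `]a, b[) q y)%R.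
Proof.
move=> iq; rewrite int2_iter; last exact: integrable_snd.
rewrite -RintegralZl//; apply: eq_Rintegral => y _.
by rewrite /= Rintegral_cst// fine_mu1_oo// mulrC.
Qed.

(** Converts a bound on almost every slice, by a quantity depending on [y] only, into integrability
    on the rectangle; the factor [d - c] is the length of a slice. *)
Lemma dom_slice (h : R * R -> R) (q : R -> R) : measurable_fun O h ->
  (mu1 R).-integrable `]a, b[ (EFin \o q) ->
  {ae (mu1 R), forall y, y \in `]a, b[ -> forall x, x \in `]c, d[ -> `|h (x, y)| <= q y} ->
  (mu2 R).-integrable O (EFin \o h) /\
  int2 O (fun p => `|h p|) <= (d - c) * (\int[mu1 R]_(y in `]a, b[) q y)%R.
Proof.
move=> mh iq /ae_snd hq.
have mq : measurable_fun `]a, b[ q by apply/measurable_EFinP; exact: measurable_int iq.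
have mqO := @measurable_snd_comp q a b c d mq.
(* Truncation by zero makes the bound valid at every point, so that the integrability of [q]
   transfers; [h'] and [h] agree almost everywhere. *)
pose h' p := if `|h p| <= q p.2 then h p else 0.
have mh' : measurable_fun O h'.
  apply: measurable_fun_if => //.
  - by apply: measurable_fun_ler => //; apply: measurableT_comp.
  - by apply: measurable_funS mh => // p [].
have hh' : {ae mu2 R, forall p, O p -> h' p = h p}.
  apply: (ae_imp hq) => -[x y] /= H [/= xcd yab].
  by rewrite /h' H.
have h'q p : O p -> `|h' p| <= `|q p.2|.
  by move=> Op; rewrite /h'; case: ifPn => [/le_trans|]; [apply; exact: ler_norm|rewrite normr0].
have ih' : (mu2 R).-integrable O (EFin \o h').
  apply: le_integrable (integrable_snd iq) => //.
  exact/measurable_EFinP.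
have ih : (mu2 R).-integrable O (EFin \o h) by exact: integrable_ae_eq ih'.
split=> //; rewrite /int2.
rewrite (@ae_Rintegral _ _ _ _ _ mO _ (fun p => `|h' p|)); last 3 first.
- exact: measurableT_comp.
- exact: measurableT_comp.
- by apply: (ae_imp hh') => p H Op; rewrite H.
rewrite -int2_snd//; apply: le_Rintegral_ae => //.
- exact: integrable_norm.
- exact: integrable_snd.
- by apply: (ae_imp hq) => -[x y] /= H [/= xcd yab]; rewrite /h' /= H// H.
Qed.

Local Notation SL G p := (\int[mu1 R]_(s in `]c, p.1[) G (s, p.2))%R.
Local Notation SR G p := (\int[mu1 R]_(s in `]p.1, d[) G (s, p.2))%R.

Lemma patchO_measurable (G : plane R -> R) : measurable_fun O G -> measurable_fun setT (G \_ O).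
Proof. by move/(measurable_restrictT _ mO). Qed.

Let mker (G : plane R -> R) (P : plane R * measurableTypeR R -> bool) :
  measurable_fun setT G -> measurable_fun setT P ->
  measurable_fun setT (fun q : plane R * measurableTypeR R =>
    if P q then G (q.2, q.1.2) else 0).
Proof.
move=> mG mP; apply: measurable_fun_ifT => //.
apply: (measurableT_comp mG); apply: measurable_fun_pair; first exact: measurable_snd.
by apply: measurableT_comp; [exact: measurable_snd|exact: measurable_fst].
Qed.

(** The bound of integration depends on the point. The integral is therefore written over the whole
    line with an indicator kernel, jointly measurable in the point and in [s], to which
    measurability of integrals with a parameter applies. *)
Lemma measurable_SL G : measurable_fun O G -> measurable_fun O (fun p => SL G p).
Proof.
move=> mG; apply: (eq_measurable_fun (fun p : plane R => (\int[mu1 R]_s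
    (if (c < s) && (s < p.1) then (G \_ O) (s, p.2) else 0))%R)).
  move=> [x y] /set_mem [/= xcd yab]; rewrite [RHS]Rintegral_mkcond.
  apply: eq_Rintegral => s _ /=; rewrite patch_slice [RHS]patchE patchE mem_set//.
  rewrite (_ : (s \in `]c, x[%classic) = (c < s < x)); last by rewrite mem_setE in_itv.
  have [/andP[cs sx]|//] := boolP (c < s < x); rewrite patchE.
  rewrite mem_set//= in_itv /= cs (lt_trans sx)//.
  by move: xcd; rewrite in_itv => /andP[].
apply: (measurable_funS measurableT) => //.
have mP : measurable_fun setT
    (fun q : plane R * measurableTypeR R => (c < q.2) && (q.2 < q.1.1)).
  apply: measurable_and; apply: measurable_fun_ltr => //.
    by apply: measurableT_comp => //; exact: measurable_fst.
have := @measurable_Rint_param _ _ _ _ _ (mu1 R) _ (mker (patchO_measurable mG) mP).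
by [].
Qed.

Lemma measurable_SR G : measurable_fun O G -> measurable_fun O (fun p => SR G p).
Proof.
move=> mG; apply: (eq_measurable_fun (fun p : plane R => (\int[mu1 R]_s
    (if (p.1 < s) && (s < d) then (G \_ O) (s, p.2) else 0))%R)).
  move=> [x y] /set_mem [/= xcd yab]; rewrite [RHS]Rintegral_mkcond.
  apply: eq_Rintegral => s _ /=; rewrite patch_slice [RHS]patchE patchE mem_set//.
  rewrite (_ : (s \in `]x, d[%classic) = (x < s < d)); last by rewrite mem_setE in_itv.
  have [/andP[xs sd]|//] := boolP (x < s < d); rewrite patchE.
  rewrite mem_set//= in_itv /= sd andbT (lt_trans _ xs)//.
  by move: xcd; rewrite in_itv => /andP[].
apply: (measurable_funS measurableT) => //.
have mP : measurable_fun setT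
    (fun q : plane R * measurableTypeR R => (q.1.1 < q.2) && (q.2 < d)).
  apply: measurable_and; apply: measurable_fun_ltr => //.
    by apply: measurableT_comp => //; exact: measurable_fst.
have := @measurable_Rint_param _ _ _ _ _ (mu1 R) _ (mker (patchO_measurable mG) mP).
by [].
Qed.

Lemma slice_L2 G : L2fun2 O G -> {ae (mu1 R), forall y, y \in `]a, b[ ->
  L2 (mu1 R) `]c, d[ (fun x => G (x, y))}.
Proof.
move=> LG; have LG' : L2 (mu2 R) O G by [].
have iG := L2_integrable mO (mu2_obox_lt c d a b) LG'.
have h1 := ae_slice_integrable iG.
have h2 := ae_slice_integrable (L2_sq LG').
apply: (ae_imp2 h1 h2) => y H1 H2 yab; split; last exact: H2.
by apply/measurable_EFinP; exact: measurable_int (H1 yab).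
Qed.

(** Cauchy-Schwarz against the indicator of [I], whose square has integral at most [d - c]. *)
Lemma sub_int_sq (I : set R) (F : R -> R) : measurable I -> I `<=` `]c, d[ ->
  L2 (mu1 R) `]c, d[ F ->
  (\int[mu1 R]_(s in I) F s)%R ^+ 2 <= (d - c) * (\int[mu1 R]_(s in `]c, d[) F s ^+ 2)%R.
Proof.
move=> mI sub LF.
have L1 : L2 (mu1 R) `]c, d[ (\1_I : R -> R).
  apply: (@L2_bounded _ _ _ _ _ _ 1) => //; first exact: mu1_itv_oo.
  by move=> x _; rewrite ger0_norm// indicE; case: (_ \in _).
have -> : (\int[mu1 R]_(s in I) F s)%R = (\int[mu1 R]_(s in `]c, d[) (\1_I s * F s))%R.
  rewrite Rintegral_mkcond [RHS]Rintegral_mkcond; apply: eq_Rintegral => s _.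
  rewrite !patchE indicE; case: ifPn => [sI|_]; last by rewrite mul0r; case: ifP.
  by rewrite mul1r mem_set//; exact/sub/set_mem.
apply: (le_trans (L2_CS _ L1 LF)) => //; rewrite ler_wpM2r//.
  by apply: Rintegral_ge0 => x _; exact: sqr_ge0.
have -> : d - c = (\int[mu1 R]_(s in `]c, d[) (fun=> 1) s)%R.
  by rewrite Rintegral_cst// mul1r fine_mu1_oo.
apply: le_Rintegral => //.
- exact: (L2_sq L1).
- have : L2 (mu1 R) `]c, d[ (fun=> 1 : R).
    by apply: (@L2_bounded _ _ _ _ _ _ 1) => // [|x _]; [exact: mu1_itv_oo|rewrite normr1].
  by move/L2_integrable; apply => //; exact: mu1_itv_oo.
Qed.

(** Common scheme for the two primitives, for the mean over a slice and for the constants of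
    integration in [acl_slices]: an operator acting slice by slice is bounded on the rectangle as
    soon as its values are bounded by the norm of the slice. *)
Lemma L2_slice_op (M : R) (S : R * R -> R) G : L2fun2 O G -> measurable_fun O S ->
  (forall y, y \in `]a, b[ -> L2 (mu1 R) `]c, d[ (fun x => G (x, y)) ->
    forall x, x \in `]c, d[ ->
    S (x, y) ^+ 2 <= M * (\int[mu1 R]_(s in `]c, d[) G (s, y) ^+ 2)%R) ->
  L2fun2 O S /\ int2 O (fun p => S p ^+ 2) <= (d - c) * M * int2 O (fun p => G p ^+ 2).
Proof.
move=> LG mS HS.
have LG' : L2 (mu2 R) O G by [].
have iq := slice_integrable (L2_sq LG').
have [] := @dom_slice (fun p => S p ^+ 2) (fun y => M * (\int[mu1 R]_(s in `]c, d[) G (s, y) ^+ 2)%R).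
- exact: measurable_funX.
- exact: integrable_realZ.
- apply: (ae_imp (slice_L2 LG)) => y H yab x xcd.
  by rewrite ger0_norm ?sqr_ge0//; apply: HS => //; exact: H.
move=> i1 i2; split; first by split.
rewrite (int2_iter (L2_sq LG')) -mulrA -RintegralZl//.
by move: i2; congr (_ <= _); apply: eq_Rintegral => p _; rewrite ger0_norm ?sqr_ge0.
Qed.

Lemma L2_SL G : L2fun2 O G -> L2fun2 O (fun p => SL G p) /\
  int2 O (fun p => SL G p ^+ 2) <= (d - c) ^+ 2 * int2 O (fun p => G p ^+ 2).
Proof.
move=> LG; rewrite expr2; apply: L2_slice_op => //; first by apply: measurable_SL; case: LG.
move=> y yab LGy x; rewrite in_itv /= => /andP[cx xd]; apply: sub_int_sq => //.
by apply: subset_itvl; rewrite bnd_simp ltW.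
Qed.

Lemma L2_SR G : L2fun2 O G -> L2fun2 O (fun p => SR G p) /\
  int2 O (fun p => SR G p ^+ 2) <= (d - c) ^+ 2 * int2 O (fun p => G p ^+ 2).
Proof.
move=> LG; rewrite expr2; apply: L2_slice_op => //; first by apply: measurable_SR; case: LG.
move=> y yab LGy x; rewrite in_itv /= => /andP[cx xd]; apply: sub_int_sq => //.
by apply: subset_itvr; rewrite bnd_simp ltW.
Qed.


(** Both members are the integral of [G s * S x] over the triangle [s < x], computed by Fubini in
    the two orders. *)
Lemma adjoint1 (G S : R -> R) :
  (mu1 R).-integrable `]c, d[ (EFin \o G) -> (mu1 R).-integrable `]c, d[ (EFin \o S) ->
  (\int[mu1 R]_(x in `]c, d[) ((\int[mu1 R]_(s in `]c, x[) G s)%R * S x))%R =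
  (\int[mu1 R]_(s in `]c, d[) (G s * (\int[mu1 R]_(x in `]s, d[) S x)%R))%R.
Proof.
move=> iG iS.
pose G0 : measurableTypeR R -> R := G \_ `]c, d[.
pose S0 : measurableTypeR R -> R := S \_ `]c, d[.
have iG0 : (mu1 R).-integrable setT (EFin \o G0).
  exact: (integrable_patch (mu1 R) G (measurable_itv _)).1 iG.
have iS0 : (mu1 R).-integrable setT (EFin \o S0).
  exact: (integrable_patch (mu1 R) S (measurable_itv _)).1 iS.
have mG0 : measurable_fun setT G0 by apply/measurable_EFinP; exact: measurable_int iG0.
have mS0 : measurable_fun setT S0 by apply/measurable_EFinP; exact: measurable_int iS0.
pose H (p : plane R) : R := if p.1 < p.2 then G0 p.1 * S0 p.2 else 0.
have mGS : measurable_fun setT (fun p : plane R => G0 p.1 * S0 p.2).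
  by apply: measurable_funM; apply: measurableT_comp.
have mH : measurable_fun setT H.
  by apply: measurable_fun_ifT => //; apply: measurable_fun_ltr.
have iH : (mu2 R).-integrable setT (EFin \o H).
  have : (mu2 R).-integrable setT (EFin \o (fun p : plane R => G0 p.1 * S0 p.2)).
    apply/(integrable12ltyP (mu1 R) (mu1 R)); first exact/measurable_EFinP.
    have E x : (\int[mu1 R]_y `|((G0 x * S0 y)%R)%:E| = `|(G0 x)%:E| * \int[mu1 R]_y `|(S0 y)%:E|)%E.
      under eq_integral do rewrite EFinM abseM.
      rewrite ge0_integralZl//; apply: measurableT_comp => //; exact/measurable_EFinP.
    rewrite (eq_integral (fun x => `|(G0 x)%:E| * \int[mu1 R]_y `|(S0 y)%:E|)%E); last first.
      by move=> x _; exact: E.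
    have iS0f : (\int[mu1 R]_y `|(S0 y)%:E| < +oo)%E by case/integrableP : iS0.
    rewrite ge0_integralZr//; last 2 first.
      by apply: measurableT_comp => //; exact/measurable_EFinP.
      exact: integral_ge0.
    rewrite lte_mul_pinfty//; first exact: integral_ge0.
      by rewrite ge0_fin_numE; [case/integrableP : iG0|exact: integral_ge0].
  apply: le_integrable => //; first exact/measurable_EFinP.
  by move=> [x y] _; rewrite /= /H /= lee_fin; case: ifPn => // _; rewrite normr0.
have h1 := Fubini iH.
clear iG0 iS0 mG0 mS0 mGS mH iH.
transitivity (fine (\int[mu1 R]_y \int[mu1 R]_x (EFin \o H) (x, y))%E).
  rewrite {h1} Rintegral_mkcond; congr fine; apply: eq_integral => x _.
  rewrite patchE.
  have -> : (fun s => (EFin \o H) (s, x)) = EFin \o (fun s => S0 x * (G \_ `]c, x[) s).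
    apply/funext => s /=; congr EFin; rewrite /H /= /G0 /S0 !patchE.
    case: ifPn => sx; last first.
      by rewrite (_ : (s \in `]c, x[%classic) = false) ?mulr0// mem_setE in_itv /= (negbTE sx) andbF.
    have [|] := boolP (x \in `]c, d[%classic); last by rewrite mulr0 mul0r.
    rewrite inE /= in_itv /= => /andP[cx xd].
    rewrite mulrC; congr (_ * _).
    have E1 : (s \in `]c, d[%classic) = (c < s) by rewrite mem_setE in_itv /= (lt_trans sx xd) andbT.
    have E2 : (s \in `]c, x[%classic) = (c < s) by rewrite mem_setE in_itv /= sx andbT.
    by rewrite E1 E2.
  case: ifPn => xcd; last first.
    by rewrite integral0_eq// => s _ /=; rewrite /S0 patchE (negbTE xcd) mul0r.
  move: xcd; rewrite inE /= in_itv /= => /andP[cx xd].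
  have iGx : (mu1 R).-integrable setT (EFin \o (G \_ `]c, x[)).
    apply: (integrable_patch (mu1 R) G (measurable_itv _)).1.
    apply: integrableS iG => //; apply: subset_itvl; by rewrite bnd_simp ltW.
  rewrite -[RHS]fineK; last by apply: integrable_fin_num; [exact: measurableT|exact: integrable_realZ].
  congr EFin; rewrite -[RHS]/(\int[mu1 R]_s (S0 x * (G \_ `]c, x[) s))%R.
  rewrite (@RintegralZl _ _ _ (mu1 R) _ _ _ measurableT iGx) mulrC -Rintegral_mkcond /S0 patchE mem_set //=.
  by rewrite in_itv /= cx xd.
rewrite -h1 {h1} [RHS]Rintegral_mkcond; congr fine; apply: eq_integral => s _.
rewrite patchE.
have -> : (fun y => (EFin \o H) (s, y)) = EFin \o (fun x => G0 s * (S \_ `]s, d[) x).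
  apply/funext => x /=; congr EFin; rewrite /H /= /G0 /S0 !patchE.
  case: ifPn => sx; last first.
    by rewrite (_ : (x \in `]s, d[%classic) = false) ?mulr0// mem_setE in_itv /= (negbTE sx).
  have [|] := boolP (s \in `]c, d[%classic); last by rewrite !mul0r.
  rewrite inE /= in_itv /= => /andP[cs sd].
  congr (_ * _).
  have E1 : (x \in `]c, d[%classic) = (x < d) by rewrite mem_setE in_itv /= (lt_trans cs sx).
  have E2 : (x \in `]s, d[%classic) = (x < d) by rewrite mem_setE in_itv /= sx.
  by rewrite E1 E2.
case: ifPn => scd; last first.
  by rewrite integral0_eq// => x _ /=; rewrite /G0 patchE (negbTE scd) mul0r.
move: scd; rewrite inE /= in_itv /= => /andP[cs sd].
have iSx : (mu1 R).-integrable setT (EFin \o (S \_ `]s, d[)).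
  apply: (integrable_patch (mu1 R) S (measurable_itv _)).1.
  apply: integrableS iS => //; apply: subset_itvr; by rewrite bnd_simp ltW.
rewrite -[LHS]fineK; last by apply: integrable_fin_num; [exact: measurableT|exact: integrable_realZ].
congr EFin; rewrite -[LHS]/(\int[mu1 R]_x (G0 s * (S \_ `]s, d[) x))%R.
rewrite (@RintegralZl _ _ _ (mu1 R) _ _ _ measurableT iSx) -Rintegral_mkcond /G0 patchE mem_set //=.
by rewrite in_itv /= cs sd.
Qed.

Lemma adjoint2 G S : L2fun2 O G -> L2fun2 O S ->
  int2 O (fun p => SL G p * S p) = int2 O (fun p => G p * SR S p).
Proof.
move=> LG LS; have [LSL _] := L2_SL LG; have [LSR _] := L2_SR LS.
rewrite !int2_iter; try exact: (L2_mul mO).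
apply: ae_Rintegral => //.
- exact: (slice_measurable (L2_mul mO LSL LS)).
- exact: (slice_measurable (L2_mul mO LG LSR)).
apply: (ae_imp2 (slice_L2 LG) (slice_L2 LS)) => y HG HS yab /=.
by apply: adjoint1; apply: L2_integrable => //; try exact: mu1_itv_oo; [exact: HG|exact: HS].
Qed.

End Slices.
End Plane.

(** * Smooth bump functions *)

Section Smooth1.
Context (R : realType).
Implicit Types (f g h phi : R -> R).

Definition smooth1 f := forall n x, derivable (derive1n n f) x 1.

(** Smoothness is a greatest fixed point: a function is smooth if it belongs to some family of
    derivable functions stable under derivation. *)
Lemma smooth1_coind (P : (R -> R) -> Prop) :
  (forall f, P f -> (forall x, derivable f x 1) /\ P (derive1 f)) ->
  forall f, P f -> smooth1 f.
Proof.
move=> H f Pf n; have : P (derive1n n f).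
  elim: n => [|n IH]; first exact: Pf.
  by rewrite derive1nS; exact: (H _ IH).2.
by move/H => [].
Qed.

Lemma smooth1_derivable f x : smooth1 f -> derivable f x 1.
Proof. by move/(_ 0%N x). Qed.

Lemma smooth1_derive1 f : smooth1 f -> smooth1 (derive1 f).
Proof. by move=> sf n x; rewrite -derive1Sn. Qed.

Lemma smooth1_continuous f : smooth1 f -> continuous f.
Proof.
by move=> sf x; apply: differentiable_continuous; apply/derivable1_diffP; exact: sf 0%N x.
Qed.

Lemma derive1_add f g x : derivable f x 1 -> derivable g x 1 ->
  derive1 (fun x => f x + g x) x = derive1 f x + derive1 g x.
Proof. by move=> df dg; rewrite !derive1E (deriveD df dg). Qed.

Lemma derive1_mul f g x : derivable f x 1 -> derivable g x 1 ->
  derive1 (fun x => f x * g x) x = derive1 f x * g x + f x * derive1 g x.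
Proof.
by move=> df dg; rewrite !derive1E (deriveM df dg) addrC; congr (_ + _); exact: mulrC.
Qed.

(** Leibniz's rule turns a product into a sum of products, so a family stable under derivation must
    be closed under both operations at once. *)
Inductive smooth_closure : (R -> R) -> Prop :=
| smooth_closure_base f : smooth1 f -> smooth_closure f
| smooth_closure_add f g : smooth_closure f -> smooth_closure g ->
    smooth_closure (fun x => f x + g x)
| smooth_closure_mul f g : smooth_closure f -> smooth_closure g ->
    smooth_closure (fun x => f x * g x).

Lemma smooth_closure_smooth1 f : smooth_closure f -> smooth1 f.
Proof.
apply: smooth1_coind => {}f; elim=> {f} [f sf|f g _ [df sf] _ [dg sg]|f g cf [df sf] cg [dg sg]].
- by split; [exact: sf 0%N|apply: smooth_closure_base; exact: smooth1_derive1].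
- split; first by move=> x; exact: derivableD.
  rewrite (_ : derive1 _ = (fun x => derive1 f x + derive1 g x)).
    exact: smooth_closure_add.
  by apply/funext => x; rewrite derive1_add.
- split; first by move=> x; exact: derivableM.
  rewrite (_ : derive1 _ = (fun x => derive1 f x * g x + f x * derive1 g x)).
    by apply: smooth_closure_add; exact: smooth_closure_mul.
  by apply/funext => x; rewrite derive1_mul.
Qed.

Lemma smooth1D f g : smooth1 f -> smooth1 g -> smooth1 (fun x => f x + g x).
Proof.
by move=> sf sg; apply: smooth_closure_smooth1; apply: smooth_closure_add;
  exact: smooth_closure_base.
Qed.

Lemma smooth1M f g : smooth1 f -> smooth1 g -> smooth1 (fun x => f x * g x).
Proof.
by move=> sf sg; apply: smooth_closure_smooth1; apply: smooth_closure_mul;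
  exact: smooth_closure_base.
Qed.

Lemma smooth1_cst (k : R) : smooth1 (fun=> k).
Proof.
apply: (@smooth1_coind (fun f => exists k, f = fun=> k)); last by exists k.
move=> _ [l ->]; split=> [x|]; first exact: derivable_cst.
by exists 0; apply/funext => x; rewrite derive1E derive_cst.
Qed.

Lemma derive1_affine f (s t x : R) : derivable f (s * x + t) 1 ->
  derivable (fun x => f (s * x + t)) x 1 /\
  derive1 (fun x => f (s * x + t)) x = s * derive1 f (s * x + t).
Proof.
move=> df.
have H1 : is_derive x (1:R) (fun x : R => s * x + t) s.
  have : is_derive x (1:R) (fun x : R => s * x + t) (s *: 1 + 0).
    apply: is_deriveD; exact: is_deriveZ.
  by rewrite addr0 /GRing.scale /= mulr1.
have H2 : is_derive (s * x + t) (1:R) f (derive1 f (s * x + t)).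
  by rewrite derive1E; exact: derivableP.
have := @is_derive1_comp R f (fun x => s * x + t) x _ _ H2 H1; rewrite [f \o _]/comp /=.
by move=> [d1 d2]; split=> //; rewrite derive1E d2 mulrC.
Qed.

Lemma smooth1_affine f (s t : R) : smooth1 f -> smooth1 (fun x => f (s * x + t)).
Proof.
move=> sf.
apply: (@smooth1_coind (fun h => exists k g, smooth1 g /\ h = fun x => k * g (s * x + t))).
  move=> _ [k [g [sg ->]]]; split=> [x|].
    by apply: derivableM => //; exact: (derive1_affine (sg 0%N _)).1.
  exists (k * s), (derive1 g); split; first exact: smooth1_derive1.
  apply/funext => x; have [d1 d2] := derive1_affine (sg 0%N (s * x + t)).
  by rewrite (derive1Ml k d1) d2 mulrA.
by exists 1, f; split=> //; apply/funext => x; rewrite mul1r.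
Qed.

(* [exp(-1/x)] times a polynomial in [1/x]: a family closed under derivation. *)
Definition flat (p : {poly R}) (x : R) : R :=
  if x <= 0 then 0 else p.[x^-1] * expR (- x^-1).

(** For [k > 0], raise [y / k <= expR (y / k)] to the power [k]. *)
Lemma expRN_le_powV k (y : R) : 0 < y -> expR (- y) <= (k%:R ^+ k) / y ^+ k.
Proof.
case: k => [|k] y0.
  by rewrite !expr0 divr1 -[leRHS]expR0 ler_expR oppr_le0 ltW.
have y0' : 0 < y / k.+1%:R by rewrite divr_gt0.
have : (y / k.+1%:R) ^+ k.+1 <= expR y.
  have -> : expR y = expR (y / k.+1%:R) ^+ k.+1.
    by rewrite -expRM_natl; congr expR; rewrite mulrC divfK// pnatr_eq0.
  rewrite ler_pXn2r ?nnegrE ?expR_ge0// ?ltW//.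
  by rewrite (lt_le_trans _ (expR_ge1Dx _)) // ltrDr.
rewrite expRN expr_div_n => H.
rewrite -[leRHS]invrK lef_pV2 ?posrE ?expR_gt0 ?invr_gt0 ?divr_gt0 ?exprn_gt0//.
by rewrite invfM invrK mulrC.
Qed.

(** The square on the right leaves one power of [x] after division by [x], which settles the
    derivative at the origin. *)
Lemma flat_quot_bound (p : {poly R}) : exists C, 0 <= C /\
  forall x : R, 0 < x -> x <= 1 -> `|p.[x^-1] * expR (- x^-1)| <= C * x ^+ 2.
Proof.
(* The term of degree [i] is of order [x^(N - i)], and [N - i >= 2] for every [i < size p]. *)
have [N hN] : exists N, N = (size p).+2 by eexists.
exists (\sum_(i < size p) `|p`_i| * (N%:R ^+ N)); split.
  by apply: sumr_ge0 => i _; rewrite mulr_ge0// exprn_ge0.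
move=> x x0 x1; rewrite horner_coef mulr_suml mulr_suml.
apply: (le_trans (ler_norm_sum _ _ _)); apply: ler_sum => i _.
rewrite !normrM -!mulrA ler_wpM2l//.
have xV : 0 < x^-1 by rewrite invr_gt0.
rewrite (ger0_norm (expR_ge0 _)) (ger0_norm (exprn_ge0 _ (ltW xV))).
have := expRN_le_powV N xV.
move=> /(ler_wpM2l (exprn_ge0 i (ltW xV))) => H.
apply: (le_trans H) => {H}.
rewrite mulrCA ler_wpM2l ?exprn_ge0// !exprVn invrK.
have -> : N = (i + (size p - i) + 2)%N by rewrite hN subnKC ?addn2// ltnW.
rewrite -addnA exprD mulrA mulVf ?expf_neq0 ?gt_eqF// mul1r exprD.
by rewrite -[leRHS]mul1r ler_wpM2r ?exprn_ge0 ?(ltW x0)// exprn_ile1// ltW.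
Qed.

Lemma flat_derivable_pos (p : {poly R}) (x : R) : 0 < x ->
  is_derive x 1 (flat p) (flat ('X^2 * (p - p^`())) x).
Proof.
move=> x0.
have xn0 : x != 0 by rewrite gt_eqF.
pose F := fun x : R => p.[x^-1] * expR (- x^-1).
have HV : is_derive x (1:R) (fun x : R => x^-1) (- x ^- 2).
  have := @is_deriveV R id x 1 1 xn0 (is_derive_id _ _).
  by rewrite /GRing.scale /= mulr1.
have Hp : is_derive x (1:R) (fun x : R => p.[x^-1]) (- x ^- 2 * p^`().[x^-1]).
  have H2 : is_derive (x^-1) (1:R) (horner p) (p^`().[x^-1]).
    by rewrite derivE derive1E; apply: derivableP; exact: derivable_horner.
  have := @is_derive1_comp R (horner p) (fun x => x^-1) x _ _ H2 HV; rewrite [_ \o _]/comp /=.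
  by rewrite mulrC.
have HN : is_derive x (1:R) (fun x : R => - x^-1) (x ^- 2).
  by have := is_deriveN HV; rewrite opprK.
have He : is_derive x (1:R) (fun x : R => expR (- x^-1)) (x ^- 2 * expR (- x^-1)).
  by have := @is_derive1_comp R expR (fun x => - x^-1) x _ _ (is_derive_expR (- x^-1)) HN; rewrite [_ \o _]/comp /= mulrC.
have HF : is_derive x (1:R) F (flat ('X^2 * (p - p^`())) x).
  have := is_deriveM Hp He; rewrite /GRing.scale /= => H; rewrite /F.
  apply: is_derive_eq H _.
  rewrite /flat leNgt x0 /= hornerM hornerXn hornerD hornerN exprVn.
  set e := expR _; set q := _.[_]; set q' := _.[_]; set X := _^-1; ring.
apply: near_eq_is_derive HF.
near=> y; rewrite /F /flat.
have -> : y <= 0 = false; last by [].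
apply/negbTE; rewrite -ltNge; near: y.
by apply: lt_nbhsr.
Unshelve. all: by end_near. Qed.

Lemma flat_derivable_neg (p : {poly R}) (x : R) : x < 0 ->
  is_derive x 1 (flat p) (flat ('X^2 * (p - p^`())) x).
Proof.
move=> x0; rewrite [X in is_derive _ _ _ X]/flat (ltW x0).
apply: (@near_eq_is_derive _ _ _ (cst 0)).
near=> y; rewrite /flat.
have -> : y <= 0 = true; last by [].
by apply: ltW; near: y; exact: lt_nbhsl.
Unshelve. all: by end_near. Qed.

Lemma flat_derivable0 (p : {poly R}) : is_derive (0 : R) 1 (flat p) (flat ('X^2 * (p - p^`())) 0).
Proof.
rewrite [X in is_derive _ _ _ X]/flat lexx.
have [C [C0 HC]] := flat_quot_bound p.
have cv : (fun h : R => h^-1 *: ((flat p \o shift 0) (h *: 1) - flat p 0)) @ (0 : R)^' --> (0 : R).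
  apply/cvgrPdist_le => e e0; near=> h.
  rewrite sub0r normrN /= addr0 {2}/flat lexx subr0 /GRing.scale /= mulr1 /flat.
  case: ifPn => [_|]; first by rewrite mulr0 normr0 ltW.
  rewrite -ltNge => h0; rewrite normrM normfV (gtr0_norm h0) ler_pdivrMl//.
  have h1 : h <= 1.
    rewrite (le_trans (ler_norm _))//; near: h; apply: dnbhs0_le; exact: ltr01.
  apply: (le_trans (HC _ h0 h1)).
  rewrite expr2 mulrA mulrAC [leRHS]mulrC ler_wpM2r ?(ltW h0)//.
  rewrite (@le_trans _ _ ((C + 1) * h))//; first by rewrite ler_wpM2r ?(ltW h0)// lerDl.
  rewrite mulrC -ler_pdivlMr; last by rewrite ltr_wpDl.
  rewrite (le_trans (ler_norm _))//; near: h; apply: dnbhs0_le.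
  by rewrite divr_gt0// ltr_wpDl.
split; first by apply/cvg_ex; exists 0.
exact: cvg_lim cv.
Unshelve. all: by end_near. Qed.

Lemma flat_is_derive (p : {poly R}) (x : R) :
  is_derive x 1 (flat p) (flat ('X^2 * (p - p^`())) x).
Proof.
have [x0|x0|->] := ltgtP x 0; [exact: flat_derivable_neg|exact: flat_derivable_pos|].
exact: flat_derivable0.
Qed.

Lemma smooth1_flat (p : {poly R}) : smooth1 (flat p).
Proof.
apply: (@smooth1_coind (fun f => exists p : {poly R}, f = flat p)); last by exists p.
move=> _ [q ->]; split; first by move=> x; have [] := flat_is_derive q x.
exists ('X^2 * (q - q^`())); apply/funext => x; rewrite derive1E.
by have [_ ->] := flat_is_derive q x.
Qed.

End Smooth1.

(** * Partial derivatives as derivatives along slices *)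

Section PartialDerivatives.
Context (R : realType).
Implicit Types (f : R * R -> R) (p : R * R).

Lemma shift_x (h x y : R) : h *: ((1, 0) : R * R) + (x, y) = (h + x, y).
Proof.
rewrite [LHS]surjective_pairing; congr pair.
  by rewrite /= /GRing.scale /= mulr1.
by rewrite /= /GRing.scale /= mulr0 add0r.
Qed.

Lemma shift_y (h x y : R) : h *: ((0, 1) : R * R) + (x, y) = (x, h + y).
Proof.
rewrite [LHS]surjective_pairing; congr pair.
  by rewrite /= /GRing.scale /= mulr0 add0r.
by rewrite /= /GRing.scale /= mulr1.
Qed.

Lemma DxE f p : Dx f p = derive1 (fun t => f (t, p.2)) p.1.
Proof.
case: p => x y; rewrite /Dx /derive /derive1.
apply: (congr1 (fun F : R -> R => lim (F @ 0^'))).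
by apply/funext => h; rewrite /= shift_x.
Qed.

Lemma DyE f p : Dy f p = derive1 (fun t => f (p.1, t)) p.2.
Proof.
case: p => x y; rewrite /Dy /derive /derive1.
apply: (congr1 (fun F : R -> R => lim (F @ 0^'))).
by apply/funext => h; rewrite /= shift_y.
Qed.

Lemma derivable_x f p :
  derivable f p ((1, 0) : R * R) <-> derivable (fun t => f (t, p.2)) p.1 1.
Proof.
case: p => x y; rewrite /derivable.
rewrite (_ : (fun h : R => h^-1 *: ((f \o shift (x, y)) (h *: ((1, 0) : R * R)) - f (x, y))) =
  (fun h : R => h^-1 *: (((fun t => f (t, y)) \o shift x) (h *: 1) - f (x, y))) )//.
by apply/funext => h; rewrite /= shift_x [h%:A]mulr1.
Qed.

Lemma derivable_y f p :
  derivable f p ((0, 1) : R * R) <-> derivable (fun t => f (p.1, t)) p.2 1.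
Proof.
case: p => x y; rewrite /derivable.
rewrite (_ : (fun h : R => h^-1 *: ((f \o shift (x, y)) (h *: ((0, 1) : R * R)) - f (x, y))) =
  (fun h : R => h^-1 *: (((fun t => f (x, t)) \o shift y) (h *: 1) - f (x, y))) )//.
by apply/funext => h; rewrite /= shift_y [h%:A]mulr1.
Qed.

End PartialDerivatives.

(** * Test functions that are tensor products *)

Section Tensor.
Context (R : realType).
Implicit Types (f g phi : R -> R).

Definition tensor f g (p : R * R) : R := f p.1 * g p.2.

Lemma derivable_tensor_x f g p : (forall x, derivable f x 1) ->
  derivable (tensor f g) p ((1, 0) : R * R).
Proof.
move=> df; apply/derivable_x; rewrite /tensor /=.
by apply: derivableM; [exact: df|exact: derivable_cst].
Qed.

Lemma derivable_tensor_y f g p : (forall x, derivable g x 1) ->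
  derivable (tensor f g) p ((0, 1) : R * R).
Proof.
move=> dg; apply/derivable_y; rewrite /tensor /=.
by apply: derivableM; [exact: derivable_cst|exact: dg].
Qed.

Lemma Dx_tensor f g : (forall x, derivable f x 1) ->
  Dx (tensor f g) = tensor (derive1 f) g.
Proof.
by move=> df; apply/funext => p; rewrite DxE /tensor /= (derive1Mr _ (df _)).
Qed.

Lemma Dy_tensor f g : (forall x, derivable g x 1) ->
  Dy (tensor f g) = tensor f (derive1 g).
Proof.
by move=> dg; apply/funext => p; rewrite DyE /tensor /= (derive1Ml _ (dg _)).
Qed.

Lemma pder_tensor f g i j : smooth1 f -> smooth1 g ->
  pder i j (tensor f g) = tensor (derive1n i f) (derive1n j g).
Proof.
move=> sf sg; rewrite /pder.
have -> : iter j (@Dy R) (tensor f g) = tensor f (derive1n j g).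
  elim: j => [|j IH]; first by [].
  by rewrite iterS IH Dy_tensor ?derive1nS//; exact: sg.
elim: i => [|i IH]; first by [].
by rewrite iterS IH Dx_tensor ?derive1nS//; exact: sf.
Qed.

Lemma continuous_tensor f g : continuous f -> continuous g -> continuous (tensor f g).
Proof.
move=> cf cg p; apply: continuousM.
  by apply: continuous_comp; [exact: cvg_fst|exact: cf].
by apply: continuous_comp; [exact: cvg_snd|exact: cg].
Qed.

Lemma smooth_tensor f g : smooth1 f -> smooth1 g -> smooth (tensor f g).
Proof.
move=> sf sg k; elim: k f g sf sg => [|k IH] f g sf sg /=.
  by apply: continuous_tensor; exact: smooth1_continuous.
split.
- by apply: continuous_tensor; exact: smooth1_continuous.
- by move=> p; apply: derivable_tensor_x; exact: (sf 0%N).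
- by move=> p; apply: derivable_tensor_y; exact: (sg 0%N).
- rewrite Dx_tensor; last exact: (sf 0%N).
  by apply: IH; [exact: smooth1_derive1|exact: sg].
- rewrite Dy_tensor; last exact: (sg 0%N).
  by apply: IH; [exact: sf|exact: smooth1_derive1].
Qed.

(** Compact support in []c, d[], expressed by a closed interval strictly inside: this form passes to
    derivatives and primitives without closures. *)
Definition test1 (c d : R) phi := smooth1 phi /\
  exists c' d', [/\ c < c', d' < d & forall x, phi x != 0 -> c' <= x <= d'].

Lemma test1_smooth c d phi : test1 c d phi -> smooth1 phi.
Proof. by case. Qed.

Lemma derive1_near0 phi x : (\forall y \near x, phi y = 0) -> derive1 phi x = 0.
Proof.
move=> H; rewrite derive1E (@near_eq_derive _ _ _ phi (cst 0)) ?derive_cst//.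
Qed.

Lemma test1_derive1 c d phi : test1 c d phi -> test1 c d (derive1 phi).
Proof.
move=> [sp [c' [d' [cc' dd' sup]]]]; split; first exact: smooth1_derive1.
exists c', d'; split=> // x; apply: contraTT => xcd.
rewrite negbK; apply/eqP; apply: derive1_near0.
move: xcd; rewrite negb_and -!ltNge => /orP[xc|dx].
  near=> y; apply/eqP; apply: contraTT isT => /sup/andP[yc _].
  suff : y < c' by rewrite ltNge yc.
  by near: y; exact: lt_nbhsl.
near=> y; apply/eqP; apply: contraTT isT => /sup/andP[_ yc].
suff : d' < y by rewrite ltNge yc.
by near: y; exact: lt_nbhsr.
Unshelve. all: by end_near. Qed.

Lemma test1_derive1n c d phi n : test1 c d phi -> test1 c d (derive1n n phi).
Proof.
move=> tp; elim: n => [|n IH]; first exact: tp.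
by rewrite derive1nS; exact: test1_derive1.
Qed.

Lemma test1_out c d phi x : test1 c d phi -> ~~ (c < x < d) -> phi x = 0.
Proof.
move=> [_ [c' [d' [cc' dd' sup]]]] H; apply/eqP; apply: contraNT H => /sup/andP[h1 h2].
by rewrite (lt_le_trans cc' h1) (le_lt_trans h2 dd').
Qed.

Lemma test1_sub c d c' d' phi : c <= c' -> d' <= d -> test1 c' d' phi -> test1 c d phi.
Proof.
move=> cc dd [sp [u [v [cu vd sup]]]]; split=> //; exists u, v; split=> //.
  exact: le_lt_trans cu.
exact: lt_le_trans vd dd.
Qed.

Lemma closed_cbox (a b c d : R) : closed (cbox a b c d).
Proof.
have -> : cbox a b c d = fst @^-1` `[a, b] `&` snd @^-1` `[c, d].
  by apply/seteqP; split => -[x y].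
apply: closedI; apply: closed_comp => //; try exact: itv_closed.
  by move=> p _; exact: cvg_fst.
by move=> p _; exact: cvg_snd.
Qed.

Lemma compact_cbox (a b c d : R) : compact (cbox a b c d).
Proof. by apply: compact_setX; exact: segment_compact. Qed.

Lemma test_function_tensor c d a b phi1 phi2 : test1 c d phi1 -> test1 a b phi2 ->
  test_function (obox c d a b) (tensor phi1 phi2).
Proof.
move=> [s1 [c1 [d1 [cc dd sup1]]]] [s2 [c2 [d2 [aa bb sup2]]]].
have sub : closure [set p | tensor phi1 phi2 p != 0] `<=` cbox c1 d1 c2 d2.
  rewrite [X in _ `<=` X](closure_id _).1; last exact: closed_cbox.
  apply: closure_subset => -[x y] /=; rewrite /tensor /= mulf_eq0 negb_or => /andP[/sup1 h1 /sup2 h2].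
  by split=> /=; rewrite in_itv.
split; first exact: smooth_tensor.
  apply: (subclosed_compact _ (@compact_cbox c1 d1 c2 d2) sub); exact: closed_closure.
apply: (subset_trans sub) => -[x y] [] /=; rewrite !in_itv /= => /andP[h1 h2] /andP[h3 h4].
split=> /=; rewrite in_itv /=.
  by rewrite (lt_le_trans cc h1) (le_lt_trans h2 dd).
by rewrite (lt_le_trans aa h3) (le_lt_trans h4 bb).
Qed.

Lemma flat1_ge0_le1 x : 0 <= flat (1 : {poly R}) x <= 1.
Proof.
rewrite /flat; case: ifPn => [_|]; first by rewrite lexx ler01.
rewrite -ltNge => x0; rewrite hornerC mul1r expR_ge0 /=.
by rewrite -[leRHS]expR0 ler_expR oppr_le0 invr_ge0 ltW.
Qed.

(* Rescaled by [n], the flat functions increase to the indicator of [(c, d)];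
   the shift by [1] keeps the supports inside the open interval. *)
Definition bump (c d : R) (n : nat) (x : R) : R :=
  flat 1 (n.+1%:R * x + (- (n.+1%:R * c) - 1)) *
  flat 1 (- n.+1%:R * x + (n.+1%:R * d - 1)).

Lemma test1_bump c d n : test1 c d (bump c d n).
Proof.
split; first by apply: smooth1M; apply: smooth1_affine; exact: smooth1_flat.
exists (c + n.+1%:R^-1), (d - n.+1%:R^-1); split.
- by rewrite ltrDl invr_gt0.
- by rewrite ltrBlDr ltrDl invr_gt0.
- have n0 : 0 < (n.+1%:R : R) by [].
  have nn : n.+1%:R * (n.+1%:R)^-1 = 1 :> R by rewrite divff// pnatr_eq0.
  move=> x; rewrite /bump /flat; case: ifPn; first by rewrite mul0r eqxx.
  rewrite -ltNge => h1; case: ifPn; first by rewrite mulr0 eqxx.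
  rewrite -ltNge => h2 _.
  rewrite -(ler_pM2l n0) -[X in _ && X](ler_pM2l n0) mulrDr mulrBr nn.
  by apply/andP; split; lra.
Qed.

Lemma bump_ge0_le1 c d n x : 0 <= bump c d n x <= 1.
Proof.
rewrite /bump; set u := _ + _; set v := _ + _.
have /andP[u0 u1] := flat1_ge0_le1 u; have /andP[v0 v1] := flat1_ge0_le1 v.
by rewrite mulr_ge0// mulr_ile1.
Qed.

Lemma flat1_cvg (s t : R) : 0 < s ->
  flat 1 (n.+1%:R * s + t) @[n --> \oo] --> (1 : R).
Proof.
move=> s0.
have H : (fun n : nat => n.+1%:R * s + t) @ \oo --> (+oo : set_system R).
  apply/cvgryPge => A; near=> n.
  rewrite -lerBlDr -ler_pdivrMr//.
  rewrite (@le_trans _ _ n%:R)// ?ler_nat//.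
  near: n; exact: nbhs_infty_ger.
have : expR (- (n.+1%:R * s + t)^-1) @[n --> \oo] --> expR (- 0 : R).
  apply: continuous_cvg; first exact: continuous_expR.
  apply: cvgN; apply/gtr0_cvgV0; last exact: H.
  by move/cvgryPgt : H => /(_ 0); apply: filterS.
rewrite oppr0 expR0; apply: cvg_trans; apply: near_eq_cvg.
move/cvgryPgt : H => /(_ 0); apply: filterS => n h.
by rewrite /flat leNgt h /= hornerC mul1r.
Unshelve. all: by end_near. Qed.

Lemma bump_cvg c d x : bump c d n x @[n --> \oo] --> (\1_(`]c, d[) x : R).
Proof.
rewrite indicE; have [|] := boolP (x \in `]c, d[%classic).
  rewrite inE /= in_itv /= => /andP[cx xd].
  rewrite -[X in _ --> X]mulr1; apply: cvgM.
    have := @flat1_cvg (x - c) (-1); rewrite subr_gt0 => /(_ cx).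
    by under eq_fun do rewrite mulrBr -addrA.
  have := @flat1_cvg (d - x) (-1); rewrite subr_gt0 => /(_ xd).
  rewrite (_ : (fun n : nat => _) =
    (fun n : nat => flat 1 (- n.+1%:R * x + (n.+1%:R * d - 1))))//.
  by apply/funext => n; congr flat; ring.
move=> H; rewrite (_ : (fun n => bump c d n x) = fun=> 0); first exact: cvg_cst.
apply/funext => n; apply: (test1_out (test1_bump c d n)).
by apply: contra H => H; rewrite inE /= in_itv.
Qed.

End Tensor.

(** * Weak derivatives tested against tensor products *)

Section Fundamental.
Context (R : realType).
Variables (c d a b : R).
Let O : set (plane R) := obox c d a b.
Let mO : measurable O := measurable_obox c d a b.

Section Null.
Variable K : plane R -> R.
Hypothesis iK : (mu2 R).-integrable O (EFin \o K).

Let nu (A : set (plane R)) := (\int[mu2 R]_(p in A `&` O) (K p)%:E)%E.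

Let iKS A : measurable A -> (mu2 R).-integrable (A `&` O) (EFin \o K).
Proof.
by move=> mA; apply: integrableS iK => //; exact: measurableI.
Qed.

(** One pass of the pi-lambda theorem, parametrized by a map [q] and a fixed set [S] so as to serve
    for each coordinate and then for the product sigma-algebra. *)
Lemma null_dynkin d' (T : measurableType d') (q : plane R -> T) (G : set (set T))
    (S : set (plane R)) : measurable_fun setT q -> measurable S ->
  @measurable _ T = <<s G >> -> setI_closed G ->
  nu S = 0%E -> (forall A, G A -> nu (q @^-1` A `&` S) = 0%E) ->
  forall A, measurable A -> nu (q @^-1` A `&` S) = 0%E.
Proof.
move=> mq mS mG GI S0 GS A; rewrite mG.
have mqA B : measurable B -> measurable (q @^-1` B `&` S).
  by move=> mB; apply: measurableI => //; rewrite -[_ @^-1` _]setTI; exact: mq.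
apply: (dynkin_induction (P := fun A => nu (q @^-1` A `&` S) = 0%E) mG GI).
- by rewrite preimage_setT setTI.
- exact: GS.
- move=> B mB B0.
  have mC := mqA _ (measurableC mB); have mB' := mqA _ mB.
  have : nu S = (nu (q @^-1` B `&` S) + nu (q @^-1` (~` B) `&` S))%E.
    rewrite /nu -integral_setU_EFin//.
    + by congr integral; rewrite -setIUl -setIUl -preimage_setU setUv preimage_setT setTI.
    + exact: measurableI.
    + exact: measurableI.
    + rewrite -setIUl; apply/measurable_EFinP; apply: measurable_int (iKS _).
      exact: measurableU.
    + apply/eqP; rewrite -subset0 => p [[[h1 _] _] [[h2 _] _]]; exact: h2.
  by rewrite S0 B0 add0e => <-.
- move=> F mF tF F0.
  rewrite /nu preimage_bigcup setI_bigcupl setI_bigcupl integral_bigcup.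
  + by rewrite eseries0// => i _ _; exact: F0.
  + apply: trivIset_setIr; apply: trivIset_setIr.
    by move=> i j _ _ [p [h1 h2]]; apply: (tF i j I I); exists (q p).
  + by move=> k; apply: measurableI => //; exact: mqA.
  + rewrite -setI_bigcupl; apply: iKS; apply: bigcup_measurable => k _; exact: mqA.
Qed.


Let nu_restr A B : A `&` O = B `&` O -> nu A = nu B.
Proof. by rewrite /nu => ->. Qed.

Let GI : setI_closed (@RGenOInfty.G R).
Proof.
move=> _ _ [x ->] [y ->]; exists (Num.max x y); apply/seteqP; split => z /=;
  rewrite !in_itv /= !andbT gt_max.
  by move=> [-> ->].
by move=> /andP[].
Qed.

Let mR : @measurable _ (measurableTypeR R) = <<s @RGenOInfty.G R >>.
Proof. exact: RGenOInfty.measurableE. Qed.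

Let mfst A : measurable A -> measurable (fst @^-1` A : set (plane R)).
Proof. by move=> mA; rewrite -[_ @^-1` _]setTI; exact: measurable_fst. Qed.

Let msnd A : measurable A -> measurable (snd @^-1` A : set (plane R)).
Proof. by move=> mA; rewrite -[_ @^-1` _]setTI; exact: measurable_snd. Qed.

(** Quadrants are replaced by measurable sets in the first coordinate, then in the second, and
    measurable rectangles generate the sigma-algebra of the plane. *)
Lemma null_rays :
  (forall x y, c <= x -> a <= y -> nu (fst @^-1` `]x, +oo[ `&` snd @^-1` `]y, +oo[) = 0%E) ->
  {ae (mu2 R), forall p, O p -> K p = 0}.
Proof.
move=> H.
(* A quadrant whose corner lies left of [c] or below [a] cuts the rectangle exactly as the one whose
   corner is moved there. *)
have H0 x y : nu (fst @^-1` `]x, +oo[ `&` snd @^-1` `]y, +oo[) = 0%E.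
  rewrite -(H (Num.max x c) (Num.max y a)) ?le_max ?lexx ?orbT//; apply: nu_restr.
  apply/seteqP; split => -[s t] /= [[]]; rewrite !in_itv /= !andbT.
    move=> h1 h2 [/= h3 h4]; split=> //; rewrite !gt_max h1 h2.
    by move: h3 h4; rewrite !in_itv /= => /andP[-> _] /andP[-> _].
  rewrite !gt_max => /andP[h1 h2] /andP[h3 h4] Op; split=> //.
have H1 A y : measurable A -> nu (fst @^-1` A `&` snd @^-1` `]y, +oo[) = 0%E.
  apply: (null_dynkin _ _ mR GI) => //; first exact: msnd.
    rewrite -(H0 c y); apply: nu_restr; apply/seteqP; split => -[s t] /= [].
      move=> h [/= h3 h4]; split=> //; split=> //.
      by move: h3; rewrite !in_itv /= => /andP[->].
    by move=> [_ ?] ?.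
  by move=> _ [x ->]; exact: H0.
have H2 A B : measurable A -> measurable B -> nu (snd @^-1` B `&` fst @^-1` A) = 0%E.
  move=> mA; apply: (null_dynkin _ _ mR GI) => //; first exact: mfst.
    rewrite -(H1 A a mA); apply: nu_restr; apply/seteqP; split => -[s t] /= [].
      move=> h [/= h3 h4]; split=> //; split=> //.
      by move: h4; rewrite !in_itv /= => /andP[->].
    by move=> [? _] ?.
  by move=> _ [x ->]; rewrite setIC; exact: H1.
have H3 A : measurable A -> nu A = 0%E.
  move=> mA; rewrite -[A]setIT -[A in A `&` _]/(id @^-1` A).
  have mP := measurable_prod_measurableType (measurableTypeR R) (measurableTypeR R).
  move: A mA; apply: (null_dynkin _ _ mP) => //.
  - move=> _ _ [A1 mA1 [B1 mB1 <-]] [A2 mA2 [B2 mB2 <-]].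
    exists (A1 `&` A2); first exact: measurableI.
    by exists (B1 `&` B2); [exact: measurableI|rewrite setXI].
  - rewrite -(H2 setT setT measurableT measurableT); congr nu.
    by rewrite !preimage_setT setIT.
  - move=> _ [A mA [B mB <-]]; rewrite preimage_id setIT -(H2 A B mA mB); congr nu.
    by apply/seteqP; split => -[x y] /= [].
have : ae_eq (mu2 R) O (EFin \o K) (cst 0%E).
  apply: integral_ae_eq => // E EO mE.
  by rewrite integral0 -[RHS](H3 E mE) /nu setIidl.
by move=> h; apply: (ae_imp h) => p hp Op; have [] := hp Op.
Qed.

(** Products of bumps converge boundedly to the indicator of []x, d[ * ]y, b[], which inside the
    rectangle is a quadrant; dominated convergence then reduces the claim to [null_rays]. *)
Lemma fundamental_tensor :
  (forall phi1 phi2, test1 c d phi1 -> test1 a b phi2 ->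
    int2 O (fun p => K p * (phi1 p.1 * phi2 p.2)) = 0) ->
  {ae (mu2 R), forall p, O p -> K p = 0}.
Proof.
move=> H; apply: null_rays => x y cx ay.
have mB u v n : measurable_fun setT (bump u v n : measurableTypeR R -> R).
  apply: continuous_measurable_fun; apply: smooth1_continuous.
  exact: (test1_smooth (test1_bump u v n)).
have bb n s t : `|bump x d n s * bump y b n t| <= 1.
  have /andP[u0 u1] := bump_ge0_le1 x d n s.
  have /andP[v0 v1] := bump_ge0_le1 y b n t.
  by rewrite normrM (ger0_norm u0) (ger0_norm v0) mulr_ile1.
pose f_ n (p : plane R) := (K p * (bump x d n p.1 * bump y b n p.2))%:E.
have mK : measurable_fun O K by apply/measurable_EFinP; exact: measurable_int iK.
have I0 n : (\int[mu2 R]_(p in O) f_ n p = 0)%E.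
  have mbb : measurable_fun O (fun p : plane R => bump x d n p.1 * bump y b n p.2).
    by apply: (measurable_funS measurableT) => //; apply: measurable_funM;
      apply: measurableT_comp => //; exact: mB.
  have : (mu2 R).-integrable O (f_ n).
    apply: le_integrable iK => //; first by apply/measurable_EFinP; exact: measurable_funM.
    by move=> p _; rewrite lee_fin normrM ler_piMr.
  move/(integrable_fin_num mO) => fin; rewrite -(fineK fin); congr EFin.
  have := H (bump x d n) (bump y b n); apply.
    exact: test1_sub (test1_bump x d n).
  exact: test1_sub (test1_bump y b n).
have C1 : ((\int[mu2 R]_(p in O) f_ n p)%E @[n --> \oo] -->
    (\int[mu2 R]_(p in O) (K p * (\1_(`]x, d[) p.1 * \1_(`]y, b[) p.2))%:E)%E).
  apply: (@dominated_cvg _ _ _ (mu2 R) O mO f_ _ (fun p => `|(K p)%:E|%E)).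
  - move=> n; apply/measurable_EFinP; apply: measurable_funM => //.
    by apply: (measurable_funS measurableT) => //; apply: measurable_funM;
        apply: measurableT_comp => //; exact: mB.
  - move=> p Op; apply: cvg_EFin; first by near=> n.
    apply: cvgM; first exact: cvg_cst.
    by apply: cvgM; exact: bump_cvg.
  - by move=> p Op.
  - exact: integrable_abse.
  - move=> n p Op; by rewrite lee_fin normrM ler_piMr.
have : (\int[mu2 R]_(p in O) (K p * (\1_(`]x, d[) p.1 * \1_(`]y, b[) p.2))%:E = 0)%E.
  apply: (cvg_unique _ C1) => //.
  by rewrite (_ : (fun n => _) = (fun=> 0%E)); [exact: cvg_cst|apply/funext => n; exact: I0].
move=> <-; rewrite /nu setIC integral_mkcondr; apply: eq_integral => -[s t].
rewrite inE => -[/= h1 h2]; rewrite !indicE patchE.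
move: h1 h2; rewrite !in_itv /= => /andP[cs sd] /andP[at_ tb].
have -> : (s \in `]x, d[%classic) = (x < s) by rewrite mem_setE in_itv /= sd andbT.
have -> : (t \in `]y, b[%classic) = (y < t) by rewrite mem_setE in_itv /= tb andbT.
have -> : ((s, t) \in fst @^-1` `]x, +oo[ `&` snd @^-1` `]y, +oo[) = (x < s) && (y < t).
  apply/idP/andP; first by rewrite inE /= !in_itv /= !andbT => -[].
  by move=> [h1 h2]; rewrite inE /= !in_itv /= !andbT.
by case: (x < s) => /=; case: (y < t); rewrite ?mulr1 ?mulr0.
Unshelve. all: by end_near. Qed.

End Null.
End Fundamental.

Section TensorWeak.
Context (R : realType).
Implicit Types (phi sigma : R -> R) (f w : R * R -> R).

(** Weak derivatives tested on products [phi1(x) phi2(y)] only. This follows from [weak_derivative],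
    still determines [w] almost everywhere, and involves only one-dimensional derivatives, so that
    each variable can be treated alone. *)
Definition tensor_weak (c d a b : R) (i j : nat) f w :=
  [/\ L2fun2 (obox c d a b) f, L2fun2 (obox c d a b) w &
    forall phi1 phi2, test1 c d phi1 -> test1 a b phi2 ->
    int2 (obox c d a b) (fun p => f p * (derive1n i phi1 p.1 * derive1n j phi2 p.2)) =
    (-1) ^+ (i + j) * int2 (obox c d a b) (fun p => w p * (phi1 p.1 * phi2 p.2))].

Lemma weak_tensor_weak c d a b i j f w :
  weak_derivative (obox c d a b) i j f w -> tensor_weak c d a b i j f w.
Proof.
move=> [Lf Lw H]; split=> // phi1 phi2 t1 t2.
have := H _ (test_function_tensor t1 t2).
by rewrite (pder_tensor _ _ (test1_smooth t1) (test1_smooth t2)).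
Qed.

Lemma tensor_weak_comp c d a b i j i' j' f w w' :
  tensor_weak c d a b i j f w -> tensor_weak c d a b i' j' w w' ->
  tensor_weak c d a b (i + i') (j + j') f w'.
Proof.
move=> [Lf _ H] [_ Lw' H']; split=> // phi1 phi2 t1 t2.
rewrite /derive1n !iterD -!/(derive1n _ _).
rewrite (H _ _ (test1_derive1n i' t1) (test1_derive1n j' t2)) (H' _ _ t1 t2).
by rewrite mulrA -exprD addnACA.
Qed.

(** Derivatives of test functions are test functions. This links the representatives chosen
    independently for each order: a higher derivative of [f] is a derivative of a lower one. *)
Lemma tensor_weak_factor c d a b i j i' j' f w w' :
  tensor_weak c d a b i j f w -> tensor_weak c d a b (i + i') (j + j') f w' ->
  tensor_weak c d a b i' j' w w'.
Proof.
move=> [Lf Lw H] [_ Lw' H']; split=> // phi1 phi2 t1 t2.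
have := H' _ _ t1 t2; rewrite /derive1n !iterD -!/(derive1n _ _).
rewrite (H _ _ (test1_derive1n i' t1) (test1_derive1n j' t2)) addnACA.
rewrite [X in _ = X * _]exprD -mulrA => /mulfI; apply.
by rewrite signr_eq0.
Qed.

Lemma smooth1_bounded phi (c d : R) : smooth1 phi ->
  exists B, forall x, x \in `]c, d[ -> `|phi x| <= B.
Proof.
move=> sp; have [cd|dc] := leP c d; last first.
  by exists 0 => x; rewrite in_itv /= => /andP[h1 h2]; have := lt_trans dc (lt_trans h1 h2); rewrite ltxx.
have cn : {within `[c, d], continuous (fun x => `|phi x|)}.
  apply: continuous_subspaceT => x; apply: cvg_norm; exact: (smooth1_continuous sp).
have [z _ Hz] := EVT_max cd cn.
by exists (`|phi z|) => x /subset_itv_oo_cc; exact: Hz.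
Qed.

Lemma smooth1_measurable phi (D : set R) : smooth1 phi ->
  measurable_fun (D : set (measurableTypeR R)) (phi : measurableTypeR R -> R).
Proof.
move=> sp; apply: measurable_funTS.
by apply: continuous_measurable_fun; exact: smooth1_continuous.
Qed.

Lemma L2_tensor_mul c d a b phi1 phi2 f : smooth1 phi1 -> smooth1 phi2 ->
  L2fun2 (obox c d a b) f ->
  L2fun2 (obox c d a b) (fun p => (phi1 p.1 * phi2 p.2) * f p).
Proof.
move=> s1 s2 Lf.
have [B1 h1] := smooth1_bounded c d s1; have [B2 h2] := smooth1_bounded a b s2.
apply: (@L2_bmul _ _ _ (mu2 R) _ (measurable_obox c d a b) (B1 * B2)) => //.
  apply: measurable_funM.
    by apply: measurable_fst_comp; exact: smooth1_measurable.
  by apply: measurable_snd_comp; exact: smooth1_measurable.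
by move=> [x y] [/= xcd yab]; rewrite normrM ler_pM// ?h1 ?h2.
Qed.

Lemma L2_tensor c d a b phi1 phi2 : smooth1 phi1 -> smooth1 phi2 ->
  L2fun2 (obox c d a b) (fun p => phi1 p.1 * phi2 p.2).
Proof.
move=> s1 s2.
have L1 : L2fun2 (obox c d a b) (fun=> 1).
  apply: (@L2_bounded _ _ _ (mu2 R) _ (measurable_obox c d a b) 1) => //.
    exact: mu2_obox_lt.
  by move=> p _; rewrite normr1.
by have := L2_tensor_mul s1 s2 L1; under eq_fun do rewrite mulr1.
Qed.

Lemma tensor_weak_unique c d a b i j f w w' :
  tensor_weak c d a b i j f w -> tensor_weak c d a b i j f w' ->
  {ae (mu2 R), forall p, obox c d a b p -> w p = w' p}.
Proof.
move=> [Lf Lw H] [_ Lw' H'].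
have mO := measurable_obox c d a b.
have LB := L2_B mO Lw Lw'.
suff : {ae (mu2 R), forall p, obox c d a b p -> w p - w' p = 0}.
  by move=> h; apply: (ae_imp h) => p hp Op; apply/eqP; rewrite -subr_eq0 hp.
apply: fundamental_tensor; first by apply: L2_integrable => //; exact: mu2_obox_lt.
move=> phi1 phi2 t1 t2.
have Lt := L2_tensor c d a b (test1_smooth t1) (test1_smooth t2).
rewrite /int2; under eq_Rintegral do rewrite mulrBl.
rewrite RintegralB//; [|exact: (L2_mul mO Lw Lt)|exact: (L2_mul mO Lw' Lt)].
have := H _ _ t1 t2; rewrite (H' _ _ t1 t2).
move/mulfI => E; apply/eqP; rewrite subr_eq0; apply/eqP/esym/E.
by rewrite signr_eq0.
Qed.

(** The vanishing integral is what makes the primitive zero to the right of the support as well. *)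
Lemma test1_primitive (c d : R) sigma : c < d -> test1 c d sigma ->
  (\int[mu1 R]_(x in `]c, d[) sigma x)%R = 0 ->
  exists Psi, test1 c d Psi /\ derive1 Psi = sigma.
Proof.
move=> cd ts i0; have [ss [c' [d' [cc dd sup]]]] := ts.
have cs : continuous sigma by exact: smooth1_continuous.
have patchE_ (D : set R) : (forall x, sigma x != 0 -> D x) -> sigma \_ D = sigma.
  move=> HD; apply/funext => x; rewrite patchE; case: ifPn => //.
  by rewrite notin_setE => nD; apply/esym/eqP; apply: contrapT => /negP /HD.
have iT : (mu1 R).-integrable setT (EFin \o (sigma : measurableTypeR R -> R)).
  have : (mu1 R).-integrable `[c, d] (EFin \o (sigma : measurableTypeR R -> R)).
    apply: continuous_compact_integrable; first exact: segment_compact.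
    exact: continuous_subspaceT.
  move/(integrable_patch (mu1 R) sigma (measurable_itv _)).1; rewrite patchE_// => x /sup /andP[h1 h2].
  by rewrite /= in_itv /= (le_trans (ltW cc) h1) (le_trans h2 (ltW dd)).
pose Psi x := (\int[mu1 R]_(t in `]-oo, x]) sigma t)%R.
have dP x : derivable Psi x 1 /\ derive1 Psi x = sigma x.
  apply: (@continuous_FTC1 _ sigma (BInfty _ true) x (x + 1)) => //.
  - by rewrite ltrDl.
  - exact: integrableS iT.
  - by rewrite ltNyr.
  - exact: cs.
have dPE : derive1 Psi = sigma by apply/funext => x; exact: (dP x).2.
exists Psi; split=> //; split.
  move=> [|n] x; first exact: (dP x).1.
  by rewrite derive1Sn dPE; exact: ss.
exists c', d'; split=> // x; apply: contraNT; rewrite negb_and -!ltNge => /orP[xc|dx].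
  apply/eqP; rewrite /Psi Rintegral_mkcond (_ : _ \_ _ = fun=> 0).
    by rewrite Rintegral_cst// mul0r.
  apply/funext => t; rewrite patchE; case: ifPn => //; rewrite inE /= in_itv /= => tx.
  apply/eqP; apply: contraTT (le_lt_trans tx xc) => /sup /andP[h _].
  by rewrite -leNgt.
apply/eqP; rewrite /Psi -i0 Rintegral_mkcond [RHS]Rintegral_mkcond !patchE_// => t /sup /andP[h1 h2] /=.
  by rewrite in_itv /= (lt_le_trans cc h1) (le_lt_trans h2 dd).
by rewrite in_itv /= (le_trans h2 (ltW dx)).
Qed.

(** Provides the weight that fixes the constants of integration in [acl_slices]: by dominated
    convergence the integrals of the bumps tend to [d - c]. *)
Lemma bump_int_pos (c d : R) : c < d ->
  exists n, 0 < (\int[mu1 R]_(x in `]c, d[) bump c d n x)%R.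
Proof.
move=> cd.
have mB n : measurable_fun (`]c, d[ : set (measurableTypeR R)) (bump c d n).
  exact: smooth1_measurable (test1_smooth (test1_bump c d n)).
have L1 : L2 (mu1 R) `]c, d[ (fun=> 1).
  apply: (@L2_bounded _ _ _ (mu1 R) _ _ 1) => // [|x _]; [exact: mu1_itv_oo|].
  by rewrite normr1.
have i1 : (mu1 R).-integrable `]c, d[ (EFin \o (fun=> 1)).
  by apply: L2_integrable => //; exact: mu1_itv_oo.
have C1 : ((\int[mu1 R]_(x in `]c, d[) (bump c d n x)%:E)%E @[n --> \oo] -->
    (\int[mu1 R]_(x in `]c, d[) (1 : R)%:E)%E).
  apply: (@dominated_cvg _ _ _ (mu1 R) _ _ _ _ (fun=> 1%:E)) => //.
  - by move=> n; exact/measurable_EFinP.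
  - move=> x xcd; apply: cvg_EFin; first by near=> n.
    by have := @bump_cvg R c d x; rewrite indicE mem_set.
  - move=> n x _; rewrite lee_fin.
    by have /andP[u0 u1] := bump_ge0_le1 c d n x; rewrite ger0_norm.
have : (\int[mu1 R]_(x in `]c, d[) (1 : R)%:E = (d - c)%:E)%E.
  rewrite integral_cst// mul1e -(fine_mu1_oo (ltW cd)) fineK// ge0_fin_numE//.
  exact: mu1_itv_oo.
move=> E; rewrite E in C1.
have C2 : fine (\int[mu1 R]_(x in `]c, d[) (bump c d n x)%:E)%E @[n --> \oo] --> (d - c).
  exact: fine_cvg C1.
have : \forall n \near \oo, 0 < fine (\int[mu1 R]_(x in `]c, d[) (bump c d n x)%:E)%E.
  by apply: (cvgr_gt (d - c)) => //; rewrite subr_gt0.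
by move=> [M _ HM]; exists M; exact: HM M (leqnn _).
Unshelve. all: by end_near. Qed.

End TensorWeak.

(** * Absolute continuity on lines *)

Section ACL.
Context (R : realType).
Variables (c d a b : R).
Hypotheses (cd : c < d).
Let O : set (plane R) := obox c d a b.
Let mO : measurable O := measurable_obox c d a b.
Implicit Types (f s : R * R -> R).

Local Notation SL G p := (\int[mu1 R]_(s in `]c, p.1[) G (s, p.2))%R.
Local Notation SR G p := (\int[mu1 R]_(s in `]p.1, d[) G (s, p.2))%R.

Lemma int1_primitive_tail Psi (x : R) : test1 c d Psi -> x < d ->
  (\int[mu1 R]_(s in `]x, d[) derive1 Psi s)%R = - Psi x.
Proof.
move=> tP xd; have sP := test1_smooth tP.
have s'P := smooth1_derive1 sP.
rewrite Rintegral_itv_obnd_cbnd; last first.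
  apply: (@integrableS _ _ _ (mu1 R) `[x, d]) => //.
    exact: subset_itv_oo_cc.
  apply: continuous_compact_integrable; first exact: segment_compact.
  by apply: continuous_subspaceT; exact: smooth1_continuous.
rewrite Rintegral_itv_bndo_bndc; last first.
  apply: (@integrableS _ _ _ (mu1 R) `[x, d]) => //.
    by apply: subset_itvl; rewrite bnd_simp.
  apply: continuous_compact_integrable; first exact: segment_compact.
  by apply: continuous_subspaceT; exact: smooth1_continuous.
rewrite /Rintegral (@continuous_FTC2 _ _ Psi)//=.
- by rewrite (test1_out tP) ?sub0r// ltxx andbF.
- by apply: continuous_subspaceT; exact: smooth1_continuous.
- split; first by move=> y _; exact: sP 0%N y.
  + by apply: cvg_at_right_filter; exact: (smooth1_continuous sP).
  + by apply: cvg_at_left_filter; exact: (smooth1_continuous sP).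
Qed.

Lemma int2_slice0 (k : R -> R) s : L2fun2 O (fun p => k p.2) -> L2fun2 O s ->
  {ae (mu1 R), forall y, y \in `]a, b[ -> (\int[mu1 R]_(x in `]c, d[) s (x, y))%R = 0} ->
  int2 O (fun p => k p.2 * s p) = 0.
Proof.
move=> Lk Ls s0; have iks := L2_mul mO Lk Ls.
rewrite (int2_iter iks) -[RHS](@Rintegral_set0 _ _ _ (mu1 R) (fun=> 0)).
rewrite Rintegral_set0 -[RHS](mul0r (fine (mu1 R `]a, b[))) -(Rintegral_cst (mu1 R))//.
apply: ae_Rintegral => //; first exact: (slice_measurable iks).
have iS := L2_integrable mO (mu2_obox_lt c d a b) Ls.
apply: (ae_imp2 s0 (ae_slice_integrable iS)) => y Hy iy yab /=.
by rewrite RintegralZl ?Hy ?mulr0//; exact: iy.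
Qed.

(** The function [f] equals, almost everywhere, the primitive [SL f1] plus a function [k] of [y]
    alone. A function [s] with zero mean on slices does not see [k], and moving the primitive onto
    [s] gives the right-hand side. No regularity or support condition is put on [s], which is what
    the Poincare inequality and the product rule require. *)
Theorem acl_slices f f1 s : tensor_weak c d a b 1 0 f f1 -> L2fun2 O s ->
  {ae (mu1 R), forall y, y \in `]a, b[ -> (\int[mu1 R]_(x in `]c, d[) s (x, y))%R = 0} ->
  int2 O (fun p => f p * s p) = int2 O (fun p => f1 p * SR s p).
Proof.
move=> [Lf Lf1 H] Ls s0.
have cd' := ltW cd.
have [LF _] := L2_SL cd' Lf1.
have [N] := bump_int_pos cd; set w := bump c d N; set I := (\int[_]_(_ in _) _)%R => I0.
have tw : test1 c d w by exact: test1_bump.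
pose G p := f p - SL f1 p.
have LG : L2fun2 O G by exact: (L2_B mO Lf LF).
(* The constant of integration on a slice, computed as the mean of [f - SL f1] with the normalized
   weight [w / I]. *)
pose k y := I^-1 * (\int[mu1 R]_(x in `]c, d[) (G (x, y) * w x))%R.
have s1 : smooth1 (fun=> 1 : R) by exact: smooth1_cst.
have Lw : L2fun2 O (fun p => w p.1).
  have := L2_tensor c d a b (test1_smooth tw) s1.
  by under eq_fun do rewrite mulr1.
have iGw : (mu2 R).-integrable O (EFin \o (fun p => G p * w p.1)) by exact: (L2_mul mO LG Lw).
have Lw1 : L2 (mu1 R) `]c, d[ w.
  have [B HB] := smooth1_bounded c d (test1_smooth tw).
  apply: (@L2_bounded _ _ _ _ _ _ B) => //; first exact: mu1_itv_oo.
  exact: smooth1_measurable (test1_smooth tw).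
have Lk : L2fun2 O (fun p => k p.2).
  have mk : measurable_fun O (fun p => k p.2).
    apply: measurable_snd_comp; apply: measurable_funM => //.
    exact: (slice_measurable iGw).
  have [|//] := L2_slice_op cd' (M := I^-1 ^+ 2 * (\int[mu1 R]_(x in `]c, d[) w x ^+ 2)%R) LG mk.
  move=> y yab LGy x xcd; rewrite -[(x, y).2]/y /k exprMn -[leRHS]mulrA.
  by apply: ler_wpM2l; [exact: sqr_ge0|rewrite [leRHS]mulrC; exact: L2_CS].
pose K p := G p - k p.2.
have LK : L2fun2 O K by exact: (L2_B mO LG Lk).
have K0 : {ae (mu2 R), forall p, O p -> K p = 0}.
  apply: fundamental_tensor; first by apply: L2_integrable => //; exact: mu2_obox_lt.
  move=> th ph tth tph.
  (* The test function [th] splits into [sg], of zero integral and hence the derivative of a test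
     function [Psi], and a multiple of the weight [w], for which [k] was designed. *)
  pose lam := I^-1 * (\int[mu1 R]_(x in `]c, d[) th x)%R.
  pose sg x := th x + (- lam) * w x.
  have iR phi : test1 c d phi -> (mu1 R).-integrable `]c, d[ (EFin \o phi).
    move=> tphi; apply: L2_integrable => //; first exact: mu1_itv_oo.
    have [B HB] := smooth1_bounded c d (test1_smooth tphi).
    apply: (@L2_bounded _ _ _ _ _ _ B) => //; first exact: mu1_itv_oo.
    exact: smooth1_measurable (test1_smooth tphi).
  have tsg : test1 c d sg.
    have [sth [u1 [v1 [cu1 vd1 sup1]]]] := tth; have [sw [u2 [v2 [cu2 vd2 sup2]]]] := tw.
    split.
      have s2 : smooth1 (fun x => - lam * w x) by exact: smooth1M (@smooth1_cst R (- lam)) sw.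
      exact: (@smooth1D R _ _ sth s2).
    exists (Num.min u1 u2), (Num.max v1 v2); split.
    - by rewrite lt_min cu1.
    - by rewrite gt_max vd1.
    - move=> x; have [/eqP th0|/sup1 /andP[h1 h2]] := boolP (th x == 0).
        rewrite /sg th0 add0r mulf_eq0 negb_or => /andP[_ /sup2 /andP[h1 h2]].
        by rewrite ge_min h1 orbT le_max h2 orbT.
      by rewrite ge_min h1 le_max h2.
  have [Psi [tPsi dPsi]] : exists Psi, test1 c d Psi /\ derive1 Psi = sg.
    apply: test1_primitive => //.
    rewrite RintegralD//; [|exact: iR|by apply: integrable_realZ => //; exact: iR].
    rewrite RintegralZl//; last exact: iR.
    by rewrite /lam -/I; field; rewrite gt_eqF.
  have Lsg : L2fun2 O (fun p => sg p.1 * ph p.2) := L2_tensor c d a b (test1_smooth tsg) (test1_smooth tph).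
  have Lth : L2fun2 O (fun p => th p.1 * ph p.2) := L2_tensor c d a b (test1_smooth tth) (test1_smooth tph).
  have LPh : L2fun2 O (fun p => Psi p.1 * ph p.2) := L2_tensor c d a b (test1_smooth tPsi) (test1_smooth tph).
  have Lwp : L2fun2 O (fun p => w p.1 * ph p.2) := L2_tensor c d a b (test1_smooth tw) (test1_smooth tph).
  (* Both [f] and [SL f1] tested against [Psi' * ph] give minus the integral of [f1 * Psi * ph]: the
     former by definition of the weak derivative, the latter by Fubini. *)
  have E1 : int2 O (fun p => G p * (sg p.1 * ph p.2)) = 0.
    rewrite /int2; under eq_Rintegral do rewrite mulrBl.
    rewrite RintegralB//; [|exact: (L2_mul mO Lf Lsg)|exact: (L2_mul mO LF Lsg)].
    have := H _ _ tPsi tph; rewrite addn0 expr1 mulN1r /derive1n /= dPsi /int2 => ->.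
    have := adjoint2 cd' Lf1 Lsg; rewrite /int2 => ->.
    rewrite [X in _ - X](@eq_Rintegral _ _ _ _ _ (fun p : plane R => - 1 * (f1 p * (Psi p.1 * ph p.2)))).
      by rewrite RintegralZl//; [rewrite mulN1r opprK addNr|exact: (L2_mul mO Lf1 LPh)].
    move=> [x y]; rewrite inE => -[/= xcd yab].
    rewrite RintegralZr//; last first.
      apply: (@integrableS _ _ _ (mu1 R) `]c, d[) => //; last exact: iR.
      by apply: subset_itvr; rewrite bnd_simp; move: xcd; rewrite in_itv => /andP[/ltW].
    rewrite -dPsi int1_primitive_tail//; last by move: xcd; rewrite in_itv => /andP[].
    ring.
  have E2 : int2 O (fun p => k p.2 * (th p.1 * ph p.2)) = lam * int2 O (fun p => G p * (w p.1 * ph p.2)).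
    rewrite (int2_iter (L2_mul mO Lk Lth)) (int2_iter (L2_mul mO LG Lwp)).
    rewrite -RintegralZl//; last exact: (slice_integrable (L2_mul mO LG Lwp)).
    apply: ae_Rintegral => //.
    - exact: (slice_measurable (L2_mul mO Lk Lth)).
    - apply: measurable_funM => //; exact: (slice_measurable (L2_mul mO LG Lwp)).
    apply: (ae_imp (ae_slice_integrable iGw)) => y iy yab /=.
    rewrite [LHS](@eq_Rintegral _ _ _ _ _ (fun x : measurableTypeR R => (k y * ph y) * th x)); last by move=> x _; ring.
    rewrite RintegralZl//; last exact: iR.
    rewrite [X in _ = _ * X](@eq_Rintegral _ _ _ _ _ (fun x : measurableTypeR R => ph y * (G (x, y) * w x))); last by move=> x _; ring.
    rewrite RintegralZl//; last exact: iy.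
    rewrite /k /lam; ring.
  rewrite /int2; under eq_Rintegral do rewrite mulrBl.
  rewrite RintegralB//; [|exact: (L2_mul mO LG Lth)|exact: (L2_mul mO Lk Lth)].
  have := E2; rewrite /int2 => ->.
  rewrite [X in X - _](@eq_Rintegral _ _ _ _ _ (fun p : plane R => G p * (sg p.1 * ph p.2) + lam * (G p * (w p.1 * ph p.2)))).
    rewrite RintegralD//; [|exact: (L2_mul mO LG Lsg)|by apply: integrable_realZ => //; exact: (L2_mul mO LG Lwp)].
    rewrite RintegralZl//; last exact: (L2_mul mO LG Lwp).
    by have := E1; rewrite /int2 => ->; rewrite add0r subrr.
  by move=> p _; rewrite /sg; ring.
have E : int2 O (fun p => f p * s p) =
    int2 O (fun p => K p * s p) + int2 O (fun p => SL f1 p * s p) + int2 O (fun p => k p.2 * s p).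
  rewrite /int2 -RintegralD//; [|exact: (L2_mul mO LK Ls)|exact: (L2_mul mO LF Ls)].
  rewrite -RintegralD//; [|by apply: integrable_realD => //; [exact: (L2_mul mO LK Ls)|exact: (L2_mul mO LF Ls)]|exact: (L2_mul mO Lk Ls)].
  by apply: eq_Rintegral => p _; rewrite /K /G; ring.
rewrite E (adjoint2 cd' Lf1 Ls) (int2_slice0 Lk Ls s0) addr0.
suff -> : int2 O (fun p => K p * s p) = 0 by rewrite add0r.
rewrite /int2 (@ae_Rintegral _ _ _ _ _ mO _ (fun=> 0)).
- by rewrite Rintegral_cst// mul0r.
- by apply/measurable_EFinP; exact: measurable_int (L2_mul mO LK Ls).
- by [].
- by apply: (ae_imp K0) => p Kp Op; rewrite Kp// mul0r.
Qed.

End ACL.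

(** * Integration by parts and the Poincare inequality *)

Section Swap.
Context (R : realType).
Implicit Types (f : R * R -> R).

Definition swapf f (p : R * R) := f (p.2, p.1).

Variables (c d a b : R).
Let O : set (plane R) := obox c d a b.
Let O' : set (plane R) := obox a b c d.
Let mO : measurable O := measurable_obox c d a b.
Let mO' : measurable O' := measurable_obox a b c d.

Let patch_swap f : swapf f \_ O' = swapf (f \_ O).
Proof.
apply/funext => -[x y]; rewrite /swapf !patchE /=.
rewrite (_ : ((x, y) \in O') = ((y, x) \in O))//.
by apply/idP/idP; rewrite !inE => -[].
Qed.

Let mswap : measurable_fun setT (fun p : plane R => (p.2, p.1) : plane R).
Proof. by apply: measurable_fun_pair; [exact: measurable_snd|exact: measurable_fst]. Qed.

Lemma integrable_swap f : (mu2 R).-integrable O (EFin \o f) ->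
  (mu2 R).-integrable O' (EFin \o swapf f).
Proof.
move=> /(integrable_patch (mu2 R) f mO).1 iF.
have mF : measurable_fun setT (EFin \o (f \_ O)) by exact: measurable_int iF.
apply: (integrable_patch (mu2 R) (swapf f) mO').2; rewrite patch_swap.
have mFs : measurable_fun setT (EFin \o (swapf (f \_ O)) : plane R -> \bar R).
  exact: (measurableT_comp mF mswap).
apply/(integrable12ltyP (mu1 R) (mu1 R) mFs).
exact: ((integrable21ltyP (mu1 R) (mu1 R) mF).1 iF).
Qed.

Lemma int2_swap f : (mu2 R).-integrable O (EFin \o f) ->
  int2 O' (swapf f) = int2 O f.
Proof.
move=> iO; have iO' := integrable_swap iO.
have iF := (integrable_patch (mu2 R) f mO).1 iO.
have iF' := (integrable_patch (mu2 R) (swapf f) mO').1 iO'.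
rewrite /int2 Rintegral_mkcond [RHS]Rintegral_mkcond /Rintegral; congr fine.
transitivity (\int[mu2 R]_z (EFin \o (swapf f \_ O')) z)%E; first by [].
rewrite -(integral12_prod_meas1 iF').
transitivity (\int[mu2 R]_z (EFin \o (f \_ O)) z)%E; last by [].
by rewrite -(integral21_prod_meas1 iF) /fubini_F /fubini_G patch_swap.
Qed.

Lemma L2_swap f : L2fun2 O f -> L2fun2 O' (swapf f).
Proof.
move=> Lf; split; last exact: (integrable_swap (L2_sq Lf)).
have iO := L2_integrable mO (mu2_obox_lt c d a b) Lf.
by apply/measurable_EFinP; exact: measurable_int (integrable_swap iO).
Qed.

Lemma tensor_weak_swap i j f w : tensor_weak c d a b i j f w -> tensor_weak a b c d j i (swapf f) (swapf w).
Proof.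
move=> [Lf Lw H]; split; [exact: L2_swap|exact: L2_swap|].
move=> phi1 phi2 t1 t2.
have L1 := L2_mul mO Lf (L2_tensor c d a b (test1_smooth (test1_derive1n i t2)) (test1_smooth (test1_derive1n j t1))).
have L3 := L2_mul mO Lw (L2_tensor c d a b (test1_smooth t2) (test1_smooth t1)).
have := H _ _ t2 t1; rewrite -(int2_swap L1) -(int2_swap L3) addnC.
by rewrite /swapf /=; under eq_fun do rewrite mulrC [X in X * _]mulrC mulrC;
  under [in RHS]eq_fun do rewrite mulrC [X in X * _]mulrC mulrC.
Qed.

End Swap.

Section WeakIbp.
Context (R : realType).
Variables (c d a b : R).
Hypotheses (cd : c < d).
Let O : set (plane R) := obox c d a b.
Let mO : measurable O := measurable_obox c d a b.
Implicit Types (f s : R * R -> R).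

Lemma int1_oo_cc (F : R -> R) : (mu1 R).-integrable `[c, d] (EFin \o F) ->
  (\int[mu1 R]_(s in `]c, d[) F s)%R = (\int[mu1 R]_(s in `[c, d]) F s)%R.
Proof.
move=> iF; rewrite Rintegral_itv_obnd_cbnd; last first.
  by apply: (@integrableS _ _ _ (mu1 R) `[c, d]) => //; exact: subset_itv_oo_cc.
by rewrite Rintegral_itv_bndo_bndc//; apply: (@integrableS _ _ _ (mu1 R) `[c, d]) => //;
  apply: subset_itvl; rewrite bnd_simp.
Qed.

End WeakIbp.

Section FTC.
Context (R : realType).

Lemma continuous_segment_integrable (F : R -> R) (c d : R) :
  (forall x, c <= x <= d -> {for x, continuous F}) ->
  (mu1 R).-integrable `[c, d] (EFin \o F).
Proof.
move=> cF; apply: continuous_compact_integrable; first exact: segment_compact.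
apply: continuous_in_subspaceT => x; rewrite inE /= in_itv /=; exact: cF.
Qed.

Lemma int1_derive (F G : R -> R) (c d : R) : c < d ->
  (forall x, c <= x <= d -> is_derive x 1 F (G x)) ->
  (forall x, c <= x <= d -> {for x, continuous G}) ->
  (\int[mu1 R]_(x in `]c, d[) G x)%R = F d - F c.
Proof.
move=> cd dF cG.
have cF x : c <= x <= d -> {for x, continuous F}.
  by move=> /dF [? _]; apply: differentiable_continuous; exact/derivable1_diffP.
have cFw : {within `[c, d], continuous F}.
  apply: continuous_in_subspaceT => x; rewrite inE /= in_itv /=; exact: cF.
rewrite int1_oo_cc; last exact: continuous_segment_integrable.
rewrite /Rintegral (@continuous_FTC2 _ _ F)//=.
- apply: continuous_in_subspaceT => x; rewrite inE /= in_itv /=; exact: cG.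
- have [h1 h2 h3] := (continuous_within_itvP _ cd).1 cFw.
  split=> // x; rewrite in_itv /= => /andP[cx xd].
  by have [] := dF x; rewrite ?(ltW cx) ?(ltW xd).
- move=> x; rewrite in_itv /= => /andP[cx xd]; rewrite derive1E.
  have cxd : c <= x <= d by rewrite !ltW.
  by have [_ ->] := dF x cxd.
Qed.

End FTC.

Section WeakIbp2.
Context (R : realType).
Variables (c d a b : R).
Hypotheses (cd : c < d).
Let O : set (plane R) := obox c d a b.
Let mO : measurable O := measurable_obox c d a b.
Implicit Types (f s : R * R -> R).

(** Instance of [acl_slices] with [s = th1]: as [th] vanishes on the sides [x = c] and [x = d], the
    slices of [th1] have zero mean and their right primitive is [- th]. The function [th] may be
    irregular in [y]. *)
Theorem weak_ibp f f1 (th th1 : R * R -> R) : tensor_weak c d a b 1 0 f f1 ->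
  L2fun2 O th1 ->
  (forall x y, c <= x <= d -> a < y < b -> is_derive x 1 (fun t => th (t, y)) (th1 (x, y))) ->
  (forall x y, c <= x <= d -> a < y < b -> {for x, continuous (fun t => th1 (t, y))}) ->
  (forall y, a < y < b -> th (c, y) = 0 /\ th (d, y) = 0) ->
  int2 O (fun p => f p * th1 p) = - int2 O (fun p => f1 p * th p).
Proof.
move=> tw L1 dth cth th0.
have sl x y : c <= x < d -> a < y < b ->
    (\int[mu1 R]_(s in `]x, d[) th1 (s, y))%R = - th (x, y).
  move=> /andP[cx xd] yab; rewrite -[RHS]add0r -(th0 y yab).2.
  apply: (@int1_derive _ (fun t => th (t, y)) (fun t => th1 (t, y)) _ _ xd).
  - by move=> t /andP[xt td]; apply: dth => //; rewrite (le_trans cx xt).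
  - by move=> t /andP[xt td]; apply: cth => //; rewrite (le_trans cx xt).
rewrite (acl_slices cd tw L1); last first.
  apply: aeW => y; rewrite in_itv /= => yab.
  by rewrite sl ?lexx ?cd// (th0 y yab).1 oppr0.
rewrite /int2 (@eq_Rintegral _ _ _ _ _ (fun p : plane R => - 1 * (f1 p * th p))); last first.
  move=> [x y]; rewrite inE /= => -[/=]; rewrite !in_itv /= => /andP[cx xd] yab.
  by rewrite sl// ?(ltW cx) ?xd//; ring.
have [_ Lf1 _] := tw.
have [LSR _] := L2_SR (ltW cd) L1.
rewrite RintegralZl ?mulN1r//.
have iS := L2_mul mO Lf1 LSR.
apply: eq_integrable (integrable_realZ mO (-1) iS) => //.
move=> [x y]; rewrite inE /= => -[/=]; rewrite !in_itv /= => /andP[cx xd] yab.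
by rewrite sl// ?(ltW cx) ?xd//; congr EFin; ring.
Qed.

Definition mean_x f (p : R * R) : R :=
  (d - c)^-1 * (\int[mu1 R]_(x in `]c, d[) f (x, p.2))%R.

Lemma L2_mean f : L2fun2 O f -> L2fun2 O (mean_x f) /\
  int2 O (fun p => mean_x f p ^+ 2) <= int2 O (fun p => f p ^+ 2).
Proof.
move=> Lf; have dc0 : d - c != 0 by rewrite subr_eq0 gt_eqF.
have iO := L2_integrable mO (mu2_obox_lt c d a b) Lf.
have mS : measurable_fun O (mean_x f).
  rewrite /mean_x; apply: measurable_funM => //.
  by apply: (@measurable_snd_comp _ (fun y => (\int[mu1 R]_(x in `]c, d[) f (x, y))%R)); exact: slice_measurable.
have [] := L2_slice_op (ltW cd) (M := (d - c)^-1) Lf mS.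
  move=> y yab LF x xcd; rewrite /mean_x /= exprMn.
  have := sub_int_sq (ltW cd) (measurable_itv _) (@subset_refl _ _) LF.
  move=> /(ler_wpM2l (sqr_ge0 (d - c)^-1)) H; apply: (le_trans H).
  by rewrite le_eqVlt; apply/orP; left; apply/eqP; field.
by move=> h1; rewrite divff// mul1r.
Qed.

Lemma int_mean_slice f : L2fun2 O f -> {ae (mu1 R), forall y, y \in `]a, b[ ->
  (\int[mu1 R]_(x in `]c, d[) (f (x, y) - mean_x f (x, y)))%R = 0}.
Proof.
move=> Lf; have iO := L2_integrable mO (mu2_obox_lt c d a b) Lf.
apply: (ae_imp (ae_slice_integrable iO)) => y iy yab.
have ic : (mu1 R).-integrable `]c, d[ (EFin \o cst (mean_x f (c, y))).
  apply: measurable_bounded_integrable => //; first exact: mu1_itv_oo.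
  exists `|mean_x f (c, y)|; split; first by rewrite num_real.
  by move=> x x1 z _ /=; rewrite ltW.
rewrite RintegralB//; last exact: iy.
rewrite /mean_x /= Rintegral_cst// fine_mu1_oo ?(ltW cd)//.
by field; rewrite subr_eq0 gt_eqF.
Qed.

(** With [s = f - mean_x f], orthogonality to the mean gives that the squared norm [N] of [s] is the
    integral of [f * s], thus of [f1 * SR s] by [acl_slices]. As [SR] has norm at most [d - c],
    Cauchy-Schwarz bounds [N^2] by [N] times the right-hand side. *)
Lemma poincare_x f f1 : tensor_weak c d a b 1 0 f f1 ->
  int2 O (fun p => (f p - mean_x f p) ^+ 2) <= (d - c) ^+ 2 * int2 O (fun p => f1 p ^+ 2).
Proof.
move=> tw; have [Lf Lf1 _] := tw.
have [Lm _] := L2_mean Lf.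
pose s p := f p - mean_x f p.
have Ls : L2fun2 O s by exact: (L2_B mO Lf Lm).
have s0 := int_mean_slice Lf.
have [LS NS] := L2_SR (ltW cd) Ls.
have E := acl_slices cd tw Ls s0.
have E2 : int2 O (fun p => mean_x f p * s p) = 0.
  exact: (@int2_slice0 _ c d a b (fun y => (d - c)^-1 * (\int[mu1 R]_(x in `]c, d[) f (x, y))%R)).
set N := int2 O (fun p => s p ^+ 2).
have NE : N = int2 O (fun p => f1 p * (\int[mu1 R]_(x in `]p.1, d[) s (x, p.2))%R).
  rewrite -E /N /int2.
  rewrite [LHS](@eq_Rintegral _ _ _ _ _ (fun p : plane R => f p * s p - mean_x f p * s p)).
    rewrite RintegralB//; [|exact: (L2_mul mO Lf Ls)|exact: (L2_mul mO Lm Ls)].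
    by have := E2; rewrite /int2 => ->; rewrite subr0.
  by move=> p _; rewrite /s; ring.
have N0 : 0 <= N by exact: L2_ge0.
have CS : N ^+ 2 <= int2 O (fun p => f1 p ^+ 2) * ((d - c) ^+ 2 * N).
  rewrite [in leLHS]NE; apply: (le_trans (L2_CS mO Lf1 LS)).
  by apply: ler_wpM2l => //; exact: L2_ge0.
have [->|Nn] := eqVneq N 0; first by rewrite mulr_ge0 ?sqr_ge0// L2_ge0.
have Np : 0 < N by rewrite lt_def Nn.
rewrite -(ler_pM2r Np); apply: (le_trans _ (le_trans CS _)); first by rewrite expr2.
by rewrite mulrA [X in X * N]mulrC.
Qed.

End WeakIbp2.

Section Poincare.
Context (R : realType).
Variables (c d a b : R).
Hypotheses (cd : c < d) (ab : a < b).
Let O : set (plane R) := obox c d a b.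
Let mO : measurable O := measurable_obox c d a b.

(** Split [f] into [f - mean_x f] and [mean_x f], each controlled by the inequality in one
    variable. *)
Theorem poincare (f fx fy : R * R -> R) : tensor_weak c d a b 1 0 f fx ->
  tensor_weak c d a b 0 1 f fy -> int2 O f = 0 ->
  int2 O (fun p => f p ^+ 2) <=
  2 * (d - c) ^+ 2 * int2 O (fun p => fx p ^+ 2) +
  2 * (b - a) ^+ 2 * int2 O (fun p => fy p ^+ 2).
Proof.
move=> twx twy f0; have [Lf Lfx _] := twx; have [_ Lfy _] := twy.
have mO' := measurable_obox a b c d.
have [Lm _] := L2_mean cd Lf.
have Lfs := L2_swap Lf; have [Lms _] := L2_mean ab Lfs.
pose g p := f p - swapf (mean_x a b (swapf f)) p.
have Lm' : L2fun2 O (swapf (mean_x a b (swapf f))) by exact: L2_swap Lms.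
have Lg : L2fun2 O g by exact: (L2_B mO Lf Lm').
have Ng : int2 O (fun p => g p ^+ 2) <= (b - a) ^+ 2 * int2 O (fun p => fy p ^+ 2).
  have := poincare_x ab (tensor_weak_swap twy).
  have -> : int2 O (fun p => g p ^+ 2) =
      int2 (obox a b c d) (fun p => (swapf f p - mean_x a b (swapf f) p) ^+ 2).
    rewrite -(int2_swap (L2_sq Lg)); apply: eq_Rintegral => -[x y] _.
    by rewrite /g /swapf.
  by rewrite -(int2_swap (L2_sq Lfy)).
have iO := L2_integrable mO (mu2_obox_lt c d a b) Lf.
have iOs := integrable_swap iO.
(* Since the total integral vanishes, subtracting from [f] its mean in [y] does not change its mean
   in [x]; hence [mean_x f] is controlled by the [y]-derivative. *)
have Mfg : {ae (mu2 R), forall p, O p -> mean_x c d f p = mean_x c d g p}.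
  have h := ae_snd (ae_slice_integrable iO).
  apply: (ae_imp h) => -[x y] H [/= xcd yab].
  rewrite /mean_x /g; congr (_ * _).
  rewrite RintegralB//; [|exact: H|].
    suff -> : (\int[mu1 R]_(x0 in `]c, d[) swapf (mean_x a b (swapf f)) (x0, y))%R = 0 by rewrite subr0.
    rewrite /swapf /mean_x /= RintegralZl//; last exact: (slice_integrable iOs).
    have := int2_iter iOs; rewrite (int2_swap iO) f0 => <-; exact: mulr0.
  apply: integrable_realZ => //; exact: (slice_integrable iOs).
have [LMg NMg] := L2_mean cd Lg.
have NM : int2 O (fun p => mean_x c d f p ^+ 2) <= (b - a) ^+ 2 * int2 O (fun p => fy p ^+ 2).
  apply: (le_trans _ (le_trans NMg Ng)).
  rewrite /int2 (@ae_Rintegral _ _ _ _ _ mO _ (fun p => mean_x c d g p ^+ 2))//.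
  - by apply: measurable_funX; case: Lm.
  - by apply: measurable_funX; case: LMg.
  - by apply: (ae_imp Mfg) => p H Op; rewrite H.
have := L2_sqD mO (L2_B mO Lf Lm) Lm.
have -> : (\int[mu2 R]_(x in O) (f x - mean_x c d f x + mean_x c d f x) ^+ 2)%R =
  int2 O (fun p => f p ^+ 2).
  by apply: eq_Rintegral => p _; rewrite subrK.
move/le_trans; apply; have h := poincare_x cd twx.
rewrite -[X in _ <= X + _]mulrA -[X in _ <= _ + X]mulrA.
by apply: lerD; apply: ler_wpM2l.
Qed.

End Poincare.

(** * Inverse estimates and projections for polynomials *)

Section Poly1.
Context (R : realType).
Implicit Types (p v : {poly R}) (a b : R).

Lemma mitvR (i : interval R) : measurable ([set` i] : set (measurableTypeR R)).
Proof. exact: measurable_itv. Qed.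

Lemma leq_fact_mono j n : (j <= n)%N -> (j`! <= n`!)%N.
Proof.
move=> /subnKC <-; elim: (n - j)%N => [|l IH]; first by rewrite addn0.
by rewrite addnS factS (leq_trans IH)// leq_pmull.
Qed.

Lemma size_derivn (n m : nat) p : (size p <= m)%N -> (size p^`(n) <= m)%N.
Proof.
move=> /leq_sizeP sp; apply/leq_sizeP => j mj.
by rewrite coef_derivn sp ?mul0rn// (leq_trans mj)// leq_addl.
Qed.

Definition primp p : {poly R} := \poly_(i < (size p).+1) (p`_i.-1 / i%:R).

Lemma deriv_primp p : (primp p)^`() = p.
Proof.
apply/polyP => i; rewrite coef_deriv coef_poly /= ltnS.
case: ltnP => [_|h]; last by rewrite mul0rn nth_default.
by rewrite -[LHS]mulr_natr mulfVK// pnatr_eq0.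
Qed.

Definition ipoly a b p : R := (\int[mu1 R]_(x in `]a, b[) p.[x])%R.

Lemma ipoly_ftc a b F p : a < b -> F^`() = p -> ipoly a b p = F.[b] - F.[a].
Proof.
move=> ab Fp; apply: int1_derive => //.
  move=> x _; rewrite -Fp derivE derive1E; apply: derivableP.
  exact: derivable_horner.
by move=> x _; exact: continuous_horner.
Qed.

Lemma ipolyE a b p : a < b -> ipoly a b p = (primp p).[b] - (primp p).[a].
Proof.
by move=> ab; apply: ipoly_ftc => //; exact: deriv_primp.
Qed.

Lemma poly_integrable a b p : (mu1 R).-integrable `]a, b[ (EFin \o horner p).
Proof.
apply: (@integrableS _ _ _ (mu1 R) `[a, b]) => //; first exact: subset_itv_oo_cc.
by apply: continuous_segment_integrable => x _; exact: continuous_horner.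
Qed.

Lemma ipolyD a b p v : ipoly a b (p + v) = ipoly a b p + ipoly a b v.
Proof.
rewrite /ipoly -RintegralD//; try exact: poly_integrable.
by apply: eq_Rintegral => x _; rewrite hornerD.
Qed.

Lemma ipolyZ a b k p : ipoly a b (k *: p) = k * ipoly a b p.
Proof.
rewrite /ipoly -RintegralZl//; try exact: poly_integrable.
by apply: eq_Rintegral => x _; rewrite hornerZ.
Qed.

Lemma ipoly0 a b : ipoly a b 0 = 0.
Proof. by rewrite -(scale0r 0) ipolyZ mul0r. Qed.

Lemma ipoly_sum a b (I : Type) (r : seq I) (F : I -> {poly R}) :
  ipoly a b (\sum_(i <- r) F i) = \sum_(i <- r) ipoly a b (F i).
Proof.
by elim: r => [|i r IH]; rewrite ?big_nil ?ipoly0// !big_cons ipolyD IH.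
Qed.

Lemma ipoly_sq_ge0 a b p : 0 <= ipoly a b (p ^+ 2).
Proof. by apply: Rintegral_ge0 => x _; rewrite horner_exp sqr_ge0. Qed.

Lemma poly_inf_roots p a b : a < b -> (forall x, a < x < b -> p.[x] = 0) -> p = 0.
Proof.
move=> ab H; apply/eqP; apply: contraT => p0.
pose n := size p.
pose r := [seq a + (b - a) * (i.+1%:R / n.+2%:R) | i <- iota 0 n.+1].
have n0 : 0 < (n.+2%:R : R) by [].
have ur : uniq r.
  rewrite map_inj_uniq ?iota_uniq// => i j /addrI /mulfI h.
  have /h /mulIf h2 : b - a != 0 by rewrite subr_eq0 gt_eqF.
  have /h2/eqP : (n.+2%:R : R)^-1 != 0 by rewrite invr_eq0 pnatr_eq0.
  by rewrite eqr_nat => /eqP [].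
have : all (root p) r.
  apply/allP => x /mapP [i]; rewrite mem_iota /= add0n => ilt ->.
  apply/rootP; apply: H.
  have h1 : 0 < i.+1%:R / n.+2%:R :> R by rewrite divr_gt0.
  have h2 : i.+1%:R / n.+2%:R < 1 :> R by rewrite ltr_pdivrMr// mul1r ltr_nat.
  have ba : 0 < b - a by rewrite subr_gt0.
  rewrite ltrDl mulr_gt0//= -ltrBrDl.
  by rewrite -[ltRHS]mulr1 ltr_pM2l.
move/(max_poly_roots p0) => /(_ ur); rewrite size_map size_iota.
by rewrite ltnNge leqnSn.
Qed.

(** A primitive of [p ^+ 2] is nondecreasing; equal values at both ends make it constant, so its
    derivative is zero. *)
Lemma ipoly_sq_eq0 a b p : a < b -> ipoly a b (p ^+ 2) = 0 -> p = 0.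
Proof.
move=> ab; rewrite ipolyE//; set P := primp _ => /eqP; rewrite subr_eq0 => /eqP Pab.
have dP x : derive1 (horner P) x = (p ^+ 2).[x] by rewrite -derivE deriv_primp.
have ndP x y : a <= x -> x <= y -> y <= b -> P.[x] <= P.[y].
  move=> ax xy yb; apply: (@ger0_derive1_ndecr _ (horner P) a b) => //.
  - by move=> t _; rewrite dP horner_exp sqr_ge0.
  - by apply: continuous_subspaceT; exact: continuous_horner.
have Pc : P - (P.[a])%:P = 0.
  apply: (poly_inf_roots ab) => x /andP[ax xb]; rewrite hornerD hornerN hornerC.
  apply/eqP; rewrite subr_eq0 eq_le; apply/andP; split.
    by rewrite -Pab; apply: ndP => //; exact: ltW.
  by apply: ndP => //; exact: ltW.
have := deriv_primp (p ^+ 2); rewrite -/P.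
move/eqP: Pc; rewrite subr_eq0 => /eqP ->; rewrite derivC => /esym/eqP.
by rewrite expf_eq0 => /andP[_ /eqP].
Qed.

Definition gram m a b : 'M[R]_m.+1 := \matrix_(i, j) ipoly a b ('X^i * 'X^j).

Definition rowpoly m (v : 'rV[R]_m.+1) : {poly R} := \poly_(i < m.+1) v ord0 (inord i).

Lemma rowpolyE m (v : 'rV[R]_m.+1) : rowpoly v = \sum_(i < m.+1) v ord0 i *: 'X^i.
Proof.
by rewrite /rowpoly poly_def; apply: eq_bigr => i _; rewrite inord_val.
Qed.

Lemma polyrow m p : (size p <= m.+1)%N -> p = rowpoly (\row_(i < m.+1) p`_i).
Proof.
move=> sp; rewrite rowpolyE -[LHS](coefK p) poly_def.
rewrite (big_ord_widen _ (fun i => p`_i *: 'X^i) sp) big_mkcond /=.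
apply: eq_bigr => i _; rewrite mxE; case: ltnP => // h.
by rewrite nth_default// scale0r.
Qed.

Lemma gramE m a b (v : 'rV[R]_m.+1) j :
  (v *m gram m a b) ord0 j = ipoly a b (rowpoly v * 'X^j).
Proof.
rewrite mxE rowpolyE mulr_suml ipoly_sum; apply: eq_bigr => i _.
by rewrite mxE -scalerAl ipolyZ.
Qed.

(** A vector in the kernel is the list of coefficients of a polynomial orthogonal to all monomials,
    hence to itself. *)
Lemma gram_unit m a b : a < b -> gram m a b \in unitmx.
Proof.
move=> ab; rewrite -row_free_unit -kermx_eq0; apply/rowV0P => v /sub_kermxP vG.
have : ipoly a b (rowpoly v ^+ 2) = 0.
  rewrite expr2 {2}rowpolyE mulr_sumr ipoly_sum big1// => i _.
  by rewrite -scalerAr ipolyZ -gramE vG mxE mulr0.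
move/(ipoly_sq_eq0 ab) => v0; apply/rowP => i.
have := congr1 (fun p : {poly R} => p`_i) v0.
by rewrite coef0 /rowpoly coef_poly ltn_ord inord_val mxE.
Qed.

Lemma poly_projection m a b (f : R -> R) : a < b ->
  (forall p, (mu1 R).-integrable `]a, b[ (EFin \o (fun x => f x * p.[x]))) ->
  exists P : {poly R}, (size P <= m.+1)%N /\
    forall v, (size v <= m.+1)%N ->
      ipoly a b (P * v) = (\int[mu1 R]_(x in `]a, b[) (f x * v.[x]))%R.
Proof.
move=> ab fi.
pose r : 'rV[R]_m.+1 := \row_j (\int[mu1 R]_(x in `]a, b[) (f x * ('X^j : {poly R}).[x]))%R.
pose c := r *m invmx (gram m a b).
exists (rowpoly c); split; first exact: size_poly.
move=> v sv; rewrite (polyrow sv); set u := \row_(i < m.+1) v`_i.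
rewrite [rowpoly u]rowpolyE mulr_sumr ipoly_sum.
under eq_bigr do rewrite -scalerAr ipolyZ -gramE /c mulmxKV ?gram_unit//.
have -> : (\int[mu1 R]_(x in `]a, b[) (f x * (\sum_(i < m.+1) u ord0 i *: 'X^i).[x]))%R =
   (\int[mu1 R]_(x in `]a, b[) (\sum_(i <- index_enum 'I_m.+1) u ord0 i * (f x * ('X^i : {poly R}).[x])))%R.
  apply: eq_Rintegral => x _; rewrite horner_sum mulr_sumr; apply: eq_bigr => i _.
  by rewrite hornerZ mulrCA.
elim: (index_enum _) => [|i s IH].
  rewrite big_nil -[LHS](mul0r (fine (mu1 R `]a, b[))) -Rintegral_cst//.
  by apply: eq_Rintegral => x _; rewrite big_nil.
have EZ := @RintegralZl _ _ _ (mu1 R) _ _ (u ord0 i : R) (measurable_itv _) (fi 'X^i).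
rewrite big_cons IH [r _ _]mxE -EZ.
rewrite -RintegralD//.
- by apply: eq_Rintegral => x _; rewrite big_cons.
- apply: integrable_realZ => //; exact: fi.
- elim: s {IH} => [|k s IH].
    rewrite (_ : EFin \o _ = cst 0%E); first exact: integrable0.
    by apply/funext => x; rewrite /= big_nil.
  have h := @integrable_realZ _ _ _ (mu1 R) _ (mitvR _) (u ord0 k : R) _ (fi 'X^k).
  apply: eq_integrable (integrable_realD (mitvR _) h IH) => // x _.
  by rewrite /= big_cons.
Qed.

(** On the reference interval the coefficients are recovered from the moments by the inverse Gram
    matrix, and Cauchy-Schwarz bounds the moments; this replaces an appeal to equivalence of
    norms. *)
Lemma coef_bound m : exists C, 0 <= C /\ forall p, (size p <= m.+1)%N ->
  forall k, p`_k ^+ 2 <= C * ipoly 0 1 (p ^+ 2).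
Proof.
pose G := invmx (gram m 0 1).
exists (\sum_(k < m.+1) (\sum_(i < m.+1) `|G i k|) ^+ 2); split.
  by apply: sumr_ge0 => k _; exact: sqr_ge0.
move=> p sp k; have [km|km] := ltnP k m.+1; last first.
  rewrite nth_default ?(leq_trans sp)// expr0n /= mulr_ge0 ?ipoly_sq_ge0//.
  by apply: sumr_ge0 => j _; exact: sqr_ge0.
rewrite -(inordK km); set K := inord k : 'I_m.+1.
have pk : p`_K = \sum_(i < m.+1) ipoly 0 1 (p * 'X^i) * G i K.
  pose v : 'rV[R]_m.+1 := \row_i p`_i.
  have -> : p`_K = v ord0 K by rewrite mxE.
  rewrite -[v](mulmxK (gram_unit m (@ltr01 R))) mxE; apply: eq_bigr => i _.
  by rewrite gramE -polyrow.
have mom i : `|ipoly 0 1 (p * 'X^i)| <= Num.sqrt (ipoly 0 1 (p ^+ 2)).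
  rewrite -sqrtr_sqr ler_wsqrtr//.
  have Lp q : L2 (mu1 R) `]0, 1[ (horner q).
    split; first by apply/measurable_EFinP; exact: measurable_int (poly_integrable 0 1 q).
    apply: eq_integrable (poly_integrable 0 1 (q ^+ 2)) => // x _.
    by rewrite /= horner_exp.
  have := @L2_CS _ _ _ (mu1 R) _ (measurable_itv _) _ _ (Lp p) (Lp 'X^i).
  have -> : (\int[mu1 R]_(x in `]0, 1[) (p.[x] * ('X^i : {poly R}).[x]))%R = ipoly 0 1 (p * 'X^i).
    by apply: eq_Rintegral => x _; rewrite hornerM.
  have -> : (\int[mu1 R]_(x in `]0, 1[) (p.[x] ^+ 2))%R = ipoly 0 1 (p ^+ 2).
    by apply: eq_Rintegral => x _; rewrite horner_exp.
  move=> h; apply: (le_trans h); rewrite -[leRHS]mulr1 ler_wpM2l ?ipoly_sq_ge0//.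
  apply: (@le_trans _ _ (\int[mu1 R]_(x in `]0%R, 1%R[) (1 : R))%R); last first.
    by rewrite Rintegral_cst// fine_mu1_oo// subr0 mulr1.
  apply: le_Rintegral => //.
  - apply: eq_integrable (poly_integrable 0 1 (('X^i) ^+ 2)) => // x _.
    by rewrite /= horner_exp.
  - apply: eq_integrable (poly_integrable 0 1 1) => // x _.
    by rewrite /= hornerC.
  - move=> x; rewrite /= in_itv /= => /andP[x0 x1]; rewrite hornerXn -exprM.
    by rewrite exprn_ile1// ltW.
set S := ipoly _ _ _ in mom *.
have S0 : 0 <= S by exact: ipoly_sq_ge0.
apply: (@le_trans _ _ ((\sum_(i < m.+1) `|G i K|) ^+ 2 * S)).
  rewrite -[S in leRHS]sqr_sqrtr// -exprMn -ler_sqrt ?sqr_ge0// !sqrtr_sqr.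
  rewrite [leRHS]ger0_norm; last by rewrite mulr_ge0 ?sqrtr_ge0// sumr_ge0.
  rewrite pk mulr_suml; apply: (le_trans (ler_norm_sum _ _ _)); apply: ler_sum => i _.
  by rewrite normrM mulrC ler_wpM2l.
rewrite ler_wpM2r// [leRHS](bigD1 K)//= lerDl; apply: sumr_ge0 => j _; exact: sqr_ge0.
Qed.

Lemma comp_affine_deriv p (s t : R) k :
  (p \Po (s *: 'X + t%:P))^`(k) = s ^+ k *: (p^`(k) \Po (s *: 'X + t%:P)).
Proof.
elim: k => [|k IH]; first by rewrite expr0 scale1r.
rewrite !derivnS IH derivZ deriv_comp derivD derivZ derivX derivC addr0.
by rewrite alg_polyC mulrC mul_polyC scalerA exprSr.
Qed.

Lemma inverse1 m : exists C, 0 <= C /\ forall p k a b x, (size p <= m.+1)%N -> a < b ->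
  a <= x <= b -> (b - a) ^+ (k.*2.+1) * (p^`(k)).[x] ^+ 2 <= C * ipoly a b (p ^+ 2).
Proof.
have [C [C0 HC]] := coef_bound m.
pose B := (\sum_(i < m.+1) (m.+1)`!%:R : R).
exists (B ^+ 2 * C); split; first by rewrite mulr_ge0// sqr_ge0.
move=> p k a b x sp ab /andP[ax xb].
have L0 : 0 < b - a by rewrite subr_gt0.
have Ln0 : b - a != 0 by rewrite gt_eqF.
pose A := (b - a) *: 'X + a%:P : {poly R}.
pose q := p \Po A.
pose t := (x - a) / (b - a).
have t0 : 0 <= t by rewrite divr_ge0 ?subr_ge0// ltW.
have t1 : t <= 1 by rewrite ler_pdivrMr// mul1r lerD2r.
have At : A.[t] = x by rewrite /A hornerD hornerZ hornerX hornerC /t mulrC divfK// subrK.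
have sA : size A = 2.
  by rewrite /A size_polyDl ?size_scale ?size_polyX// size_polyC; case: (a != 0).
have sq : (size q <= m.+1)%N.
  rewrite (leq_trans (size_comp_poly_leq _ _))// sA /= muln1.
  by case: (size p) sp => [|n].
have Eq : (b - a) * ipoly 0 1 (q ^+ 2) = ipoly a b (p ^+ 2).
  rewrite -ipolyZ.
  have dF : (primp (p ^+ 2) \Po A)^`() = (b - a) *: q ^+ 2.
    rewrite deriv_comp deriv_primp /A derivD derivZ derivX derivC addr0.
    by rewrite alg_polyC mulrC mul_polyC /q rmorphXn.
  rewrite (ipoly_ftc (@ltr01 R) dF) (ipolyE _ ab) !horner_comp.
  by rewrite /A !hornerD !hornerZ !hornerX !hornerC mulr1 mulr0 add0r subrK.
have qk : (q^`(k)).[t] = (b - a) ^+ k * (p^`(k)).[x].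
  by rewrite /q comp_affine_deriv hornerZ horner_comp At.
set S := ipoly 0 1 (q ^+ 2) in Eq.
have S0 : 0 <= S by exact: ipoly_sq_ge0.
have -> : (b - a) ^+ k.*2.+1 * (p^`(k)).[x] ^+ 2 = (b - a) * (q^`(k)).[t] ^+ 2.
  by rewrite qk exprMn -[X in _ = _ * (X * _)]exprM muln2 [RHS]mulrA -exprS.
rewrite -Eq [leRHS]mulrCA; apply: ler_wpM2l; first exact: ltW.
have CS0 : 0 <= C * S by exact: mulr_ge0.
rewrite -mulrA -[C * S]sqr_sqrtr// -exprMn -ler_sqrt ?sqr_ge0// !sqrtr_sqr.
rewrite [leRHS]ger0_norm; last by rewrite mulr_ge0 ?sqrtr_ge0// sumr_ge0.
have sqk : (size q^`(k) <= m.+1)%N.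
  exact: size_derivn.
rewrite (horner_coef_wide _ sqk) /B mulr_suml; apply: (le_trans (ler_norm_sum _ _ _)).
apply: ler_sum => i _.
rewrite normrM [X in _ * X]ger0_norm ?exprn_ge0// coef_derivn normrMn.
apply: (@le_trans _ _ (`|q`_(k + i)| *+ (k + i) ^_ k)).
  by rewrite ler_piMr ?mulrn_wge0// exprn_ile1.
have qb : `|q`_(k + i)| <= Num.sqrt (C * S).
  by rewrite -sqrtr_sqr ler_wsqrtr// HC.
have [kim|kim] := ltnP (k + i)%N m.+1; last first.
  by rewrite nth_default ?(leq_trans sq)// normr0 mul0rn mulr_ge0 ?sqrtr_ge0.
rewrite -[leLHS]mulr_natl; apply: ler_pM => //.
rewrite ler_nat; apply: (@leq_trans ((k + i)`!)); last first.
  by apply: leq_fact_mono; exact: ltnW.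
by rewrite -(ffact_fact (leq_addr i k)) leq_pmulr// fact_gt0.
Qed.

End Poly1.

Lemma continuous_sumf (R : realType) (T : topologicalType) (I : Type) (r : seq I)
    (F : I -> T -> R) : (forall i, continuous (F i)) ->
  continuous (fun p => \sum_(i <- r) F i p).
Proof.
move=> cF; elim: r => [|i r IH] p.
  by under eq_fun do rewrite big_nil; exact: cvg_cst.
by under eq_fun do rewrite big_cons; apply: cvgD; [exact: cF|exact: IH].
Qed.

Lemma measurable_sumf (R : realType) d (T : measurableType d) (D : set T)
    (I : Type) (r : seq I) (F : I -> T -> R) :
  (forall i, measurable_fun D (F i)) -> measurable_fun D (fun p => \sum_(i <- r) F i p).
Proof.
move=> mF; elim: r => [|i r IH].
  by under eq_fun do rewrite big_nil; exact: measurable_cst.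
by under eq_fun do rewrite big_cons; exact: measurable_funD.
Qed.

(** * Polynomials in two variables *)

Section Poly2.
Context (R : realType).
Implicit Types (q : {poly {poly R}}) (p : R * R).

Definition ev q p : R := (q.[(p.1)%:P]).[p.2].

Definition pdx q : {poly {poly R}} := q^`().
Definition pdy q : {poly {poly R}} := map_poly (@deriv R) q.
Definition pd i j q := iter i pdx (iter j pdy q).

Lemma ev_sum q p : ev q p = \sum_(i < size q) (q`_i).[p.2] * p.1 ^+ i.
Proof.
rewrite /ev [q.[_]]horner_coef horner_sum; apply: eq_bigr => i _.
by rewrite hornerM -rmorphXn hornerC.
Qed.

Lemma ev_sum_wide n q p : (size q <= n)%N ->
  ev q p = \sum_(i < n) (q`_i).[p.2] * p.1 ^+ i.
Proof.
move=> sq; rewrite /ev [q.[_]](horner_coef_wide _ sq) horner_sum; apply: eq_bigr => i _.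
by rewrite hornerM -rmorphXn hornerC.
Qed.

Definition atx q (y : R) : {poly R} := \poly_(i < size q) (q`_i).[y].

Lemma atxE q y x : ev q (x, y) = (atx q y).[x].
Proof. by rewrite ev_sum /atx horner_poly. Qed.

Lemma coef_atx q y i : (atx q y)`_i = (q`_i).[y].
Proof.
rewrite coef_poly; case: ltnP => // h; by rewrite nth_default// horner0.
Qed.

Lemma deriv_atx q y : (atx q y)^`() = atx (pdx q) y.
Proof.
by apply/polyP => i; rewrite coef_deriv !coef_atx coef_deriv hornerMn.
Qed.

Lemma Dx_ev q : Dx (ev q) = ev (pdx q).
Proof.
apply/funext => -[x y]; rewrite DxE /=.
have -> : (fun t => ev q (t, y)) = horner (atx q y).
  by apply/funext => t; exact: atxE.
by rewrite -derivE deriv_atx atxE.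
Qed.

Lemma coef_pdy q i : (pdy q)`_i = (q`_i)^`().
Proof. by rewrite coef_map_id0 // deriv0. Qed.

Lemma size_pdy q : (size (pdy q) <= size q)%N.
Proof. by apply/leq_sizeP => j h; rewrite coef_pdy nth_default// deriv0. Qed.

Lemma Dy_ev q : Dy (ev q) = ev (pdy q).
Proof.
apply/funext => -[x y]; rewrite DyE /= /ev /= -derivE.
congr (_.[y]); rewrite [q.[_]]horner_coef [(pdy q).[_]](horner_coef_wide _ (size_pdy q)).
rewrite raddf_sum /=; apply: eq_bigr => i _.
by rewrite derivM coef_pdy -rmorphXn /= derivC mulr0 addr0.
Qed.

Lemma pder_ev i j q : pder i j (ev q) = ev (pd i j q).
Proof.
rewrite /pder /pd.
have -> : iter j (@Dy R) (ev q) = ev (iter j pdy q).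
  by elim: j => [|j IH]//; rewrite !iterS IH Dy_ev.
by elim: i => [|i IH]//; rewrite !iterS IH Dx_ev.
Qed.

Lemma coef_pd i j q k : (pd i j q)`_k = (q`_(i + k))^`(j) *+ (i + k) ^_ i.
Proof.
have -> : pd i j q = (iter j pdy q)^`(i) by elim: i => [|i IH] //; rewrite derivnS -IH.
rewrite coef_derivn; congr (_ *+ _).
by elim: j (i + k)%N => [|j IH] l //; rewrite iterS coef_pdy IH -derivnS.
Qed.

(** The bounds are on sizes, so that [inQ m.+1] is the space of degree at most [m] in each
    variable. *)
Definition inQ m q := (size q <= m)%N /\ forall i, (size (q`_i)%R <= m)%N.

Lemma inQ_pd m i j q : inQ m q -> inQ m (pd i j q).
Proof.
move=> [s1 s2]; split.
  apply/leq_sizeP => k mk; rewrite coef_pd (leq_sizeP _ _ s1).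
    by rewrite derivn_poly0 ?mul0rn// size_poly0.
  by rewrite (leq_trans mk)// leq_addl.
move=> k; rewrite coef_pd; apply/leq_sizeP => l ml.
by rewrite coefMn (leq_sizeP _ _ (size_derivn j (s2 _)))// mul0rn.
Qed.

Lemma evD q q' p : ev (q + q') p = ev q p + ev q' p.
Proof. by rewrite /ev !hornerD. Qed.

Lemma evN q p : ev (- q) p = - ev q p.
Proof. by rewrite /ev !hornerN. Qed.

Lemma evB q q' p : ev (q - q') p = ev q p - ev q' p.
Proof. by rewrite evD evN. Qed.

Lemma pdD i j q q' : pd i j (q + q') = pd i j q + pd i j q'.
Proof.
apply/polyP => k; rewrite coefD !coef_pd coefD.
by rewrite derivnD mulrnDl.
Qed.

Lemma inQB m q q' : inQ m q -> inQ m q' -> inQ m (q - q').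
Proof.
move=> [s1 s2] [s1' s2']; split.
  by rewrite (leq_trans (size_polyD _ _))// size_polyN geq_max s1.
by move=> i; rewrite coefB (leq_trans (size_polyD _ _))// size_polyN geq_max s2 s2'.
Qed.

Lemma Qpoly_ev m (c : 'M[R]_m.+1) : exists q, inQ m.+1 q /\ Qpoly c = ev q.
Proof.
exists (\poly_(i < m.+1) \poly_(j < m.+1) c (inord i) (inord j)); split.
  split; first exact: size_poly.
  by move=> i; rewrite coef_poly; case: ifP => _; rewrite ?size_poly0// size_poly.
apply/funext => -[x y]; rewrite (ev_sum_wide _ (size_poly _ _)) /Qpoly /=.
apply: eq_bigr => i _; rewrite coef_poly ltn_ord horner_poly mulr_suml inord_val.
by apply: eq_bigr => j _; rewrite inord_val mulrAC.
Qed.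

Lemma ev_Qpoly m q : inQ m.+1 q -> exists c : 'M[R]_m.+1, Qpoly c = ev q.
Proof.
move=> [s1 s2]; exists (\matrix_(i, j) (q`_i)`_j).
apply/funext => -[x y]; rewrite (ev_sum_wide _ s1) /Qpoly /=.
apply: eq_bigr => i _; rewrite (horner_coef_wide _ (s2 i)) mulr_suml.
by apply: eq_bigr => j _; rewrite mxE mulrAC.
Qed.

Lemma ev_continuous q : continuous (ev q).
Proof.
have -> : ev q = (fun p => \sum_(i < size q) (q`_i).[p.2] * ('X^i : {poly R}).[p.1]).
  by apply/funext => p; rewrite ev_sum; apply: eq_bigr => i _; rewrite hornerXn.
apply: continuous_sumf => i p; apply: cvgM.
  by apply: (@continuous_comp _ _ _ snd (horner q`_i)); [exact: cvg_snd|exact: continuous_horner].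
by apply: (@continuous_comp _ _ _ fst (horner ('X^i : {poly R}))); [exact: cvg_fst|exact: continuous_horner].
Qed.

Lemma ev_measurable q (D : set (plane R)) : measurable_fun D (ev q : plane R -> R).
Proof.
apply: measurable_funTS.
have -> : ev q = (fun p => \sum_(i < size q) (q`_i).[p.2] * p.1 ^+ i).
  by apply/funext => p; exact: ev_sum.
apply: measurable_sumf => i.
apply: measurable_funM.
  apply: measurableT_comp => //; apply: continuous_measurable_fun; exact: continuous_horner.
by apply: measurable_funX.
Qed.

Lemma continuous_bounded_box (F : R * R -> R) (c d a b : R) : continuous F ->
  exists B, forall p, cbox c d a b p -> `|F p| <= B.
Proof.
move=> cF; have [->|/set0P n0] := eqVneq (cbox c d a b) set0.
  by exists 0.
have cF' : {within cbox c d a b, continuous (fun p => `|F p|)}.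
  apply: continuous_subspaceT => p; apply: cvg_norm; exact: cF.
have [z _ H] := compact_EVT_max n0 (@compact_cbox R c d a b) cF'.
by exists (`|F z|) => p Op; apply: H; rewrite inE.
Qed.

Lemma obox_cbox (c d a b : R) : obox c d a b `<=` cbox c d a b.
Proof. by move=> [x y] [/= h1 h2]; split=> /=; exact: subset_itv_oo_cc. Qed.

Lemma L2_ev c d a b q : L2fun2 (obox c d a b) (ev q).
Proof.
have [B HB] := continuous_bounded_box c d a b (@ev_continuous q).
apply: (@L2_bounded _ _ _ (mu2 R) _ (measurable_obox c d a b) B).
- exact: mu2_obox_lt.
- exact: ev_measurable.
- by move=> p /obox_cbox; exact: HB.
Qed.


Lemma sum_sq_le n (F : nat -> R) :
  (\sum_(i < n) F i) ^+ 2 <= n%:R * \sum_(i < n) F i ^+ 2.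
Proof.
have : 0 <= \sum_(i < n) \sum_(j < n) (F i - F j) ^+ 2.
  by apply: sumr_ge0 => i _; apply: sumr_ge0 => j _; exact: sqr_ge0.
have -> : \sum_(i < n) \sum_(j < n) (F i - F j) ^+ 2 =
    2 * (n%:R * (\sum_(i < n) F i ^+ 2) - (\sum_(i < n) F i) ^+ 2).
  under eq_bigr => i _.
    under eq_bigr do rewrite sqrrB.
    rewrite big_split /= big_split /= sumr_const card_ord sumrN.
    under [X in _ - X + _]eq_bigr do rewrite -mulrnAr.
    rewrite -mulr_sumr -mulr_natl.
    over.
  rewrite big_split /= big_split /= sumrN -mulr_suml -mulr_sumr sumr_const card_ord.
  rewrite sumrMnl -mulr_natl -[X in _ - _ * X]mulr_natl; ring.
by rewrite pmulr_rge0// subr_ge0.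
Qed.

Section Boxes.
Variables (c d a b : R).
Hypotheses (cd : c < d) (ab : a < b) (c0 : c <= 0) (d0 : 0 <= d).
Let O : set (plane R) := obox c d a b.
Let mO : measurable O := measurable_obox c d a b.

Lemma int2_evE q : int2 O (fun p => ev q p ^+ 2) =
  (\int[mu1 R]_(y in `]a, b[) ipoly c d (atx q y ^+ 2))%R.
Proof.
rewrite (int2_iter (L2_sq (L2_ev c d a b q))); apply: eq_Rintegral => y _.
by apply: eq_Rintegral => x _; rewrite horner_exp atxE.
Qed.

(** At [x = 0], which belongs to the closed interval, the [i]-th derivative in [x] is [i!] times the
    coefficient; the inverse inequality in [x] is applied on each slice and integrated in [y]. *)
Lemma coef_est m C q i : (forall (p : {poly R}) k a b x, (size p <= m.+1)%N -> a < b -> a <= x <= b ->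
    (b - a) ^+ (k.*2.+1) * (p^`(k)).[x] ^+ 2 <= C * ipoly a b (p ^+ 2)) ->
  inQ m.+1 q ->
  (d - c) ^+ (i.*2.+1) * ipoly a b (q`_i ^+ 2) <= C * int2 O (fun p => ev q p ^+ 2).
Proof.
move=> HC [s1 s2]; rewrite -ipolyZ.
have iO : (mu1 R).-integrable `]a, b[ (EFin \o (fun y => ipoly c d (atx q y ^+ 2))).
  apply: eq_integrable (slice_integrable (L2_sq (L2_ev c d a b q))) => // y _ /=.
  by congr EFin; apply: eq_Rintegral => x _; rewrite horner_exp atxE.
rewrite int2_evE -RintegralZl//; apply: le_Rintegral => //.
- exact: poly_integrable.
- by apply: integrable_realZ.
move=> y yab; have sz : (size (atx q y) <= m.+1)%N by rewrite (leq_trans (size_poly _ _)).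
have := HC (atx q y) i c d 0 sz cd; rewrite c0 d0 => /(_ isT); apply: le_trans.
rewrite hornerZ horner_exp ler_wpM2l//; first by rewrite exprn_ge0// subr_ge0 ltW.
rewrite horner_coef0 coef_derivn addn0 ffactnn coef_atx.
rewrite -[X in _ <= X ^+ 2]mulr_natr exprMn.
by rewrite ler_peMr ?sqr_ge0// exprn_ege1// ler1n fact_gt0.
Qed.

(** Converse of [coef_est]: the interval contains 0, hence [|x| <= d - c], and the sum of [m] terms
    is squared by Cauchy-Schwarz. *)
Lemma val_est m q : (size q <= m)%N ->
  int2 O (fun p => ev q p ^+ 2) <=
  m%:R * \sum_(i < m) (d - c) ^+ (i.*2.+1) * ipoly a b (q`_i ^+ 2).
Proof.
move=> sq.
have isnd P : (mu2 R).-integrable O (EFin \o (fun p => P.[p.2])).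
  exact: (@integrable_snd R c d a b (ltW cd) (horner P) (poly_integrable a b P)).
have iP P k : (mu2 R).-integrable O (EFin \o (fun p => k * P.[p.2])).
  exact: (integrable_realZ mO).
have E n : (\int[mu2 R]_(p in O) (\sum_(i < n) (d - c) ^+ (i.*2) * (q`_i ^+ 2).[p.2]))%R =
    \sum_(i < n) (d - c) ^+ (i.*2.+1) * ipoly a b (q`_i ^+ 2) /\
    (mu2 R).-integrable O (EFin \o (fun p => \sum_(i < n) (d - c) ^+ (i.*2) * (q`_i ^+ 2).[p.2])).
  elim: n => [|n [IH1 IH2]].
    split; last first.
      rewrite (_ : EFin \o _ = cst 0%E); first exact: integrable0.
      by apply/funext => x; rewrite /= big_ord0.
    rewrite big_ord0 -[RHS](mul0r (fine (mu2 R O))) -Rintegral_cst//.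
    by apply: eq_Rintegral => p _; rewrite big_ord0.
  have E1 : (fun p : plane R => \sum_(i < n.+1) (d - c) ^+ (i.*2) * (q`_i ^+ 2).[p.2]) =
     (fun p : plane R => (\sum_(i < n) (d - c) ^+ (i.*2) * (q`_i ^+ 2).[p.2]) + (d - c) ^+ (n.*2) * (q`_n ^+ 2).[p.2]).
    by apply/funext => p; rewrite big_ord_recr.
  split; last by rewrite E1; exact: (integrable_realD mO IH2 (iP _ _)).
  rewrite E1 (RintegralD mO IH2 (iP (q`_n ^+ 2) ((d - c) ^+ (n.*2)))).
  rewrite IH1 big_ord_recr /=; congr (_ + _).
  rewrite (@RintegralZl _ _ _ (mu2 R) _ _ _ mO (isnd (q`_n ^+ 2))).
  have := @int2_snd R c d a b (ltW cd) (horner (q`_n ^+ 2)) (poly_integrable a b _).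
  by rewrite /int2 => ->; rewrite mulrA -exprSr.
have [E1 E2] := E m.
rewrite -E1 -RintegralZl//; apply: le_Rintegral => //.
- exact: (L2_sq (L2_ev c d a b q)).
- exact: (integrable_realZ mO).
move=> [x y] [/= xcd yab]; rewrite (ev_sum_wide _ sq) /=.
apply: (le_trans (sum_sq_le m (fun i => (q`_i).[y] * x ^+ i))).
apply: ler_wpM2l => //; apply: ler_sum => i _.
rewrite exprMn horner_exp mulrC; apply: ler_wpM2r; first exact: sqr_ge0.
rewrite -exprM muln2 -!muln2 mulnC !exprM; apply: lerXn2r; rewrite ?nnegrE ?sqr_ge0//.
move: xcd; rewrite in_itv /= => /andP[cx xd].
have h1 : `|x| <= d - c.
  rewrite ler_norml opprB; apply/andP; split.
    by rewrite (le_trans _ (ltW cx))// lerBlDr ler_wpDr.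
  by rewrite (le_trans (ltW xd))// lerBrDr gerDl.
by rewrite -real_normK ?num_real// lerXn2r ?nnegrE// (le_trans _ h1).
Qed.

End Boxes.

(** Coefficients separate the variables: [val_est] passes to them, [inverse1] differentiates them in
    [y], and [coef_est] returns to the polynomial, the powers of [d - c] leaving [(d - c)^(2 i)]. *)
Lemma pd_est m : exists C, 0 <= C /\ forall c d a b q i j, c < d -> a < b -> c <= 0 -> 0 <= d ->
  inQ m.+1 q ->
  (d - c) ^+ (i.*2) * (b - a) ^+ (j.*2) * int2 (obox c d a b) (fun p => ev (pd i j q) p ^+ 2)
    <= C * int2 (obox c d a b) (fun p => ev q p ^+ 2).
Proof.
have [C [C0 HC]] := inverse1 R m.
exists (m.+1%:R * \sum_(k < m.+1) ((m.+1)`!%:R ^+ 2 * (C * C))); split.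
  by rewrite mulr_ge0// sumr_ge0// => k _; rewrite !mulr_ge0.
move=> c d a b q i j cd ab c0 d0 Qq.
have L0 : 0 < b - a by rewrite subr_gt0.
have D0 : 0 < d - c by rewrite subr_gt0.
have Qp := inQ_pd i j Qq.
apply: (@le_trans _ _ ((d - c) ^+ (i.*2) * (b - a) ^+ (j.*2) * (m.+1%:R *
   \sum_(k < m.+1) (d - c) ^+ (k.*2.+1) * ipoly a b ((pd i j q)`_k ^+ 2)))).
  apply: ler_wpM2l; first by rewrite mulr_ge0// exprn_ge0// ltW.
  by apply: val_est => //; case: Qp.
rewrite mulrCA -[leRHS]mulrA; apply: ler_wpM2l => //.
rewrite mulr_sumr mulr_suml; apply: ler_sum => k _.
rewrite coef_pd.
set N := int2 _ _.
have N0 : 0 <= N by exact: L2_ge0.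
have [ikm|ikm] := ltnP (i + k)%N m.+1; last first.
  case: Qq => sq _; rewrite (leq_sizeP _ _ sq _ ikm) derivn_poly0 ?size_poly0// mul0rn expr0n /= ipoly0 !mulr0.
  by rewrite !mulr_ge0.
set P := q`_(i + k).
have sP : (size P <= m.+1)%N by case: Qq => _; exact.
have e1 : (b - a) ^+ j.*2 * ipoly a b ((P^`(j) *+ (i + k) ^_ i) ^+ 2) <=
    (m.+1)`!%:R ^+ 2 * (C * ipoly a b (P ^+ 2)).
  have -> : (P^`(j) *+ (i + k) ^_ i) ^+ 2 = (((i + k) ^_ i)%:R ^+ 2) *: (P^`(j) ^+ 2).
    by rewrite -scaler_nat exprZn.
  rewrite ipolyZ mulrCA; apply: ler_pM.
  - exact: sqr_ge0.
  - by rewrite mulr_ge0 ?ipoly_sq_ge0// exprn_ge0// ltW.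
  - rewrite lerXn2r ?nnegrE// ler_nat.
    apply: (@leq_trans ((i + k)`!)); last by apply: leq_fact_mono; exact: ltnW.
    by rewrite -(ffact_fact (leq_addr k i)) leq_pmulr// fact_gt0.
  rewrite -(ler_pM2r L0) mulrAC -exprSr -ipolyZ.
  have -> : C * ipoly a b (P ^+ 2) * (b - a) = ipoly a b ((C * ipoly a b (P ^+ 2))%:P).
    rewrite /ipoly; under [RHS]eq_Rintegral do rewrite hornerC.
    by rewrite Rintegral_cst// fine_mu1_oo// ltW.
  apply: le_Rintegral => //; try exact: poly_integrable.
  move=> x; rewrite /= in_itv /= => /andP[ax xb]; rewrite hornerZ horner_exp hornerC.
  by apply: HC => //; rewrite !ltW.
have e2 := @coef_est c d a b cd c0 d0 m C q (i + k)%N HC Qq.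
apply: (@le_trans _ _ ((d - c) ^+ i.*2 * (d - c) ^+ k.*2.+1 * ((m.+1)`!%:R ^+ 2 * (C * ipoly a b (P ^+ 2))))).
  rewrite [leLHS](_ : _ = (d - c) ^+ i.*2 * (d - c) ^+ k.*2.+1 * ((b - a) ^+ j.*2 * ipoly a b ((P^`(j) *+ (i + k) ^_ i) ^+ 2))); last by ring.
  by apply: ler_wpM2l => //; rewrite mulr_ge0// exprn_ge0// ltW.
rewrite [leLHS](_ : _ = (m.+1)`!%:R ^+ 2 * (C * ((d - c) ^+ (i + k).*2.+1 * ipoly a b (P ^+ 2)))); last first.
  by rewrite doubleD -addnS exprD; ring.
rewrite -[leRHS]mulrA; apply: ler_wpM2l; first exact: sqr_ge0.
by rewrite -[leRHS]mulrA; apply: ler_wpM2l.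
Qed.

End Poly2.

(** * Weak derivatives of products and polynomials *)

Section BMul.
Context (R : realType).
Variables (c d a b : R).
Hypotheses (cd : c < d).
Let O : set (plane R) := obox c d a b.
Let mO : measurable O := measurable_obox c d a b.
Implicit Types (f J G : R * R -> R).

Lemma L2_cst (k : R) : L2fun2 O (fun=> k).
Proof.
apply: (@L2_bounded _ _ _ (mu2 R) _ mO `|k|) => //.
exact: mu2_obox_lt.
Qed.

Lemma tensor_weak_cst (k : R) : tensor_weak c d a b 1 0 (fun=> k) (fun=> 0).
Proof.
split; [exact: L2_cst|exact: L2_cst|] => phi1 phi2 t1 t2.
have s1 := test1_smooth (test1_derive1n 1 t1); have s2 := test1_smooth (test1_derive1n 0 t2).
have L1 := L2_mul mO (L2_cst k) (L2_tensor c d a b s1 s2).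
have -> : int2 (obox c d a b) (fun p => 0 * (phi1 p.1 * phi2 p.2)) = 0.
  rewrite /int2 (@eq_Rintegral _ _ _ _ _ (fun=> 0)); last by move=> p _; rewrite mul0r.
  by rewrite Rintegral_cst// mul0r.
rewrite mulr0 (int2_iter L1).
rewrite (@eq_Rintegral _ _ _ _ _ (fun=> 0)); last first.
  move=> y _ /=.
  rewrite (@eq_Rintegral _ _ _ _ _ (fun x : measurableTypeR R => (k * phi2 y) * derive1 phi1 x)); last first.
    by move=> x _; rewrite /= -mulrA; congr (_ * _); exact: mulrC.
  have cc x : {for x, continuous (derive1 phi1)} by exact: (smooth1_continuous s1).
  have ic := @continuous_segment_integrable R (derive1 phi1) c d (fun x _ => cc x).
  rewrite (@RintegralZl _ _ _ (mu1 R) _ _ _ (measurable_itv _)); last first.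
    by apply: (integrableS _ _ _ ic) => //; exact: subset_itv_oo_cc.
  suff -> : (\int[mu1 R]_(x in `]c, d[) derive1 phi1 x)%R = phi1 d - phi1 c.
    by rewrite !(test1_out t1) ?ltxx ?andbF// subrr mulr0.
  apply: (@int1_derive _ phi1 (derive1 phi1) _ _ cd).
  - move=> x _; apply: DeriveDef; last by rewrite derive1E.
    by apply: smooth1_derivable; exact: (test1_smooth t1).
  - by move=> x _; exact: cc.
by rewrite Rintegral_cst// mul0r.
Qed.

(** Integration by parts with [th = J * phi1 * phi2], which vanishes on the two sides thanks to
    [phi1]. It is not a test function, since [J] is only measurable in [y]; this is the reason for
    [weak_ibp]. *)
Lemma tensor_weak_bmul (B B1 : R) (f f1 J G : R * R -> R) : tensor_weak c d a b 1 0 f f1 ->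
  measurable_fun O J -> measurable_fun O G ->
  (forall p, O p -> `|J p| <= B) -> (forall p, O p -> `|G p| <= B1) ->
  (forall x y, c <= x <= d -> a < y < b -> is_derive x 1 (fun t => J (t, y)) (G (x, y))) ->
  (forall x y, c <= x <= d -> a < y < b -> {for x, continuous (fun t => G (t, y))}) ->
  tensor_weak c d a b 1 0 (fun p => J p * f p) (fun p => G p * f p + J p * f1 p).
Proof.
move=> tw mJ mG bJ bG dJ cG; have [Lf Lf1 _] := tw.
have LJf : L2fun2 O (fun p => J p * f p) by exact: (L2_bmul mO mJ bJ Lf).
have LGf : L2fun2 O (fun p => G p * f p) by exact: (L2_bmul mO mG bG Lf).
have LJf1 : L2fun2 O (fun p => J p * f1 p) by exact: (L2_bmul mO mJ bJ Lf1).
have LS := L2_D mO LGf LJf1.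
split=> // phi1 phi2 t1 t2.
have s1 := test1_smooth t1; have s1' := test1_smooth (test1_derive1n 1 t1).
have s2 := test1_smooth t2.
have LT := L2_tensor c d a b s1 s2; have LT' := L2_tensor c d a b s1' s2.
have K1 := L2_bmul mO mG bG LT; have K2 := L2_bmul mO mJ bJ LT'.
have LK := L2_D mO K1 K2.
have dphi (x : R) : is_derive x (1 : R) phi1 (derive1 phi1 x).
  by apply: DeriveDef; [exact: smooth1_derivable|rewrite derive1E].
have := @weak_ibp R c d a b cd f f1 (fun p => J p * (phi1 p.1 * phi2 p.2))
  (fun p => G p * (phi1 p.1 * phi2 p.2) + J p * (derive1 phi1 p.1 * phi2 p.2)) tw LK.
move=> H; have {H} : int2 O (fun p => f p * (G p * (phi1 p.1 * phi2 p.2) + J p * (derive1 phi1 p.1 * phi2 p.2))) =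
   - int2 O (fun p => f1 p * (J p * (phi1 p.1 * phi2 p.2))).
  apply: H.
  - move=> x y xcd yab /=; have h1 := dJ x y xcd yab; have h2 := dphi x.
    apply: is_derive_eq; rewrite /GRing.scale /=; ring.
  - move=> x y xcd yab /=; apply: cvgD; apply: cvgM.
    + exact: cG.
    + by apply: cvgM; [exact: (smooth1_continuous s1)|exact: cvg_cst].
    + have cJ : {for x, continuous (fun t => J (t, y))}; last exact: cJ.
      by have [h1 _] := dJ x y xcd yab; apply: differentiable_continuous; exact/derivable1_diffP.
    + by apply: cvgM; [exact: (smooth1_continuous s1')|exact: cvg_cst].
  - by move=> y _ /=; rewrite !(test1_out t1) ?ltxx ?andbF// !mul0r !mulr0.
rewrite /int2 => H.
have I1 := L2_mul mO Lf K2; have I2 := L2_mul mO Lf K1; have I3 := L2_mul mO Lf1 (L2_bmul mO mJ bJ LT).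
have E1 : (\int[mu2 R]_(p in O) (f p * (G p * (phi1 p.1 * phi2 p.2) + J p * (derive1 phi1 p.1 * phi2 p.2))))%R =
   (\int[mu2 R]_(p in O) (f p * (G p * (phi1 p.1 * phi2 p.2))))%R +
   (\int[mu2 R]_(p in O) (f p * (J p * (derive1 phi1 p.1 * phi2 p.2))))%R.
  by rewrite -RintegralD//; apply: eq_Rintegral => p _; rewrite mulrDr.
have E2 : (\int[mu2 R]_(p in O) ((G p * f p + J p * f1 p) * (phi1 p.1 * phi2 p.2)))%R =
   (\int[mu2 R]_(p in O) (f p * (G p * (phi1 p.1 * phi2 p.2))))%R +
   (\int[mu2 R]_(p in O) (f1 p * (J p * (phi1 p.1 * phi2 p.2))))%R.
  by rewrite -RintegralD//; apply: eq_Rintegral => p _; ring.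
rewrite E2 addn0 expr1 mulN1r opprD -H E1 addrA addrC addrA addrNK.
by apply: eq_Rintegral => p _; rewrite [in RHS]mulrCA -!mulrA; congr (_ * _); rewrite !mulrA.
Qed.

Lemma tensor_weak_classical (B B1 : R) (J G : R * R -> R) :
  measurable_fun O J -> measurable_fun O G ->
  (forall p, O p -> `|J p| <= B) -> (forall p, O p -> `|G p| <= B1) ->
  (forall x y, c <= x <= d -> a < y < b -> is_derive x 1 (fun t => J (t, y)) (G (x, y))) ->
  (forall x y, c <= x <= d -> a < y < b -> {for x, continuous (fun t => G (t, y))}) ->
  tensor_weak c d a b 1 0 J G.
Proof.
move=> mJ mG bJ bG dJ cG.
have := tensor_weak_bmul (tensor_weak_cst 1) mJ mG bJ bG dJ cG.
rewrite (_ : (fun p => J p * 1) = J); last by apply/funext => p; rewrite mulr1.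
by rewrite (_ : (fun p => G p * 1 + J p * 0) = G)//; apply/funext => p; rewrite mulr1 mulr0 addr0.
Qed.

End BMul.

Section PolyWeak.
Context (R : realType).
Variables (c d a b : R).
Hypotheses (cd : c < d) (ab : a < b).
Let O : set (plane R) := obox c d a b.
Let mO : measurable O := measurable_obox c d a b.
Implicit Type q : {poly {poly R}}.

Lemma is_derive_ev_x q (x y : R) : is_derive x (1 : R) (fun t => ev q (t, y)) (ev (pdx q) (x, y)).
Proof.
rewrite (_ : (fun t => ev q (t, y)) = horner (atx q y)); last first.
  by apply/funext => t; exact: atxE.
by rewrite atxE -deriv_atx; exact: is_derive_poly.
Qed.

Lemma ev_fixx q (x : R) : exists p : {poly R}, forall y, ev q (x, y) = p.[y].
Proof. by exists (q.[x%:P]). Qed.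

Lemma is_derive_ev_y q (x y : R) : is_derive y (1 : R) (fun t => ev q (x, t)) (ev (pdy q) (x, y)).
Proof.
have [p Hp] := ev_fixx q x.
have -> : ev (pdy q) (x, y) = p^`().[y].
  by rewrite -Dy_ev DyE /= derivE; congr (derive1 _ y); apply/funext => t; exact: Hp.
by rewrite (funext Hp); exact: is_derive_poly.
Qed.

Lemma tensor_weak_ev_x q : tensor_weak c d a b 1 0 (ev q) (ev (pdx q)).
Proof.
have [B HB] := continuous_bounded_box c d a b (@ev_continuous R q).
have [B1 HB1] := continuous_bounded_box c d a b (@ev_continuous R (pdx q)).
apply: (@tensor_weak_classical R c d a b cd B B1).
- exact: ev_measurable.
- exact: ev_measurable.
- by move=> p /obox_cbox; exact: HB.
- by move=> p /obox_cbox; exact: HB1.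
- by move=> x y _ _; exact: is_derive_ev_x.
- move=> x y _ _.
  have [h _] := is_derive_ev_x (pdx q) x y.
  by apply: differentiable_continuous; exact/derivable1_diffP.
Qed.

Lemma tensor_weak_ev_y q : tensor_weak c d a b 0 1 (ev q) (ev (pdy q)).
Proof.
have [B HB] := continuous_bounded_box c d a b (@ev_continuous R q).
have [B1 HB1] := continuous_bounded_box c d a b (@ev_continuous R (pdy q)).
have mS (F : R * R -> R) B0 : continuous F -> L2fun2 O F -> (forall p, cbox c d a b p -> `|F p| <= B0) ->
    measurable_fun (obox a b c d : set (plane R)) (swapf F) /\
    (forall p, obox a b c d p -> `|swapf F p| <= B0).
  move=> cF LF HF; split; first by have [] := L2_swap LF.
  by move=> [x y] [/= h1 h2]; apply: HF; apply: obox_cbox.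
have [m1 b1] := mS _ _ (@ev_continuous R q) (L2_ev c d a b q) HB.
have [m2 b2] := mS _ _ (@ev_continuous R (pdy q)) (L2_ev c d a b (pdy q)) HB1.
have : tensor_weak a b c d 1 0 (swapf (ev q)) (swapf (ev (pdy q))).
  apply: (tensor_weak_classical ab m1 m2 b1 b2).
  - by move=> x y _ _; exact: is_derive_ev_y.
  - move=> x y _ _.
    have [h _] := is_derive_ev_y (pdy q) y x.
    by apply: differentiable_continuous; exact/derivable1_diffP.
by move/tensor_weak_swap; congr tensor_weak; apply/funext => -[].
Qed.

Lemma tensor_weak_refl f : L2fun2 O f -> tensor_weak c d a b 0 0 f f.
Proof. by move=> Lf; split=> // phi1 phi2 _ _; rewrite expr0 mul1r. Qed.

Lemma tensor_weak_ev i j q : tensor_weak c d a b i j (ev q) (ev (pd i j q)).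
Proof.
have h0 : tensor_weak c d a b 0 j (ev q) (ev (pd 0 j q)).
  elim: j => [|j IH]; first exact: tensor_weak_refl (L2_ev _ _ _ _ _).
  by have := tensor_weak_comp IH (tensor_weak_ev_y (pd 0 j q)); rewrite addn1.
elim: i => [|i IH] //.
by have := tensor_weak_comp IH (tensor_weak_ev_x (pd i j q)); rewrite addn1 addn0.
Qed.

Lemma tensor_weak_D i j f w f' w' : tensor_weak c d a b i j f w -> tensor_weak c d a b i j f' w' ->
  tensor_weak c d a b i j (fun p => f p + f' p) (fun p => w p + w' p).
Proof.
move=> [Lf Lw H] [Lf' Lw' H']; split; [exact: (L2_D mO)|exact: (L2_D mO)|].
move=> phi1 phi2 t1 t2.
have T1 := L2_tensor c d a b (test1_smooth (test1_derive1n i t1)) (test1_smooth (test1_derive1n j t2)).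
have T2 := L2_tensor c d a b (test1_smooth t1) (test1_smooth t2).
have I1 := L2_mul mO Lf T1; have I1' := L2_mul mO Lf' T1.
have I2 := L2_mul mO Lw T2; have I2' := L2_mul mO Lw' T2.
have := H _ _ t1 t2; have := H' _ _ t1 t2; rewrite /int2 => E' E.
have -> : (\int[mu2 R]_(p in O) ((f p + f' p) * (derive1n i phi1 p.1 * derive1n j phi2 p.2)))%R =
  (\int[mu2 R]_(p in O) (f p * (derive1n i phi1 p.1 * derive1n j phi2 p.2)))%R +
  (\int[mu2 R]_(p in O) (f' p * (derive1n i phi1 p.1 * derive1n j phi2 p.2)))%R.
  by rewrite -RintegralD//; apply: eq_Rintegral => p _; rewrite mulrDl.
have -> : (\int[mu2 R]_(p in O) ((w p + w' p) * (phi1 p.1 * phi2 p.2)))%R =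
  (\int[mu2 R]_(p in O) (w p * (phi1 p.1 * phi2 p.2)))%R +
  (\int[mu2 R]_(p in O) (w' p * (phi1 p.1 * phi2 p.2)))%R.
  by rewrite -RintegralD//; apply: eq_Rintegral => p _; rewrite mulrDl.
by rewrite E E' mulrDr.
Qed.

Lemma tensor_weak_N i j f w : tensor_weak c d a b i j f w ->
  tensor_weak c d a b i j (fun p => - f p) (fun p => - w p).
Proof.
move=> [Lf Lw H]; split; [exact: (L2_N mO)|exact: (L2_N mO)|].
move=> phi1 phi2 t1 t2.
have T1 := L2_tensor c d a b (test1_smooth (test1_derive1n i t1)) (test1_smooth (test1_derive1n j t2)).
have T2 := L2_tensor c d a b (test1_smooth t1) (test1_smooth t2).
have I1 := L2_mul mO Lf T1; have I2 := L2_mul mO Lw T2.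
have := H _ _ t1 t2; rewrite /int2 => E.
rewrite [LHS](@eq_Rintegral _ _ _ _ _ (fun p : plane R => -1 * (f p * (derive1n i phi1 p.1 * derive1n j phi2 p.2)))); last first.
  by move=> p _; rewrite mulN1r mulNr.
rewrite [X in _ = _ * X](@eq_Rintegral _ _ _ _ _ (fun p : plane R => -1 * (w p * (phi1 p.1 * phi2 p.2)))); last first.
  by move=> p _; rewrite mulN1r mulNr.
by rewrite !RintegralZl// E mulrCA.
Qed.

Lemma tensor_weak_B i j f w f' w' : tensor_weak c d a b i j f w -> tensor_weak c d a b i j f' w' ->
  tensor_weak c d a b i j (fun p => f p - f' p) (fun p => w p - w' p).
Proof. by move=> h /tensor_weak_N; exact: tensor_weak_D. Qed.

End PolyWeak.

(** * Polynomial approximation on a rectangle *)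

Section Means.
Context (R : realType).
Implicit Type q : {poly {poly R}}.

Lemma coef2_pd i j q k l :
  ((pd i j q)`_k)`_l = (q`_(i + k))`_(j + l) *+ (j + l) ^_ j *+ (i + k) ^_ i.
Proof. by rewrite coef_pd coefMn coef_derivn. Qed.

Definition tdeg_lt n q := forall i j, (n <= i + j)%N -> (q`_i)`_j = 0.

Lemma tdeg_lt_inQ n q : tdeg_lt n q -> inQ n q.
Proof.
move=> H; split.
  apply/leq_sizeP => i ni; apply/polyP => j; rewrite coef0 H//.
  by rewrite (leq_trans ni)// leq_addr.
move=> i; apply/leq_sizeP => j nj; rewrite H//.
by rewrite (leq_trans nj)// leq_addl.
Qed.

Lemma tdeg_lt_pd n i j q : tdeg_lt n q -> (n <= i + j)%N -> pd i j q = 0.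
Proof.
move=> H nij; apply/polyP => k; apply/polyP => l; rewrite !coef0 coef2_pd H ?mul0rn//.
by rewrite addnACA (leq_trans nij)// leq_addr.
Qed.

(** The derivatives of order [n] only see the homogeneous part of degree [n], where they are
    constants; this fixes the top part, and the lower part, given by induction, compensates its
    contribution to the lower means. *)
Lemma mean_poly c d a b n (M : nat -> nat -> R) : c < d -> a < b ->
  exists q, tdeg_lt n q /\
    forall i j, (i + j < n)%N -> int2 (obox c d a b) (ev (pd i j q)) = M i j.
Proof.
move=> cd ab; pose A := (d - c) * (b - a).
have A0 : A != 0 by rewrite mulf_neq0// subr_eq0 gt_eqF.
have mO := measurable_obox c d a b.
have intc (k : R) : int2 (obox c d a b) (fun=> k) = k * A.
  have := @int2_snd R c d a b (ltW cd) (fun=> k).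
  move=> ->; last by apply: eq_integrable (poly_integrable a b k%:P) => // x _ /=; rewrite hornerC.
  by rewrite Rintegral_cst// fine_mu1_oo ?ltW// /A [LHS]mulrCA.
elim: n M => [|n IH] M.
  by exists 0; split=> // i j _; rewrite !coef0.
(* The derivative of order [(i, j)] of the top part is the constant [i! j! co i j], to be integrated
   over the area [A]. *)
pose co i j := M i j / ((i`! * j`!)%:R * A).
pose top : {poly {poly R}} := \poly_(i < n.+1) (co i (n - i)%N *: 'X^(n - i)).
have ctop i j : (top`_i)`_j = if (i + j == n)%N then co i j else 0.
  rewrite coef_poly; case: ltnP => hi; last first.
    by rewrite coef0 ifF//; apply/negbTE; move: hi; lia.
  rewrite coefZ coefXn; case: eqP => h1; case: eqP => h2.
  - by rewrite mulr1 h1.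
  - by exfalso; lia.
  - by exfalso; lia.
  - by rewrite mulr0.
have pdtop i j : (i + j = n)%N -> ev (pd i j top) = fun=> (M i j / A).
  move=> ijn; have -> : pd i j top = (M i j / A)%:P%:P.
    apply/polyP => k; apply/polyP => l; rewrite coef2_pd ctop !coefC.
    case: k => [|k] /=; last first.
      by rewrite coef0 ifF ?mul0rn//; apply/negbTE; lia.
    rewrite coefC; case: l => [|l] /=; last first.
      by rewrite ifF ?mul0rn//; apply/negbTE; lia.
    rewrite !addn0 ijn eqxx !ffactnn -mulrnA /co invfM -[LHS]mulr_natl [(i`! * _)%N]mulnC.
    have f0 : ((j`! * i`!)%:R : R) != 0 by rewrite pnatr_eq0 muln_eq0 negb_or -!lt0n !fact_gt0.
    by rewrite [M i j * _]mulrCA mulVKf.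
  by apply/funext => p; rewrite /ev !hornerC.
have [q [q0 qM]] := IH (fun i j => M i j - int2 (obox c d a b) (ev (pd i j top))).
have ttop : tdeg_lt n.+1 top.
  by move=> i j nij; rewrite ctop ifF//; apply/negbTE; lia.
exists (q + top); split.
  by move=> i j nij; rewrite !coefD (q0 i j (ltnW nij)) ttop// addr0.
move=> i j; rewrite ltnS leq_eqVlt => /orP[/eqP ijn|ijn].
  rewrite pdD (tdeg_lt_pd q0) ?ijn// add0r (pdtop _ _ ijn) intc.
  by rewrite divfK.
rewrite pdD -[RHS](subrK (int2 (obox c d a b) (ev (pd i j top)))) -(qM _ _ ijn).
have I1 := L2_integrable mO (mu2_obox_lt c d a b) (L2_ev c d a b (pd i j q)).
have I2 := L2_integrable mO (mu2_obox_lt c d a b) (L2_ev c d a b (pd i j top)).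
by rewrite /int2 -RintegralD//; apply: eq_Rintegral => p _; rewrite evD.
Qed.

End Means.

Section Bramble.
Context (R : realType).

Lemma wder_weak (O : set (R * R)) s i j u : sobolev s O u -> (i + j <= s)%N ->
  weak_derivative O i j u (wder O i j u).
Proof.
move=> Su ij; have [w Hw] := Su _ _ ij.
have := @xgetPex _ (fun _ : R * R => (0 : R)) [set w | weak_derivative O i j u w].
by apply; exists w.
Qed.

Variables (c d a b : R).
Let O : set (plane R) := obox c d a b.
Let mO : measurable O := measurable_obox c d a b.

Lemma wder_tensor_weak s i j u : sobolev s O u -> (i + j <= s)%N ->
  tensor_weak c d a b i j u (wder O i j u).
Proof. by move=> Su ij; apply: weak_tensor_weak; exact: wder_weak ij. Qed.

Lemma wder_tensor_weak_step s i j i' j' u : sobolev s O u -> (i + i' + (j + j') <= s)%N ->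
  tensor_weak c d a b i' j' (wder O i j u) (wder O (i + i') (j + j') u).
Proof.
move=> Su ij; apply: (@tensor_weak_factor _ c d a b i j i' j' u).
  by apply: wder_tensor_weak Su _; lia.
exact: wder_tensor_weak Su _.
Qed.

Lemma seminorm_ge0 k f : 0 <= seminorm_sq k O f.
Proof. by apply: sumr_ge0 => i _; exact: L2_ge0. Qed.

Lemma le_seminorm k i j f : (i + j = k)%N ->
  int2 O (fun p => wder O i j f p ^+ 2) <= seminorm_sq k O f.
Proof.
move=> ijk; have ik : (i < k.+1)%N by lia.
rewrite /seminorm_sq (bigD1 (Ordinal ik)) //=.
rewrite (_ : (k - i)%N = j); last by lia.
by rewrite lerDl sumr_ge0// => l _; exact: L2_ge0.
Qed.

End Bramble.

(** The polynomial is chosen so that every derivative of [u - q] of order at most [m] has zero mean;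
    the Poincare inequality is then iterated up to order [m.+1], where [q] contributes nothing. *)
Lemma bramble (R : realType) m (L : R) : exists C, 0 <= C /\
  forall c d a b h u, c < d -> a < b -> d - c <= h -> b - a <= L * h ->
  sobolev m.+1 (obox c d a b) u ->
  exists q, inQ m.+1 q /\ forall i j, (i + j <= m.+1)%N ->
    tensor_weak c d a b i j (fun p => u p - ev q p)
       (fun p => wder (obox c d a b) i j u p - ev (pd i j q) p) /\
    int2 (obox c d a b) (fun p => (wder (obox c d a b) i j u p - ev (pd i j q) p) ^+ 2) <=
    C * h ^+ ((m.+1 - (i + j)).*2) * seminorm_sq m.+1 (obox c d a b) u.
Proof.
(* Cost of one application of the Poincare inequality: the sides are at most [h] and [L * h]. *)
pose K : R := 2 + 2 * L ^+ 2.
have K1 : 1 <= K by rewrite /K; have := sqr_ge0 L; lra.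
exists (K ^+ m.+1); split; first by rewrite exprn_ge0// (le_trans ler01 K1).
move=> c d a b h u cd ab dch baL Su.
set O := obox c d a b; have mO := measurable_obox c d a b.
have h0 : 0 < h by rewrite (lt_le_trans _ dch)// subr_gt0.
have [q [q0 qM]] := mean_poly m.+1 (fun i j => int2 O (wder O i j u)) cd ab.
exists q; split; first exact: tdeg_lt_inQ.
set z := fun i j p => wder O i j u p - ev (pd i j q) p.
set S := seminorm_sq m.+1 O u.
have S0 : 0 <= S by exact: seminorm_ge0.
have twz i j i' j' : (i + i' + (j + j') <= m.+1)%N -> tensor_weak c d a b i' j' (z i j) (z (i + i')%N (j + j')%N).
  move=> ij; apply: (tensor_weak_B (wder_tensor_weak_step Su ij)).
  apply: (@tensor_weak_factor _ c d a b i j i' j' (ev q)); exact: tensor_weak_ev.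
have key t : forall i j, (i + j + t = m.+1)%N ->
    int2 O (fun p => z i j p ^+ 2) <= K ^+ t * h ^+ t.*2 * S.
  elim: t => [|t IH] i j ijt.
    rewrite expr0 mul1r mul1r.
    rewrite (_ : int2 O _ = int2 O (fun p => wder O i j u p ^+ 2)).
      by apply: le_seminorm; lia.
    apply: eq_Rintegral => p _; rewrite /z (tdeg_lt_pd q0); last by lia.
    by rewrite /ev horner0 horner0 subr0.
  have twx := twz i j 1%N 0%N; have twy := twz i j 0%N 1%N.
  have Z0 : int2 O (z i j) = 0.
    have [Lz _ _] := twx ltac:(lia).
    have [_ Lw _] := wder_tensor_weak Su (i := i) (j := j) ltac:(lia).
    rewrite /int2 /z RintegralB//; last 2 first.
      exact: (L2_integrable mO (mu2_obox_lt c d a b) Lw).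
      exact: (L2_integrable mO (mu2_obox_lt c d a b) (L2_ev c d a b _)).
    have := qM i j ltac:(lia); rewrite /int2 => ->; exact: subrr.
  have := poincare cd ab (twx ltac:(lia)) (twy ltac:(lia)) Z0.
  move/le_trans; apply; rewrite addn1 addn0 addn1 addn0.
  have e1 := IH i.+1 j ltac:(lia); have e2 := IH i j.+1 ltac:(lia).
  set T := K ^+ t * h ^+ t.*2 * S in e1 e2.
  have T0 : 0 <= T.
    by rewrite /T !mulr_ge0// exprn_ge0 ?ltW// (lt_le_trans ltr01 K1).
  apply: (@le_trans _ _ (2 * h ^+ 2 * T + 2 * (L * h) ^+ 2 * T)).
    apply: lerD; apply: ler_pM => //.
    - by rewrite mulr_ge0// sqr_ge0.
    - exact: L2_ge0.
    - by rewrite ler_wpM2l// lerXn2r ?nnegrE ?subr_ge0 ?(ltW cd) ?(ltW h0).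
    - by rewrite mulr_ge0// sqr_ge0.
    - exact: L2_ge0.
    - rewrite ler_wpM2l// lerXn2r ?nnegrE ?subr_ge0 ?(ltW ab)//.
      by rewrite (le_trans _ baL)// subr_ge0 ltW.
  rewrite /T doubleS !exprS /K le_eqVlt; apply/orP; left; apply/eqP; ring.
move=> i j ij; split.
  apply: (tensor_weak_B (wder_tensor_weak Su ij)); exact: tensor_weak_ev.
have := key (m.+1 - (i + j))%N i j ltac:(lia); move/le_trans; apply.
rewrite -!mulrA; apply: ler_wpM2r.
  by rewrite mulr_ge0// exprn_ge0// ltW.
by apply: ler_weXn2l => //; lia.
Qed.

(** * Leibniz sums and the coefficients of the operator *)

Section Leibniz.
Context (R : realType).
Implicit Types (J F : nat -> R * R -> R).

(** The [n]-th derivative of a product, expanded one derivation at a time instead of with binomial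
    coefficients: [2 ^+ n] terms, which explains the factors [2 ^+ n] and [4 ^+ n] in the bounds. *)
Fixpoint leibniz n J F : R * R -> R :=
  if n is n'.+1 then
    fun p => leibniz n' (fun k => J k.+1) F p + leibniz n' J (fun k => F k.+1) p
  else fun p => J 0%N p * F 0%N p.

Lemma leibniz_derive n J F x y :
  (forall k, is_derive x (1 : R) (fun t => J k (t, y)) (J k.+1 (x, y))) ->
  (forall k, is_derive x (1 : R) (fun t => F k (t, y)) (F k.+1 (x, y))) ->
  is_derive x (1 : R) (fun t => leibniz n J F (t, y)) (leibniz n.+1 J F (x, y)).
Proof.
elim: n J F => [|n IH] J F dJ dF.
  have h1 := dJ 0%N; have h2 := dF 0%N.
  by apply: is_derive_eq; rewrite /GRing.scale /=; ring.
have h1 := IH (fun k => J k.+1) F (fun k => dJ k.+1) dF.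
have h2 := IH J (fun k => F k.+1) dJ (fun k => dF k.+1).
by apply: is_derive_eq.
Qed.

Lemma leibniz_bound n J F p B M : 0 <= B -> 0 <= M ->
  (forall k, (k <= n)%N -> `|J k p| <= B) -> (forall k, (k <= n)%N -> `|F k p| <= M) ->
  `|leibniz n J F p| <= 2 ^+ n * (B * M).
Proof.
move=> B0 M0; elim: n J F => [|n IH] J F bJ bF.
  by rewrite expr0 mul1r normrM ler_pM ?bJ ?bF.
apply: (le_trans (ler_normD _ _)).
rewrite exprS -mulrA mulr_natl mulr2n; apply: lerD; apply: IH => k kn.
- exact: bJ.
- by apply: bF; exact: leqW.
- by apply: bJ; exact: leqW.
- exact: bF.
Qed.

Lemma leibniz_B n J F F' p : leibniz n J (fun k p => F k p - F' k p) p = leibniz n J F p - leibniz n J F' p.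
Proof.
elim: n J F F' => [|n IH] J F F' /=; first by rewrite mulrBr.
by rewrite !IH; ring.
Qed.

Lemma leibniz_D n J F F' p : leibniz n J (fun k p => F k p + F' k p) p = leibniz n J F p + leibniz n J F' p.
Proof.
elim: n J F F' => [|n IH] J F F' /=; first by rewrite mulrDr.
by rewrite !IH; ring.
Qed.

Lemma leibniz_measurable n J F (D : set (plane R)) :
  (forall k, (k <= n)%N -> measurable_fun D (J k)) ->
  (forall k, (k <= n)%N -> measurable_fun D (F k)) -> measurable_fun D (leibniz n J F).
Proof.
elim: n J F => [|n IH] J F mJ mF /=.
  by apply: measurable_funM; [exact: mJ|exact: mF].
apply: measurable_funD; apply: IH => k kn.
- exact: mJ.
- by apply: mF; exact: leqW.
- by apply: mJ; exact: leqW.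
- exact: mF.
Qed.

Section Weak.
Variables (c d a b : R).
Hypothesis cd : c < d.
Let O : set (plane R) := obox c d a b.
Let mO : measurable O := measurable_obox c d a b.

(* [J k] is the k-th derivative of [J 0] in the first variable. *)
Definition jet (B : nat -> R) J :=
  [/\ forall k, measurable_fun O (J k), forall k p, cbox c d a b p -> `|J k p| <= B k &
   forall k x y, cbox c d a b (x, y) -> is_derive x (1 : R) (fun t => J k (t, y)) (J k.+1 (x, y))].

Lemma jet_shift B J : jet B J -> jet (fun k => B k.+1) (fun k => J k.+1).
Proof. by move=> [h1 h2 h3]; split=> k *; [exact: h1|exact: h2|exact: h3]. Qed.

Lemma jet_tensor_weak B J f f1 : jet B J -> tensor_weak c d a b 1 0 f f1 ->
  tensor_weak c d a b 1 0 (fun p => J 0%N p * f p) (fun p => J 1%N p * f p + J 0%N p * f1 p).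
Proof.
move=> [h1 h2 h3] tw.
have cb x y : c <= x <= d -> a < y < b -> cbox c d a b (x, y).
  by move=> xcd /andP[ay yb]; split; rewrite /= in_itv //= !ltW.
apply: (tensor_weak_bmul cd (B := B 0%N) (B1 := B 1%N) tw).
- exact: h1.
- exact: h1.
- by move=> p /obox_cbox; exact: h2.
- by move=> p /obox_cbox; exact: h2.
- by move=> x y h h'; exact/h3/cb.
- move=> x y h h'; have [d1 _] := h3 1%N x y (cb _ _ h h').
  by apply: differentiable_continuous; exact/derivable1_diffP.
Qed.

Lemma jet_L2 B J k f : jet B J -> L2fun2 O f -> L2fun2 O (fun p => J k p * f p).
Proof.
move=> [h1 h2 _] Lf; apply: (L2_bmul mO (h1 k) (B := B k)) => // p /obox_cbox; exact: h2.
Qed.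

Lemma leibniz_L2 n B J F : jet B J -> (forall k, (k <= n)%N -> L2fun2 O (F k)) -> L2fun2 O (leibniz n J F).
Proof.
elim: n B J F => [|n IH] B J F jJ LF /=; first by apply: (@jet_L2 B J 0%N) => //; exact: LF.
apply: (L2_D mO); last by apply: IH jJ _ => k kn; exact: LF.
by apply: IH (jet_shift jJ) _ => k kn; apply: LF; exact: leqW.
Qed.

Lemma leibniz_norm n B J F b0 M : jet B J -> (forall k, (k <= n)%N -> L2fun2 O (F k)) ->
  (forall k, (k <= n)%N -> B k <= b0) -> 0 <= b0 ->
  (forall k, (k <= n)%N -> int2 O (fun p => F k p ^+ 2) <= M) ->
  int2 O (fun p => leibniz n J F p ^+ 2) <= 4 ^+ n * (b0 ^+ 2 * M).
Proof.
move=> jJ LF Bb b00 NF; elim: n B J F jJ LF Bb NF => [|n IH] B J F jJ LF Bb NF.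
  rewrite expr0 mul1r /=; have [h1 h2 _] := jJ.
  apply: (le_trans (L2_sqbM mO (h1 0%N) (B := b0) _ (LF 0%N (leqnn _)))).
    by move=> p /obox_cbox Op; rewrite (le_trans (h2 _ _ Op))// Bb.
  by apply: ler_wpM2l; [exact: sqr_ge0|exact: NF].
have L1 : L2fun2 O (leibniz n (fun k => J k.+1) F).
  by apply: leibniz_L2 (jet_shift jJ) _ => k kn; apply: LF; exact: leqW.
have L2 : L2fun2 O (leibniz n J (fun k => F k.+1)).
  by apply: leibniz_L2 jJ _ => k kn; exact: LF.
have e1 := IH _ _ F (jet_shift jJ) (fun k kn => LF k (leqW kn)) (fun k kn => Bb k.+1 kn) (fun k kn => NF k (leqW kn)).
have e2 := IH _ _ (fun k => F k.+1) jJ (fun k kn => LF k.+1 kn) (fun k kn => Bb k (leqW kn)) (fun k kn => NF k.+1 kn).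
apply: (le_trans (L2_sqD mO L1 L2)).
rewrite exprS; rewrite /int2 in e1 e2; lra.
Qed.

Lemma leibniz_tensor_weak n B J F : jet B J ->
  (forall k, (k <= n)%N -> tensor_weak c d a b 1 0 (F k) (F k.+1)) ->
  tensor_weak c d a b 1 0 (leibniz n J F) (leibniz n.+1 J F).
Proof.
elim: n B J F => [|n IH] B J F jJ twF; first exact: jet_tensor_weak jJ (twF 0%N (leqnn _)).
apply: tensor_weak_D.
  by apply: IH (jet_shift jJ) _ => k kn; apply: twF; exact: leqW.
by apply: IH jJ _ => k kn; exact: twF.
Qed.

End Weak.

Lemma jet_sub c d a b c' d' a' b' B J : c <= c' -> d' <= d -> a <= a' -> b' <= b ->
  jet c d a b B J -> jet c' d' a' b' B J.
Proof.
move=> cc dd aa bb [h1 h2 h3].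
have sub : cbox c' d' a' b' `<=` cbox c d a b.
  move=> [x y] [/=]; rewrite !in_itv /= => /andP[u1 u2] /andP[u3 u4].
  split; rewrite /= in_itv /= ?(le_trans cc u1) ?(le_trans u2 dd) ?(le_trans aa u3) ?(le_trans u4 bb)//.
have sub' : obox c' d' a' b' `<=` obox c d a b.
  move=> [x y] [/=]; rewrite !in_itv /= => /andP[u1 u2] /andP[u3 u4].
  split; rewrite /= in_itv /= ?(le_lt_trans cc u1) ?(lt_le_trans u2 dd) ?(le_lt_trans aa u3) ?(lt_le_trans u4 bb)//.
split.
- move=> k; apply: measurable_funS (h1 k) => //; exact: measurable_obox.
- by move=> k p /sub; exact: h2.
- by move=> k x y /sub; exact: h3.
Qed.

(** A derivative only depends on nearby values, so the identity propagates inside the open strip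
    [|x| < r]. It connects jets with the iterated classical derivatives that occur in [Vspace]. *)
Lemma iter_Dx_jet (J : nat -> R * R -> R) r y : 0 < r ->
  (forall k x, `|x| < r -> is_derive x (1 : R) (fun t => J k (t, y)) (J k.+1 (x, y))) ->
  forall n x, `|x| < r -> iter n (@Dx R) (J 0%N) (x, y) = J n (x, y).
Proof.
move=> r0 dJ; elim=> [//|n IH] x xr; rewrite iterS DxE /=.
have [d1 <-] := dJ n x xr; rewrite derive1E; apply: near_eq_derive => //.
near=> t; apply: IH; near: t.
exact: (@cvgr_norm_lt _ _ _ _ _ id x cvg_id r xr).
Unshelve. all: by end_near.
Qed.

End Leibniz.

(** * Sums, products and inverses of jets *)

Section JetAlgebra.
Context (R : realType).
Variables (c d a b : R).
Let O : set (plane R) := obox c d a b.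
Let mO : measurable O := measurable_obox c d a b.
Implicit Types (B : nat -> R) (J K : nat -> R * R -> R).

Definition mul_bound B B' n : R :=
  2 ^+ n * ((\sum_(k < n.+1) `|B k|) * (\sum_(k < n.+1) `|B' k|)).

Lemma le_sum_bound B n k : (k <= n)%N -> B k <= \sum_(i < n.+1) `|B i|.
Proof.
rewrite -ltnS => kn; rewrite (bigD1 (Ordinal kn))//= (le_trans (ler_norm _))//.
by rewrite lerDl sumr_ge0.
Qed.

Lemma jet_mul B B' J K : jet c d a b B J -> jet c d a b B' K ->
  jet c d a b (mul_bound B B') (fun n => leibniz n J K).
Proof.
move=> [h1 h2 h3] [h1' h2' h3']; split.
- by move=> n; apply: leibniz_measurable.
- move=> n p Op; apply: leibniz_bound; rewrite ?sumr_ge0// => k kn.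
    by rewrite (le_trans (h2 _ _ Op))// le_sum_bound.
  by rewrite (le_trans (h2' _ _ Op))// le_sum_bound.
- by move=> n x y Op; apply: leibniz_derive => k; [exact: h3|exact: h3'].
Qed.

Lemma jet_add B B' J K : jet c d a b B J -> jet c d a b B' K ->
  jet c d a b (fun k => B k + B' k) (fun k p => J k p + K k p).
Proof.
move=> [h1 h2 h3] [h1' h2' h3']; split.
- by move=> n; apply: measurable_funD.
- by move=> n p Op; rewrite (le_trans (ler_normD _ _))// lerD ?h2 ?h2'.
- move=> n x y Op; have d1 := h3 n x y Op; have d2 := h3' n x y Op.
  by apply: is_derive_eq.
Qed.

Lemma jet_snd (M : R) (f : R -> R) : 0 <= M -> measurable_fun `]a, b[ f ->
  (forall y, a <= y <= b -> `|f y| <= M) ->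
  jet c d a b (fun=> M) (fun k p => if k is 0%N then f p.2 else 0).
Proof.
move=> M0 mf fM; split.
- by move=> [|n]; [exact: measurable_snd_comp|exact: measurable_cst].
- move=> [|n] [x y] [/= _ yab]; last by rewrite normr0.
  by apply: fM; move: yab; rewrite in_itv.
- move=> n x y _; have := @is_derive_cst R R R (if n is 0%N then f y else 0) x 1.
  by case: n.
Qed.

Lemma jet_fst (M : R) : 1 <= M -> - M <= c -> d <= M ->
  jet c d a b (fun=> M) (fun k p => if k is 0%N then p.1 else if k is 1%N then 1 else 0).
Proof.
move=> M1 Mc dM; split.
- move=> [|[|n]]; [|exact: measurable_cst|exact: measurable_cst].
  by apply: (measurable_funS measurableT) => //; exact: measurable_fst.
- move=> [|[|n]] [x y] [/= xcd _]; [|by rewrite normr1|by rewrite normr0 (le_trans ler01 M1)].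
  move: xcd; rewrite in_itv /= ler_norml => /andP[cx xd].
  by rewrite (le_trans Mc cx) (le_trans xd dM).
- move=> [|[|n]] x y Op; [exact: is_derive_id|exact: is_derive_cst|exact: is_derive_cst].
Qed.

Lemma measurable_inv_pos d' (T : measurableType d') (D : set T) (f : T -> R) :
  measurable D -> measurable_fun D f ->
  (forall x, D x -> 0 < f x) -> measurable_fun D (fun x => (f x)^-1).
Proof.
move=> mD mf f0.
apply: (eq_measurable_fun (fun x => expR (- ln (f x)))).
  by move=> x /set_mem Dx; rewrite expRN lnK// posrE f0.
apply: measurableT_comp; first exact: measurable_expR.
apply: measurableT_comp; first exact: oppr_measurable.
by apply: measurableT_comp => //; exact: measurable_ln.
Qed.

(* The powers of [psi] are generated by [d/dt (1 + t k)^-1 = - k (1 + t k)^-2]. *)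
Lemma jet_inv (M : R) (f : R -> R) : 0 <= M -> measurable_fun `]a, b[ f ->
  (forall y, a <= y <= b -> `|f y| <= M) ->
  (forall x y, c <= x <= d -> a <= y <= b -> `|x * f y| <= 1 / 2) ->
  jet c d a b (fun k => k`!%:R * M ^+ k * 2 ^+ k.+1)
   (fun k p => (-1) ^+ k * k`!%:R * f p.2 ^+ k * (1 + p.1 * f p.2)^-1 ^+ k.+1).
Proof.
move=> M0 mf fM xf.
have pos x y : c <= x <= d -> a <= y <= b -> 1 / 2 <= 1 + x * f y.
  by move=> xcd yab; have := xf x y xcd yab; rewrite ler_norml => /andP[]; lra.
have mf2 : measurable_fun O (fun p : plane R => f p.2) by exact: measurable_snd_comp.
have mi : measurable_fun O (fun p : plane R => (1 + p.1 * f p.2)^-1).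
  apply: measurable_inv_pos => //.
    apply: measurable_funD => //; apply: measurable_funM => //.
    by apply: (measurable_funS measurableT) => //; exact: measurable_fst.
  move=> [x y] [/=]; rewrite !in_itv /= => /andP[h1 h2] /andP[h3 h4].
  by rewrite (lt_le_trans _ (pos x y _ _)) ?divr_gt0// !ltW.
split.
- move=> k; apply: measurable_funM.
    by apply: measurable_funM => //; exact: measurable_funX.
  exact: measurable_funX.
- move=> k [x y] [/=]; rewrite !in_itv /= => xcd yab.
  have p0 := pos x y xcd yab.
  rewrite !normrM normrX normrN1 expr1n mul1r normr_nat.
  apply: ler_pM; rewrite ?mulr_ge0//.
    by rewrite ler_wpM2l// normrX lerXn2r ?nnegrE// fM.
  have p1 : 0 < 1 + x * f y by rewrite (lt_le_trans _ p0)// divr_gt0.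
  rewrite ger0_norm ?exprn_ge0 ?invr_ge0 ?(ltW p1)//.
  rewrite lerXn2r ?nnegrE ?invr_ge0 ?(ltW p1)//.
  by rewrite -[leRHS]invrK lef_pV2 ?posrE ?invr_gt0//; lra.
- move=> k x y [/=]; rewrite !in_itv /= => xcd yab.
  have p0 := pos x y xcd yab.
  have p1 : 1 + x * f y != 0 by rewrite gt_eqF// (lt_le_trans _ p0)// divr_gt0.
  have d1 : is_derive x (1 : R) (fun t => 1 + t * f y) (f y).
    by apply: is_derive_eq; rewrite /GRing.scale /=; ring.
  have d2 := @is_deriveV R (fun t => 1 + t * f y) x _ _ p1 d1.
  have d3 : is_derive x (1 : R) (fun t => (1 + t * f y)^-1 ^+ k.+1)
    (k.+1%:R * (1 + x * f y)^-1 ^+ k * (- (1 + x * f y) ^- 2 * f y)).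
    have := @is_deriveX R _ _ k.+1 x _ _ d2; rewrite exprfctE /= /GRing.scale /=.
    exact.
  have := @is_deriveZ _ _ _ _ ((-1) ^+ k * k`!%:R * f y ^+ k) _ _ _ d3.
  rewrite /= /GRing.scale /= => H.
  apply: is_derive_eq H _.
  rewrite factS natrM !exprS; field.
  by rewrite p1.
Qed.

End JetAlgebra.

(** * Regularity of the curve *)

Section Components.
Context (R : realType).
Implicit Type f : R -> R * R.

Lemma is_derive_pair f x : derivable f x 1 ->
  is_derive x (1 : R) (fun t => (f t).1) (derive1 f x).1 /\
  is_derive x (1 : R) (fun t => (f t).2) (derive1 f x).2.
Proof.
move=> df; have cf : (fun h : R => h^-1 *: (f (h *: (1 : R) + x) - f x)) @ 0^' --> 'D_1 f x by exact: df.
rewrite derive1E.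
have h1 : {for 'D_1 f x, continuous (fst : R * R -> R)} by exact: cvg_fst.
have h2 : {for 'D_1 f x, continuous (snd : R * R -> R)} by exact: cvg_snd.
have c1 := cvg_comp _ _ cf h1.
have c2 := cvg_comp _ _ cf h2.
split; constructor.
- by apply/cvg_ex; exists ('D_1 f x).1.
- exact: (cvg_lim _ c1).
- by apply/cvg_ex; exists ('D_1 f x).2.
- exact: (cvg_lim _ c2).
Qed.

End Components.

Section WithinBound.
Context (R : realType).

Lemma within_bounded (f : R -> R) (a b : R) : a <= b -> {within `[a, b], continuous f} ->
  exists M, 0 <= M /\ forall x, a <= x <= b -> `|f x| <= M.
Proof.
move=> ab cf.
have cn : {within `[a, b], continuous (fun x => `|f x|)}.
  by move=> x; apply: cvg_norm; exact: cf.
have [z zab Hz] := EVT_max ab cn.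
by exists `|f z|; split=> // x xab; apply: Hz; rewrite in_itv.
Qed.

Lemma within_measurable (f : R -> R) (a b c d : R) : a <= c -> d <= b ->
  {within `[a, b], continuous f} -> measurable_fun (`]c, d[ : set (measurableTypeR R)) f.
Proof.
move=> ac db cf.
have := subspace_continuous_measurable_fun (measurable_itv `[a, b]) cf.
apply: measurable_funS; first exact: measurable_itv.
by move=> x /=; rewrite !in_itv /= => /andP[/ltW h1 /ltW h2]; rewrite (le_trans ac h1) (le_trans h2 db).
Qed.

Lemma is_derive_sqr_sum (u v : R -> R) (x du dv : R) :
  is_derive x (1 : R) u du -> is_derive x (1 : R) v dv ->
  is_derive x (1 : R) (fun t => u t ^+ 2 + v t ^+ 2) (2 * (u x * du + v x * dv)).
Proof.
move=> d1 d2; rewrite (_ : (fun t => _) = (fun t => u t * u t + v t * v t))//.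
by apply: is_derive_eq; rewrite /GRing.scale /=; ring.
Qed.

Lemma is_derive_cube_cross (i u v w z : R -> R) (x di du dv dw dz : R) :
  is_derive x (1 : R) i di -> is_derive x (1 : R) u du -> is_derive x (1 : R) v dv ->
  is_derive x (1 : R) w dw -> is_derive x (1 : R) z dz ->
  is_derive x (1 : R) (fun t => (i t * (i t * i t)) * (u t * z t - v t * w t))
   (3 * (i x ^+ 2 * di) * (u x * z x - v x * w x) +
    i x ^+ 3 * (du * z x + u x * dz - dv * w x - v x * dw)).
Proof.
by move=> d1 d2 d3 d4 d5; apply: is_derive_eq; rewrite /GRing.scale /=; ring.
Qed.

End WithinBound.

Section Curve.
Context (R : realType) (m : nat) (hm : (1 <= m)%N) (g : R -> R * R) (xs xe eps : R).
Hypothesis hg : admissible_curve m g xs xe eps.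

Let xse : xs <= xe. Proof. exact/ltW/(ac_interval hg). Qed.

Lemma curve_derive j x : xs <= x <= xe -> (j < m.+2)%N ->
  is_derive x (1 : R) (fun t => (derive1n j g t).1) (derive1n j.+1 g x).1 /\
  is_derive x (1 : R) (fun t => (derive1n j g t).2) (derive1n j.+1 g x).2.
Proof.
move=> xx jm; have [H _] := ac_smooth hg.
by rewrite derive1nS; exact: is_derive_pair (H j jm x xx).
Qed.

Lemma is_derive_cont (f : R -> R) (x df : R) : is_derive x 1 f df -> {for x, continuous f}.
Proof. by move=> [d1 _]; apply: differentiable_continuous; exact/derivable1_diffP. Qed.

Lemma curve_continuous j : (j <= m.+2)%N ->
  {within `[xs, xe], continuous (fun t => (derive1n j g t).1)} /\
  {within `[xs, xe], continuous (fun t => (derive1n j g t).2)}.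
Proof.
rewrite leq_eqVlt => /orP[/eqP ->|jm]; last first.
  split; apply: continuous_in_subspaceT => x; rewrite inE /= in_itv /= => xx;
    have [d1 d2] := curve_derive xx jm; exact: is_derive_cont.
have [_ H] := ac_smooth hg; split=> x.
- have h1 : {for derive1n m.+2 g x, continuous (fst : R * R -> R)} by exact: cvg_fst.
  exact: (cvg_comp _ _ (H x) h1).
- have h1 : {for derive1n m.+2 g x, continuous (snd : R * R -> R)} by exact: cvg_snd.
  exact: (cvg_comp _ _ (H x) h1).
Qed.

Definition speed x := enorm (derive1 g x).

Lemma speed_gt0 x : xs <= x <= xe -> 0 < speed x.
Proof.
move=> /(ac_regular hg); rewrite /speed /enorm; case: (derive1 g x) => u v uv.
rewrite sqrtr_gt0 lt_def addr_ge0 ?sqr_ge0// andbT.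
apply: contra uv; rewrite paddr_eq0 ?sqr_ge0//= !sqrf_eq0 => /andP[/eqP -> /eqP ->].
exact: eqxx.
Qed.

Lemma speed_continuous : {within `[xs, xe], continuous speed}.
Proof.
have [c1 c2] := curve_continuous (j := 1) isT.
move=> x; apply: (@continuous_comp _ _ _ (fun t : subspace `[xs, xe] => (derive1 g t).1 ^+ 2 + (derive1 g t).2 ^+ 2) Num.sqrt).
  by apply: cvgD; apply: cvgM; [exact: c1|exact: c1|exact: c2|exact: c2].
exact: sqrt_continuous.
Qed.

Lemma speed_derive x : xs <= x <= xe -> is_derive x (1 : R) speed
  (dotp (derive1 g x) (derive1n 2 g x) / speed x).
Proof.
move=> xx; have s0 := speed_gt0 xx.
have [d1 d2] := curve_derive xx (j := 1) isT.
have d3 : is_derive x (1 : R) (fun t => (derive1 g t).1 ^+ 2 + (derive1 g t).2 ^+ 2)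
   (2 * dotp (derive1 g x) (derive1n 2 g x)).
  exact: is_derive_sqr_sum.
have E0 : 0 < (derive1 g x).1 ^+ 2 + (derive1 g x).2 ^+ 2.
  by rewrite -sqrtr_gt0.
have d4 := @is_derive1_comp R Num.sqrt (fun t => (derive1 g t).1 ^+ 2 + (derive1 g t).2 ^+ 2) x _ _ (is_derive1_sqrt E0) d3.
apply: is_derive_eq d4 _.
rewrite /speed /enorm in s0 *; field.
by rewrite gt_eqF.
Qed.

Let s0 x : xs <= x <= xe -> speed x != 0. Proof. by move/speed_gt0; case: ltgtP. Qed.

Lemma within_mul (f1 f2 : R -> R) : {within `[xs, xe], continuous f1} ->
  {within `[xs, xe], continuous f2} -> {within `[xs, xe], continuous (fun x => f1 x * f2 x)}.
Proof. by move=> c1 c2 x; apply: cvgM; [exact: c1|exact: c2]. Qed.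

Lemma within_add (f1 f2 : R -> R) : {within `[xs, xe], continuous f1} ->
  {within `[xs, xe], continuous f2} -> {within `[xs, xe], continuous (fun x => f1 x + f2 x)}.
Proof. by move=> c1 c2 x; apply: cvgD; [exact: c1|exact: c2]. Qed.

Lemma within_opp (f1 : R -> R) : {within `[xs, xe], continuous f1} ->
  {within `[xs, xe], continuous (fun x => - f1 x)}.
Proof. by move=> c1 x; apply: cvgN; exact: c1. Qed.

Lemma within_inv (f1 : R -> R) : {within `[xs, xe], continuous f1} ->
  (forall x, xs <= x <= xe -> f1 x != 0) ->
  {within `[xs, xe], continuous (fun x => (f1 x)^-1)}.
Proof.
move=> c1 f0; apply/continuous_within_itvP; first exact: (ac_interval hg).
have [h1 h2 h3] := (continuous_within_itvP _ (ac_interval hg)).1 c1.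
split.
- move=> x xx; apply: cvgV; last exact: h1.
  by apply: f0; move: xx; rewrite in_itv /= => /andP[/ltW -> /ltW ->].
- by apply: cvgV => //; apply: f0; rewrite lexx.
- by apply: cvgV => //; apply: f0; rewrite lexx andbT.
Qed.

Lemma within_eq (f1 f2 : R -> R) : {within `[xs, xe], continuous f1} ->
  (forall x, xs <= x <= xe -> f1 x = f2 x) -> {within `[xs, xe], continuous f2}.
Proof.
move=> c1 H; apply: (subspace_eq_continuous _ c1).
by move=> x; rewrite mem_setE in_itv /= => xx; exact: H.
Qed.

Lemma dotp_continuous : {within `[xs, xe], continuous (fun x => dotp (derive1 g x) (derive1n 2 g x))}.
Proof.
have [c1 c2] := curve_continuous (j := 1) isT; have [e1 e2] := curve_continuous (j := 2) isT.
exact: within_add (within_mul c1 e1) (within_mul c2 e2).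
Qed.

Lemma curvature_continuous : {within `[xs, xe], continuous (curvature g)}.
Proof.
have [c1 c2] := curve_continuous (j := 1) isT; have [e1 e2] := curve_continuous (j := 2) isT.
have cs := speed_continuous.
have ci := within_inv (within_mul cs (within_mul cs cs)) _.
apply: within_mul (ci _) (within_add (within_mul c1 e2) (within_mul c2 (within_opp e1))) => x xx.
by rewrite !mulf_neq0// s0.
Qed.

(** In the derivative of [g' . Q g''] the term [g'' . Q g''] vanishes and [g' . Q g'''] remains; its
    continuity uses three derivatives of [g], hence [m >= 1]. *)
Lemma curvature_derive : exists k1, {within `[xs, xe], continuous k1} /\
  forall x, xs <= x <= xe -> is_derive x (1 : R) (curvature g) (k1 x).
Proof.
have [c1 c2] := curve_continuous (j := 1) isT; have [e1 e2] := curve_continuous (j := 2) isT.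
have [f1 f2] := curve_continuous (j := 3) ltac:(lia).
have cs := speed_continuous.
pose N x := dotp (derive1 g x) (rotQ (derive1n 2 g x)).
pose N1 x := dotp (derive1 g x) (rotQ (derive1n 3 g x)).
exists (fun x => - 3 * ((speed x)^-1 ^+ 4 * (dotp (derive1 g x) (derive1n 2 g x) * (speed x)^-1)) * N x
   + (speed x)^-1 ^+ 3 * N1 x).
have ci := within_inv cs s0.
have cN : {within `[xs, xe], continuous N}.
  exact: within_add (within_mul c1 e2) (within_mul c2 (within_opp e1)).
have cN1 : {within `[xs, xe], continuous N1}.
  exact: within_add (within_mul c1 f2) (within_mul c2 (within_opp f1)).
have cX k : {within `[xs, xe], continuous (fun x => (speed x)^-1 ^+ k)}.
  elim: k => [|k IH]; first by move=> x; exact: cvg_cst.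
  rewrite (_ : (fun x => _) = (fun x => (speed x)^-1 * (speed x)^-1 ^+ k)); first exact: within_mul.
  by apply/funext => x; rewrite exprS.
split.
  apply: within_add; last exact: within_mul.
  apply: within_mul; last exact: cN.
  have c3 : {within `[xs, xe], continuous (fun=> - 3 : R)} by move=> x; exact: cvg_cst.
  apply: within_mul; first exact: c3.
  by apply: within_mul; [exact: cX|exact: within_mul dotp_continuous ci].
move=> x xx; have h := s0 xx.
have ds := speed_derive xx.
have [d1 d2] := curve_derive xx (j := 1) isT.
have [d3 d4] := curve_derive xx (j := 2) ltac:(lia).
have dsi := @is_deriveV R speed x _ _ h ds.
have cube (w : R) : (w ^+ 3)^-1 = w^-1 * (w^-1 * w^-1) by rewrite -exprVn.
have -> : curvature g = (fun x => ((speed x)^-1 * ((speed x)^-1 * (speed x)^-1)) *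
    ((derive1 g x).1 * (derive1n 2 g x).2 - (derive1 g x).2 * (derive1n 2 g x).1)).
  apply/funext => t; rewrite /curvature cube.
  by congr (_ * _); rewrite /dotp /rotQ /= mulrN.
apply: is_derive_eq (is_derive_cube_cross dsi d1 d2 d3 d4) _.
have alg (w a1 a2 b1 b2 c1' c2' : R) : w != 0 ->
   3 * (w^-1 ^+ 2 * (- w ^- 2 * ((a1 * b1 + a2 * b2) / w))) * (a1 * b2 - a2 * b1) +
    w^-1 ^+ 3 * (b1 * b2 + a1 * c2' - b2 * b1 - a2 * c1') =
   - 3 * (w^-1 ^+ 4 * ((a1 * b1 + a2 * b2) * w^-1)) * (a1 * b2 + a2 * - b1) +
   w^-1 ^+ 3 * (a1 * c2' + a2 * - c1').
  by move=> w0; field.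
exact: (alg (speed x) (derive1 g x).1 (derive1 g x).2 (derive1n 2 g x).1
  (derive1n 2 g x).2 (derive1n 3 g x).1 (derive1n 3 g x).2 h).
Qed.

Lemma curvature_le x : xs <= x <= xe -> `|curvature g x| <= max_curvature g xs xe.
Proof.
move=> xx; apply: sup_upper_bound; last first.
  by exists x => //=; rewrite in_itv.
split; first by exists `|curvature g x|; exists x => //=; rewrite in_itv.
have [M [_ HM]] := within_bounded xse curvature_continuous.
by exists M => _ [y /= + <-]; rewrite in_itv /= => /HM.
Qed.

(** The bounds are chosen before [h], [a] and [b], which makes the final constant independent of the
    element. Only derivatives in [eta] are taken, and [eta] enters through polynomials and powers of
    [psi]; in [xi] continuity on the compact parameter interval suffices. *)
Lemma operator_jets : exists B0 B1 B2 : nat -> R, exists K0 K1 K2 : nat -> R * R -> R,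
  [/\ K0 0%N = J0 g, K1 0%N = J1 g, K2 0%N = J2 g &
   forall h a b, 0 < h -> h < eps -> h * max_curvature g xs xe <= 1 / 2 ->
    xs <= a -> a < b -> b <= xe ->
    [/\ jet (- h) h a b B0 K0, jet (- h) h a b B1 K1 & jet (- h) h a b B2 K2]].
Proof.
have [k1 [ck1 dk1]] := curvature_derive.
have ck := curvature_continuous.
have ci := within_inv speed_continuous s0.
pose f0 x := (speed x)^-1 * (speed x)^-1.
have cf0 : {within `[xs, xe], continuous f0} by exact: within_mul.
pose f3 x := dotp (derive1 g x) (derive1n 2 g x) * f0 x.
have cf3 : {within `[xs, xe], continuous f3} by exact: within_mul dotp_continuous cf0.
have cf0N : {within `[xs, xe], continuous (fun x => - f0 x)} by exact: within_opp.
have ckp : {within `[xs, xe], continuous (derive1 (curvature g))}.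
  by apply: (within_eq ck1) => x /dk1 [_ <-]; rewrite derive1E.
have [M0 [M00 b0]] := within_bounded xse cf0.
have [M0' [M00' b0']] := within_bounded xse cf0N.
have [M3 [M30 b3]] := within_bounded xse cf3.
have [Mk [Mk0 bk]] := within_bounded xse ck.
have [Mp [Mp0 bp]] := within_bounded xse ckp.
pose snd_jet (f : R -> R) := fun (k : nat) (p : R * R) => if k is 0%N then f p.2 else 0.
pose fst_jet := fun (k : nat) (p : R * R) => if k is 0%N then p.1 else if k is 1%N then 1 else 0 : R.
pose P := fun (k : nat) (p : R * R) => (-1) ^+ k * k`!%:R * curvature g p.2 ^+ k *
   (1 + p.1 * curvature g p.2)^-1 ^+ k.+1.
pose BP := fun k => k`!%:R * Mk ^+ k * 2 ^+ k.+1.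
pose PP n := leibniz n P P; pose BPP := mul_bound BP BP.
pose K0 n := leibniz n PP (snd_jet f0).
pose K1 n := leibniz n (snd_jet (curvature g)) P.
pose KA n := leibniz n PP (snd_jet (fun x => - f0 x)).
pose KB n := leibniz n fst_jet (snd_jet (derive1 (curvature g))).
pose KC n := leibniz n KB P.
pose K2 n := leibniz n KA (fun k p => KC k p + snd_jet f3 k p).
exists (mul_bound BPP (fun=> M0)), (mul_bound (fun=> Mk) BP),
  (mul_bound (mul_bound BPP (fun=> M0'))
    (fun k => mul_bound (mul_bound (fun=> 1 + eps) (fun=> Mp)) BP k + M3)), K0, K1, K2.
have P0 : P 0%N = psi g.
  by apply/funext => p; rewrite /P /psi fact0 !expr0 !mul1r expr1.
have sq2 (w : R) : w^-1 * w^-1 = (w ^+ 2)^-1 by rewrite -invfM expr2.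
split.
- by apply/funext => p; rewrite /K0 /J0 /= /PP /= P0 /f0 sq2 -expr2.
- by apply/funext => p; rewrite /K1 /J1 /= P0.
- apply/funext => p; rewrite /K2 /J2 /KA /KC /KB /= /PP /= P0 /f3 /f0 sq2 -expr2.
  by rewrite mulrN.
move=> h a b h0 heps hk xa ab bx.
have e0 := ac_eps hg.
have sub y : a <= y <= b -> xs <= y <= xe.
  by move=> /andP[ay yb]; rewrite (le_trans xa ay) (le_trans yb bx).
have jsnd (f : R -> R) M : 0 <= M -> {within `[xs, xe], continuous f} ->
    (forall x, xs <= x <= xe -> `|f x| <= M) -> jet (- h) h a b (fun=> M) (snd_jet f).
  move=> M_0 cf bf; apply: jet_snd => //; last by move=> y /sub; exact: bf.
  exact: within_measurable cf.
have jP : jet (- h) h a b BP P.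
  apply: jet_inv => //; last 2 first.
  - by move=> y /sub; exact: bk.
  - move=> x y xh /sub yx; rewrite normrM (le_trans _ hk)//.
    apply: ler_pM => //; first by rewrite ler_norml.
    exact: curvature_le.
  exact: within_measurable ck.
have jPP : jet (- h) h a b BPP PP by exact: jet_mul.
(* The bound [1 + eps] covers both [|eta| <= h < eps] and the derivative 1. *)
have jfst : jet (- h) h a b (fun=> 1 + eps) fst_jet by apply: jet_fst; lra.
split.
- by apply: jet_mul jPP (jsnd _ _ M00 cf0 b0).
- by apply: jet_mul (jsnd _ _ Mk0 ck bk) jP.
- apply: jet_mul (jet_mul jPP (jsnd _ _ M00' cf0N b0')) _.
  apply: jet_add; last exact: jsnd.
  exact: jet_mul (jet_mul jfst (jsnd _ _ Mp0 ckp bp)) jP.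
Qed.

End Curve.

(** * Traces *)

Section PlaneMeasurable.
Context (R : realType).

Let box (q1 q2 : rat) (n : nat) : set (R * R) :=
  obox (ratr q1 - n.+1%:R^-1) (ratr q1 + n.+1%:R^-1) (ratr q2 - n.+1%:R^-1) (ratr q2 + n.+1%:R^-1).

(** The plane carries the product sigma-algebra; an open set is the countable union of the squares
    with rational centre and radius [1 / n.+1] contained in it. *)
Lemma open_measurable_plane (U : set (R * R)) : open U -> measurable (U : set (plane R)).
Proof.
move=> oU.
pose G (n : nat) : set (R * R) := match unpickle n : option (rat * rat * nat) with
  | Some (q1, q2, k) => if `[< box q1 q2 k `<=` U >] then box q1 q2 k else set0
  | None => set0 end.
have -> : U = \bigcup_n G n.
  apply/seteqP; split; last first.
    move=> p [n _]; rewrite /G; case: unpickle => [[[q1 q2] k]|//].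
    by case: asboolP => // sub /sub.
  move=> [x y] Up.
  have /nbhs_ballP[e e0 He] := open_nbhs_nbhs (conj oU Up).
  have [n Hn] : exists n : nat, 2 * n.+1%:R^-1 < (e : R).
    have e1 : 0 < e by exact: e0.
    exists (Num.bound (2 / e)); rewrite ltr_pdivrMr// mulrC -ltr_pdivrMr//.
    have := archi_boundP (ltW (divr_gt0 (ltr0n R 2) e1)).
    by move=> /lt_le_trans; apply; rewrite ler_nat.
  have n0 : 0 < n.+1%:R^-1 :> R by rewrite invr_gt0.
  set t : R := n.+1%:R^-1 in Hn n0.
  have [q1 /andP[a1 b1]] : exists q, x - t < (ratr q : R) < x + t.
    have [|q] := @rat_in_itvoo R (x - t) (x + t); first by lra.
    by rewrite in_itv; exists q.
  have [q2 /andP[a2 b2]] : exists q, y - t < (ratr q : R) < y + t.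
    have [|q] := @rat_in_itvoo R (y - t) (y + t); first by lra.
    by rewrite in_itv; exists q.
  have sub : box q1 q2 n `<=` U.
    rewrite /box -/t => -[x' y'] [/=]; rewrite !in_itv /= => /andP[h1 h2] /andP[h3 h4].
    by apply: He; split; rewrite /ball /= ltr_norml; apply/andP; split; lra.
  have inb : box q1 q2 n (x, y).
    by rewrite /box -/t; split; rewrite /= in_itv /=; apply/andP; split; lra.
  have Gin k : k = pickle (q1, q2, n) -> G k (x, y).
    by move=> ->; rewrite /G pickleK asboolT.
  by have [k Hk] : exists k, k = pickle (q1, q2, n); [eexists; reflexivity|exists k; [exact: I|exact: Gin]].
apply: bigcupT_measurable => n; rewrite /G; case: unpickle => [[[q1 q2] k]|]; last exact: measurable0.
by case: asboolP => _; [exact: measurable_obox|exact: measurable0].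
Qed.

Lemma continuous_measurable_plane (F : R * R -> R) (D : set (plane R)) : continuous F ->
  measurable_fun D (F : plane R -> R).
Proof.
move=> /continuousP cF; apply: measurable_funTS.
apply: (measurability _ (RGenOpens.measurableE R)).
move=> _ [_ [a [b ->] <-]]; rewrite setTI; apply: open_measurable_plane.
exact/cF/interval_open.
Qed.

Lemma continuous_L2 c d a b (F : R * R -> R) : continuous F -> L2fun2 (obox c d a b) F.
Proof.
move=> cF; have [B HB] := continuous_bounded_box c d a b cF.
apply: (@L2_bounded _ _ _ (mu2 R) _ (measurable_obox c d a b) B).
- exact: mu2_obox_lt.
- exact: continuous_measurable_plane.
- by move=> p /obox_cbox; exact: HB.
Qed.

End PlaneMeasurable.

Lemma continuous_pairl (R : realType) (y : R) : continuous (fun t : R => (t, y)).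
Proof.
move=> x; have c1 : (fun t : R => t) @ x --> x by exact: cvg_id.
have c2 : (fun t : R => y) @ x --> y by exact: cvg_cst.
exact: (cvg_pair c1 c2).
Qed.

Lemma continuous_pairr (R : realType) (x : R) : continuous (fun t : R => (x, t)).
Proof.
move=> y; have c1 : (fun t : R => x) @ y --> x by exact: cvg_cst.
have c2 : (fun t : R => t) @ y --> y by exact: cvg_id.
exact: (cvg_pair c1 c2).
Qed.

Section Trace.
Context (R : realType).
Variables (s : bool) (h a b : R).
Hypotheses (h0 : 0 < h) (ab : a < b).

Definition side : set (R * R) := if s then obox 0 h a b else obox (- h) 0 a b.
Let c : R := if s then 0 else - h.
Let d : R := if s then h else 0.
Let O : set (plane R) := obox c d a b.
Let mO : measurable O := measurable_obox c d a b.

Lemma sideE : side = obox c d a b. Proof. by rewrite /side /c /d; case: s. Qed.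

Let cd : c < d. Proof. by rewrite /c /d; case: s; rewrite ?oppr_lt0. Qed.
Let dc : d - c = h. Proof. by rewrite /c /d; case: s; rewrite ?subr0// sub0r opprK. Qed.

Definition side_sign : R := if s then 1 else -1.
Definition cutoff (x : R) : R := 1 - side_sign * x / h.

Lemma cutoff_le1 x : c <= x <= d -> `|cutoff x| <= 1.
Proof.
rewrite /cutoff /side_sign /c /d ler_norml => /andP[h1 h2].
have h3 : 0 <= side_sign * x / h <= 1.
  rewrite /side_sign; move: h1 h2; case: s => h1 h2; rewrite ?mul1r ?mulN1r; apply/andP; split.
  - by rewrite divr_ge0// ltW.
  - by rewrite ler_pdivrMr// mul1r.
  - by rewrite divr_ge0 ?oppr_ge0// ltW.
  - by rewrite ler_pdivrMr// mul1r lerNl.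
by move: h3; rewrite /side_sign => /andP[h3 h4]; apply/andP; split; lra.
Qed.

(** If [f1] is the derivative of [f] in [eta], the integrand is the [eta]-derivative of [f * cutoff]
    times [v]: the slope of the cut-off is [- side_sign / h]. *)
Definition bform (f1 f : R * R -> R) (v : {poly R}) : R :=
  int2 side (fun p => (f1 p * cutoff p.1 - f p * (side_sign / h)) * v.[p.2]).

Let mcut : measurable_fun O (fun p : plane R => cutoff p.1).
Proof.
apply: measurable_funB => //; apply: measurable_funM => //; apply: measurable_funM => //.
by apply: (measurable_funS measurableT) => //; exact: measurable_fst.
Qed.

Lemma bform_L2 f1 f : L2fun2 O f1 -> L2fun2 O f ->
  L2fun2 O (fun p => f1 p * cutoff p.1 - f p * (side_sign / h)) /\
  int2 O (fun p => (f1 p * cutoff p.1 - f p * (side_sign / h)) ^+ 2) <=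
    2 * int2 O (fun p => f1 p ^+ 2) + 2 * h ^- 2 * int2 O (fun p => f p ^+ 2).
Proof.
move=> L1 Lf.
have bcut (p : plane R) : O p -> `|cutoff p.1| <= 1.
  by move=> [/= + _]; rewrite in_itv /= => /andP[/ltW h1 /ltW h2]; rewrite cutoff_le1// h1.
have La := L2_bmul mO mcut bcut L1.
have Lb := L2_Z mO (side_sign / h) Lf.
have E : (fun p => f1 p * cutoff p.1 - f p * (side_sign / h)) = (fun p => cutoff p.1 * f1 p - (side_sign / h) * f p).
  by apply/funext => p; rewrite mulrC [X in _ - X]mulrC.
split; first by rewrite E; exact: (L2_B mO La Lb).
have := L2_sqB mO La Lb; have e2 := L2_sqbM mO mcut bcut L1; have e3 := L2_sqZ mO (side_sign / h) Lf.
rewrite e3 => H.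
have -> : int2 O (fun p => (f1 p * cutoff p.1 - f p * (side_sign / h)) ^+ 2) =
    (\int[mu2 R]_(p in O) (cutoff p.1 * f1 p - side_sign / h * f p) ^+ 2)%R.
  by apply: eq_Rintegral => p _; congr (_ ^+ 2); rewrite mulrC [X in _ - X]mulrC.
apply: (le_trans H); rewrite expr1n mul1r in e2; apply: lerD; first by rewrite ler_wpM2l.
rewrite -mulrA ler_wpM2l// ler_wpM2r ?L2_ge0//.
by rewrite exprMn exprVn /side_sign; case: s; rewrite ?sqrrN expr1n mul1r.
Qed.

Lemma poly_L2 (v : {poly R}) : L2fun2 O (fun p => v.[p.2]) /\
  int2 O (fun p => v.[p.2] ^+ 2) = h * ipoly a b (v ^+ 2).
Proof.
have L : L2fun2 O (ev (map_poly polyC v)).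
  exact: L2_ev.
have E : (fun p : R * R => v.[p.2]) = ev (v%:P).
  by apply/funext => p; rewrite /ev hornerC.
split; first by rewrite E; exact: L2_ev.
have iv := poly_integrable a b (v ^+ 2).
rewrite -[h in RHS]dc -(int2_snd (ltW cd) iv).
by apply: eq_Rintegral => p _; rewrite horner_exp.
Qed.

Lemma bform_bound f1 f v : L2fun2 O f1 -> L2fun2 O f ->
  bform f1 f v ^+ 2 <=
   (2 * int2 O (fun p => f1 p ^+ 2) + 2 * h ^- 2 * int2 O (fun p => f p ^+ 2)) *
   (h * ipoly a b (v ^+ 2)).
Proof.
move=> L1 Lf; rewrite /bform sideE; have [L N] := bform_L2 L1 Lf; have [Lv Nv] := poly_L2 v.
apply: (le_trans (L2_CS mO L Lv)); have := Nv; rewrite /int2 => ->.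
by apply: ler_wpM2r => //; rewrite mulr_ge0 ?ipoly_sq_ge0// ltW.
Qed.

Lemma bformB f1 f g1 g v : L2fun2 O f1 -> L2fun2 O f -> L2fun2 O g1 -> L2fun2 O g ->
  bform (fun p => f1 p - g1 p) (fun p => f p - g p) v = bform f1 f v - bform g1 g v.
Proof.
move=> L1 Lf L2 Lg; rewrite /bform sideE; have [Lv _] := poly_L2 v.
have [K1 _] := bform_L2 L1 Lf; have [K2 _] := bform_L2 L2 Lg.
rewrite /int2 -RintegralB//; [|exact: (L2_mul mO K1 Lv)|exact: (L2_mul mO K2 Lv)].
by apply: eq_Rintegral => p _; ring.
Qed.

Lemma bform_ae f1 f g1 g v : L2fun2 O f1 -> L2fun2 O f -> L2fun2 O g1 -> L2fun2 O g ->
  {ae (mu2 R), forall p, O p -> f1 p = g1 p} -> {ae (mu2 R), forall p, O p -> f p = g p} ->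
  bform f1 f v = bform g1 g v.
Proof.
move=> L1 Lf L2 Lg e1 e2; rewrite /bform sideE; have [Lv _] := poly_L2 v.
have [K1 _] := bform_L2 L1 Lf; have [K2 _] := bform_L2 L2 Lg.
apply: (@ae_Rintegral _ _ _ _ _ mO).
- by apply: measurable_funM; [case: K1|case: Lv].
- by apply: measurable_funM; [case: K2|case: Lv].
- by apply: (ae_imp2 e1 e2) => p h1 h2 Op; rewrite h1// h2.
Qed.

(** The fundamental theorem on each slice: the cut-off is 1 on the interface and 0 on the opposite
    side. The interface is the left end of the plus half and the right end of the minus half, hence
    the sign. *)
Lemma bform_trace (th th1 : R * R -> R) v : L2fun2 O th -> L2fun2 O th1 ->
  (forall x y, c <= x <= d -> a < y < b -> is_derive x (1 : R) (fun t => th (t, y)) (th1 (x, y))) ->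
  (forall x y, c <= x <= d -> a < y < b -> {for x, continuous (fun t => th1 (t, y))}) ->
  (mu1 R).-integrable `]a, b[ (EFin \o (fun y => th (0, y) * v.[y])) ->
  (\int[mu1 R]_(y in `]a, b[) (th (0, y) * v.[y]))%R = - side_sign * bform th1 th v.
Proof.
move=> L0 L1 dth cth ith; rewrite /bform sideE; have [Lv _] := poly_L2 v.
have [K1 _] := bform_L2 L1 L0.
rewrite (int2_iter (L2_mul mO K1 Lv)).
rewrite [X in _ = _ * X](@eq_Rintegral _ _ _ _ _ (fun y : measurableTypeR R => - side_sign * (th (0, y) * v.[y]))); last first.
  move=> y; rewrite inE /= in_itv /= => yab.
  pose F t := (th (t, y) * cutoff t) * v.[y].
  pose G t := (th1 (t, y) * cutoff t - th (t, y) * (side_sign / h)) * v.[y].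
  have dF x : c <= x <= d -> is_derive x (1 : R) F (G x).
    move=> xcd; have d1 := dth x y xcd yab.
    have d2 : is_derive x (1 : R) cutoff (- (side_sign / h)).
      by rewrite /cutoff; apply: is_derive_eq; rewrite /GRing.scale /=; ring.
    by rewrite /F /G; apply: is_derive_eq; rewrite /GRing.scale /=; ring.
  have -> : (\int[mu1 R]_(x in `]c, d[) ((th1 (x, y) * cutoff x - th (x, y) * (side_sign / h)) * v.[y]))%R = F d - F c.
    apply: (@int1_derive _ F G _ _ cd dF) => x xcd.
    have d1 := dth x y xcd yab.
    have cth0 : {for x, continuous (fun t => th (t, y))}.
      by have [h1 _] := d1; apply: differentiable_continuous; exact/derivable1_diffP.
    have cc : {for x, continuous cutoff}.
      apply: cvgB; first exact: cvg_cst.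
      by apply: cvgM; [apply: cvgM; [exact: cvg_cst|exact: cvg_id]|exact: cvg_cst].
    apply: cvgM; last exact: cvg_cst.
    apply: cvgB; first by apply: cvgM; [exact: (cth x y xcd yab)|exact: cc].
    by apply: cvgM; [exact: cth0|exact: cvg_cst].
  rewrite /F /cutoff /side_sign /c /d; case: s; rewrite ?mulr0 ?mul0r.
    by rewrite mul1r divff ?gt_eqF// subrr mulr0 mul0r subr0 mulr1 sub0r mulN1r.
  by rewrite mulN1r opprK divff ?gt_eqF// subrr mulr0 mul0r !subr0 mulr1 opprK mul1r.
rewrite (@RintegralZl _ _ _ (mu1 R) _ _ _ (mitvR _) ith) mulrA.
by rewrite /side_sign; case: s; rewrite ?mulrNN ?opprK ?mulr1 mul1r.
Qed.


Lemma smooth_slice phi x y : smooth phi ->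
  is_derive x (1 : R) (fun t => phi (t, y)) (Dx phi (x, y)) /\
  {for x, continuous (fun t => Dx phi (t, y))}.
Proof.
move=> sphi; have [_ dphi _ cD _] := sphi 1%N; split.
  constructor; last by rewrite DxE /= derive1E.
  exact: (derivable_x phi (x, y)).1.
apply: (@continuous_comp _ _ _ (fun t : R => (t, y)) (Dx phi)); last exact: cD.
exact: continuous_pairl.
Qed.

Lemma L2_oo_cc (F : R -> R) : L2fun1 a b F -> L2 (mu1 R) `]a, b[ F /\
  (\int[mu1 R]_(y in `]a, b[) F y ^+ 2)%R = int1 a b (fun y => F y ^+ 2).
Proof.
move=> [mF iF]; split; last exact: int1_oo_cc.
split; first by apply: (measurable_funS _ _ mF) => //; exact: subset_itv_oo_cc.
by apply: (integrableS _ _ _ iF) => //; exact: subset_itv_oo_cc.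
Qed.

Lemma poly_L2_1 (v : {poly R}) : L2 (mu1 R) `]a, b[ (fun y => v.[y]).
Proof.
split.
  by apply/measurable_EFinP; exact: measurable_int (poly_integrable a b v).
by apply: eq_integrable (poly_integrable a b (v ^+ 2)) => // y _ /=; rewrite horner_exp.
Qed.

(** The formula holds for the smooth approximants in the definition of the trace, and both members
    are continuous for the convergences stated there. *)
Theorem trace_formula w T v : side_trace a b side w T ->
  (\int[mu1 R]_(y in `]a, b[) (T y * v.[y]))%R =
    - side_sign * bform (wder side 1 0 w) (wder side 0 0 w) v.
Proof.
move=> [Sw LT [phi [sphi cphi cT]]].
set W1 := wder side 1 0 w; set W0 := wder side 0 0 w.
have LW1 : L2fun2 O W1.
  by rewrite /W1 sideE; have Sw' := Sw; rewrite sideE in Sw'; have [_ ? _] := wder_tensor_weak Sw' (i := 1) (j := 0) isT.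
have LW0 : L2fun2 O W0.
  by rewrite /W0 sideE; have Sw' := Sw; rewrite sideE in Sw'; have [_ ? _] := wder_tensor_weak Sw' (i := 0) (j := 0) isT.
pose V := ipoly a b (v ^+ 2).
have V0 : 0 <= V by exact: ipoly_sq_ge0.
pose A := (\int[mu1 R]_(y in `]a, b[) (T y * v.[y]))%R + side_sign * bform W1 W0 v.
pose t n := int1 a b (fun y => (phi n (0, y) - T y) ^+ 2).
pose a1 n := int2 side (fun p => (pder 1 0 (phi n) p - W1 p) ^+ 2).
pose b1 n := int2 side (fun p => (pder 0 0 (phi n) p - W0 p) ^+ 2).
have [LT' _] := L2_oo_cc LT; have Lv := poly_L2_1 v.
(* The defect [A] does not depend on [n], while the right-hand side tends to zero. *)
have key n : A ^+ 2 <= 2 * (t n * V) + 2 * ((2 * a1 n + 2 * h ^- 2 * b1 n) * (h * V)).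
  have [cph _ _ cD _] := sphi n 1%N.
  have L0 : L2fun2 O (phi n) by exact: continuous_L2.
  have L1 : L2fun2 O (Dx (phi n)) by exact: continuous_L2.
  have cs y : {for y, continuous (fun y => phi n (0, y))}.
    apply: (@continuous_comp _ _ _ (fun t : R => (0, t)) (phi n)); last exact: cph.
    exact: continuous_pairr.
  have Lp : L2fun1 a b (fun y => phi n (0, y)).
    split.
      apply: measurable_funTS; apply: continuous_measurable_fun => y; exact: cs.
    apply: (@continuous_segment_integrable R (fun y => phi n (0, y) ^+ 2)) => y _.
    by apply: cvgM; exact: cs.
  have [Lp' _] := L2_oo_cc Lp.
  have ith : (mu1 R).-integrable `]a, b[ (EFin \o (fun y => phi n (0, y) * v.[y])).
    exact: (L2_mul (mitvR _) Lp' Lv).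
  have E := bform_trace L0 L1 (fun x y _ _ => (smooth_slice x y (sphi n)).1)
    (fun x y _ _ => (smooth_slice x y (sphi n)).2) ith.
  have LTp := L2_B (mitvR _) Lp' LT'.
  have EA : A = - (\int[mu1 R]_(y in `]a, b[) ((phi n (0, y) - T y) * v.[y]))%R
      - side_sign * bform (fun p => Dx (phi n) p - W1 p) (fun p => phi n p - W0 p) v.
    rewrite bformB// /A.
    rewrite (@eq_Rintegral _ _ _ _ _ (fun y : measurableTypeR R => phi n (0, y) * v.[y] - T y * v.[y])
       (fun y : measurableTypeR R => (phi n (0, y) - T y) * v.[y])); last by move=> y _; ring.
    rewrite RintegralB//; [|exact: (L2_mul (mitvR _) LT' Lv)].
    rewrite E; ring.
  have e1 : (\int[mu1 R]_(y in `]a, b[) ((phi n (0, y) - T y) * v.[y]))%R ^+ 2 <= t n * V.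
    apply: (le_trans (L2_CS (mitvR _) LTp Lv)).
    have [_ ->] := L2_oo_cc (L2_B (mitvR `[a, b]) Lp LT).
    by rewrite /V /ipoly; under [in leRHS]eq_Rintegral do rewrite horner_exp.
  have e2 := bform_bound v (L2_B mO L1 LW1) (L2_B mO L0 LW0).
  rewrite EA.
  set X := (\int[mu1 R]_(y in _) _)%R in e1 *; set Y := bform _ _ _ in e2 *.
  have s2 : (side_sign * Y) ^+ 2 = Y ^+ 2.
    by rewrite exprMn /side_sign; case: s; rewrite ?sqrrN expr1n mul1r.
  apply: (@le_trans _ _ (2 * X ^+ 2 + 2 * Y ^+ 2)).
    by rewrite -s2; have := sqr_ge0 (- X + side_sign * Y); lra.
  apply: lerD; apply: ler_wpM2l => //.
  by rewrite /a1 /b1 sideE.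
have cR : (2 * (t n * V) + 2 * ((2 * a1 n + 2 * h ^- 2 * b1 n) * (h * V))) @[n --> \oo] -->
   (2 * (0 * V) + 2 * ((2 * 0 + 2 * h ^- 2 * 0) * (h * V)) : R).
  have ca := cphi 1%N 0%N isT; have cb := cphi 0%N 0%N isT.
  apply: cvgD; apply: cvgM; try exact: cvg_cst.
    by apply: cvgM; [exact: cT|exact: cvg_cst].
  apply: cvgM; last exact: cvg_cst.
  by apply: cvgD; apply: cvgM; try exact: cvg_cst; [exact: ca|exact: cb].
have A0 : A ^+ 2 <= 0.
  have E0 : 2 * (0 * V) + 2 * ((2 * 0 + 2 * h ^- 2 * 0) * (h * V)) = 0 by ring.
  rewrite -[leRHS]E0; apply: (ler_cvg_to _ cR); first exact: cvg_cst.
  exact: nearW.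
have /eqP : A ^+ 2 = 0 by apply/eqP; rewrite eq_le A0 sqr_ge0.
by rewrite sqrf_eq0 /A addr_eq0 => /eqP ->; rewrite mulNr.
Qed.

End Trace.

(** * The functionals of the jump conditions *)

Section Operators.
Context (R : realType).
Variables (K0 K1 K2 : nat -> R * R -> R).
Implicit Types (F G : nat -> nat -> R * R -> R) (q : {poly {poly R}}).

(* [Lop_der j F] is the j-th derivative in the first variable of the operator whose
   coefficients are [K0 0], [K1 0], [K2 0], in terms of the family [F] of all the
   derivatives of a function. *)
Definition Lop_der j F p : R := F j.+2 0%N p + leibniz j K0 (fun k => F k 2) p +
  leibniz j K1 (fun k => F k.+1 0%N) p + leibniz j K2 (fun k => F k 1%N) p.

(** The index counts at once the jump conditions and the order of derivation involved. Its companion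
    [trace_dop l] is the derivative in the first variable, needed in the cut-off formula. *)
Definition trace_op l F : R * R -> R :=
  match l with 0 => F 0%N 0%N | 1 => F 1%N 0%N | j.+2 => Lop_der j F end.

Definition trace_dop l F : R * R -> R :=
  match l with 0 => F 1%N 0%N | 1 => F 2 0%N | j.+2 => Lop_der j.+1 F end.

Lemma Lop_derB j F G p : Lop_der j (fun i k p => F i k p - G i k p) p = Lop_der j F p - Lop_der j G p.
Proof. by rewrite /Lop_der (leibniz_B j K0) (leibniz_B j K1) (leibniz_B j K2); ring. Qed.

Lemma opB l F G p : trace_op l (fun i k p => F i k p - G i k p) p = trace_op l F p - trace_op l G p.
Proof. by case: l => [|[|l]] //=; exact: Lop_derB. Qed.

Lemma Lop_derD j F G p : Lop_der j (fun i k p => F i k p + G i k p) p = Lop_der j F p + Lop_der j G p.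
Proof. by rewrite /Lop_der (leibniz_D j K0) (leibniz_D j K1) (leibniz_D j K2); ring. Qed.

Lemma opD l F G p : trace_op l (fun i k p => F i k p + G i k p) p = trace_op l F p + trace_op l G p.
Proof. by case: l => [|[|l]] //=; exact: Lop_derD. Qed.

Lemma dopB l F G p : trace_dop l (fun i k p => F i k p - G i k p) p = trace_dop l F p - trace_dop l G p.
Proof. by case: l => [|[|l]] //=; exact: Lop_derB. Qed.

Definition pdf q i j : R * R -> R := ev (pd i j q).

Lemma pdf0 q i j y : pdf q i j (0, y) = i`!%:R * ((q`_i)^`(j)).[y].
Proof.
rewrite /pdf atxE horner_coef0 coef_atx coef_pd addn0 ffactnn hornerMn.
by rewrite mulr_natl.
Qed.

Section Box.
Variables (c d a b : R) (B0 B1 B2 : nat -> R).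
Hypotheses (cd : c < d) (ab : a < b).
Hypotheses (j0 : jet c d a b B0 K0) (j1 : jet c d a b B1 K1) (j2 : jet c d a b B2 K2).
Let O : set (plane R) := obox c d a b.
Let mO : measurable O := measurable_obox c d a b.

Lemma Lop_der_L2 j F : (forall i k, (i + k <= j.+2)%N -> L2fun2 O (F i k)) -> L2fun2 O (Lop_der j F).
Proof.
move=> LF; apply: (L2_D mO).
  apply: (L2_D mO).
    apply: (L2_D mO); first by apply: LF; rewrite addn0.
    by apply: (leibniz_L2 j0) => k kj; apply: LF; lia.
  by apply: (leibniz_L2 j1) => k kj; apply: LF; lia.
by apply: (leibniz_L2 j2) => k kj; apply: LF; lia.
Qed.

Lemma Lop_der_tensor_weak s j F : (forall i k, (i + k < s)%N -> tensor_weak c d a b 1 0 (F i k) (F i.+1 k)) ->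
  (j.+2 < s)%N -> tensor_weak c d a b 1 0 (Lop_der j F) (Lop_der j.+1 F).
Proof.
move=> tF js; apply: tensor_weak_D.
  apply: tensor_weak_D.
    apply: tensor_weak_D; first by apply: tF; lia.
    by apply: (leibniz_tensor_weak cd j0) => k kj; apply: tF; lia.
  by apply: (leibniz_tensor_weak cd j1) => k kj; apply: tF; lia.
by apply: (leibniz_tensor_weak cd j2) => k kj; apply: tF; lia.
Qed.

Lemma Lop_der_tensor_weak_n s j F : (forall i k, (i + k < s)%N -> tensor_weak c d a b 1 0 (F i k) (F i.+1 k)) ->
  (forall i k, (i + k <= 2)%N -> L2fun2 O (F i k)) ->
  (j.+2 <= s)%N -> tensor_weak c d a b j 0 (Lop_der 0 F) (Lop_der j F).
Proof.
move=> tF LF; elim: j => [|j IH] js.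
  by apply: tensor_weak_refl; apply: Lop_der_L2.
have := tensor_weak_comp (IH (ltnW js)) (Lop_der_tensor_weak tF js).
by rewrite addn1 addn0.
Qed.

Lemma op_L2 l F : (forall i k, (i + k <= l)%N -> L2fun2 O (F i k)) -> L2fun2 O (trace_op l F).
Proof. by case: l => [|[|l]] LF; [exact: LF|exact: LF|exact: Lop_der_L2]. Qed.

Lemma dop_L2 l F : (forall i k, (i + k <= l.+1)%N -> L2fun2 O (F i k)) -> L2fun2 O (trace_dop l F).
Proof. by case: l => [|[|l]] LF; [exact: LF|exact: LF|exact: Lop_der_L2]. Qed.

Lemma pdf_L2 q i k : L2fun2 O (pdf q i k). Proof. exact: L2_ev. Qed.

End Box.

Variables (B0 B1 B2 : nat -> R).

(** The factor 4 comes from squaring the sum of four terms, [4 ^+ j] from [leibniz_norm]; the sums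
    dominate all the bounds of index at most [j]. *)
Definition Lop_der_cst j : R :=
  4 * (1 + 4 ^+ j * ((\sum_(k < j.+1) `|B0 k|) ^+ 2 + (\sum_(k < j.+1) `|B1 k|) ^+ 2 +
    (\sum_(k < j.+1) `|B2 k|) ^+ 2)).

Lemma Lop_der_cst_ge1 j : 1 <= Lop_der_cst j.
Proof.
rewrite /Lop_der_cst.
set X := 4 ^+ j * _; have : 0 <= X by rewrite mulr_ge0 ?exprn_ge0 ?addr_ge0 ?sqr_ge0.
by lra.
Qed.

Lemma Lop_der_norm c d a b j F M : c < d ->
  jet c d a b B0 K0 -> jet c d a b B1 K1 -> jet c d a b B2 K2 ->
  (forall i k, (i + k <= j.+2)%N -> L2fun2 (obox c d a b) (F i k)) ->
  (forall i k, (i + k <= j.+2)%N -> int2 (obox c d a b) (fun p => F i k p ^+ 2) <= M) ->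
  int2 (obox c d a b) (fun p => Lop_der j F p ^+ 2) <= Lop_der_cst j * M.
Proof.
move=> cd j0 j1 j2 LF NF.
set O := obox c d a b; have mO := measurable_obox c d a b.
have La : L2fun2 O (F j.+2 0%N) by apply: LF; lia.
have LFb k : (k <= j)%N -> L2fun2 O (F k 2) by move=> kj; apply: LF; lia.
have LFc k : (k <= j)%N -> L2fun2 O (F k.+1 0%N) by move=> kj; apply: LF; lia.
have LFd k : (k <= j)%N -> L2fun2 O (F k 1%N) by move=> kj; apply: LF; lia.
have Lb := leibniz_L2 j0 LFb; have Lc := leibniz_L2 j1 LFc; have Ld := leibniz_L2 j2 LFd.
have sg (B : nat -> R) : 0 <= \sum_(k < j.+1) `|B k| by rewrite sumr_ge0.
have sb (B : nat -> R) k : (k <= j)%N -> B k <= \sum_(k < j.+1) `|B k| by exact: le_sum_bound.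
have eb := leibniz_norm j0 LFb (sb B0) (sg B0) (M := M) ltac:(by move=> k kj; apply: NF; lia).
have ec := leibniz_norm j1 LFc (sb B1) (sg B1) (M := M) ltac:(by move=> k kj; apply: NF; lia).
have ed := leibniz_norm j2 LFd (sb B2) (sg B2) (M := M) ltac:(by move=> k kj; apply: NF; lia).
have ea : int2 O (fun p => F j.+2 0%N p ^+ 2) <= M by apply: NF; lia.
have h1 := L2_sqD mO (L2_D mO La Lb) (L2_D mO Lc Ld).
have h2 := L2_sqD mO La Lb; have h3 := L2_sqD mO Lc Ld.
have -> : int2 O (fun p => Lop_der j F p ^+ 2) = (\int[mu2 R]_(p in O) (F j.+2 0%N p + leibniz j K0 (fun k => F k 2) p +
  (leibniz j K1 (fun k => F k.+1 0%N) p + leibniz j K2 (fun k => F k 1%N) p)) ^+ 2)%R.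
  by apply: eq_Rintegral => p _; rewrite /Lop_der addrA.
rewrite /int2 in ea eb ec ed.
rewrite /Lop_der_cst.
apply: (le_trans h1).
set s0 := _ ^+ 2 in eb *; set s1 := _ ^+ 2 in ec *; set s2 := _ ^+ 2 in ed *.
set fj := 4 ^+ j in eb ec ed *.
lra.
Qed.

Definition op_cst m : R := 1 + \sum_(j < m.+1) Lop_der_cst j.

Lemma Lop_der_le_op_cst m j : (j <= m)%N -> Lop_der_cst j <= op_cst m.
Proof.
rewrite -ltnS => jm; rewrite /op_cst (bigD1 (Ordinal jm))//= addrCA lerDl addr_ge0//.
by rewrite sumr_ge0// => k _; rewrite (le_trans ler01)// Lop_der_cst_ge1.
Qed.

Lemma op_cst_ge1 m : 1 <= op_cst m.
Proof. by rewrite /op_cst lerDl sumr_ge0// => k _; rewrite (le_trans ler01)// Lop_der_cst_ge1. Qed.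

Lemma op_norm c d a b m l F M : c < d -> (l <= m)%N -> 0 <= M ->
  jet c d a b B0 K0 -> jet c d a b B1 K1 -> jet c d a b B2 K2 ->
  (forall i k, (i + k <= l)%N -> L2fun2 (obox c d a b) (F i k)) ->
  (forall i k, (i + k <= l)%N -> int2 (obox c d a b) (fun p => F i k p ^+ 2) <= M) ->
  int2 (obox c d a b) (fun p => trace_op l F p ^+ 2) <= op_cst m * M.
Proof.
move=> cd lm M0 j0 j1 j2 LF NF.
have c1 := op_cst_ge1 m.
case: l lm LF NF => [|[|l]] lm LF NF.
- by rewrite (le_trans (NF 0%N 0%N _))// ler_peMl.
- by rewrite (le_trans (NF 1%N 0%N _))// ler_peMl.
- apply: (le_trans (Lop_der_norm cd j0 j1 j2 LF NF)).
  by rewrite ler_wpM2r// Lop_der_le_op_cst//; lia.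
Qed.

Lemma dop_norm c d a b m l F M : c < d -> (l <= m)%N -> 0 <= M ->
  jet c d a b B0 K0 -> jet c d a b B1 K1 -> jet c d a b B2 K2 ->
  (forall i k, (i + k <= l.+1)%N -> L2fun2 (obox c d a b) (F i k)) ->
  (forall i k, (i + k <= l.+1)%N -> int2 (obox c d a b) (fun p => F i k p ^+ 2) <= M) ->
  int2 (obox c d a b) (fun p => trace_dop l F p ^+ 2) <= op_cst m * M.
Proof.
move=> cd lm M0 j0 j1 j2 LF NF.
have c1 := op_cst_ge1 m.
case: l lm LF NF => [|[|l]] lm LF NF.
- by rewrite (le_trans (NF 1%N 0%N _))// ler_peMl.
- by rewrite (le_trans (NF 2%N 0%N _))// ler_peMl.
- apply: (le_trans (Lop_der_norm cd j0 j1 j2 LF NF)).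
  by rewrite ler_wpM2r// Lop_der_le_op_cst//; lia.
Qed.

Section Classical.
Variables (c d a b : R).
Hypotheses (j0 : jet c d a b B0 K0) (j1 : jet c d a b B1 K1) (j2 : jet c d a b B2 K2).

Lemma is_derive_pdf q i k x y :
  is_derive x (1 : R) (fun t => pdf q i k (t, y)) (pdf q i.+1 k (x, y)).
Proof. exact: is_derive_ev_x. Qed.

Lemma Lop_der_derive q j x y : cbox c d a b (x, y) ->
  is_derive x (1 : R) (fun t => Lop_der j (pdf q) (t, y)) (Lop_der j.+1 (pdf q) (x, y)).
Proof.
move=> Op; have [_ _ d0] := j0; have [_ _ d1] := j1; have [_ _ d2] := j2.
have e0 := @leibniz_derive R j K0 (fun k => pdf q k 2) x y (fun k => d0 k x y Op) (fun k => is_derive_pdf q k 2 x y).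
have e1 := @leibniz_derive R j K1 (fun k => pdf q k.+1 0%N) x y (fun k => d1 k x y Op) (fun k => is_derive_pdf q k.+1 0 x y).
have e2 := @leibniz_derive R j K2 (fun k => pdf q k 1%N) x y (fun k => d2 k x y Op) (fun k => is_derive_pdf q k 1 x y).
have e3 := is_derive_pdf q j.+2 0 x y.
by rewrite /Lop_der; apply: is_derive_eq.
Qed.

Lemma op_derive q l x y : cbox c d a b (x, y) ->
  is_derive x (1 : R) (fun t => trace_op l (pdf q) (t, y)) (trace_dop l (pdf q) (x, y)).
Proof.
by case: l => [|[|l]] Op; [exact: is_derive_pdf|exact: is_derive_pdf|exact: Lop_der_derive].
Qed.

Lemma dop_continuous q l x y : cbox c d a b (x, y) ->
  {for x, continuous (fun t => trace_dop l (pdf q) (t, y))}.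
Proof.
move=> Op; case: l => [|[|l]].
- exact: is_derive_cont (is_derive_pdf q 1 0 x y).
- exact: is_derive_cont (is_derive_pdf q 2 0 x y).
- exact: is_derive_cont (Lop_der_derive q l.+1 Op).
Qed.

Definition low_cst j : R := (j.+2)`!%:R * 2 ^+ j *
  (\sum_(k < j.+1) `|B0 k| + \sum_(k < j.+1) `|B1 k| + \sum_(k < j.+1) `|B2 k|).

(** This is the triangular structure: at [eta = 0] the term with [j.+2] derivatives in [eta]
    isolates the coefficient of index [j.+2], and every other term involves [r] derivatives in [xi]
    of a coefficient of smaller index [k], with [k + r <= l]. The last inequality is what later
    balances the powers of [h]. *)
Lemma op_leading q l y M : cbox c d a b (0, y) -> 0 <= M ->
  (forall k r, (k < l)%N -> (k + r <= l)%N -> `|((q`_k)^`(r)).[y]| <= M) ->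
  `|trace_op l (pdf q) (0, y) - l`!%:R * (q`_l).[y]| <= (\sum_(j < l) `|low_cst j|) * M.
Proof.
move=> Op M0 HM; case: l HM => [|[|j]] HM.
- by rewrite /= pdf0 subrr normr0 big_ord0 mul0r.
- by rewrite /= pdf0 subrr normr0 mulr_ge0// sumr_ge0.
have [_ b0 _] := j0; have [_ b1 _] := j1; have [_ b2 _] := j2.
have sg (B : nat -> R) : 0 <= \sum_(k < j.+1) `|B k| by rewrite sumr_ge0.
have fM k r i : (k <= j.+1)%N -> (k + r <= j.+2)%N -> (i <= j.+2)%N ->
    `|i`!%:R * ((q`_k)^`(r)).[y]| <= (j.+2)`!%:R * M.
  move=> kj krj ij; rewrite normrM normr_nat; apply: ler_pM => //.
    by rewrite ler_nat leq_fact_mono.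
  exact: HM.
have FM0 : 0 <= (j.+2)`!%:R * M by rewrite mulr_ge0.
have f0 k : (k <= j)%N -> `|pdf q k 2 (0, y)| <= (j.+2)`!%:R * M.
  by move=> kj; rewrite pdf0; apply: fM; lia.
have e0 := @leibniz_bound R j K0 (fun k => pdf q k 2) (0, y) _ _ (sg B0) FM0
  (fun k kj => le_trans (b0 k _ Op) (le_sum_bound B0 kj)) f0.
have f1 k : (k <= j)%N -> `|pdf q k.+1 0%N (0, y)| <= (j.+2)`!%:R * M.
  by move=> kj; rewrite pdf0; apply: fM; lia.
have e1 := @leibniz_bound R j K1 (fun k => pdf q k.+1 0%N) (0, y) _ _ (sg B1) FM0
  (fun k kj => le_trans (b1 k _ Op) (le_sum_bound B1 kj)) f1.
have f2 k : (k <= j)%N -> `|pdf q k 1%N (0, y)| <= (j.+2)`!%:R * M.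
  by move=> kj; rewrite pdf0; apply: fM; lia.
have e2 := @leibniz_bound R j K2 (fun k => pdf q k 1%N) (0, y) _ _ (sg B2) FM0
  (fun k kj => le_trans (b2 k _ Op) (le_sum_bound B2 kj)) f2.
rewrite /= /Lop_der [pdf q j.+2 0 _]pdf0.
rewrite (_ : ?[x] + _ + _ + _ - ?x = leibniz j K0 (fun k => pdf q k 2) (0, y) +
   leibniz j K1 (fun k => pdf q k.+1 0%N) (0, y) + leibniz j K2 (fun k => pdf q k 1%N) (0, y)); last by rewrite derivn0; ring.
apply: (@le_trans _ _ (low_cst j * M)).
  apply: (le_trans (ler_normD _ _)); rewrite /low_cst.
  apply: (@le_trans _ _ (2 ^+ j * ((\sum_(k < j.+1) `|B0 k|) * ((j.+2)`!%:R * M)) +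
    2 ^+ j * ((\sum_(k < j.+1) `|B1 k|) * ((j.+2)`!%:R * M)) +
    2 ^+ j * ((\sum_(k < j.+1) `|B2 k|) * ((j.+2)`!%:R * M)))).
    apply: lerD e2; apply: (le_trans (ler_normD _ _)); exact: lerD.
  by rewrite le_eqVlt; apply/orP; left; apply/eqP; ring.
apply: ler_wpM2r => //.
rewrite !big_ord_recr /= addrAC (le_trans (ler_norm _))// lerDr addr_ge0// sumr_ge0//.
Qed.

Lemma op_low q l y : cbox c d a b (0, y) ->
  (forall k, (k < l)%N -> q`_k = 0) -> trace_op l (pdf q) (0, y) = l`!%:R * (q`_l).[y].
Proof.
move=> Op q0; apply/eqP; rewrite -subr_eq0 -normr_le0.
have := @op_leading q l y 0 Op (lexx _); rewrite mulr0; apply => k r kl _.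
by rewrite q0// derivn_poly0 ?size_poly0// horner0 normr0.
Qed.

End Classical.

End Operators.

(** * Moments on the interface and membership in the discrete space *)

Section Interface.
Context (R : realType).
Variables (K0 K1 K2 : nat -> R * R -> R) (B0 B1 B2 : nat -> R).
Variables (h a b : R).
Hypotheses (h0 : 0 < h) (ab : a < b).
Hypotheses (j0 : jet (- h) h a b B0 K0) (j1 : jet (- h) h a b B1 K1)
  (j2 : jet (- h) h a b B2 K2).
Implicit Types (q : {poly {poly R}}) (v : {poly R}).
Let O : set (plane R) := obox (- h) h a b.
Let op := trace_op K0 K1 K2.
Let lop := Lop_der K0 K1 K2.
Let dop := trace_dop K0 K1 K2.

Lemma slice0_measurable (G : R * R -> R) : measurable_fun O (G : plane R -> R) ->
  measurable_fun (`]a, b[ : set (measurableTypeR R)) (fun y : measurableTypeR R => G (0, y)).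
Proof.
move=> mG; apply: (measurable_comp (F := O) _ _ mG); first exact: measurable_obox.
  by move=> _ [y yab <-]; split => //=; rewrite in_itv /= oppr_lt0 h0.
by apply: measurable_funTS; exact: measurable_pair1.
Qed.

Lemma poly_bounded (p : {poly R}) : exists M, 0 <= M /\ forall y, a <= y <= b -> `|p.[y]| <= M.
Proof.
apply: within_bounded; first exact: ltW.
apply: continuous_subspaceT; exact: continuous_horner.
Qed.

Lemma inbox0 y : a <= y <= b -> cbox (- h) h a b (0, y).
Proof. by move=> yab; split; rewrite /= in_itv //= oppr_le0 !ltW. Qed.

Lemma op_bounded q l : exists M, 0 <= M /\ forall y, a <= y <= b -> `|op l (pdf q) (0, y)| <= M.
Proof.
have [M HM] := choice (fun kr : nat * nat => poly_bounded ((q`_kr.1)^`(kr.2))).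
pose N := \sum_(k < l.+1) \sum_(r < l.+1) M (k : nat, r : nat).
have N0 : 0 <= N by apply: sumr_ge0 => k _; apply: sumr_ge0 => r _; case: (HM (k : nat, r : nat)).
have bN k r y : (k < l.+1)%N -> (r < l.+1)%N -> a <= y <= b -> `|((q`_k)^`(r)).[y]| <= N.
  move=> kl rl yab; have [_ H] := HM (k, r); apply: (le_trans (H y yab)).
  rewrite /N (bigD1 (Ordinal kl))//= (bigD1 (Ordinal rl))//= -addrA lerDl addr_ge0//.
    by apply: sumr_ge0 => r' _; case: (HM (k, r' : nat)).
  by apply: sumr_ge0 => k' _; apply: sumr_ge0 => r' _; case: (HM (k' : nat, r' : nat)).
exists ((\sum_(j < l) `|low_cst B0 B1 B2 j|) * N + l`!%:R * N); split.
  by rewrite addr_ge0// mulr_ge0// sumr_ge0.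
move=> y yab; rewrite -[op _ _ _](subrK (l`!%:R * (q`_l).[y])).
apply: (le_trans (ler_normD _ _)); apply: lerD.
  apply: (op_leading j0 j1 j2 (inbox0 yab) N0) => k r kl krl; apply: bN => //; lia.
rewrite normrM normr_nat; apply: ler_wpM2l => //.
by have := bN l 0%N y (ltnSn _) isT yab; rewrite derivn0.
Qed.

Lemma op_measurable q l : measurable_fun (`]a, b[ : set (measurableTypeR R))
  (fun y : measurableTypeR R => op l (pdf q) (0, y)).
Proof.
apply: slice0_measurable.
have cd : - h < h by rewrite (lt_trans _ h0)// oppr_lt0.
have LF i k : (i + k <= l)%N -> L2fun2 O (pdf q i k) by move=> _; exact: pdf_L2.
by have [] := op_L2 cd ab j0 j1 j2 LF.
Qed.

(** Jets are measurable on open boxes, whereas the jump conditions integrate over closed intervals;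
    the two end points are measurable singletons. *)
Lemma closed_integrable (f : R -> R) (M : R) :
  measurable_fun (`]a, b[ : set (measurableTypeR R)) (f : measurableTypeR R -> R) ->
  (forall y, a <= y <= b -> `|f y| <= M) -> (mu1 R).-integrable `[a, b] (EFin \o f).
Proof.
move=> mf fM; apply: measurable_bounded_integrable => //.
- exact: mu1_itv_cc.
- rewrite (_ : `[a, b]%classic = `]a, b[%classic `|` [set a] `|` [set b]).
    have m1 x : measurable_fun ([set x] : set (measurableTypeR R)) (f : measurableTypeR R -> R).
      exact: measurable_fun_set1.
    have ms x : measurable ([set x] : set (measurableTypeR R)) by exact: measurable_set1.
    apply/measurable_funU => //; first by apply: measurableU.
    by split=> //; apply/measurable_funU.
  apply/seteqP; split=> x /=; rewrite !in_itv /=.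
    move=> /andP[ax xb]; have [->|xa] := eqVneq x a; first by left; right.
    have [->|xb'] := eqVneq x b; first by right.
    by left; left; rewrite !lt_def xa ax eq_sym xb' xb.
  by move=> [[/andP[/ltW -> /ltW ->]|->]|->]//; rewrite lexx ltW.
exists M; split; first by rewrite num_real.
by move=> x Mx y /=; rewrite in_itv /= => yab; rewrite (le_trans (fM y yab))// ltW.
Qed.

Definition moment l q v : R := (\int[mu1 R]_(y in `]a, b[) (op l (pdf q) (0, y) * v.[y]))%R.

Lemma moment_integrable l q v :
  (mu1 R).-integrable `[a, b] (EFin \o (fun y => op l (pdf q) (0, y) * v.[y])).
Proof.
have [M [M0 HM]] := op_bounded q l; have [N [N0 HN]] := poly_bounded v.
apply: (@closed_integrable _ (M * N)).
  apply: measurable_funM; first exact: op_measurable.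
  by have [] := poly_L2_1 a b v.
by move=> y yab; rewrite normrM ler_pM ?HM ?HN.
Qed.

Lemma moment_integrable_oo l q v :
  (mu1 R).-integrable `]a, b[ (EFin \o (fun y => op l (pdf q) (0, y) * v.[y])).
Proof.
by apply: (integrableS _ _ _ (moment_integrable l q v)) => //; exact: subset_itv_oo_cc.
Qed.

Lemma int1_moment l q q' v (k k' : R) :
  int1 a b (fun y => (k * op l (pdf q) (0, y) - k' * op l (pdf q') (0, y)) * v.[y]) =
  k * moment l q v - k' * moment l q' v.
Proof.
have i1 := moment_integrable l q v; have i2 := moment_integrable l q' v.
rewrite /int1 (@eq_Rintegral _ _ _ _ _ (fun y : measurableTypeR R =>
  k * (op l (pdf q) (0, y) * v.[y]) - k' * (op l (pdf q') (0, y) * v.[y]))); last first.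
  by move=> y _; ring.
rewrite RintegralB//; [|exact: (integrable_realZ (mitvR _) _ i1)|exact: (integrable_realZ (mitvR _) _ i2)].
rewrite !RintegralZl//.
by rewrite /moment !(int1_oo_cc i1) (int1_oo_cc i2).
Qed.

Lemma moment_D l q q' v : moment l (q + q') v = moment l q v + moment l q' v.
Proof.
have i1 := moment_integrable_oo l q v; have i2 := moment_integrable_oo l q' v.
rewrite /moment -RintegralD//; apply: eq_Rintegral => y _; rewrite -mulrDl -opD; congr (_ * _).
congr (trace_op _ _ _ _ _ _); apply/funext => i; apply/funext => k; apply/funext => p.
by rewrite /pdf pdD evD.
Qed.

Lemma moment_B l q q' v : moment l (q - q') v = moment l q v - moment l q' v.
Proof.
by apply/eqP; rewrite eq_sym subr_eq -moment_D subrK.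
Qed.

Variables (g : R -> R * R).
Hypotheses (e0 : K0 0%N = J0 g) (e1 : K1 0%N = J1 g) (e2 : K2 0%N = J2 g).

Lemma Lop_der0 (D : nat -> nat -> (R * R -> R) -> (R * R -> R)) f :
  Lop g D f = lop 0 (fun i k => D i k f).
Proof. by apply/funext => p; rewrite /Lop /lop /Lop_der /= e0 e1 e2. Qed.

Lemma pder_Lop q j y : a <= y <= b ->
  pder j 0 (Lop g (@pder R) (ev q)) (0, y) = op j.+2 (pdf q) (0, y).
Proof.
move=> yab; rewrite Lop_der0.
have -> : (fun i k => pder i k (ev q)) = pdf q.
  by apply/funext => i; apply/funext => k; rewrite pder_ev.
have := @iter_Dx_jet R (fun n => lop n (pdf q)) h y h0.
move=> /(_ _ j 0); rewrite normr0; apply => // k x xh.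
apply: (Lop_der_derive j0 j1 j2); split; rewrite /= in_itv //=.
by move: xh; rewrite ltr_norml => /andP[/ltW -> /ltW ->].
Qed.

(** The jump of the function itself carries no [beta], all the others do. *)
Definition jump_weight l (bb : R) : R := if l is 0%N then 1 else bb.

Lemma Vspace_pair m qp qm bp bm : inQ m.+1 qp -> inQ m.+1 qm ->
  (forall l v, (l <= m)%N -> (size v <= m.+1)%N -> jump_weight l bp * moment l qp v = jump_weight l bm * moment l qm v) ->
  (1 <= m)%N ->
  Vspace m g h a b bp bm (fun p => if 0 <= p.1 then ev qp p else ev qm p).
Proof.
move=> Qp Qm HL m1; have [cp Ep] := ev_Qpoly Qp; have [cm Em] := ev_Qpoly Qm.
exists cp, cm; rewrite Ep Em; split.
- by move=> p _ ->.
- by move=> p _ p0; rewrite leNgt p0.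
move=> v sv; split.
- have := int1_moment 0 qp qm v 1 1; have := HL 0%N v isT sv; rewrite /jump_weight => ->; rewrite subrr => E; rewrite -[RHS]E.
  by apply: eq_Rintegral => y _; rewrite !mul1r.
- have := int1_moment 1 qp qm v bp bm; have := HL 1%N v m1 sv; rewrite /jump_weight => ->; rewrite subrr => E; rewrite -[RHS]E.
  by apply: eq_Rintegral => y _; rewrite !pder_ev.
- move=> j jm; have := int1_moment j.+2 qp qm v bp bm; have := HL j.+2 v jm sv; rewrite /jump_weight => ->; rewrite subrr => E; rewrite -[RHS]E.
  by apply: eq_Rintegral => y; rewrite inE /= in_itv /= => yab; rewrite !pder_Lop.
Qed.

End Interface.

Ltac nat_lia := repeat match goal with H : ?T |- _ =>
  lazymatch T with nat => fail | is_true (leq _ _) => fail | @eq nat _ _ => fail | _ => clear H end end; lia.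

(** * The approximation error and its moments on one side *)

Section SideEstimate.
Context (R : realType).

(** Since [h] is bounded by [e], surplus powers of [h] are absorbed in a constant; [M] is any bound
    on the surplus. *)
Lemma pow_le (h e : R) n k M : 0 <= h -> h <= e -> (k <= n)%N -> (n <= k + M)%N ->
  h ^+ n <= (1 + e) ^+ M * h ^+ k.
Proof.
move=> h0 he kn nM; rewrite -(subnK kn) exprD; apply: ler_wpM2r; first exact: exprn_ge0.
have e1 : 1 <= 1 + e by rewrite lerDl (le_trans h0).
apply: (@le_trans _ _ ((1 + e) ^+ (n - k))); last by apply: ler_weXn2l => //; lia.
by rewrite lerXn2r ?nnegrE ?(le_trans h0) ?lerDr// ?(le_trans ler01 e1)//; lra.
Qed.

(* The function whose trace enters the l-th jump condition on [u]. *)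
Definition trace_rel (g : R -> R * R) (O : set (R * R)) (u : R * R -> R) l (w : R * R -> R) : Prop :=
  match l with
  | 0 => w = u
  | 1 => w = wder O 1 0 u
  | j.+2 => weak_derivative O j 0 (Lop g (wder O) u) w
  end.

Theorem side_estimate m (L e : R) (B0 B1 B2 : nat -> R) : exists C, 0 <= C /\
  forall K0 K1 K2 s h a b u g, 0 < h -> h <= e -> a < b -> b - a <= L * h ->
  jet (- h) h a b B0 K0 -> jet (- h) h a b B1 K1 -> jet (- h) h a b B2 K2 ->
  K0 0%N = J0 g -> K1 0%N = J1 g -> K2 0%N = J2 g ->
  let O := side s h a b in let S := seminorm_sq m.+1 O u in
  sobolev m.+1 O u ->
  exists q, [/\ inQ m.+1 q,
    forall i j, (i + j <= m.+1)%N ->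
      tensor_weak (if s then 0 else - h) (if s then h else 0) a b i j (fun p => u p - ev q p)
       (fun p => wder O i j u p - ev (pd i j q) p) /\
      int2 O (fun p => (wder O i j u p - ev (pd i j q) p) ^+ 2) <=
        C * h ^+ ((m.+1 - (i + j)).*2) * S &
    forall l w T v, (l <= m)%N -> trace_rel g O u l w -> side_trace a b O w T ->
      ((\int[mu1 R]_(y in `]a, b[) (T y * v.[y]))%R - moment K0 K1 K2 a b l q v) ^+ 2 <=
        C * h ^+ ((m - l).*2.+1) * S * ipoly a b (v ^+ 2)].
Proof.
have [Cb [Cb0 HB]] := bramble m L.
pose E := (1 + e) ^+ (m.+1).*2; pose oc := op_cst B0 B1 B2 m.
have oc1 : 1 <= oc by exact: op_cst_ge1.
exists (Cb + 4 * oc * (Cb * `|E|)); split.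
  by rewrite addr_ge0// !mulr_ge0// (le_trans ler01 oc1).
move=> K0 K1 K2 s h a b u g h0 he ab baL jj0 jj1 jj2 e0 e1 e2 O S Su.
set c : R := if s then 0 else - h; set d : R := if s then h else 0.
have OE : O = obox c d a b by exact: sideE.
have mO := measurable_obox c d a b.
have cd : c < d by rewrite /c /d; case: (s); rewrite ?oppr_lt0.
have dc : d - c <= h by rewrite /c /d; case: (s); rewrite ?subr0// sub0r opprK.
have hc : - h <= c by rewrite /c; case: (s); rewrite // oppr_le0 ltW.
have dh : d <= h by rewrite /d; case: (s); rewrite // ltW.
have e00 : 0 <= e by rewrite (le_trans (ltW h0)).
have E1 : 1 <= E by rewrite /E exprn_ege1// lerDl.
have S0 : 0 <= S by rewrite /S OE; exact: seminorm_ge0.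
have j0 := jet_sub hc dh (lexx a) (lexx b) jj0.
have j1 := jet_sub hc dh (lexx a) (lexx b) jj1.
have j2 := jet_sub hc dh (lexx a) (lexx b) jj2.
have [|q [Qq Hq]] := HB c d a b h u cd ab dc baL; first by rewrite -OE.
rewrite -OE in Hq.
have EE : `|E| = E by rewrite ger0_norm// (le_trans ler01 E1).
exists q; split=> //.
  move=> i j ij; have [h1 h2] := Hq i j ij; split=> //; apply: (le_trans h2).
  rewrite -!mulrA; apply: ler_wpM2r; first by rewrite mulr_ge0// exprn_ge0// ltW.
  by rewrite lerDl !mulr_ge0// (le_trans ler01 oc1).
move=> l w T v lm rel tr.
pose W i k := wder O i k u; pose Z i k p := W i k p - pdf q i k p.
have Su' : sobolev m.+1 (obox c d a b) u by rewrite -OE.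
have LW i k : (i + k <= m.+1)%N -> L2fun2 (obox c d a b) (W i k).
  by move=> ik; have [_] := wder_tensor_weak Su' ik; rewrite -OE.
have twW i k : (i + k < m.+1)%N -> tensor_weak c d a b 1 0 (W i k) (W i.+1 k).
  move=> ik; have := @wder_tensor_weak_step R c d a b m.+1 i k 1 0 u Su' ltac:(nat_lia).
  by rewrite -OE addn1 addn0.
have LZ i k : (i + k <= m.+1)%N -> L2fun2 (obox c d a b) (Z i k).
  by move=> ik; apply: (L2_B mO (LW _ _ ik)); exact: pdf_L2.
have NZ n i k : (i + k <= n)%N -> (n <= m.+1)%N ->
    int2 (obox c d a b) (fun p => Z i k p ^+ 2) <= Cb * E * S * h ^+ ((m.+1 - n).*2).
  move=> ikn nm; have [_] := Hq i k (leq_trans ikn nm); rewrite {1}OE => /le_trans; apply.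
  rewrite -/S (_ : Cb * E * S * _ = Cb * (E * h ^+ (m.+1 - n).*2) * S); last by ring.
  apply: ler_wpM2r => //; apply: ler_wpM2l => //.
  by apply: pow_le => //; [exact: ltW|nat_lia|nat_lia].
have OL F : (forall i k, (i + k <= m.+1)%N -> L2fun2 (obox c d a b) (F i k)) ->
    L2fun2 (obox c d a b) (trace_op K0 K1 K2 l F) /\ L2fun2 (obox c d a b) (trace_dop K0 K1 K2 l F).
  move=> LF; split; [apply: (op_L2 cd ab j0 j1 j2)|apply: (dop_L2 cd ab j0 j1 j2)] => i k ik; apply: LF; nat_lia.
have [LoW LdW] := OL W LW.
have [LoZ LdZ] := OL Z LZ.
have [LoQ LdQ] := OL (pdf q) (fun i k _ => pdf_L2 c d a b q i k).
(* The function [w] whose trace is taken and the explicit expression [trace_op l W] are weak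
   derivatives of the same order of a common function. Uniqueness identifies them almost everywhere,
   and then also their [eta]-derivatives. *)
have [base [i0 [t1 t2]]] : exists base i0, tensor_weak c d a b i0 0 base w /\ tensor_weak c d a b i0 0 base (trace_op K0 K1 K2 l W).
  move: lm rel {OL LoW LdW LoZ LdZ LoQ LdQ}; case: l => [|[|j]] lm rel.
  - exists u, 0%N; rewrite rel; have t := wder_tensor_weak Su' (i := 0) (j := 0) isT; split.
      by apply: tensor_weak_refl; case: t.
    by rewrite -OE in t.
  - by exists u, 1%N; rewrite rel; have t := wder_tensor_weak Su' (i := 1) (j := 0) isT; rewrite -OE in t.
  - exists (Lop_der K0 K1 K2 0 W), j; split.
      by apply: weak_tensor_weak; rewrite -OE; move: rel; rewrite /trace_rel (Lop_der0 e0 e1 e2).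
    apply: (Lop_der_tensor_weak_n cd ab j0 j1 j2 twW _ (leqW lm)) => i k ik; apply: LW; nat_lia.
have t3 : tensor_weak c d a b 1 0 (trace_op K0 K1 K2 l W) (trace_dop K0 K1 K2 l W).
  move: lm {rel OL LoW LdW LoZ LdZ LoQ LdQ t2}; case: l => [|[|j]] lm.
  - exact: twW.
  - by apply: twW; nat_lia.
  - by apply: (Lop_der_tensor_weak cd ab j0 j1 j2 twW); nat_lia.
have [Sw _ _] := tr; have Sw' : sobolev 1 (obox c d a b) w by rewrite -OE.
have u0 := tensor_weak_comp t1 (wder_tensor_weak Sw' (i := 0) (j := 0) isT).
have u1 := tensor_weak_comp t1 (wder_tensor_weak Sw' (i := 1) (j := 0) isT).
have a1 := tensor_weak_unique u1 (tensor_weak_comp t2 t3).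
rewrite !addn0 in u0; have a0 := tensor_weak_unique u0 t2.
rewrite -OE in a0 a1.
have Lw0 : L2fun2 (obox c d a b) (wder O 0 0 w) by have [_] := u0; rewrite OE.
have Lw1 : L2fun2 (obox c d a b) (wder O 1 0 w) by have [_] := u1; rewrite OE.
have F1 := trace_formula h0 v tr.
have F2 : moment K0 K1 K2 a b l q v = - side_sign R s * bform s h a b (trace_dop K0 K1 K2 l (pdf q)) (trace_op K0 K1 K2 l (pdf q)) v.
  apply: (bform_trace h0) => //; last exact: (moment_integrable_oo h0 ab jj0 jj1 jj2).
    move=> x y xcd /andP[ya yb]; apply: (op_derive j0 j1 j2).
    by split; rewrite /= in_itv //= !ltW.
  move=> x y xcd /andP[ya yb]; apply: (dop_continuous j0 j1 j2).
  by split; rewrite /= in_itv //= !ltW.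
have F3 : bform s h a b (wder O 1 0 w) (wder O 0 0 w) v = bform s h a b (trace_dop K0 K1 K2 l W) (trace_op K0 K1 K2 l W) v.
  by apply: (bform_ae h0) => //; rewrite -OE.
rewrite F1 F2 F3 -mulrBr -bformB// exprMn.
rewrite (_ : (- side_sign R s) ^+ 2 = 1) ?mul1r; last by rewrite /side_sign; case: (s); rewrite ?sqrrN expr1n.
rewrite (_ : (fun p => trace_dop _ _ _ _ _ p - _) = trace_dop K0 K1 K2 l Z); last first.
  by apply/funext => p; rewrite -dopB.
rewrite (_ : (fun p => trace_op _ _ _ _ _ p - _) = trace_op K0 K1 K2 l Z); last first.
  by apply/funext => p; rewrite -opB.
apply: (le_trans (bform_bound h0 v LdZ LoZ)).
rewrite -/c -/d.
pose M1 := Cb * E * S * h ^+ (m - l).*2.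
have E0 : 0 <= E := le_trans ler01 E1.
have h2 : 0 <= h ^+ (m - l).*2 by rewrite exprn_ge0// ltW.
have M10 : 0 <= M1 := mulr_ge0 (mulr_ge0 (mulr_ge0 Cb0 E0) S0) h2.
have M0E : Cb * E * S * h ^+ (m.+1 - l).*2 = M1 * h ^+ 2.
  by rewrite /M1 -[RHS]mulrA -exprD; congr (_ * h ^+ _); nat_lia.
have M00 : 0 <= M1 * h ^+ 2 by rewrite mulr_ge0// sqr_ge0.
have N1 : int2 (obox c d a b) (fun p => trace_dop K0 K1 K2 l Z p ^+ 2) <= oc * M1.
  apply: (dop_norm cd lm M10 j0 j1 j2) => i k ik; first by apply: LZ; nat_lia.
  by have := NZ l.+1 i k ik lm; rewrite subSS.
have N0 : int2 (obox c d a b) (fun p => trace_op K0 K1 K2 l Z p ^+ 2) <= oc * (M1 * h ^+ 2).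
  apply: (op_norm cd lm M00 j0 j1 j2) => i k ik; first by apply: LZ; nat_lia.
  by rewrite -M0E; apply: NZ => //; nat_lia.
have V0 := ipoly_sq_ge0 a b v.
rewrite [h ^+ (m - l).*2.+1]exprS [leRHS](_ : _ = (Cb + 4 * oc * (Cb * `|E|)) * h ^+ (m - l).*2 * S * (h * ipoly a b (v ^+ 2))); last by ring.
apply: ler_wpM2r; first by rewrite mulr_ge0// ltW.
(* The term without derivative is smaller by [h ^+ 2], which compensates the squared slope [h ^- 2]
   of the cut-off; both terms have the same size. *)
apply: (@le_trans _ _ (2 * (oc * M1) + 2 * h ^- 2 * (oc * (M1 * h ^+ 2)))).
  apply: lerD; apply: ler_wpM2l => //.
  by rewrite mulr_ge0// invr_ge0 sqr_ge0.
rewrite (_ : 2 * h ^- 2 * (oc * (M1 * h ^+ 2)) = 2 * (oc * M1)); last first.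
  by field; rewrite gt_eqF.
rewrite (_ : _ + _ = 4 * oc * (Cb * E) * h ^+ (m - l).*2 * S); last by rewrite /M1; ring.
rewrite EE; apply: ler_wpM2r => //; apply: ler_wpM2r => //.
by rewrite lerDr.
Qed.

End SideEstimate.

(** * Extension across the interface *)

Section Extension.
Context (R : realType).
Variables (K0 K1 K2 : nat -> R * R -> R) (B0 B1 B2 : nat -> R).
Variables (h a b : R).
Hypotheses (h0 : 0 < h) (ab : a < b).
Hypotheses (j0 : jet (- h) h a b B0 K0) (j1 : jet (- h) h a b B1 K1)
  (j2 : jet (- h) h a b B2 K2).
Implicit Types (q : {poly {poly R}}) (v P : {poly R}).
Let Lam0 := moment K0 K1 K2 a b.
Let op := trace_op K0 K1 K2.

Lemma coefMono P n k : (P *: 'X^n : {poly {poly R}})`_k = if k == n then P else 0.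
Proof. by rewrite coefZ coefXn; case: eqP; rewrite ?mulr1 ?mulr0. Qed.

Lemma moment_mono l n P v : (l <= n)%N ->
  Lam0 l (P *: 'X^n) v = if l == n then n`!%:R * ipoly a b (P * v) else 0.
Proof.
move=> ln; rewrite /Lam0 /moment.
rewrite (@eq_Rintegral _ _ _ _ _ (fun y : measurableTypeR R => if l == n then n`!%:R * (P * v).[y] else 0)); last first.
  move=> y; rewrite inE /= in_itv /= => /andP[/ltW ay /ltW yb].
  have Oy := @inbox0 R h a b h0 y ltac:(by rewrite ay).
  rewrite (op_low j0 j1 j2 Oy); last by move=> k kl; rewrite coefMono ifF//; apply/negbTE; lia.
  rewrite coefMono; case: eqP => [->|_]; first by rewrite hornerM mulrA.
  by rewrite horner0 mulr0 mul0r.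
case: eqP => _; last by rewrite Rintegral_cst// mul0r.
by rewrite RintegralZl//; exact: poly_integrable.
Qed.

(** Coefficients are found in increasing order: adding [P * eta^n] leaves the moments of index below
    [n] unchanged and adds [n!] times the moment of [P] to the [n]-th one, so [P] is the projection
    onto polynomials of degree at most [m] of the defect divided by [n!]. *)
Lemma extend_poly m (r : nat -> R) q : exists p, inQ m.+1 p /\
  forall l v, (l <= m)%N -> (size v <= m.+1)%N -> Lam0 l p v = r l * Lam0 l q v.
Proof.
suff H n : (n <= m.+1)%N -> exists p, inQ m.+1 p /\
    forall l v, (l < n)%N -> (size v <= m.+1)%N -> Lam0 l p v = r l * Lam0 l q v.
  by have [p Hp] := H m.+1 (leqnn _); exists p.
elim: n => [|n IH] nm.
  by exists 0; split; first by split=> [|i]; rewrite ?coef0 size_poly0.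
have [p [[s1 s2] Hp]] := IH (ltnW nm).
pose f y := n`!%:R^-1 * (r n * op n (pdf q) (0, y) - op n (pdf p) (0, y)).
have i1 v := moment_integrable_oo h0 ab j0 j1 j2 n q v.
have i2 v := moment_integrable_oo h0 ab j0 j1 j2 n p v.
have intf v : (mu1 R).-integrable `]a, b[ (EFin \o (fun y => f y * v.[y])) /\
    (\int[mu1 R]_(y in `]a, b[) (f y * v.[y]))%R = n`!%:R^-1 * (r n * Lam0 n q v - Lam0 n p v).
  have I1 := integrable_realZ (mitvR _) (r n) (i1 v).
  have I := integrable_realB (mitvR _) I1 (i2 v).
  have E : (fun y => f y * v.[y]) = (fun y => n`!%:R^-1 * (r n * (op n (pdf q) (0, y) * v.[y]) - op n (pdf p) (0, y) * v.[y])).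
    by apply/funext => y; rewrite /f; ring.
  split; first by rewrite E; exact: (integrable_realZ (mitvR _)).
  rewrite E (@RintegralZl _ _ _ (mu1 R) _ _ _ (mitvR _) I); congr (_ * _).
  rewrite RintegralB//; congr (_ - _).
  by rewrite (@RintegralZl _ _ _ (mu1 R) _ _ _ (mitvR _) (i1 v)).
have [|P [sP HP]] := @poly_projection R m a b f ab.
  by move=> v; case: (intf v).
exists (p + P *: 'X^n); split.
  split=> [|i].
    rewrite (leq_trans (size_polyD _ _))// geq_max s1 (leq_trans (size_scale_leq _ _))//.
    by rewrite size_polyXn.
  rewrite coefD coefMono (leq_trans (size_polyD _ _))// geq_max s2.
  by case: ifP => _; rewrite ?size_poly0.
move=> l v; rewrite ltnS => ln sv.
rewrite [LHS](moment_D h0 ab j0 j1 j2) -/Lam0 moment_mono//; case: eqP => [->|/eqP lnn].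
  rewrite HP//; have [_ ->] := intf v.
  by rewrite mulVKf ?pnatr_eq0 -?lt0n ?fact_gt0// addrC subrK.
by rewrite addr0 -Hp// ltn_neqAle lnn.
Qed.

End Extension.

(** * Solving the triangular system with the right powers of [h] *)

Section Difference.
Context (R : realType).
Implicit Types (q d : {poly {poly R}}) (v P : {poly R}).

(** Forward substitution: the [l]-th moment equals [l!] times the coefficient of index [l], up to a
    remainder controlled by the earlier ones. The induction carries a single constant for all
    earlier indices. *)
Theorem diff_estimate m (L e c0 A : R) (B0 B1 B2 : nat -> R) : 0 < c0 -> 0 <= A -> 0 <= L -> exists C, 0 <= C /\
  forall K0 K1 K2 h a b d S, 0 < h -> h <= e -> a < b -> c0 * h <= b - a -> b - a <= L * h -> 0 <= S ->
  jet (- h) h a b B0 K0 -> jet (- h) h a b B1 K1 -> jet (- h) h a b B2 K2 ->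
  inQ m.+1 d ->
  (forall l v, (l <= m)%N -> (size v <= m.+1)%N ->
    moment K0 K1 K2 a b l d v ^+ 2 <= A * h ^+ ((m - l).*2.+1) * S * ipoly a b (v ^+ 2)) ->
  forall k, (k <= m)%N -> ipoly a b (d`_k ^+ 2) <= C * h ^+ ((m - k).*2.+1) * S.
Proof.
move=> c00 A0 L0; have [Ci [Ci0 HCi]] := inverse1 R m.
suff H n : (n <= m.+1)%N -> exists C, 0 <= C /\
  forall K0 K1 K2 h a b d S, 0 < h -> h <= e -> a < b -> c0 * h <= b - a -> b - a <= L * h -> 0 <= S ->
  jet (- h) h a b B0 K0 -> jet (- h) h a b B1 K1 -> jet (- h) h a b B2 K2 ->
  inQ m.+1 d ->
  (forall l v, (l <= m)%N -> (size v <= m.+1)%N ->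
    moment K0 K1 K2 a b l d v ^+ 2 <= A * h ^+ ((m - l).*2.+1) * S * ipoly a b (v ^+ 2)) ->
  forall k, (k < n)%N -> ipoly a b (d`_k ^+ 2) <= C * h ^+ ((m - k).*2.+1) * S.
  have [C [C0 HC]] := H m.+1 (leqnn _); exists C; split=> //.
elim: n => [|l IH] lm; first by exists 0; split.
have [C [C0 HC]] := IH (ltnW lm).
pose D := (1 + c0^-1) ^+ (m.*2.+1); pose E := (1 + `|e|) ^+ m.*2.
pose C2 := Ci * C * D * E.
pose Lc := \sum_(j < l) `|low_cst B0 B1 B2 j|.
have D0 : 0 <= D by rewrite /D exprn_ge0// addr_ge0// invr_ge0 ltW.
have E0 : 0 <= E by rewrite /E exprn_ge0// addr_ge0.
have C20 : 0 <= C2 := mulr_ge0 (mulr_ge0 (mulr_ge0 Ci0 C0) D0) E0.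
have Lc0 : 0 <= Lc by apply: sumr_ge0.
pose Cn := 2 * (A + L * Lc ^+ 2 * C2).
have Cn0 : 0 <= Cn.
  by apply: mulr_ge0 => //; apply: addr_ge0 => //; apply: mulr_ge0 => //; apply: mulr_ge0 => //; exact: sqr_ge0.
exists (C + Cn); split; first exact: addr_ge0.
move=> K0 K1 K2 h a b d S h0 he ab cab abL S0 j0 j1 j2 Qd HL.
have hn n : 0 <= h ^+ n by rewrite exprn_ge0// ltW.
have HC' := HC K0 K1 K2 h a b d S h0 he ab cab abL S0 j0 j1 j2 Qd HL.
have mono n X Y Z : 0 <= Y -> X <= Y * h ^+ n * S -> X <= (Y + `|Z|) * h ^+ n * S.
  move=> Y0 /le_trans; apply; apply: ler_wpM2r => //; apply: ler_wpM2r => //.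
  by rewrite lerDl.
move=> k; rewrite ltnS leq_eqVlt => /orP[/eqP -> {k}|kl]; last first.
  by rewrite -(ger0_norm Cn0); apply: mono => //; exact: HC'.
rewrite addrC -(ger0_norm C0); apply: mono => //.
have [s1 s2] := Qd; have sl := s2 l.
pose M2 := C2 * h ^+ (m - l).*2 * S.
have M20 : 0 <= M2 by rewrite /M2 mulr_ge0// mulr_ge0.
pose M := Num.sqrt M2.
have M0 : 0 <= M by exact: sqrtr_ge0.
have MM : M ^+ 2 = M2 by rewrite sqr_sqrtr.
(* The inverse inequality gives pointwise bounds at the cost of [2 r + 1] powers of [h], because
   [b - a >= c0 * h]; the exponent left is [2 (m - k - r)], at least [2 (m - l)]. *)
have ptw k r y : (k < l)%N -> (k + r <= l)%N -> a <= y <= b -> `|((d`_k)^`(r)).[y]| <= M.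
  move=> kl krl yab; rewrite -(@ler_pXn2r _ 2)// ?nnegrE// MM real_normK ?num_real//.
  have e1 := HCi (d`_k) r a b y (s2 k) ab yab.
  have e2 := HC' k kl.
  have hr : 0 < h ^+ r.*2.+1 by rewrite exprn_gt0.
  have cr : 0 < c0 ^+ r.*2.+1 by rewrite exprn_gt0.
  have e3 : (c0 * h) ^+ r.*2.+1 <= (b - a) ^+ r.*2.+1.
    by rewrite lerXn2r ?nnegrE// ?subr_ge0 ?(ltW ab)// mulr_ge0 ?ltW.
  set X := _ ^+ 2 in e1 *; have X0 : 0 <= X by exact: sqr_ge0.
  have e4 : (c0 * h) ^+ r.*2.+1 * X <= Ci * (C * h ^+ (m - k).*2.+1 * S).
    apply: (le_trans (ler_wpM2r X0 e3)); apply: (le_trans e1); exact: ler_wpM2l.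
  have hE : h ^+ (m - k).*2.+1 = h ^+ r.*2.+1 * h ^+ (m - k - r).*2.
    by rewrite -exprD; congr (_ ^+ _); nat_lia.
  rewrite hE exprMn in e4.
  have e5 : c0 ^+ r.*2.+1 * X <= Ci * C * h ^+ (m - k - r).*2 * S.
    rewrite -(ler_pM2l hr); apply: le_trans (le_trans _ e4) _.
      by rewrite le_eqVlt; apply/orP; left; apply/eqP; ring.
    by rewrite le_eqVlt; apply/orP; left; apply/eqP; ring.
  have e6 : X <= c0 ^- r.*2.+1 * (Ci * C * h ^+ (m - k - r).*2 * S).
    by rewrite ler_pdivlMl.
  apply: (le_trans e6); rewrite /M2 /C2.
  have e7 : c0 ^- r.*2.+1 <= D.
    rewrite /D -exprVn; apply: (@le_trans _ _ ((1 + c0^-1) ^+ r.*2.+1)).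
      by rewrite lerXn2r ?nnegrE ?addr_ge0 ?invr_ge0 ?(ltW c00)// lerDr.
    apply: ler_weXn2l; last by nat_lia.
    by rewrite lerDl invr_ge0 ltW.
  have e8 : h ^+ (m - k - r).*2 <= E * h ^+ (m - l).*2.
    apply: pow_le => //; [exact: ltW|by rewrite (le_trans he) ?ler_norm|nat_lia|nat_lia].
  have CC : 0 <= Ci * C := mulr_ge0 Ci0 C0.
  apply: (@le_trans _ _ (D * (Ci * C * (E * h ^+ (m - l).*2) * S))); last first.
    by rewrite le_eqVlt; apply/orP; left; apply/eqP; ring.
  have nn : 0 <= Ci * C * h ^+ (m - k - r).*2 * S := mulr_ge0 (mulr_ge0 CC (hn _)) S0.
  apply: (le_trans (ler_wpM2r nn e7)); apply: ler_wpM2l => //.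
  by apply: ler_wpM2r => //; exact: ler_wpM2l.
pose P := d`_l; pose V := ipoly a b (P ^+ 2).
have V0 : 0 <= V by exact: ipoly_sq_ge0.
pose rho y := trace_op K0 K1 K2 l (pdf d) (0, y) - l`!%:R * P.[y].
have mrho : measurable_fun (`]a, b[ : set (measurableTypeR R)) (rho : measurableTypeR R -> R).
  apply: measurable_funB; first exact: (op_measurable h0 ab j0 j1 j2).
  by apply: measurable_funM => //; have [] := poly_L2_1 a b P.
have rhoM y : `]a, b[%classic y -> `|rho y| <= Lc * M.
  rewrite /= in_itv /= => /andP[/ltW ay /ltW yb].
  have yab : a <= y <= b by rewrite ay.
  apply: (op_leading j0 j1 j2 (inbox0 h0 yab) M0) => k r kl krl; exact: ptw.
have Lrho : L2 (mu1 R) `]a, b[ rho.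
  by apply: (@L2_bounded _ _ _ (mu1 R) _ (mitvR _) (Lc * M)) => //; exact: mu1_itv_oo.
have LP := poly_L2_1 a b P.
have Nrho : (\int[mu1 R]_(y in `]a, b[) rho y ^+ 2)%R <= L * h * (Lc ^+ 2 * M2).
  apply: (@le_trans _ _ (\int[mu1 R]_(y in `]a, b[) (Lc ^+ 2 * M2))%R).
    apply: le_Rintegral => //; first by case: Lrho.
      have ic := poly_integrable a b (Lc ^+ 2 * M2)%:P.
      by apply: eq_integrable ic => // y _ /=; rewrite hornerC.
    move=> y yab; rewrite -MM -exprMn -[leLHS]real_normK ?num_real//.
    by rewrite lerXn2r ?nnegrE// ?mulr_ge0// rhoM.
  rewrite Rintegral_cst// (fine_mu1_oo (ltW ab)) [leLHS]mulrC; apply: ler_wpM2r => //.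
  by apply: mulr_ge0 => //; exact: sqr_ge0.
(* The coefficient [P] has degree at most [m], hence is an admissible test polynomial for its own
   equation. *)
have EL : moment K0 K1 K2 a b l d P = l`!%:R * V + (\int[mu1 R]_(y in `]a, b[) (rho y * P.[y]))%R.
  rewrite /V -ipolyZ /ipoly -RintegralD//; [|exact: poly_integrable|exact: (L2_mul (mitvR _) Lrho LP)].
  by apply: eq_Rintegral => y _; rewrite hornerZ horner_exp /rho; ring.
have eL := HL l P lm sl; rewrite EL -/V in eL.
have eR := L2_CS (mitvR _) Lrho LP.
have EV : (\int[mu1 R]_(y in `]a, b[) P.[y] ^+ 2)%R = V.
  by apply: eq_Rintegral => y _; rewrite horner_exp.
rewrite EV in eR.
set I := (\int[mu1 R]_(y in _) (rho y * P.[y]))%R in eL eR.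
have f1 : 1 <= (l`!%:R : R) by rewrite ler1n fact_gt0.
(* Each term carries one factor [V], which is divided out at the end; integrating the pointwise
   bound of [rho] over a length at most [L * h] supplies the odd power of [h]. *)
have key : V ^+ 2 <= Cn * h ^+ (m - l).*2.+1 * S * V.
  apply: (@le_trans _ _ ((l`!%:R * V) ^+ 2)).
    by rewrite lerXn2r ?nnegrE ?mulr_ge0// ler_peMl.
  apply: (@le_trans _ _ (2 * ((l`!%:R * V + I) ^+ 2) + 2 * I ^+ 2)).
    have := sqr_ge0 (l`!%:R * V + I + I); set w := l`!%:R * V; lra.
  apply: (@le_trans _ _ (2 * (A * h ^+ (m - l).*2.+1 * S * V) + 2 * (L * h * (Lc ^+ 2 * M2) * V))).
    apply: lerD; apply: ler_wpM2l => //; apply: (le_trans eR); exact: ler_wpM2r.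
  by rewrite le_eqVlt; apply/orP; left; apply/eqP; rewrite /Cn /M2 exprS; ring.
have [Vz|Vn] := eqVneq V 0.
  by rewrite -/P -/V Vz mulr_ge0// mulr_ge0.
have Vp : 0 < V by rewrite lt_def Vn.
by rewrite -(ler_pM2r Vp) -expr2.
Qed.

Lemma ev_norm_le m (C h a b S : R) s d : 0 < h -> a < b -> 0 <= S -> (size d <= m.+1)%N ->
  (forall k, (k <= m)%N -> ipoly a b (d`_k ^+ 2) <= C * h ^+ ((m - k).*2.+1) * S) ->
  int2 (side s h a b) (fun p => ev d p ^+ 2) <= m.+1%:R ^+ 2 * C * h ^+ (m.+1).*2 * S.
Proof.
move=> h0 ab S0 sd HV; rewrite sideE.
set c : R := if s then 0 else - h; set d' : R := if s then h else 0.
have cd : c < d' by rewrite /c /d'; case: (s); rewrite ?oppr_lt0.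
have dc : d' - c = h by rewrite /c /d'; case: (s); rewrite ?subr0// sub0r opprK.
have c0 : c <= 0 by rewrite /c; case: (s); rewrite // oppr_le0 ltW.
have d0 : 0 <= d' by rewrite /d'; case: (s); rewrite // ltW.
apply: (le_trans (@val_est R c d' a b cd c0 d0 m.+1 d sd)); rewrite dc.
set H := h ^+ (m.+1).*2.
rewrite (_ : m.+1%:R ^+ 2 * C * H * S = m.+1%:R * (m.+1%:R * (C * H * S))); last by ring.
apply: ler_wpM2l => //.
rewrite mulr_natl -[X in _ *+ X]card_ord -sumr_const; apply: ler_sum => k _.
have kk : (k <= m)%N by rewrite -ltnS ltn_ord.
apply: (@le_trans _ _ (h ^+ k.*2.+1 * (C * h ^+ (m - k).*2.+1 * S))).
  by apply: ler_wpM2l; [rewrite exprn_ge0// ltW|exact: HV].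
have -> : H = h ^+ k.*2.+1 * h ^+ (m - k).*2.+1.
  by rewrite /H -exprD; congr (_ ^+ _); nat_lia.
by rewrite le_eqVlt; apply/orP; left; apply/eqP; ring.
Qed.

End Difference.

(** * The two sides of the fictitious element *)

Section Split.
Context (R : realType).

Lemma ae_fst (P : R -> Prop) : {ae (mu1 R), forall y, P y} ->
  {ae (mu2 R), forall p : plane R, P p.1}.
Proof.
move=> [N [mN N0 sub]]; exists (N `*` setT); split.
- exact: measurableX.
- rewrite product_measure1E//; transitivity (0 * (mu1 R) setT)%E; last exact: mul0e.
  by congr (_ * _)%E; exact: N0.
- by move=> p np; split => //; apply: sub.
Qed.

Lemma ae_neq (x : R) : {ae (mu1 R), forall y, y <> x}.
Proof.
exists [set x]; split; first exact: measurable_set1.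
  exact: lebesgue_measure_set1.
by move=> y /contrapT ->.
Qed.

Variables (h a b : R).
Hypotheses (h0 : 0 < h) (ab : a < b).
Let K : set (plane R) := Kfict h a b.
Let mK : measurable K := measurable_cbox (- h) h a b.

Lemma side_sub s : side s h a b `<=` K.
Proof.
move=> [x y]; rewrite sideE => -[/=]; rewrite !in_itv /= => /andP[h1 h2] /andP[h3 h4].
split; rewrite /= in_itv /=; last by rewrite !ltW.
case: s h1 h2 => h1 h2; apply/andP; split; try exact: ltW.
  by rewrite (le_trans _ (ltW h1))// oppr_le0 ltW.
by rewrite (le_trans (ltW h2))// ltW.
Qed.

Lemma measurable_side s : measurable (side s h a b : set (plane R)).
Proof. by rewrite sideE; exact: measurable_obox. Qed.

(** The closed rectangle differs from its two open halves by points on the lines [x = -h, 0, h] and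
    [y = a, b], which are null sets. *)
Lemma Kfict_split (f : R * R -> R) : measurable_fun K (f : plane R -> R) ->
  (forall s, (mu2 R).-integrable (side s h a b : set (plane R)) (EFin \o f)) ->
  int2 K f = int2 (side true h a b) f + int2 (side false h a b) f.
Proof.
move=> mf fi.
pose G s : plane R -> R := f \_ (side s h a b).
have iG s : (mu2 R).-integrable K (EFin \o G s).
  by apply: (@integrableS _ _ _ (mu2 R) setT) => //; exact: (integrable_patch (mu2 R) f (measurable_side s)).1.
have E s : (\int[mu2 R]_(p in K) G s p)%R = int2 (side s h a b) f.
  rewrite /int2 Rintegral_mkcond [RHS]Rintegral_mkcond; congr (Rintegral _ _ _).
  apply/funext => p; rewrite patchE /G; case: ifPn => // nK; rewrite patchE ifF//.
  by apply: contraNF nK; rewrite !inE; exact: side_sub.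
rewrite -!E -RintegralD//.
apply: ae_Rintegral => //.
  by apply: measurable_funD; apply/measurable_EFinP; exact: measurable_int (iG _).
have A1 := ae_fst (ae_imp2 (ae_neq h) (ae_imp2 (ae_neq (- h)) (ae_neq 0) (fun x u v => conj u v)) (fun x u v => conj u v)).
have A2 := ae_snd (ae_imp2 (ae_neq a) (ae_neq b) (fun x u v => conj u v)).
apply: (ae_imp2 A1 A2) => -[x y] [/= xh [xmh x0]] [ya yb] [/=]; rewrite !in_itv /= => /andP[h1 h2] /andP[h3 h4].
have n (u v : R) : u <= v -> v <> u -> u < v by move=> uv nv; rewrite lt_neqAle uv andbT eq_sym; exact/eqP.
have n' (u v : R) : u <= v -> u <> v -> u < v by move=> uv nv; rewrite lt_neqAle uv andbT; exact/eqP.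
have yab : a < y < b by rewrite n ?n'.
rewrite /G !patchE; case: (ltgtP x 0) => [xn|xp|//].
  rewrite memNset; last by rewrite sideE => -[/=]; rewrite in_itv /= ltNge (ltW xn).
  rewrite mem_set ?add0r// sideE; split; rewrite /= in_itv //= xn andbT.
  exact: n.
rewrite mem_set; last by rewrite sideE; split; rewrite /= in_itv //= xp /= n'.
by rewrite memNset ?addr0// sideE => -[/=]; rewrite !in_itv /= [x < 0]ltNge (ltW xp) andbF.
Qed.

End Split.

Section BrokenLemmas.
Context (R : realType).

Lemma tensor_weak_eq c d a b i j (f f' w : R * R -> R) : (forall p, obox c d a b p -> f p = f' p) ->
  L2fun2 (obox c d a b) f' -> tensor_weak c d a b i j f w -> tensor_weak c d a b i j f' w.
Proof.
move=> ff Lf' [_ Lw H]; split=> // phi1 phi2 t1 t2; rewrite -H//.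
by apply: eq_Rintegral => p /set_mem Op; rewrite ff.
Qed.

(** Brings the three kinds of jump conditions to one form indexed by [l], so that the later
    arguments need no case distinction. *)
Lemma jump_data m (g : R -> R * R) h a b bp bm u : (1 <= m)%N ->
  Hspace m.+1 h a b bp bm u ->
  (forall j : nat, (j.+2 <= m)%N -> extended_jump g h a b bp bm j u) ->
  forall l, (l <= m)%N -> exists (w : bool -> R * R -> R) (T : bool -> R -> R),
    (forall s, trace_rel g (side s h a b) u l (w s) /\ side_trace a b (side s h a b) (w s) (T s)) /\
    {ae (mu1 R), forall xi : R, a <= xi <= b -> jump_weight l bp * T true xi = jump_weight l bm * T false xi}.
Proof.
move=> m1 [_ _ _ J0 J1] ext [|[|j]] lm.
- have [Tp [Tm [tp tm ae]]] := J0.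
  by exists (fun=> u), (fun s => if s then Tp else Tm); split=> // -[].
- have [Tp [Tm [tp tm ae]]] := J1.
  by exists (fun s => wder (side s h a b) 1 0 u), (fun s => if s then Tp else Tm); split=> // -[].
- have [wp [wm [h1 h2 [Tp [Tm [tp tm ae]]]]]] := ext j lm.
  by exists (fun s => if s then wp else wm), (fun s => if s then Tp else Tm); split=> // -[].
Qed.

End BrokenLemmas.

(** * A competitor in the discrete space *)

Section Pair.
Context (R : realType).

Definition setting (e c0 L : R) (B0 B1 B2 : nat -> R) (K0 K1 K2 : nat -> R * R -> R)
    (g : R -> R * R) (h a b : R) : Prop :=
  [/\ [/\ 0 < h, h <= e, a < b, c0 * h <= b - a & b - a <= L * h],
      [/\ jet (- h) h a b B0 K0, jet (- h) h a b B1 K1 & jet (- h) h a b B2 K2] &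
      [/\ K0 0%N = J0 g, K1 0%N = J1 g & K2 0%N = J2 g]].

Definition total_sq m h a b u : R :=
  seminorm_sq m (side true h a b) u + seminorm_sq m (side false h a b) u.

Lemma le_total_sq m h a b u s : seminorm_sq m (side s h a b) u <= total_sq m h a b u.
Proof.
have S0 s' : 0 <= seminorm_sq m (side s' h a b) u by rewrite sideE; exact: seminorm_ge0.
rewrite /total_sq; case: s; first by rewrite lerDl; exact: (S0 false).
by rewrite lerDr; exact: (S0 true).
Qed.

Lemma total_sq_split m h a b u s :
  seminorm_sq m (side s h a b) u + seminorm_sq m (side (~~ s) h a b) u = total_sq m h a b u.
Proof. by case: s; [reflexivity|exact: addrC]. Qed.

Lemma total_sq_ge0 m h a b u : 0 <= total_sq m h a b u.
Proof. by apply: addr_ge0; rewrite sideE; exact: seminorm_ge0. Qed.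

Lemma jump_weight_gt0 l (x : R) : 0 < x -> 0 < jump_weight l x. Proof. by case: l. Qed.

(** On each side [q s] approximates [u] and [qq s] is the competitor; they differ on one side only.
    The seminorm on both sides enters, since the correction compares the two approximations. *)
Theorem interface_pair m (e c0 L : R) (B0 B1 B2 : nat -> R) : (1 <= m)%N -> 0 < c0 -> 0 <= L ->
  exists C, 0 <= C /\ forall K0 K1 K2 g h a b bp bm u,
  setting e c0 L B0 B1 B2 K0 K1 K2 g h a b -> 0 < bp -> 0 < bm ->
  Hspace m.+1 h a b bp bm u ->
  (forall j : nat, (j.+2 <= m)%N -> extended_jump g h a b bp bm j u) ->
  exists q qq : bool -> {poly {poly R}},
  [/\ forall s, inQ m.+1 (q s) /\ inQ m.+1 (qq s),
    forall s i j, (i + j <= m.+1)%N ->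
      tensor_weak (if s then 0 else - h) (if s then h else 0) a b i j (fun p => u p - ev (q s) p)
       (fun p => wder (side s h a b) i j u p - ev (pd i j (q s)) p) /\
      int2 (side s h a b) (fun p => (wder (side s h a b) i j u p - ev (pd i j (q s)) p) ^+ 2) <=
        C * h ^+ ((m.+1 - (i + j)).*2) * total_sq m.+1 h a b u,
    forall s, int2 (side s h a b) (fun p => ev (q s - qq s) p ^+ 2) <=
        C * h ^+ (m.+1).*2 * total_sq m.+1 h a b u &
    forall l (v : {poly R}), (l <= m)%N -> (size v <= m.+1)%N ->
      jump_weight l bp * moment K0 K1 K2 a b l (qq true) v = jump_weight l bm * moment K0 K1 K2 a b l (qq false) v].
Proof.
move=> m1 c00 L0; have [Cs [Cs0 HS]] := side_estimate m L e B0 B1 B2.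
have A0 : 0 <= 2 * Cs by rewrite mulr_ge0.
have [Cd [Cd0 HD]] := diff_estimate m e B0 B1 B2 c00 A0 L0.
pose Ce := m.+1%:R ^+ 2 * Cd.
have Ce0 : 0 <= Ce by rewrite /Ce mulr_ge0// sqr_ge0.
exists (Cs + Ce); split; first exact: addr_ge0.
move=> K0 K1 K2 g h a b bp bm u [[h0 he ab cab abL] [j0 j1 j2] [e0 e1 e2]] bp0 bm0 Hu ext.
set S := total_sq m.+1 h a b u; have S0 : 0 <= S by exact: total_sq_ge0.
have hn n : 0 <= h ^+ n by rewrite exprn_ge0// ltW.
have Sob s : sobolev m.+1 (side s h a b) u by case: Hu => _ h1 h2 _ _; case: s.
have [q Hq] := choice (fun s => HS K0 K1 K2 s h a b u g h0 he ab abL j0 j1 j2 e0 e1 e2 (Sob s)).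
pose be s := if s then bp else bm.
have be0 s : 0 < be s by rewrite /be; case: s.
(* The side [s0] with the larger [beta] is the one whose polynomial gets replaced by the extension,
   so the ratio [r] is at most 1. *)
have [s0 bs] : exists s0, be (~~ s0) <= be s0.
  by case: (leP bp bm) => H; [exists false|exists true; exact: ltW].
pose r l := jump_weight l (be (~~ s0)) / jump_weight l (be s0).
have w0 l s : 0 < jump_weight l (be s) by exact: jump_weight_gt0.
have r0 l : 0 <= r l by rewrite divr_ge0// ltW.
have r1 l : r l <= 1 by rewrite ler_pdivrMr// mul1r; case: l.
have [p [Qp Hp]] := extend_poly h0 ab j0 j1 j2 m r (q (~~ s0)).
have Qq s : inQ m.+1 (q s) by have [] := Hq s.
pose d := q s0 - p.
have Qd : inQ m.+1 d by exact: inQB.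
have HL l (v : {poly R}) : (l <= m)%N -> (size v <= m.+1)%N ->
    moment K0 K1 K2 a b l d v ^+ 2 <= 2 * Cs * h ^+ ((m - l).*2.+1) * S * ipoly a b (v ^+ 2).
  move=> lm sv; have [w [T [HT ae]]] := jump_data m1 Hu ext lm.
  pose I s := (\int[mu1 R]_(y in `]a, b[) (T s y * v.[y]))%R.
  have LT s : L2 (mu1 R) `]a, b[ (T s).
    by have [_ [_ LT _]] := HT s; have [] := L2_oo_cc LT.
  have IT s : (mu1 R).-integrable `]a, b[ (EFin \o (fun y => T s y * v.[y])).
    exact: (L2_mul (mitvR _) (LT s) (poly_L2_1 a b v)).
  have J : jump_weight l bp * I true = jump_weight l bm * I false.
    rewrite /I -!RintegralZl//; apply: ae_Rintegral => //.
    - by apply: measurable_funM => //; apply/measurable_EFinP; exact: measurable_int (IT _).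
    - by apply: measurable_funM => //; apply/measurable_EFinP; exact: measurable_int (IT _).
    apply: (ae_imp ae) => y Hy; rewrite /= in_itv /= => /andP[/ltW ay /ltW yb].
    by rewrite !mulrA Hy// ay.
  have Is : I s0 = r l * I (~~ s0).
    apply: (mulfI (x := jump_weight l (be s0))); first by rewrite gt_eqF.
    rewrite mulrA mulrCA divff ?gt_eqF// mulr1.
    by move: J; rewrite /be; case: (s0).
  have est s : (I s - moment K0 K1 K2 a b l (q s) v) ^+ 2 <=
      Cs * h ^+ (m - l).*2.+1 * seminorm_sq m.+1 (side s h a b) u * ipoly a b (v ^+ 2).
    by have [_ _] := Hq s; move/(_ l (w s) (T s) v lm); apply; case: (HT s).
  rewrite (moment_B h0 ab j0 j1 j2) Hp//.
  set X := I s0 - moment K0 K1 K2 a b l (q s0) v.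
  set Y := I (~~ s0) - moment K0 K1 K2 a b l (q (~~ s0)) v.
  (* The jump condition [I s0 = r l * I (~~ s0)] cancels the moments of [u]; only the approximation
     errors [X] and [Y] remain, and [r l <= 1] removes [beta] from the bound. *)
  rewrite (_ : _ - _ = r l * Y - X); last by rewrite /X /Y Is mulrBr opprB [RHS]addrCA [X in _ = _ + X]addrAC subrr add0r.
  apply: (@le_trans _ _ (2 * Y ^+ 2 + 2 * X ^+ 2)).
    apply: (@le_trans _ _ (2 * (r l * Y) ^+ 2 + 2 * X ^+ 2)).
      have := sqr_ge0 (r l * Y + X); set Z := r l * Y; lra.
    rewrite lerD2r ler_wpM2l// exprMn ler_piMl ?sqr_ge0//.
    by rewrite exprn_ile1.
  apply: (@le_trans _ _ (2 * (Cs * h ^+ (m - l).*2.+1 * seminorm_sq m.+1 (side (~~ s0) h a b) u * ipoly a b (v ^+ 2)) +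
      2 * (Cs * h ^+ (m - l).*2.+1 * seminorm_sq m.+1 (side s0 h a b) u * ipoly a b (v ^+ 2)))).
    by apply: lerD; apply: ler_wpM2l (est _); exact: ler0n.
  rewrite /S -(total_sq_split _ _ _ _ _ s0) le_eqVlt; apply/orP; left; apply/eqP; ring.
have Hd := HD K0 K1 K2 h a b d S h0 he ab cab abL S0 j0 j1 j2 Qd HL.
have Nd : int2 (side s0 h a b) (fun p => ev d p ^+ 2) <= Ce * h ^+ (m.+1).*2 * S.
  by apply: (ev_norm_le s0 h0 ab S0 _ Hd); case: Qd.
pose qq s := if s == s0 then p else q s.
exists q, qq; split.
- by move=> s; split=> //; rewrite /qq; case: ifP.
- move=> s i j ij; have [_ H _] := Hq s; have [h1 h2] := H i j ij; split=> //.
  apply: (le_trans h2); apply: ler_pM => //.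
  + by apply: mulr_ge0.
  + by rewrite sideE; exact: seminorm_ge0.
  + by apply: ler_wpM2r => //; rewrite lerDl.
  + exact: le_total_sq.
- move=> s; rewrite /qq; case: eqP => [->|_].
    apply: (le_trans Nd); apply: ler_wpM2r => //; apply: ler_wpM2r => //; by rewrite lerDr.
  rewrite subrr (_ : int2 _ _ = 0).
    by rewrite mulr_ge0// mulr_ge0// addr_ge0.
  rewrite /int2 (@eq_Rintegral _ _ _ _ _ (fun=> 0)); last by move=> x _; rewrite /ev !horner0 expr0n.
  by rewrite Rintegral_cst ?mul0r//; exact: measurable_side.
- move=> l v lm sv; have HH := Hp l v lm sv.
  move: HH w0; rewrite /qq /r /be; case: (s0) => /= HH w0.
    have := w0 l true; rewrite /= => w1.
    by rewrite HH mulrA mulrCA divff ?gt_eqF// mulr1.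
  have := w0 l false; rewrite /= => w1.
  by rewrite HH mulrA [in RHS]mulrCA divff ?gt_eqF// mulr1.
Qed.

End Pair.

(** * Optimality of the orthogonal projection *)

Section Projection.
Context (R : realType).
Variables (h a b : R).
Hypotheses (h0 : 0 < h) (ab : a < b).
Implicit Types (P Q : bool -> {poly {poly R}}) (u : R * R -> R).

Let mside s := @measurable_side R h a b s.

Definition piecewise P (p : R * R) : R := if 0 <= p.1 then ev (P true) p else ev (P false) p.

Lemma piecewise_measurable P (D : set (plane R)) :
  measurable_fun D (piecewise P : plane R -> R).
Proof.
apply: measurable_funTS; rewrite /piecewise.
apply: (@measurable_fun_ifT _ _ _ _ (fun p : plane R => ev (P true) p) (fun p : plane R => ev (P false) p) (fun p : plane R => 0 <= p.1)).
- by apply: measurable_fun_ler => //; exact: measurable_fst.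
- exact: ev_measurable.
- exact: ev_measurable.
Qed.

Lemma piecewise_side P s p : side s h a b p -> piecewise P p = ev (P s) p.
Proof.
rewrite sideE /piecewise; case: p => x y [/=]; rewrite in_itv /=.
case: s => /andP[h1 h2] _; first by rewrite ltW.
by rewrite leNgt h2.
Qed.

Lemma side_L2_ev q s : L2fun2 (side s h a b) (ev q).
Proof. by rewrite sideE; exact: L2_ev. Qed.

(* Both the competitor and the projection are piecewise polynomials, so testing
   the orthogonality relation with each of them suffices. *)
Lemma projection_best P Q u pu : measurable_fun (Kfict h a b : set (plane R)) (u : plane R -> R) ->
  (forall s, L2fun2 (side s h a b) u) ->
  (forall p, Kfict h a b p -> pu p = piecewise P p) ->
  int2 (Kfict h a b) (fun p => (u p - pu p) * piecewise Q p) = 0 ->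
  int2 (Kfict h a b) (fun p => (u p - pu p) * pu p) = 0 ->
  \sum_(s : bool) int2 (side s h a b) (fun p => ev (P s - Q s) p ^+ 2) <=
  \sum_(s : bool) int2 (side s h a b) (fun p => (u p - ev (Q s) p) ^+ 2).
Proof.
move=> mu Lu puE oQ oP.
have mK : measurable (Kfict h a b : set (plane R)) := measurable_cbox (- h) h a b.
have key F : (int2 (Kfict h a b) (fun p => (u p - piecewise P p) * piecewise F p) = 0) ->
    \sum_(s : bool) int2 (side s h a b) (fun p => (u p - ev (P s) p) * ev (F s) p) = 0.
  move=> E.
  have I s : (mu2 R).-integrable (side s h a b : set (plane R)) (EFin \o (fun p => (u p - ev (P s) p) * ev (F s) p)).
    exact: (L2_mul (mside s) (L2_B (mside s) (Lu s) (side_L2_ev (P s) s)) (side_L2_ev (F s) s)).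
  have := @Kfict_split R h a b h0 (fun p => (u p - piecewise P p) * piecewise F p).
  rewrite E big_bool /= => H; rewrite [RHS]H.
  - congr (_ + _); apply: eq_Rintegral => p /set_mem Op.
      by rewrite !(@piecewise_side _ true _ Op).
    by rewrite !(@piecewise_side _ false _ Op).
  - apply: measurable_funM; last exact: piecewise_measurable.
    by apply: measurable_funB => //; exact: piecewise_measurable.
  - move=> s; apply: eq_integrable (I s) => // p /set_mem Op.
    by rewrite /= !(piecewise_side _ Op).
have kQ : \sum_(s : bool) int2 (side s h a b) (fun p => (u p - ev (P s) p) * ev (Q s) p) = 0.
  by apply: key; rewrite -[RHS]oQ; apply: eq_Rintegral => p /set_mem Kp; rewrite puE.
have kP : \sum_(s : bool) int2 (side s h a b) (fun p => (u p - ev (P s) p) * ev (P s) p) = 0.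
  by apply: key; rewrite -[RHS]oP; apply: eq_Rintegral => p /set_mem Kp; rewrite puE.
have E s : int2 (side s h a b) (fun p => (u p - ev (Q s) p) ^+ 2) =
    int2 (side s h a b) (fun p => (u p - ev (P s) p) ^+ 2) +
    2 * (int2 (side s h a b) (fun p => (u p - ev (P s) p) * ev (P s) p) -
         int2 (side s h a b) (fun p => (u p - ev (P s) p) * ev (Q s) p)) +
    int2 (side s h a b) (fun p => ev (P s - Q s) p ^+ 2).
  have L1 := L2_B (mside s) (Lu s) (side_L2_ev (P s) s).
  have := L2_expand (mside s) L1 (side_L2_ev (P s - Q s) s).
  have -> : (\int[mu2 R]_(x in side s h a b) (u x - ev (P s) x + ev (P s - Q s) x) ^+ 2)%R =
      int2 (side s h a b) (fun p => (u p - ev (Q s) p) ^+ 2).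
    by apply: eq_Rintegral => p _; rewrite evB; congr (_ ^+ 2); ring.
  move=> ->; congr (_ + _ * _ + _).
  rewrite /int2 -RintegralB//; [|exact: (L2_mul (mside s) L1 (side_L2_ev (P s) s))|exact: (L2_mul (mside s) L1 (side_L2_ev (Q s) s))].
  by apply: eq_Rintegral => p _; rewrite evB mulrBr.
under [leRHS]eq_bigr do rewrite E.
rewrite !big_split /= -mulr_sumr sumrB kP kQ subrr mulr0 addr0.
by rewrite lerDr sumr_ge0// => s _; exact: L2_ge0.
Qed.

(* If no weak derivative exists, [wder] is the zero function by convention. *)
Lemma wder_le s i j u f (P : {poly {poly R}}) (w : R * R -> R) :
  (forall p, side s h a b p -> f p = ev P p - u p) ->
  tensor_weak (if s then 0 else - h) (if s then h else 0) a b i j (fun p => u p - ev P p) w ->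
  int2 (side s h a b) (fun p => wder (side s h a b) i j f p ^+ 2) <=
  int2 (side s h a b) (fun p => w p ^+ 2).
Proof.
move=> fE tw; have [Lz Lw _] := tw.
have OE := @sideE R s h a b.
have mO := mside s.
have [[w' Hw']|nex] := pselect (exists w', weak_derivative (side s h a b) i j f w'); last first.
  rewrite /wder xgetPN; last by move=> x Hx; apply: nex; exists x.
  rewrite /int2 (@eq_Rintegral _ _ _ _ _ (fun=> 0)); last by move=> x _; rewrite expr0n.
  by rewrite Rintegral_cst ?mul0r//; exact: L2_ge0.
have := @xgetPex _ (fun _ : R * R => (0 : R)) [set w | weak_derivative (side s h a b) i j f w] (ex_intro _ w' Hw').
rewrite -/(wder _ _ _ _); set W := wder _ _ _ _ => HW.
have tW : tensor_weak (if s then 0 else - h) (if s then h else 0) a b i j f W.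
  by apply: weak_tensor_weak; rewrite -OE; exact: HW.
have tw2 : tensor_weak (if s then 0 else - h) (if s then h else 0) a b i j (fun p => - (u p - ev P p)) W.
  apply: tensor_weak_eq tW; last by apply: (L2_N _ Lz); rewrite -OE.
  by move=> p; rewrite -OE => Op; rewrite fE// opprB.
have ae := tensor_weak_unique tw2 (tensor_weak_N tw).
have [_ LW _] := tW.
rewrite le_eqVlt; apply/orP; left; apply/eqP; apply: (ae_Rintegral mO).
- by apply: measurable_funX; rewrite OE; case: LW.
- by apply: measurable_funX; rewrite OE; case: Lw.
- by apply: (ae_imp ae) => p H Op; rewrite H ?sqrrN// -OE.
Qed.

End Projection.

(** * The estimate in broken seminorms *)

Section Broken.
Context (R : realType).

Lemma pd_est_side m : exists C, 0 <= C /\ forall s h a b q i j, 0 < h -> a < b -> inQ m.+1 q ->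
  h ^+ (i.*2) * (b - a) ^+ (j.*2) * int2 (side s h a b) (fun p : R * R => ev (pd i j q) p ^+ 2)
    <= C * int2 (side s h a b) (fun p => ev q p ^+ 2).
Proof.
have [C [C0 HC]] := pd_est R m; exists C; split=> // s h a b q i j h0 ab Qq.
rewrite sideE.
set c : R := if s then 0 else - h; set d : R := if s then h else 0.
have cd : c < d by rewrite /c /d; case: (s); rewrite ?oppr_lt0.
have dc : d - c = h by rewrite /c /d; case: (s); rewrite ?subr0// sub0r opprK.
have c0 : c <= 0 by rewrite /c; case: (s); rewrite // oppr_le0 ltW.
have d0 : 0 <= d by rewrite /d; case: (s); rewrite // ltW.
by rewrite -[X in X ^+ i.*2]dc; exact: HC.
Qed.

(** The projection [P] is compared on each side with [q]: their difference is a polynomial, small in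
    the norm of order zero by optimality, and inverse inequalities carry this to all derivatives. No
    stability of the projection in higher norms is used. *)
Theorem broken_estimate m (e c0 L : R) (B0 B1 B2 : nat -> R) : (1 <= m)%N -> 0 < c0 -> 0 <= L ->
  exists C, 0 <= C /\ forall K0 K1 K2 g h a b bp bm u pu,
  setting e c0 L B0 B1 B2 K0 K1 K2 g h a b -> 0 < bp -> 0 < bm ->
  Hspace m.+1 h a b bp bm u ->
  (forall j : nat, (j.+2 <= m)%N -> extended_jump g h a b bp bm j u) ->
  is_L2_projection [set v | Vspace m g h a b bp bm v] (Kfict h a b) u pu ->
  forall i, (i <= m.+1)%N ->
    broken_seminorm i h a b (fun p => pu p - u p) <=
    C * h ^+ (m.+1 - i) * broken_seminorm m.+1 h a b u.
Proof.
move=> m1 c00 L0; have [C1 [C10 HC1]] := interface_pair e B0 B1 B2 m1 c00 L0.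
have [Cp [Cp0 HCp]] := pd_est_side m.
pose D := (1 + c0^-1) ^+ (m.+1).*2.
have D0 : 0 <= D by rewrite /D exprn_ge0// addr_ge0// invr_ge0 ltW.
(* With unit [C1 * h^(2 m + 2) * S] for squared norms: 4 for [u - qq] on a side, 8 for the two sides
   and thus for [P - qq], and [18 = 2 * 8 + 2] for [P - q]. The factor [D] dominates all the
   negative powers of [c0] that occur. *)
pose Cw := 2 * (Cp * D * (18 * C1)) + 2 * C1.
have Cw0 : 0 <= Cw.
  by apply: addr_ge0; apply: mulr_ge0 => //; apply: mulr_ge0; apply: mulr_ge0.
exists (Num.sqrt (2 * m.+2%:R * Cw)); split; first exact: sqrtr_ge0.
move=> K0 K1 K2 g h a b bp bm u pu st bp0 bm0 Hu ext [Vpu orth] i im.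
have [q [qq [Qq Hz Nq J]]] := HC1 K0 K1 K2 g h a b bp bm u st bp0 bm0 Hu ext.
have [[h0 he ab cab abL] [j0 j1 j2] [e0 e1 e2]] := st.
set S := total_sq m.+1 h a b u in Hz Nq; have S0 : 0 <= S by exact: total_sq_ge0.
have hn n : 0 <= h ^+ n by rewrite exprn_ge0// ltW.
have mside s := @measurable_side R h a b s.
have Vqq : Vspace m g h a b bp bm (piecewise qq).
  apply: (Vspace_pair h0 ab j0 j1 j2 e0 e1 e2 _ _ J m1); first by case: (Qq true).
  by case: (Qq false).
have [cp [cm [puP puM _]]] := Vpu.
have [Pp [QPp EPp]] := Qpoly_ev cp; have [Pm [QPm EPm]] := Qpoly_ev cm.
pose P s := if s then Pp else Pm.
have QP s : inQ m.+1 (P s) by rewrite /P; case: s.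
have puE p : Kfict h a b p -> pu p = piecewise P p.
  move=> Kp; rewrite /piecewise; case: ifPn => p0; first by rewrite puP// EPp.
  by rewrite puM ?EPm// ltNge.
have mu : measurable_fun (Kfict h a b : set (plane R)) (u : plane R -> R) by case: Hu.
have Lu s : L2fun2 (side s h a b) u.
  have Su : sobolev m.+1 (side s h a b) u by case: Hu => _ h1 h2 _ _; case: s.
  by rewrite sideE in Su *; have [] := wder_tensor_weak Su (i := 0) (j := 0) isT.
have NuQ s : int2 (side s h a b) (fun p => (u p - ev (q s) p) ^+ 2) <= C1 * h ^+ (m.+1).*2 * S.
  have [tw] := Hz s 0%N 0%N isT; rewrite addn0 subn0; apply: le_trans.
  have [Lz Lw _] := tw; have ae := tensor_weak_unique (tensor_weak_refl Lz) tw.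
  rewrite le_eqVlt; apply/orP; left; apply/eqP; apply: (ae_Rintegral (mside s)).
  - by apply: measurable_funX; rewrite sideE; case: Lz.
  - by apply: measurable_funX; rewrite [X in measurable_fun X _]sideE; case: Lw.
  - by apply: (ae_imp ae) => p H Op; rewrite H// -sideE.
have H22 : 0 <= C1 * h ^+ (m.+1).*2 * S := mulr_ge0 (mulr_ge0 C10 (hn _)) S0.
have NuQQ s : int2 (side s h a b) (fun p => (u p - ev (qq s) p) ^+ 2) <= 4 * (C1 * h ^+ (m.+1).*2 * S).
  have := L2_sqD (mside s) (L2_B (mside s) (Lu s) (side_L2_ev h a b (q s) s)) (side_L2_ev h a b (q s - qq s) s).
  have -> : (\int[mu2 R]_(x in side s h a b) (u x - ev (q s) x + ev (q s - qq s) x) ^+ 2)%R =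
      int2 (side s h a b) (fun p => (u p - ev (qq s) p) ^+ 2).
    by apply: eq_Rintegral => p _; rewrite evB; congr (_ ^+ 2); ring.
  move/le_trans; apply; have n1 := NuQ s; have n2 := Nq s.
  rewrite /int2 in n1 n2; set X := C1 * _ * S in n1 n2 *; lra.
(* The projection is tested against the competitor and against itself; both belong to the discrete
   space. *)
have best := projection_best h0 mu Lu puE (orth _ Vqq) (orth _ Vpu).
have NPQQ s : int2 (side s h a b) (fun p => ev (P s - qq s) p ^+ 2) <= 8 * (C1 * h ^+ (m.+1).*2 * S).
  apply: (@le_trans _ _ (\sum_(s : bool) int2 (side s h a b) (fun p => ev (P s - qq s) p ^+ 2))).
    rewrite (bigD1 s)//= lerDl sumr_ge0// => s' _; exact: L2_ge0.
  apply: (le_trans best); rewrite big_bool /=; have n1 := NuQQ true; have n2 := NuQQ false.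
  rewrite /= in n1 n2; set X := C1 * _ * S in n1 n2 *; lra.
have NPQ s : int2 (side s h a b) (fun p => ev (P s - q s) p ^+ 2) <= 18 * (C1 * h ^+ (m.+1).*2 * S).
  have := L2_sqB (mside s) (side_L2_ev h a b (P s - qq s) s) (side_L2_ev h a b (q s - qq s) s).
  have -> : (\int[mu2 R]_(x in side s h a b) (ev (P s - qq s) x - ev (q s - qq s) x) ^+ 2)%R =
      int2 (side s h a b) (fun p => ev (P s - q s) p ^+ 2).
    by apply: eq_Rintegral => p _; rewrite !evB; congr (_ ^+ 2); ring.
  move/le_trans; apply; have n1 := NPQQ s; have n2 := Nq s.
  rewrite /int2 in n1 n2; set X := C1 * _ * S in n1 n2 *; lra.
(* The inverse inequality loses [h^k] in [eta] and [(b - a)^l] in [xi]; as [b - a >= c0 * h], the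
   total loss is [h^(k + l)]. *)
have Npd s k l : (k + l <= m.+1)%N -> int2 (side s h a b) (fun p => ev (pd k l (P s - q s)) p ^+ 2) <=
    Cp * D * (18 * C1) * h ^+ (m.+1 - (k + l)).*2 * S.
  move=> kl; have := HCp s h a b (P s - q s) k l h0 ab (inQB (QP s) (Qq s).1).
  set N := int2 _ (fun p => ev (pd k l _) p ^+ 2); have N0 : 0 <= N by exact: L2_ge0.
  move=> H.
  have e3 : (c0 * h) ^+ l.*2 <= (b - a) ^+ l.*2.
    by rewrite lerXn2r ?nnegrE// ?subr_ge0 ?(ltW ab)// mulr_ge0 ?ltW.
  have hkl : 0 < h ^+ (k + l).*2 by rewrite exprn_gt0.
  have cl : 0 < c0 ^+ l.*2 by rewrite exprn_gt0.
  have e4 : h ^+ k.*2 * (c0 * h) ^+ l.*2 * N <= Cp * (18 * (C1 * h ^+ (m.+1).*2 * S)).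
    apply: (@le_trans _ _ (h ^+ k.*2 * (b - a) ^+ l.*2 * N)).
      by apply: ler_wpM2r => //; apply: ler_wpM2l.
    by apply: (le_trans H); apply: ler_wpM2l => //; exact: NPQ.
  have hE : h ^+ (m.+1).*2 = h ^+ (k + l).*2 * h ^+ (m.+1 - (k + l)).*2.
    by rewrite -exprD; congr (_ ^+ _); nat_lia.
  have hE2 : h ^+ (k + l).*2 = h ^+ k.*2 * h ^+ l.*2 by rewrite -exprD doubleD.
  set H1 := h ^+ (m.+1 - (k + l)).*2 in hE *.
  have e5 : c0 ^+ l.*2 * N <= Cp * (18 * C1) * H1 * S.
    rewrite -(ler_pM2l hkl); apply: le_trans (le_trans _ e4) _.
      by rewrite exprMn hE2 le_eqVlt; apply/orP; left; apply/eqP; ring.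
    by rewrite hE le_eqVlt; apply/orP; left; apply/eqP; ring.
  have e6 : N <= c0 ^- l.*2 * (Cp * (18 * C1) * H1 * S) by rewrite ler_pdivlMl.
  apply: (le_trans e6).
  have e7 : c0 ^- l.*2 <= D.
    rewrite /D -exprVn; apply: (@le_trans _ _ ((1 + c0^-1) ^+ l.*2)).
      by rewrite lerXn2r ?nnegrE ?addr_ge0 ?invr_ge0 ?(ltW c00)// lerDr.
    apply: ler_weXn2l; last by nat_lia.
    by rewrite lerDl invr_ge0 ltW.
  have nn : 0 <= Cp * (18 * C1) * H1 * S.
    exact: mulr_ge0 (mulr_ge0 (mulr_ge0 Cp0 (mulr_ge0 (ler0n _ 18) C10)) (hn _)) S0.
  apply: (le_trans (ler_wpM2r nn e7)).
  by rewrite le_eqVlt; apply/orP; left; apply/eqP; ring.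
(* The error is the sum of [q - u], controlled by the approximation estimate, and of the polynomial
   [P - q]. *)
have Nw s k l : (k + l <= m.+1)%N ->
    int2 (side s h a b) (fun p => wder (side s h a b) k l (fun p => pu p - u p) p ^+ 2) <=
    Cw * h ^+ (m.+1 - (k + l)).*2 * S.
  move=> kl; have [tw nz] := Hz s k l kl.
  have cd : (if s then 0 else - h) < (if s then h else 0) by case: (s); rewrite ?oppr_lt0.
  have tP := tensor_weak_B tw (@tensor_weak_ev R _ _ a b cd ab k l (P s - q s)).
  set w := (fun p => _) in tP; set w' := (fun p => wder _ _ _ _ _ - _ - _) in tP.
  have tP' : tensor_weak (if s then 0 else - h) (if s then h else 0) a b k l (fun p => u p - ev (P s) p) w'.
    apply: tensor_weak_eq tP.
      by move=> p _; rewrite /w evB; ring.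
    by rewrite -sideE; exact: (L2_B (mside s) (Lu s) (side_L2_ev h a b (P s) s)).
  have fE p : side s h a b p -> pu p - u p = ev (P s) p - u p.
    by move=> Op; rewrite puE ?(piecewise_side P Op)//; exact: side_sub Op.
  apply: (le_trans (wder_le fE tP')).
  have [_ Lw _] := tw; rewrite -sideE in Lw.
  apply: (le_trans (L2_sqB (mside s) Lw (side_L2_ev h a b (pd k l (P s - q s)) s))).
  have n1 := Npd s k l kl.
  rewrite /int2 in n1 nz.
  set Hh := h ^+ _ in n1 nz *.
  rewrite [leRHS](_ : _ = 2 * (C1 * Hh * S) + 2 * (Cp * D * (18 * C1) * Hh * S)); last by rewrite /Cw; ring.
  by apply: lerD; apply: ler_wpM2l.
have Nsemi s : seminorm_sq i (side s h a b) (fun p => pu p - u p) <= m.+2%:R * (Cw * h ^+ (m.+1 - i).*2 * S).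
  rewrite /seminorm_sq; apply: (@le_trans _ _ (\sum_(k < i.+1) (Cw * h ^+ (m.+1 - i).*2 * S))).
    apply: ler_sum => k _; have ki : (k <= i)%N by rewrite -ltnS ltn_ord.
    by have := Nw s k (i - k)%N ltac:(by rewrite subnKC); rewrite subnKC.
  rewrite sumr_const card_ord -[leLHS]mulr_natl; apply: ler_wpM2r.
    exact: mulr_ge0 (mulr_ge0 Cw0 (hn _)) S0.
  by rewrite ler_nat.
set n := (m.+1 - i)%N in Nsemi *.
have hnE : h ^+ n.*2 = (h ^+ n) ^+ 2 by rewrite -exprM muln2.
rewrite -[h ^+ n]ger0_norm// -sqrtr_sqr.
have c1 : 0 <= 2 * m.+2%:R * Cw by rewrite mulr_ge0.
rewrite /broken_seminorm -sqrtrM// -sqrtrM ?mulr_ge0 ?sqr_ge0//.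
apply: ler_wsqrtr; have n1 := Nsemi true; have n2 := Nsemi false.
rewrite -/(total_sq m.+1 h a b u) -/S.
rewrite hnE in n1 n2; set H2 := (h ^+ n) ^+ 2 in n1 n2 *.
rewrite [leRHS](_ : _ = m.+2%:R * (Cw * H2 * S) + m.+2%:R * (Cw * H2 * S)); last by ring.
exact: lerD n1 n2.
Qed.

End Broken.

(** * The tubular neighbourhood *)

Lemma is_derive_cstB (R : realType) (k : R) (u : R -> R) (x du : R) :
  is_derive x (1 : R) u du -> is_derive x (1 : R) (fun t => k - u t) (- du).
Proof.
by move=> d1; have d2 := is_deriveB (is_derive_cst k x (1 : R)) d1; rewrite sub0r in d2.
Qed.

Lemma continuous_hypot (R : realType) (u v : R -> R) : continuous u -> continuous v ->
  continuous (fun t => Num.sqrt (u t ^+ 2 + v t ^+ 2)).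
Proof.
move=> cu cv t.
apply: (@continuous_comp _ _ _ (fun t => u t ^+ 2 + v t ^+ 2) (@Num.sqrt R)); last exact: sqrt_continuous.
by apply: cvgD; apply: cvgM; [exact: cu|exact: cu|exact: cv|exact: cv].
Qed.

Section TubeParameter.
Context (R : realType) (m : nat) (hm : (1 <= m)%N) (g : R -> R * R) (xs xe eps : R).
Hypothesis hg : admissible_curve m g xs xe eps.
Implicit Types (A : R * R) (eta xi zeta : R).

Lemma enorm_le A B : A.1 ^+ 2 + A.2 ^+ 2 <= B.1 ^+ 2 + B.2 ^+ 2 -> enorm A <= enorm (B : R * R).
Proof. exact: ler_wsqrtr. Qed.

Lemma enorm_sqr A : enorm A ^+ 2 = A.1 ^+ 2 + A.2 ^+ 2.
Proof. by rewrite sqr_sqrtr// addr_ge0// sqr_ge0. Qed.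

Lemma enorm_fst A : `|A.1| <= enorm A.
Proof. by rewrite -sqrtr_sqr; apply: ler_wsqrtr; rewrite lerDl sqr_ge0. Qed.

Lemma enorm_snd A : `|A.2| <= enorm A.
Proof. by rewrite -sqrtr_sqr; apply: ler_wsqrtr; rewrite lerDr sqr_ge0. Qed.

Lemma enorm_le_sum A : enorm A <= `|A.1| + `|A.2|.
Proof.
rewrite -[leRHS]ger0_norm ?addr_ge0// -sqrtr_sqr; apply: ler_wsqrtr.
rewrite sqrrD !real_normK ?num_real// addrAC lerDl.
by rewrite mulrn_wge0// mulr_ge0.
Qed.

Lemma tube_mapE eta xi : tube_map g (eta, xi) =
  ((g xi).1 + eta * ((derive1 g xi).2 / speed g xi), (g xi).2 - eta * ((derive1 g xi).1 / speed g xi)).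
Proof.
rewrite /tube_map /unit_normal /rotQ /speed /=; case: (g xi) => u v.
congr pair; rewrite /= /GRing.scale /=; first by rewrite [_^-1 * _]mulrC.
by rewrite mulrN [_^-1 * _]mulrC.
Qed.

Lemma tube_map0 xi : tube_map g (0, xi) = g xi.
Proof. by rewrite tube_mapE !mul0r addr0 subr0 -surjective_pairing. Qed.

Lemma tube_dist eta xi : xs <= xi <= xe -> enorm (tube_map g (eta, xi) - g xi) = `|eta|.
Proof.
move=> xx; have s0 := speed_gt0 hg xx.
rewrite -sqrtr_sqr /enorm; congr Num.sqrt; rewrite tube_mapE /=.
rewrite addrAC subrr add0r addrAC subrr add0r.
set s := speed g xi in s0 *.
have sE : s ^+ 2 = (derive1 g xi).1 ^+ 2 + (derive1 g xi).2 ^+ 2 by exact: enorm_sqr.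
rewrite (_ : _ + _ = eta ^+ 2 * ((derive1 g xi).1 ^+ 2 + (derive1 g xi).2 ^+ 2) / s ^+ 2).
  by rewrite -sE mulfK// sqrf_eq0 gt_eqF.
by field; rewrite gt_eqF.
Qed.

Lemma curve_dist_le A xi : xs <= xi <= xe -> curve_dist g xs xe A <= enorm (A - g xi).
Proof.
move=> xx; apply: ge_inf; first by exists 0 => _ [y _ <-]; exact: sqrtr_ge0.
by exists xi => //=; rewrite in_itv.
Qed.

Lemma is_derive_curve xi : xs <= xi <= xe ->
  is_derive xi (1 : R) (fun t => (g t).1) (derive1 g xi).1 /\
  is_derive xi (1 : R) (fun t => (g t).2) (derive1 g xi).2.
Proof. by move=> xx; exact: (curve_derive hg xx (j := 0)). Qed.

(** At an interior minimum the derivative of the squared distance vanishes, so [A - g xi] is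
    orthogonal to the tangent and is a multiple [eta] of the unit normal. *)
Lemma nearest_interior A xi : nearest_parameter g xs xe A xi -> xs < xi < xe ->
  exists eta, `|eta| = enorm (A - g xi) /\ A = tube_map g (eta, xi).
Proof.
move=> [xx dA] /andP[sx xe']; have s0 := speed_gt0 hg xx.
pose D t := (A.1 - (g t).1) ^+ 2 + (A.2 - (g t).2) ^+ 2.
have dD t : xs <= t <= xe -> is_derive t (1 : R) D
    (- 2 * ((A.1 - (g t).1) * (derive1 g t).1 + (A.2 - (g t).2) * (derive1 g t).2)).
  move=> tt; have [d1 d2] := is_derive_curve tt.
  have d3 : is_derive t (1 : R) (fun t => A.1 - (g t).1) (- (derive1 g t).1).
    exact: is_derive_cstB.
  have d4 : is_derive t (1 : R) (fun t => A.2 - (g t).2) (- (derive1 g t).2).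
    exact: is_derive_cstB.
  apply: is_derive_eq (is_derive_sqr_sum d3 d4) _.
  by rewrite /=; ring.
have oo t : t \in `]xs, xe[ -> xs <= t <= xe.
  by rewrite in_itv /= => /andP[/ltW -> /ltW ->].
have d0 : is_derive xi (1 : R) D 0.
  apply: (@derive1_at_min R D xs xe xi (ltW (ac_interval hg))).
  - by move=> t /oo /dD [].
  - by rewrite in_itv /= sx.
  - move=> t /oo tt; have := curve_dist_le A tt; rewrite -dA => /(fun h => lerXn2r 2 h).
    rewrite !nnegrE !sqrtr_ge0 => /(_ isT isT).
    by rewrite !enorm_sqr.
have E : (A.1 - (g xi).1) * (derive1 g xi).1 + (A.2 - (g xi).2) * (derive1 g xi).2 = 0.
  have [_ e1] := d0; have [_ e2] := dD xi xx; move: e2; rewrite e1 => /esym/eqP.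
  by rewrite mulf_eq0 oppr_eq0 pnatr_eq0 => /eqP.
have sE : speed g xi ^+ 2 = (derive1 g xi).1 ^+ 2 + (derive1 g xi).2 ^+ 2 by exact: enorm_sqr.
set s := speed g xi in s0 sE *; set a1 := (derive1 g xi).1 in E sE *; set a2 := (derive1 g xi).2 in E sE *.
set v1 := A.1 - (g xi).1 in E *; set v2 := A.2 - (g xi).2 in E *.
have sn : s != 0 by rewrite gt_eqF.
pose eta := (v1 * a2 - v2 * a1) / s.
have h1 : eta * (a2 / s) = v1.
  have -> : eta * (a2 / s) = (v1 * s ^+ 2 - a1 * (v1 * a1 + v2 * a2)) / s ^+ 2.
    by rewrite /eta [in v1 * s ^+ 2]sE; field.
  by rewrite E mulr0 subr0 mulfK// sqrf_eq0.
have h2 : - (eta * (a1 / s)) = v2.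
  have -> : - (eta * (a1 / s)) = (v2 * s ^+ 2 - a2 * (v1 * a1 + v2 * a2)) / s ^+ 2.
    by rewrite /eta [in v2 * s ^+ 2]sE; field.
  by rewrite E mulr0 subr0 mulfK// sqrf_eq0.
have EA : A = tube_map g (eta, xi).
  rewrite tube_mapE -/s -/a1 -/a2 h1 h2 [LHS]surjective_pairing.
  by congr pair; rewrite /v1 /v2 addrC subrK.
by exists eta; split => //; rewrite [in RHS]EA tube_dist.
Qed.

Lemma cbox_tube eta xi : `|eta| <= eps -> xs <= xi <= xe -> cbox (- eps) eps xs xe (eta, xi).
Proof. by move=> he xx; split; rewrite /= in_itv //= -ler_norml. Qed.

(** An interior nearest parameter gives a second tubular representation of the point, with offset no
    larger than [|eta|], and the tubular map is injective. *)
Lemma nearest_endpoint eta zeta xi : `|eta| <= eps -> xs <= zeta <= xe ->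
  nearest_parameter g xs xe (tube_map g (eta, zeta)) xi -> xi = zeta \/ xi = xs \/ xi = xe.
Proof.
move=> he zz near; have [xx dA] := near.
have [/andP[xi0 xi1]|] := boolP (xs < xi < xe); last first.
  move: xx => /andP[h1 h2]; rewrite negb_and -!leNgt => /orP[h|h]; right.
    by left; apply/eqP; rewrite eq_le h.
  by right; apply/eqP; rewrite eq_le h2.
left; have [|eta' [e1 e2]] := nearest_interior near; first by rewrite xi0.
have he' : `|eta'| <= eps.
  by rewrite e1 dA; apply: (le_trans (curve_dist_le _ zz)); rewrite tube_dist.
have := ac_inj hg (cbox_tube he' xx) (cbox_tube he zz) (esym e2).
by case.
Qed.

(* Along the normal segment issued from [g zeta] the nearest parameter cannot
   jump to an end point of the curve: at the first equality of the distances
   there would be two nearest parameters. *)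
Lemma nearest_tube eta zeta xi : `|eta| <= eps -> xs <= zeta <= xe ->
  nearest_parameter g xs xe (tube_map g (eta, zeta)) xi -> xi = zeta.
Proof.
move=> he zz near; apply: contrapT => xz.
have x01 : xs <= xs <= xe by rewrite lexx ltW// (ac_interval hg).
have x11 : xs <= xe <= xe by rewrite lexx ltW// (ac_interval hg).
have [xx dA] := near.
(* Besides [zeta] the only candidates are the two end points. One of them is [xi] and [e] is the
   other, except that [e = xi] when [zeta] is itself that other end point. *)
have [e [ee ez He]] : exists e, [/\ xs <= e <= xe, e <> zeta &
    forall y, y = zeta \/ y = xs \/ y = xe -> y = zeta \/ y = xi \/ y = e].
  have := nearest_endpoint he zz near => -[//|[xE|xE]].
    have [zE|/eqP n] := eqVneq zeta xe.
      exists xi; split; [exact: xx|exact: xz|].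
      by rewrite zE -xE => y [->|[->|->]]; [left|right; left|left].
    by exists xe; split; [exact: x11|exact: nesym|rewrite -xE => y [->|[->|->]]; [left|right; left|right; right]].
  have [zE|/eqP n] := eqVneq zeta xs.
    exists xi; split; [exact: xx|exact: xz|].
    by rewrite zE -xE => y [->|[->|->]]; [left|left|right; left].
  by exists xs; split; [exact: x01|exact: nesym|rewrite -xE => y [->|[->|->]]; [left|right; right|right; left]].
pose B s := tube_map g (s * eta, zeta).
(* Compares the distance from [B s] to the remaining candidates with [s * |eta|], its distance to
   [g zeta]. It is nonnegative at 0 and nonpositive at 1 because [xi] is nearest there. *)
pose F s := Num.min (enorm (B s - g xi)) (enorm (B s - g e)) - s * `|eta|.
have cB y : continuous (fun s => enorm (B s - g y)).
  move=> s.
  have -> : (fun s => enorm (B s - g y)) = (fun s : R => Num.sqrt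
     (((g zeta).1 + s * eta * ((derive1 g zeta).2 / speed g zeta) - (g y).1) ^+ 2 +
      ((g zeta).2 - s * eta * ((derive1 g zeta).1 / speed g zeta) - (g y).2) ^+ 2)).
    by apply/funext => t; rewrite /enorm /B tube_mapE.
  have caff (p q r : R) : continuous (fun s : R => p + s * eta * q - r).
    by move=> t; apply: cvgB; [apply: cvgD; [exact: cvg_cst|apply: cvgM; [apply: cvgM; [exact: cvg_id|exact: cvg_cst]|exact: cvg_cst]]|exact: cvg_cst].
  have caff' (p q r : R) : continuous (fun s : R => p - s * eta * q - r).
    by move=> t; apply: cvgB; [apply: cvgB; [exact: cvg_cst|apply: cvgM; [apply: cvgM; [exact: cvg_id|exact: cvg_cst]|exact: cvg_cst]]|exact: cvg_cst].
  exact: continuous_hypot (caff _ _ _) (caff' _ _ _) s.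
have cF : continuous F.
  move=> s; apply: cvgB; last by apply: cvgM; [exact: cvg_id|exact: cvg_cst].
  exact: (continuous_min (cB xi s) (cB e s)).
have dist0 y : xs <= y <= xe -> y <> zeta -> 0 < enorm (g zeta - g y).
  move=> yy yz; rewrite lt_def sqrtr_ge0 andbT; apply/eqP => E; apply: yz.
  have : enorm (g zeta - g y) ^+ 2 = 0 by rewrite E expr0n.
  rewrite enorm_sqr => /eqP; rewrite paddr_eq0 ?sqr_ge0// !sqrf_eq0 !subr_eq0 => /andP[/eqP h1 /eqP h2].
  have E' : tube_map g (0, y) = tube_map g (0, zeta).
    by rewrite !tube_map0 [LHS]surjective_pairing [RHS]surjective_pairing h1 h2.
  have e0 : `|0 : R| <= eps by rewrite normr0; exact: ltW (ac_eps hg).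
  by have [] := ac_inj hg (cbox_tube e0 yy) (cbox_tube e0 zz) E'.
have F0 : 0 <= F 0.
  rewrite /F mul0r subr0 /B mul0r tube_map0 le_min.
  by apply/andP; split; apply: ltW; [exact: dist0 xx xz|exact: dist0 ee ez].
have F1 : F 1 <= 0.
  rewrite /F mul1r subr_le0 /B mul1r ge_min dA.
  by apply/orP; left; rewrite -(tube_dist eta zz); exact: curve_dist_le.
have cFw : {within `[0, 1], continuous F} by exact: continuous_subspaceT.
have [s] : exists2 s, s \in `[0, 1] & F s = 0.
  by apply: IVT => //; rewrite ge_min le_max F0 F1 orbT.
rewrite in_itv /= => /andP[s0 s1] Fs.
have hs : `|s * eta| <= eps by rewrite normrM ger0_norm// (le_trans _ he)// ler_piMl.
have ds y : xs <= y <= xe -> y = zeta -> enorm (B s - g y) = s * `|eta|.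
  by move=> yy ->; rewrite /B tube_dist// normrM ger0_norm.
have Bt : tube g xs xe eps (B s) by exists (s * eta, zeta) => //; exact: cbox_tube.
have [y [ny uy]] := ac_nearest hg Bt.
have minE : Num.min (enorm (B s - g xi)) (enorm (B s - g e)) = s * `|eta|.
  by apply/eqP; rewrite -subr_eq0; apply/eqP.
have ge_xi : s * `|eta| <= enorm (B s - g xi) by rewrite -minE ge_min lexx.
have ge_e : s * `|eta| <= enorm (B s - g e) by rewrite -minE ge_min lexx orbT.
have [yy dy] := ny.
have dz := ds zeta zz erefl.
have dyE : curve_dist g xs xe (B s) = s * `|eta|.
  apply/eqP; rewrite eq_le -[X in _ <= X]dz curve_dist_le//= -dy.
  have := He y (nearest_endpoint hs zz ny) => -[->|[->|->]] //.
  by rewrite dz.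
have nz : nearest_parameter g xs xe (B s) zeta by split=> //; rewrite dyE.
have yz := uy _ nz.
have [lt|lt] := leP (enorm (B s - g xi)) (enorm (B s - g e)).
  have nx : nearest_parameter g xs xe (B s) xi.
    by split=> //; rewrite dyE -minE min_l.
  by apply: xz; rewrite -(uy _ nx).
have ne : nearest_parameter g xs xe (B s) e.
  by split=> //; rewrite dyE -minE min_r// ltW.
by apply: ez; rewrite -(uy _ ne).
Qed.

(** The nearest parameter used to define the element is thus the second tubular coordinate of the
    point, so the offset from [g] is normal to the curve even at the end points. *)
Lemma parameter_tube A : tube g xs xe eps A -> exists eta,
  [/\ `|eta| <= eps, xs <= parameter_of g xs xe A <= xe,
     A = tube_map g (eta, parameter_of g xs xe A) & `|eta| = curve_dist g xs xe A].
Proof.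
move=> tA; have [xi0 [n0 _]] := ac_nearest hg tA.
have := @xgetPex _ 0 [set xi | nearest_parameter g xs xe A xi] (ex_intro _ xi0 n0).
rewrite -/(parameter_of g xs xe A) => nA.
have [[eta zeta] [/= h1 h2] tE] := tA.
rewrite in_itv /= -ler_norml in h1; rewrite in_itv /= in h2.
have nA' := nA; rewrite -tE in nA'.
have pz := nearest_tube h1 h2 nA'; rewrite tE in pz.
have [xx dA] := nA; exists eta; split; [exact: h1|exact: xx|by rewrite pz|].
by rewrite -dA -{1}tE pz tube_dist.
Qed.

End TubeParameter.

(** * Size of the fictitious element *)

Lemma is_derive_lincomb (R : realType) (u v : R -> R) (x du dv k l : R) :
  is_derive x (1 : R) u du -> is_derive x (1 : R) v dv ->
  is_derive x (1 : R) (fun t => u t * k + v t * l) (du * k + dv * l).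
Proof. by move=> d1 d2; apply: is_derive_eq; rewrite /GRing.scale /=; ring. Qed.

Lemma itv_dist (R : realType) (l r p q : R) : l <= p <= r -> l <= q <= r -> `|p - q| <= r - l.
Proof.
move=> /andP[h1 h2] /andP[h3 h4]; rewrite ler_norml opprB.
by apply/andP; split; exact: lerB.
Qed.

Section MeanValue.
Context (R : realType) (xs xe : R) (f df : R -> R).
Hypothesis dfE : forall x, xs <= x <= xe -> is_derive x (1 : R) f (df x).

Let mvt x y : xs <= x -> x <= y -> y <= xe ->
  exists t, [/\ x <= t, t <= y & f y - f x = df t * (y - x)].
Proof.
move=> xx xy yx.
have sub t : x <= t <= y -> xs <= t <= xe.
  by move=> /andP[h1 h2]; rewrite (le_trans xx h1) (le_trans h2 yx).
have [||t] := @MVT_segment R f df x y xy _ _.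
- by move=> t; rewrite in_itv /= => /andP[h1 h2]; apply/dfE/sub; rewrite !ltW.
- apply: continuous_in_subspaceT => t; rewrite inE /= in_itv /= => /sub tt.
  exact: is_derive_cont (dfE tt).
by rewrite in_itv /= => /andP[h1 h2] E; exists t.
Qed.

Lemma mvt_le M x y : (forall t, xs <= t <= xe -> `|df t| <= M) ->
  xs <= x <= xe -> xs <= y <= xe -> `|f x - f y| <= M * `|x - y|.
Proof.
move=> dM; wlog xy : x y / x <= y.
  move=> H xx yy; have [xy|/ltW yx] := leP x y; first exact: H.
  by rewrite distrC [`|x - y|]distrC; exact: H.
move=> /andP[x1 x2] /andP[y1 y2]; have [t [h1 h2 E]] := mvt x1 xy y2.
rewrite distrC E normrM [`|x - y|]distrC; apply: ler_wpM2r; first exact: normr_ge0.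
by apply: dM; rewrite (le_trans x1 h1) (le_trans h2 y2).
Qed.

Lemma mvt_ge k x y : xs <= x -> x <= y -> y <= xe -> (forall t, x <= t <= y -> k <= df t) ->
  k * (y - x) <= f y - f x.
Proof.
move=> x1 xy y2 dk; have [t [h1 h2 E]] := mvt x1 xy y2.
by rewrite E; apply: ler_wpM2r; [rewrite subr_ge0|apply: dk; rewrite h1].
Qed.

End MeanValue.

Section ElementSize.
Context (R : realType) (m : nat) (hm : (1 <= m)%N) (g : R -> R * R) (xs xe eps : R).
Hypothesis hg : admissible_curve m g xs xe eps.
Let xse : xs < xe := ac_interval hg.
Let g1 (t : R) : R := (g t).1.
Let g2 (t : R) : R := (g t).2.
Let u1 (t : R) : R := (derive1 g t).1.
Let u2 (t : R) : R := (derive1 g t).2.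

Lemma curve_bounds : exists G M c : R, [/\ 0 <= G, 0 <= M, 0 < c &
  forall x, xs <= x <= xe -> [/\ `|u1 x| <= G, `|u2 x| <= G,
    `|(derive1n 2 g x).1| <= M, `|(derive1n 2 g x).2| <= M & c <= speed g x]].
Proof.
have [c1 c2] := curve_continuous hg (j := 1) isT.
have [e1 e2] := curve_continuous hg (j := 2) isT.
have [G1 [G10 H1]] := within_bounded (ltW xse) c1.
have [G2 [G20 H2]] := within_bounded (ltW xse) c2.
have [M1 [M10 H3]] := within_bounded (ltW xse) e1.
have [M2 [M20 H4]] := within_bounded (ltW xse) e2.
have [z zx Hz] := EVT_min (ltW xse) (speed_continuous hg).
exists (G1 + G2), (M1 + M2), (speed g z); split; [exact: addr_ge0|exact: addr_ge0| |].
  by apply: (speed_gt0 hg); move: zx; rewrite in_itv.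
move=> x xx; split.
- by apply: (le_trans (H1 x xx)); rewrite lerDl.
- by apply: (le_trans (H2 x xx)); rewrite lerDr.
- by apply: (le_trans (H3 x xx)); rewrite lerDl.
- by apply: (le_trans (H4 x xx)); rewrite lerDr.
- by apply: Hz; rewrite in_itv.
Qed.

Let dg1 x : xs <= x <= xe -> is_derive x (1 : R) g1 (u1 x).
Proof. by move=> xx; have [] := is_derive_curve hg xx. Qed.
Let dg2 x : xs <= x <= xe -> is_derive x (1 : R) g2 (u2 x).
Proof. by move=> xx; have [] := is_derive_curve hg xx. Qed.
Let du1 x : xs <= x <= xe -> is_derive x (1 : R) u1 (derive1n 2 g x).1.
Proof. by move=> xx; have [] := curve_derive hg xx (j := 1) isT. Qed.
Let du2 x : xs <= x <= xe -> is_derive x (1 : R) u2 (derive1n 2 g x).2.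
Proof. by move=> xx; have [] := curve_derive hg xx (j := 1) isT. Qed.

Let D (p : R * R) : R := `|g1 p.1 - g1 p.2| + `|g2 p.1 - g2 p.2|.

Let D_gt0 x y : xs <= x <= xe -> xs <= y <= xe -> x <> y -> 0 < D (x, y).
Proof.
move=> xx yy xy; rewrite lt_def addr_ge0// andbT; apply/eqP => /eqP.
rewrite paddr_eq0// !normr_eq0 !subr_eq0 => /andP[/eqP h1 /eqP h2]; apply: xy.
have E : tube_map g (0, x) = tube_map g (0, y).
  by rewrite !(tube_map0 g) [LHS]surjective_pairing [RHS]surjective_pairing; congr pair.
have e0 : `|0 : R| <= eps by rewrite normr0; exact: ltW (ac_eps hg).
by have [] := ac_inj hg (cbox_tube e0 xx) (cbox_tube e0 yy) E.
Qed.

(** For close parameters, the chord projected on the tangent at [x] is bounded below by the speed;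
    for distant ones, injectivity and compactness bound the chord away from zero. *)
Lemma curve_bilipschitz : exists L, 0 <= L /\ forall x y, xs <= x <= xe -> xs <= y <= xe ->
  `|x - y| <= L * D (x, y).
Proof.
have [G [M [c [G0 M0 c0 H]]]] := curve_bounds.
(* Over a parameter length [de] the tangent turns so little that [g'(t) . g'(x)] stays above
   [c ^+ 2 / 2]; adding 1 keeps the denominator positive. *)
pose de := c ^+ 2 / (4 * M * G + 1).
have MG : 0 < 4 * M * G + 1 by rewrite ltr_pwDr// !mulr_ge0.
have c2 : 0 < c ^+ 2 by rewrite exprn_gt0.
have de0 : 0 < de by rewrite divr_gt0.
have deE : 2 * M * G * de <= c ^+ 2 / 2.
  rewrite /de mulrA ler_pdivrMr// mulrC.
  have := mulr_ge0 M0 G0; move: (ltW c2); set X := c ^+ 2; set Y := M * G => X0 Y0.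
  have XY := mulr_ge0 X0 Y0.
  rewrite (_ : 2 * M * G = 2 * Y); last by rewrite /Y mulrA.
  rewrite (_ : 4 * M * G = 4 * Y); last by rewrite /Y mulrA.
  by nra.
have close x y : xs <= x -> x <= y -> y <= xe -> y - x <= de ->
    `|x - y| <= 2 * G / c ^+ 2 * D (x, y).
  move=> x1 xy y2 yd.
  have xx : xs <= x <= xe by rewrite x1 (le_trans xy y2).
  have yy : xs <= y <= xe by rewrite y2 (le_trans x1 xy).
  pose P t := g1 t * u1 x + g2 t * u2 x.
  have dP t : xs <= t <= xe -> is_derive t (1 : R) P (u1 t * u1 x + u2 t * u2 x).
    move=> tt; have h1 := dg1 tt; have h2 := dg2 tt.
    exact: is_derive_lincomb.
  have Pge : c ^+ 2 / 2 * (y - x) <= P y - P x.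
    apply: (mvt_ge dP x1 xy y2) => t /andP[t1 t2].
    have tt : xs <= t <= xe by rewrite (le_trans x1 t1) (le_trans t2 y2).
    have [b1 b2 _ _ cx] := H x xx.
    have m1 := @mvt_le R xs xe u1 _ du1 M t x (fun s ss => let: And5 _ _ h _ _ := H s ss in h) tt xx.
    have m2 := @mvt_le R xs xe u2 _ du2 M t x (fun s ss => let: And5 _ _ _ h _ := H s ss in h) tt xx.
    have sE : speed g x ^+ 2 = u1 x ^+ 2 + u2 x ^+ 2 by exact: enorm_sqr.
    have cs : c ^+ 2 <= speed g x ^+ 2 by rewrite lerXn2r ?nnegrE ?(ltW c0)// (le_trans (ltW c0)).
    have tde : `|t - x| <= de by rewrite ger0_norm ?subr_ge0// (le_trans _ yd)// lerB.
    have n1 : `|(u1 t - u1 x) * u1 x| <= M * de * G.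
      rewrite normrM; apply: ler_pM => //; apply: (le_trans m1); exact: ler_wpM2l.
    have n2 : `|(u2 t - u2 x) * u2 x| <= M * de * G.
      rewrite normrM; apply: ler_pM => //; apply: (le_trans m2); exact: ler_wpM2l.
    have n1' : - (M * de * G) <= (u1 t - u1 x) * u1 x by move: n1; rewrite ler_norml => /andP[].
    have n2' : - (M * de * G) <= (u2 t - u2 x) * u2 x by move: n2; rewrite ler_norml => /andP[].
    have deE' : M * de * G + M * de * G <= c ^+ 2 / 2.
      by apply: le_trans deE; rewrite le_eqVlt; apply/orP; left; apply/eqP; ring.
    move: sE cs n1' n2' deE'; move: (u1 t) (u2 t) (u1 x) (u2 x) (speed g x) (M * de * G) (c ^+ 2).
    move=> a1 a2 b1' b2' s k w -> h1 h2 h3 h4.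
    rewrite (_ : a1 * b1' + a2 * b2' = b1' ^+ 2 + b2' ^+ 2 + ((a1 - b1') * b1' + (a2 - b2') * b2')); last by ring.
    move: h1 h2 h3; move: (b1' ^+ 2 + b2' ^+ 2) ((a1 - b1') * b1') ((a2 - b2') * b2') => q1 q2 q3; lra.
  have Ple : P y - P x <= G * D (x, y).
    have [b1 b2 _ _ _] := H x xx.
    have -> : P y - P x = (g1 y - g1 x) * u1 x + (g2 y - g2 x) * u2 x by rewrite /P; ring.
    rewrite /D mulrDr; apply: lerD.
      apply: (le_trans (ler_norm _)); rewrite normrM mulrC distrC; exact: ler_wpM2r.
    apply: (le_trans (ler_norm _)); rewrite normrM mulrC distrC; exact: ler_wpM2r.
  rewrite distrC ger0_norm ?subr_ge0//.
  have := le_trans Pge Ple; rewrite mulrAC ler_pdivrMr// => h.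
  rewrite mulrAC ler_pdivlMr// mulrC (le_trans h)// le_eqVlt; apply/orP; left; apply/eqP; ring.
(* The compact set of distant pairs, where [D] has a positive minimum unless the set is empty. *)
pose A : set (R * R) := cbox xs xe xs xe `&` [set p | de <= `|p.1 - p.2|].
have Dxy x y : D (x, y) = D (y, x) by rewrite /D distrC [X in _ + X]distrC.
have [A0|/set0P A0] := eqVneq A set0.
  exists (2 * G / c ^+ 2); split; first by rewrite divr_ge0 ?mulr_ge0// ltW.
  move=> x y xx yy; wlog xy : x y xx yy / x <= y.
    by move=> W; have [xy|/ltW yx] := leP x y; [exact: W|rewrite distrC Dxy; exact: W].
  have [/andP[x1 _] /andP[_ y2]] := (xx, yy); apply: close => //.
  have [//|dd] := leP (y - x) de; have : A (x, y).
    split; first by split; rewrite /= in_itv.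
    by rewrite /= distrC ger0_norm ?subr_ge0// ltW.
  by rewrite A0.
have cA : compact A.
  apply: compact_closedI; first exact: compact_cbox.
  have cn : continuous (fun p : R * R => `|p.1 - p.2|).
    by move=> p; apply: cvg_norm; apply: cvgB; [exact: cvg_fst|exact: cvg_snd].
  have -> : [set p : R * R | de <= `|p.1 - p.2|] = (fun p : R * R => `|p.1 - p.2|) @^-1` [set t | de <= t] by [].
  by apply: closed_comp => [p _|]; [exact: cn|exact: closed_ge].
have cD : {within A, continuous D}.
  apply: continuous_in_subspaceT => p /set_mem [[/= p1 p2] _].
  rewrite in_itv /= in p1; rewrite in_itv /= in p2.
  have cg (f : R -> R) (x : R * R) : {for x.1, continuous f} -> {for x, continuous (fun q => f q.1)}.
    by move=> cf; apply: (@continuous_comp _ _ _ fst f); [exact: cvg_fst|exact: cf].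
  have cg' (f : R -> R) (x : R * R) : {for x.2, continuous f} -> {for x, continuous (fun q => f q.2)}.
    by move=> cf; apply: (@continuous_comp _ _ _ snd f); [exact: cvg_snd|exact: cf].
  apply: cvgD; apply: cvg_norm; apply: cvgB.
  - exact: (cg g1 p (is_derive_cont (dg1 p1))).
  - exact: (cg' g1 p (is_derive_cont (dg1 p2))).
  - exact: (cg g2 p (is_derive_cont (dg2 p1))).
  - exact: (cg' g2 p (is_derive_cont (dg2 p2))).
have [[x0 y0] /set_mem [[/= xx0 yy0] dxy] Hmin] := compact_EVT_min A0 cA cD.
rewrite in_itv /= in xx0; rewrite in_itv /= in yy0.
have Dm : 0 < D (x0, y0).
  apply: D_gt0 => // E; move: dxy; rewrite E subrr normr0; apply/negP; rewrite -ltNge; exact: de0.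
have K0 : 0 <= 2 * G / c ^+ 2 by rewrite divr_ge0 ?mulr_ge0// ltW.
have K1 : 0 <= (xe - xs) / D (x0, y0) by rewrite divr_ge0 ?subr_ge0 ?(ltW Dm) ?(ltW xse).
exists (2 * G / c ^+ 2 + (xe - xs) / D (x0, y0)); split; first exact: addr_ge0.
have D0 p : 0 <= D p by exact: addr_ge0.
move=> x y xx yy; wlog xy : x y xx yy / x <= y.
  by move=> W; have [xy|/ltW yx] := leP x y; [exact: W|rewrite distrC Dxy; exact: W].
have [/andP[x1 x2] /andP[y1 y2]] := (xx, yy); rewrite mulrDl.
have [yd|/ltW dd] := leP (y - x) de.
  by apply: (le_trans (close x y x1 xy y2 yd)); rewrite lerDl mulr_ge0.
apply: (@le_trans _ _ ((xe - xs) / D (x0, y0) * D (x, y))); last by rewrite lerDr mulr_ge0.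
have Axy : (x, y) \in A.
  rewrite inE; split; first by split; rewrite /= in_itv.
  by rewrite /= distrC ger0_norm ?subr_ge0.
have Dge := Hmin _ Axy.
apply: (@le_trans _ _ (xe - xs)).
  by rewrite distrC ger0_norm ?subr_ge0// lerB.
rewrite mulrAC ler_pdivlMr//; apply: ler_wpM2l => //; by rewrite subr_ge0 ltW.
Qed.


Let par := parameter_of g xs xe.

Lemma vertex_data h A X : tube g xs xe eps A -> (g @` `[xs, xe]) X -> enorm (A - X) <= h ->
  exists eta, [/\ `|eta| <= h, xs <= par A <= xe, A = tube_map g (eta, par A),
     `|A.1 - g1 (par A)| <= h & `|A.2 - g2 (par A)| <= h].
Proof.
move=> tA [x xx <-] Ah; rewrite /= in_itv /= in xx.
have [eta [he pp AE dE]] := parameter_tube hg tA.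
have eh : `|eta| <= h by rewrite dE (le_trans (curve_dist_le g A xx)).
have dA : enorm (A - g (par A)) <= h by rewrite {1}AE (tube_dist hg).
exists eta; split=> //.
  exact: le_trans (enorm_fst _) dA.
exact: le_trans (enorm_snd _) dA.
Qed.

Lemma dist3 (p q r s h : R) : `|p - q| <= h -> `|p - r| <= h -> `|r - s| <= h -> `|q - s| <= 3 * h.
Proof.
rewrite !ler_norml => /andP[h1 h2] /andP[h3 h4] /andP[h5 h6]; apply/andP; split; lra.
Qed.

(** The offset of [A] is orthogonal to the tangent at its own parameter [x]; its component along the
    tangent at [y] therefore only sees the variation of the tangent, of order [|x - y|]. *)
Lemma offset_tangent G M h l eta x y A : 0 <= M -> `|eta| <= h ->
  (forall t, xs <= t <= xe -> `|(derive1n 2 g t).1| <= M /\ `|(derive1n 2 g t).2| <= M) ->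
  xs <= x <= xe -> xs <= y <= xe -> `|x - y| <= l -> A = tube_map g (eta, x) ->
  (forall t, xs <= t <= xe -> `|u1 t| <= G /\ `|u2 t| <= G) ->
  `|(A.1 - g1 x) * u1 y + (A.2 - g2 x) * u2 y| <= h * (2 * M * l).
Proof.
move=> M0 eh HM xx yy xy AE HG; have s0 := speed_gt0 hg xx.
have m1 := @mvt_le R xs xe u1 _ du1 M x y (fun s ss => (HM s ss).1) xx yy.
have m2 := @mvt_le R xs xe u2 _ du2 M x y (fun s ss => (HM s ss).2) xx yy.
have b1 : `|u1 x / speed g x| <= 1.
  by rewrite normrM normfV [X in _ / X]gtr0_norm// ler_pdivrMr// mul1r; exact: enorm_fst.
have b2 : `|u2 x / speed g x| <= 1.
  by rewrite normrM normfV [X in _ / X]gtr0_norm// ler_pdivrMr// mul1r; exact: enorm_snd.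
have e1 : A.1 - g1 x = eta * (u2 x / speed g x) by rewrite AE tube_mapE /= addrAC subrr add0r.
have e2 : A.2 - g2 x = - (eta * (u1 x / speed g x)) by rewrite AE tube_mapE /= addrAC subrr add0r.
rewrite e1 e2.
have -> : eta * (u2 x / speed g x) * u1 y + - (eta * (u1 x / speed g x)) * u2 y =
   eta * ((u1 x / speed g x) * (u2 x - u2 y) - (u2 x / speed g x) * (u1 x - u1 y)).
  move: (u1 x) (u2 x) (u1 y) (u2 y) (speed g x)^-1 => p1 p2 q1 q2 w; ring.
rewrite normrM; apply: ler_pM => //.
move: b1 b2; move: (u1 x / speed g x) (u2 x / speed g x) => p1 p2 b1 b2.
apply: (le_trans (ler_normB _ _)); rewrite !normrM.
rewrite (_ : 2 * M * l = 1 * (M * l) + 1 * (M * l)); last by ring.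
apply: lerD; apply: ler_pM => //.
  by apply: (le_trans m2); exact: ler_wpM2l.
by apply: (le_trans m1); exact: ler_wpM2l.
Qed.

(** Upper bound: the vertices project on points of the curve at distance of order [h], and
    [curve_bilipschitz] applies. Lower bound: if the parameters fill an interval of length [l],
    every edge has a component at most [B * l] along the tangent at [a]; the edges point in both
    coordinate directions, and the tangent cannot be nearly orthogonal to both. *)
Theorem element_size (rho : R) : 0 < rho -> exists c0 L, [/\ 0 < c0, 0 <= L &
  forall xl xr yl yr : R, xl < xr -> yl < yr ->
  let hx := xr - xl in let hy := yr - yl in let h := enorm (hx, hy) in
  hx = rho * hy -> h < eps ->
  obox xl xr yl yr `&` (g @` `[xs, xe]) !=set0 ->
  cbox xl xr yl yr `<=` tube g xs xe eps ->
  let a := Num.min (Num.min (par (xl, yl)) (par (xr, yl)))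
                   (Num.min (par (xl, yr)) (par (xr, yr))) in
  let b := Num.max (Num.max (par (xl, yl)) (par (xr, yl)))
                   (Num.max (par (xl, yr)) (par (xr, yr))) in
  [/\ xs <= a, b <= xe, c0 * h <= b - a & b - a <= L * h]].
Proof.
move=> r0; have [G [M [c [G0 M0 c0 H]]]] := curve_bounds.
have [Lg [Lg0 HL]] := curve_bilipschitz.
have e0 := ac_eps hg.
(* Chosen so that [w * h] is at most both [hx] and [hy], by way of [h <= (1 + rho) * hy]. *)
pose w := rho / (1 + rho) ^+ 2.
have r1 : 0 < 1 + rho by rewrite addr_gt0.
have w0 : 0 < w by rewrite divr_gt0// exprn_gt0.
(* Two normal offsets contribute [eps * (2 * M)] each, the chord of the curve contributes
   [2 * (G * G)]. *)
pose B := 2 * (eps * (2 * M)) + 2 * (G * G).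
have B0 : 0 <= B.
  by apply: addr_ge0; apply: mulr_ge0 => //; apply: mulr_ge0 => //; [exact: ltW|exact: mulr_ge0].
have B1 : 0 < 2 * B + 1 by rewrite ltr_pwDr// mulr_ge0.
exists (w * c / (2 * B + 1)), (6 * Lg); split.
- by rewrite divr_gt0// mulr_gt0.
- exact: mulr_ge0.
move=> xl xr yl yr xlr ylr hx hy h hxy heps [X [KX GX]] sub a b.
have hx0 : 0 < hx by rewrite subr_gt0.
have hy0 : 0 < hy by rewrite subr_gt0.
have h_hx : hx <= h by have := enorm_fst (hx, hy); rewrite /= ger0_norm// ltW.
have h_hy : hy <= h by have := enorm_snd (hx, hy); rewrite /= ger0_norm// ltW.
have h0 : 0 < h by exact: lt_le_trans hx0 h_hx.
have inb A : cbox xl xr yl yr A -> enorm (A - X) <= h.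
  case: A => p q [/=]; rewrite !in_itv /= => p1 q1.
  move: KX => {GX}; case: X => p' q' [/=]; rewrite !in_itv /= => /andP[p3 p4] /andP[q3 q4].
  apply: enorm_le; rewrite /=; apply: lerD; rewrite -[leLHS]real_normK ?num_real// lerXn2r ?nnegrE ?(ltW hx0) ?(ltW hy0)//.
    by apply: itv_dist => //; rewrite !ltW.
  by apply: itv_dist => //; rewrite !ltW.
have vd A : cbox xl xr yl yr A -> exists eta, [/\ `|eta| <= h, xs <= par A <= xe, A = tube_map g (eta, par A),
     `|A.1 - g1 (par A)| <= h & `|A.2 - g2 (par A)| <= h].
  by move=> KA; apply: (vertex_data (sub A KA) GX); exact: inb.
have pair A A' : cbox xl xr yl yr A -> cbox xl xr yl yr A' -> par A - par A' <= 6 * Lg * h.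
  move=> KA KA'; have [eta [_ pA _ a1 a2]] := vd A KA; have [eta' [_ pA' _ a1' a2']] := vd A' KA'.
  have [d1 d2] : `|A.1 - A'.1| <= h /\ `|A.2 - A'.2| <= h.
    move: KA KA' => [+ +] [+ +]; rewrite /= !in_itv /= => q1 q2 q3 q4.
    by split; [exact: le_trans (itv_dist q1 q3) h_hx|exact: le_trans (itv_dist q2 q4) h_hy].
  apply: (le_trans (ler_norm _)); apply: (le_trans (HL _ _ pA pA')).
  rewrite (_ : 6 * Lg * h = Lg * (3 * h + 3 * h)); last by ring.
  apply: ler_wpM2l => //; rewrite /D /=; apply: lerD; [exact: dist3 a1 d1 a1'|exact: dist3 a2 d2 a2'].
have inx : (xl <= xl <= xr) * (xl <= xr <= xr) by rewrite !lexx ltW.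
have iny : (yl <= yl <= yr) * (yl <= yr <= yr) by rewrite !lexx ltW.
have K1 : cbox xl xr yl yr (xl, yl) by split; rewrite /= in_itv /= ?inx ?iny.
have K2 : cbox xl xr yl yr (xr, yl) by split; rewrite /= in_itv /= ?inx ?iny.
have K3 : cbox xl xr yl yr (xl, yr) by split; rewrite /= in_itv /= ?inx ?iny.
have K4 : cbox xl xr yl yr (xr, yr) by split; rewrite /= in_itv /= ?inx ?iny.
have pr A : cbox xl xr yl yr A -> xs <= par A <= xe by move=> /vd [eta []].
have /andP[p1 p1'] := pr _ K1; have /andP[p2 p2'] := pr _ K2.
have /andP[p3 p3'] := pr _ K3; have /andP[p4 p4'] := pr _ K4.
have xa : xs <= a by rewrite /a !le_min p1 p2 p3 p4.
have bx : b <= xe by rewrite /b !ge_max p1' p2' p3' p4'.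
have upper : b - a <= 6 * Lg * h.
  rewrite lerBlDr /b !ge_max; apply/andP; split; apply/andP; split; rewrite -lerBlDl /a !le_min;
    by apply/andP; split; apply/andP; split; rewrite lerBlDl -lerBlDr; exact: pair.
split=> //.
have ap1 : a <= par (xl, yl) by rewrite /a !ge_min lexx.
have ap2 : a <= par (xr, yl) by rewrite /a !ge_min lexx ?orbT.
have ap3 : a <= par (xl, yr) by rewrite /a !ge_min lexx ?orbT.
have pb1 : par (xl, yl) <= b by rewrite /b !le_max lexx.
have pb2 : par (xr, yl) <= b by rewrite /b !le_max lexx ?orbT.
have pb3 : par (xl, yr) <= b by rewrite /b !le_max lexx ?orbT.
have aa : xs <= a <= xe by rewrite xa (le_trans ap1).
set l := b - a.
have l0 : 0 <= l by rewrite subr_ge0 (le_trans ap1 pb1).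
have HM t : xs <= t <= xe -> `|(derive1n 2 g t).1| <= M /\ `|(derive1n 2 g t).2| <= M by move=> /H [].
have HG t : xs <= t <= xe -> `|u1 t| <= G /\ `|u2 t| <= G by move=> /H [].
have off A : cbox xl xr yl yr A -> a <= par A -> par A <= b ->
    `|(A.1 - g1 (par A)) * u1 a + (A.2 - g2 (par A)) * u2 a| <= eps * (2 * M) * l.
  move=> KA aA Ab; have [eta [eh pA AE _ _]] := vd A KA.
  have dl : `|par A - a| <= l by rewrite ger0_norm ?subr_ge0// lerB.
  apply: (le_trans (offset_tangent M0 eh HM pA aa dl AE HG)).
  rewrite -[leRHS]mulrA; apply: ler_wpM2r; last exact: ltW.
  by rewrite mulr_ge0// mulr_ge0.
have chord x y : xs <= x <= xe -> xs <= y <= xe -> `|x - y| <= l ->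
    `|(g1 x - g1 y) * u1 a + (g2 x - g2 y) * u2 a| <= 2 * (G * G) * l.
  move=> xx yy xy; have [ga1 ga2] := HG a aa.
  have m1 := @mvt_le R xs xe g1 _ dg1 G x y (fun s ss => (HG s ss).1) xx yy.
  have m2 := @mvt_le R xs xe g2 _ dg2 G x y (fun s ss => (HG s ss).2) xx yy.
  apply: (le_trans (ler_normD _ _)); rewrite !normrM.
  rewrite (_ : 2 * (G * G) * l = G * l * G + G * l * G); last by ring.
  apply: lerD; apply: ler_pM => //.
    by apply: (le_trans m1); exact: ler_wpM2l.
  by apply: (le_trans m2); exact: ler_wpM2l.
(* An edge is the difference of the offsets of its end points plus the chord between their
   projections on the curve. *)
have edge A A' : cbox xl xr yl yr A -> cbox xl xr yl yr A' -> a <= par A -> par A <= b ->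
    a <= par A' -> par A' <= b -> `|(A.1 - A'.1) * u1 a + (A.2 - A'.2) * u2 a| <= B * l.
  move=> KA KA' aA Ab aA' Ab'; have o1 := off A KA aA Ab; have o2 := off A' KA' aA' Ab'.
  have dl : `|par A - par A'| <= l.
    by apply: itv_dist; [rewrite aA|rewrite aA'].
  have o3 := chord _ _ (pr A KA) (pr A' KA') dl.
  set X1 := (A.1 - g1 _) * _ + _ in o1; set X2 := (A'.1 - g1 _) * _ + _ in o2.
  set X3 := (g1 _ - g1 _) * _ + _ in o3.
  have -> : (A.1 - A'.1) * u1 a + (A.2 - A'.2) * u2 a = X1 - X2 + X3.
    rewrite /X1 /X2 /X3; move: (g1 (par A)) (g2 (par A)) (g1 (par A')) (g2 (par A')) (u1 a) (u2 a).
    by move=> q1 q2 q3 q4 v1 v2; ring.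
  apply: (le_trans (ler_normD _ _)).
  apply: (@le_trans _ _ (eps * (2 * M) * l + eps * (2 * M) * l + 2 * (G * G) * l)).
    apply: lerD o3; apply: (le_trans (ler_normB _ _)); exact: lerD.
  by rewrite /B le_eqVlt; apply/orP; left; apply/eqP; ring.
have ex : hx * `|u1 a| <= B * l.
  have := edge _ _ K2 K1 ap2 pb2 ap1 pb1; rewrite /= subrr mul0r addr0 normrM.
  by rewrite -/hx gtr0_norm.
have ey : hy * `|u2 a| <= B * l.
  have := edge _ _ K3 K1 ap3 pb3 ap1 pb1; rewrite /= subrr mul0r add0r normrM.
  by rewrite -/hy gtr0_norm.
have hsum : h <= (1 + rho) * hy.
  have := enorm_le_sum (hx, hy); rewrite /= !gtr0_norm// => /le_trans; apply.
  by rewrite hxy mulrDl mul1r addrC.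
have whE : w * h <= rho * hy / (1 + rho).
  apply: (@le_trans _ _ (w * ((1 + rho) * hy))); first by apply: ler_wpM2l => //; exact: ltW.
  by rewrite le_eqVlt; apply/orP; left; apply/eqP; rewrite /w; field; rewrite gt_eqF.
have wx : w * h <= hx.
  apply: (le_trans whE); rewrite -hxy ler_pdivrMr// (ler_peMr (ltW hx0))// lerDl; exact: ltW.
have wy : w * h <= hy.
  apply: (le_trans whE); rewrite ler_pdivrMr// mulrC; apply: ler_wpM2l; first exact: ltW.
  by rewrite lerDr.
have [_ _ _ _ ca] := H a aa.
have cs : c <= `|u1 a| + `|u2 a| by apply: (le_trans ca); exact: enorm_le_sum.
(* Weighting the two edge estimates by the coordinates of the tangent, whose sum is at least [c],
   bounds [w * h * c] by [2 * B * l]. *)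
rewrite mulrAC ler_pdivrMr//.
apply: (@le_trans _ _ (w * h * (`|u1 a| + `|u2 a|))).
  rewrite mulrAC; apply: ler_wpM2l => //; by rewrite mulr_ge0// ltW.
apply: (@le_trans _ _ (B * l + B * l)).
  rewrite mulrDr; apply: lerD; [apply: le_trans ex|apply: le_trans ey]; exact: ler_wpM2r.
by rewrite -/l [leRHS](_ : _ = B * l + B * l + l); [rewrite lerDl|ring].
Qed.

End ElementSize.

Unset Implicit Arguments.

Theorem theorem1 (R : realType) (m : nat) (hm : (1 <= m)%N)
    (g : R -> R * R) (xs xe eps : R) (hg : admissible_curve m g xs xe eps)
    (rho : R) (hrho : 0 < rho) :
  exists C : R,
  forall (x0 x1 y0 y1 : R) (Omp Omm : set (R * R)),
    x0 < x1 -> y0 < y1 ->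
    divides (g @` `[xs, xe]) (obox x0 x1 y0 y1) Omp Omm ->
  forall (bp bm : R), 0 < bp -> 0 < bm ->
  (* uniform mesh with n1 * n2 cells *)
  forall (n1 n2 : nat), (0 < n1)%N -> (0 < n2)%N ->
  let hx := (x1 - x0) / n1%:R in
  let hy := (y1 - y0) / n2%:R in
  let h := enorm (hx, hy) in
    hx = rho * hy -> h < eps -> h * max_curvature g xs xe <= 1 / 2 ->
  (* interface element *)
  forall (k : 'I_n1) (l : 'I_n2),
  let xl := x0 + k%:R * hx in
  let xr := x0 + k.+1%:R * hx in
  let yl := y0 + l%:R * hy in
  let yr := y0 + l.+1%:R * hy in
    obox xl xr yl yr `&` (g @` `[xs, xe]) !=set0 ->
    cbox xl xr yl yr `<=` tube g xs xe eps ->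
    (forall p : R * R, cbox (- eps) eps xs xe p ->
       obox xl xr yl yr (tube_map g p) ->
       (0 < p.1 -> Omp (tube_map g p)) /\ (p.1 < 0 -> Omm (tube_map g p))) ->
  let par := parameter_of g xs xe in
  let a := Num.min (Num.min (par (xl, yl)) (par (xr, yl)))
                   (Num.min (par (xl, yr)) (par (xr, yr))) in
  let b := Num.max (Num.max (par (xl, yl)) (par (xr, yl)))
                   (Num.max (par (xl, yr)) (par (xr, yr))) in
  forall (u : R * R -> R),
    Hspace m.+1 h a b bp bm u ->
    (forall j : nat, (j.+2 <= m)%N -> extended_jump g h a b bp bm j u) ->
  forall (pu : R * R -> R),
    is_L2_projection [set v | Vspace m g h a b bp bm v] (Kfict h a b) u pu ->
  forall (i : nat), (i <= m.+1)%N ->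
    broken_seminorm i h a b (fun p => pu p - u p) <=
      C * h ^+ (m.+1 - i) * broken_seminorm m.+1 h a b u.
Proof.
(* The three sources of constants (coefficients, size of the element, estimate on a given element)
   only see [m], the curve, [eps] and [rho], so [C] is fixed before the mesh and the two values of
   [beta]. *)
have [B0 [B1 [B2 [K0 [K1 [K2 [E0 E1 E2 HJ]]]]]]] := operator_jets hm hg.
have [c0 [L [c00 L0 HE]]] := element_size hg hrho.
have [C [_ HC]] := broken_estimate eps B0 B1 B2 hm c00 L0.
exists C => x0 x1 y0 y1 Omp Omm x01 y01 _ bp bm bp0 bm0 n1 n2 n10 n20 hx hy h hxy heps hk k l.
move=> xl xr yl yr ne sub _ par a b u Hu ext pu proj i im.
have hx0 : 0 < hx by rewrite divr_gt0 ?subr_gt0// ltr0n.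
have hy0 : 0 < hy by rewrite divr_gt0 ?subr_gt0// ltr0n.
have ex : xr - xl = hx by rewrite /xr /xl -natr1; ring.
have ey : yr - yl = hy by rewrite /yr /yl -natr1; ring.
have xlr : xl < xr by rewrite -subr_gt0 ex.
have ylr : yl < yr by rewrite -subr_gt0 ey.
have := HE xl xr yl yr xlr ylr; rewrite ex ey => /(_ hxy heps ne sub).
rewrite -/par -/a -/b -/h => -[xa bx cab abL].
have h0 : 0 < h by apply: lt_le_trans (enorm_fst (hx, hy)); rewrite /= normr_gt0 gt_eqF.
have ab : a < b by rewrite -subr_gt0 (lt_le_trans _ cab)// mulr_gt0.
have [j0 j1 j2] := HJ h a b h0 heps hk xa ab bx.
have st : setting eps c0 L B0 B1 B2 K0 K1 K2 g h a b by split=> //; split=> //; exact: ltW.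
exact: (HC K0 K1 K2 g h a b bp bm u pu st bp0 bm0 Hu ext proj i im).
Qed.
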